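(* For each $p\in\{2,3\}$, the representation $\rho_4\otimes\mathbf Z_p\colon B_4\to GL_3(\mathbf Z_p[t,t^{-1}])$ (the reduced Burau representation with coefficients in $\mathbf Z_p=\mathbf Z/p\mathbf Z$) is not faithful, and its kernel contains braids that are not Brunnian. Hence, for $p=2,3$, $\ker(\rho_4\otimes\mathbf Z_p)$ is an all pseudo-Anosov normal subgroup of $B_4$ that is not contained in Whittlesey's example of an all pseudo-Anosov normal subgroup, namely the Brunnian mapping classes on a sphere with at least five punctures.
   Context: The 4-braid group $B_4$ is the group of mapping classes of the 4-punctured disk (homeomorphisms fixing the boundary pointwise, up to isotopy). It has generators $\sigma_1,\sigma_2,\sigma_3$ and relations $\sigma_1\sigma_3=\sigma_3\sigma_1$, $\sigma_1\sigma_2\sigma_1=\sigma_2\sigma_1\sigma_2$, $\sigma_2\sigma_3\sigma_2=\sigma_3\sigma_2\sigma_3$. Its center is infinite cyclic, generated by the Dehn twist along the boundary. A braid is periodic if some nonzero power of it lies in the center. A braid is reducible if it is represented by a homeomorphism of the punctured disk that preserves a nonempty collection of pairwise disjoint essential simple closed curves (essential: enclosing at least two and fewer than all of the punctures). A braid is pseudo-Anosov if it is neither periodic nor reducible. A subgroup of $B_4$ is all pseudo-Anosov if all of its non-trivial elements are pseudo-Anosov. A braid in $B_4$ is Brunnian if it is a pure braid that becomes trivial after forgetting any one of its strands. A mapping class of a punctured sphere is Brunnian if it fixes each puncture and becomes trivial after forgetting (filling in) any one of the punctures. Whittlesey showed that the nontrivial Brunnian mapping classes on a sphere with at least five punctures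 are neither periodic nor reducible. A 4-braid is regarded as a mapping class of the 5-punctured sphere by collapsing the boundary of the 4-punctured disk to a fifth puncture. The reduced Burau representation $\rho_4\colon B_4\to GL_3(\mathbf Z[t,t^{-1}])$ is given by $$\rho_4(\sigma_1)=\begin{pmatrix}-t&0&0\\1&1&0\\0&0&1\end{pmatrix},\quad \rho_4(\sigma_2)=\begin{pmatrix}1&t&0\\0&-t&0\\0&1&1\end{pmatrix},\quad \rho_4(\sigma_3)=\begin{pmatrix}1&0&0\\0&1&t\\0&0&-t\end{pmatrix}$$ (matrices acting on row vectors from the right), and $\rho_4\otimes\mathbf Z_p$ is obtained by reducing all coefficients modulo $p$. *)

(* Defs.v *)
From HB Require Import structures.
From mathcomp Require Import all_boot all_order all_algebra.
From mathcomp Require Import all_classical all_reals all_analysis.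
From mathcomp Require Import zify ring lra.

Set Implicit Arguments.
Unset Strict Implicit.
Unset Printing Implicit Defensive.

Import Order.TTheory GRing.Theory Num.Theory.
Import numFieldNormedType.Exports.

Local Open Scope classical_set_scope.
Local Open Scope quotient_scope.
Local Open Scope ring_scope.

(* The letter (false, i) is the generator sigma_(i+1), (true, i) its inverse. *)
Definition letter := (bool * 'I_3)%type.
Definition word := seq letter.

Definition sigma (k : nat) : letter := (false, inord k.-1).
Definition inv_letter (x : letter) : letter := (~~ x.1, x.2).
Definition inv_word (w : word) : word := rev (map inv_letter w).

Inductive braid_eq : word -> word -> Prop :=
| braid_refl w : braid_eq w w
| braid_sym v w : braid_eq v w -> braid_eq w v
| braid_trans u v w : braid_eq u v -> braid_eq v w -> braid_eq u w
| braid_cat u u' v v' :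
    braid_eq u u' -> braid_eq v v' -> braid_eq (u ++ v) (u' ++ v')
| braid_inv x : braid_eq [:: x; inv_letter x] [::]
| braid_far : braid_eq [:: sigma 1; sigma 3] [:: sigma 3; sigma 1]
| braid_near12 :
    braid_eq [:: sigma 1; sigma 2; sigma 1] [:: sigma 2; sigma 1; sigma 2]
| braid_near23 :
    braid_eq [:: sigma 2; sigma 3; sigma 2] [:: sigma 3; sigma 2; sigma 3].

Definition braid_eqb (v w : word) : bool := `[< braid_eq v w >].

Lemma braid_eqb_equiv : equiv_class_of braid_eqb.
Proof.
split=> [w|v w|u v w].
- exact/asboolP/braid_refl.
- by apply/asboolP/asboolP; exact: braid_sym.
- by move=> /asboolP uv /asboolP vw; apply/asboolP/(braid_trans uv vw).
Qed.

Canonical braid_equiv := EquivRelPack braid_eqb_equiv.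

Definition B4 := {eq_quot braid_equiv}.
HB.instance Definition _ := Choice.on B4.
HB.instance Definition _ := Quotient.on B4.

Definition braid_of_word (w : word) : B4 := \pi_B4 w.

Lemma braid_of_wordP v w : braid_of_word v = braid_of_word w <-> braid_eq v w.
Proof.
split=> [/eqmodP/asboolP//|vw].
by apply/eqmodP/asboolP.
Qed.

Lemma braid_eq_repr w : braid_eq (repr (braid_of_word w)) w.
Proof. by apply/braid_of_wordP; rewrite /braid_of_word reprK. Qed.

Lemma braid_of_wordK (b : B4) : braid_of_word (repr b) = b.
Proof. exact: reprK. Qed.

Definition B4_one : B4 := braid_of_word [::].
Definition B4_mul (a b : B4) : B4 := braid_of_word (repr a ++ repr b).
Definition B4_inv (a : B4) : B4 := braid_of_word (inv_word (repr a)).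

Lemma inv_letterK : involutive inv_letter.
Proof. by case=> e i; rewrite /inv_letter /= negbK. Qed.

Lemma inv_wordK : involutive inv_word.
Proof.
by move=> w; rewrite /inv_word map_rev revK -map_comp (eq_map inv_letterK) map_id.
Qed.

Lemma braid_eq_catV w : braid_eq (w ++ inv_word w) [::].
Proof.
elim: w => [|x w IHw]; first exact: braid_refl.
have -> : (x :: w) ++ inv_word (x :: w) =
    [:: x] ++ ((w ++ inv_word w) ++ [:: inv_letter x]).
  by rewrite /inv_word /= rev_cons -cats1 -catA.
apply: (@braid_trans _ ([:: x] ++ ([::] ++ [:: inv_letter x]))).
  apply: braid_cat; first exact: braid_refl.
  by apply: braid_cat => //; exact: braid_refl.
exact: braid_inv.
Qed.

Lemma braid_eq_catVl w : braid_eq (inv_word w ++ w) [::].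
Proof. by rewrite -{2}(inv_wordK w); exact: braid_eq_catV. Qed.

Lemma B4_mulA : associative B4_mul.
Proof.
move=> a b c; apply/braid_of_wordP.
apply: (@braid_trans _ (repr a ++ (repr b ++ repr c))).
  by apply: braid_cat; [exact: braid_refl | exact: braid_eq_repr].
rewrite catA; apply: braid_sym.
by apply: braid_cat; [exact: braid_eq_repr | exact: braid_refl].
Qed.

Lemma B4_mul1 : left_id B4_one B4_mul.
Proof.
move=> a; rewrite -[RHS]braid_of_wordK; apply/braid_of_wordP.
rewrite -[X in braid_eq _ X]cat0s; apply: braid_cat; last exact: braid_refl.
exact: braid_eq_repr.
Qed.

Lemma B4_mulr1 : right_id B4_one B4_mul.
Proof.
move=> a; rewrite -[RHS]braid_of_wordK; apply/braid_of_wordP.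
rewrite -[X in braid_eq _ X]cats0; apply: braid_cat; first exact: braid_refl.
exact: braid_eq_repr.
Qed.

Lemma B4_mulV : left_inverse B4_one B4_inv B4_mul.
Proof.
move=> a; apply/braid_of_wordP; apply: braid_trans (braid_eq_catVl (repr a)).
by apply: braid_cat; [exact: braid_eq_repr | exact: braid_refl].
Qed.

Lemma B4_mulrV : right_inverse B4_one B4_inv B4_mul.
Proof.
move=> a; apply/braid_of_wordP; apply: braid_trans (braid_eq_catV (repr a)).
by apply: braid_cat; [exact: braid_refl | exact: braid_eq_repr].
Qed.

HB.instance Definition _ :=
  isGroup.Build B4 B4_mulA B4_mul1 B4_mulr1 B4_mulV B4_mulrV.

Lemma braid_of_word_cat v w :
  braid_of_word (v ++ w) = (braid_of_word v * braid_of_word w)%g.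
Proof.
apply/braid_of_wordP/braid_sym.
by apply: braid_cat; exact: braid_eq_repr.
Qed.

Section LaurentDef.
Variable A : idomainType.

(* The subring A[t, t^-1] of the fraction field of A[t]. *)
Definition is_laurent : {pred {fraction {poly A}}} := fun x =>
  `[< exists (n : nat) (P : {poly A}), x * tofrac 'X ^+ n = tofrac P >].

Lemma is_laurent_subring : subring_closed is_laurent.
Proof.
split.
- by apply/asboolP; exists 0%N, 1; rewrite expr0 mulr1 rmorph1.
- move=> x y /asboolP[m [P xP]] /asboolP[n [Q yQ]]; apply/asboolP.
  exists (m + n)%N, (P * 'X^n - Q * 'X^m).
  rewrite tofracB !tofracM !tofracXn -xP -yQ exprD; ring.
- move=> x y /asboolP[m [P xP]] /asboolP[n [Q yQ]]; apply/asboolP.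
  by exists (m + n)%N, (P * Q); rewrite tofracM -xP -yQ exprD; ring.
Qed.

HB.instance Definition _ :=
  GRing.isSubringClosed.Build {fraction {poly A}} is_laurent is_laurent_subring.

Record laurent := Laurent {
  laurent_val :> {fraction {poly A}};
  _ : laurent_val \in is_laurent }.

HB.instance Definition _ := [isSub for laurent_val].
HB.instance Definition _ := [Choice of laurent by <:].
HB.instance Definition _ := [SubChoice_isSubComNzRing of laurent by <:].

Definition laurent_unit : {pred laurent} := fun x => `[< exists y, y * x = 1 >].

Definition laurent_inv (x : laurent) : laurent :=
  if pselect (exists y, y * x = 1) is left e then projT1 (cid e) else x.

Lemma laurent_mulVx : {in laurent_unit, left_inverse 1 laurent_inv *%R}.
Proof.
move=> x /asboolP ux; rewrite /laurent_inv.
by case: pselect => // e; exact: projT2 (cid e).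
Qed.

Lemma laurent_unitPl (x y : laurent) : y * x = 1 -> laurent_unit x.
Proof. by move=> yx; apply/asboolP; exists y. Qed.

Lemma laurent_inv_out : {in [predC laurent_unit], laurent_inv =1 id}.
Proof.
by move=> x /asboolP ux; rewrite /laurent_inv; case: pselect.
Qed.

HB.instance Definition _ := GRing.ComNzRing_hasMulInverse.Build laurent
  laurent_mulVx laurent_unitPl laurent_inv_out.

Lemma laurentX_subproof : tofrac 'X \in is_laurent.
Proof. by apply/asboolP; exists 0%N, 'X; rewrite expr0 mulr1. Qed.

Definition laurentX : laurent := Laurent laurentX_subproof.

Lemma laurentX_unit : laurentX \is a GRing.unit.
Proof.
have X0 : tofrac ('X : {poly A}) != 0 by rewrite tofrac_eq0 polyX_eq0.
have Vl : (tofrac ('X : {poly A}))^-1 \in is_laurent.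
  by apply/asboolP; exists 1%N, 1; rewrite expr1 mulVf // rmorph1.
apply/asboolP; exists (Laurent Vl); apply: val_inj.
by rewrite rmorphM rmorph1 /= mulVf.
Qed.
End LaurentDef.

Arguments laurentX {A}.

Section Burau.
Variable S : comUnitRingType.
Variable t : S.

Definition mx3 (rows : seq (seq S)) : 'M[S]_3 :=
  \matrix_(i, j) nth 0 (nth [::] rows i) j.

Definition burau_gen (i : 'I_3) : 'M[S]_3 :=
  match val i with
  | 0%N => mx3 [:: [:: - t; 0; 0];
                   [:: 1;   1; 0];
                   [:: 0;   0; 1]]
  | 1%N => mx3 [:: [:: 1; t;   0];
                   [:: 0; - t; 0];
                   [:: 0; 1;   1]]
  | _   => mx3 [:: [:: 1; 0; 0];
                   [:: 0; 1; t];
                   [:: 0; 0; - t]]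
  end.

Definition burau_letter (x : letter) : 'M[S]_3 :=
  if x.1 then (burau_gen x.2)^-1 else burau_gen x.2.

Definition burau_word (w : word) : 'M[S]_3 := \prod_(x <- w) burau_letter x.

Lemma mx3M a b c d e f g h i a' b' c' d' e' f' g' h' i' :
  mx3 [:: [:: a; b; c]; [:: d; e; f]; [:: g; h; i]] *
  mx3 [:: [:: a'; b'; c']; [:: d'; e'; f']; [:: g'; h'; i']] =
  mx3 [:: [:: a * a' + b * d' + c * g'; a * b' + b * e' + c * h';
              a * c' + b * f' + c * i'];
          [:: d * a' + e * d' + f * g'; d * b' + e * e' + f * h';
              d * c' + e * f' + f * i'];
          [:: g * a' + h * d' + i * g'; g * b' + h * e' + i * h';
              g * c' + h * f' + i * i']].
Proof.
apply/matrixP => j k; rewrite !mxE !big_ord_recl big_ord0 !mxE /= addr0 addrA.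
by case: j => [[|[|[|//]]] ?]; case: k => [[|[|[|//]]] ?].
Qed.

Lemma mx3_1 : 1 = mx3 [:: [:: 1; 0; 0]; [:: 0; 1; 0]; [:: 0; 0; 1]].
Proof.
apply/matrixP => j k; rewrite !mxE.
by case: j => [[|[|[|//]]] ?]; case: k => [[|[|[|//]]] ?].
Qed.

Hypothesis tU : t \is a GRing.unit.

Definition burau_gen_inv (i : 'I_3) : 'M[S]_3 :=
  match val i with
  | 0%N => mx3 [:: [:: - t^-1; 0; 0]; [:: t^-1; 1; 0]; [:: 0; 0; 1]]
  | 1%N => mx3 [:: [:: 1; 1; 0]; [:: 0; - t^-1; 0]; [:: 0; t^-1; 1]]
  | _   => mx3 [:: [:: 1; 0; 0]; [:: 0; 1; 1]; [:: 0; 0; - t^-1]]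
  end.

Lemma burau_gen_mulV i : burau_gen i * burau_gen_inv i = 1.
Proof.
have ttV : t * t^-1 = 1 by rewrite mulrV.
rewrite mx3_1 /burau_gen /burau_gen_inv.
case: i => [[|[|[|//]]] ?] /=; rewrite mx3M; congr mx3; do !congr (_ :: _);
  rewrite ?mulrN ?mulNr ?opprK ?ttV; ring.
Qed.

Lemma burau_gen_unit i : burau_gen i \is a GRing.unit.
Proof. by have [] := mulmx1_unit (burau_gen_mulV i). Qed.

Lemma burau_word_eq v w : braid_eq v w -> burau_word v = burau_word w.
Proof.
rewrite /burau_word.
elim=> {v w} [//|//|u v w _ -> _ -> //|u u' v v' _ uv _ vw||||].
- by rewrite !big_cat uv vw.
- case=> -[] i; rewrite !big_cons big_nil mulr1 /burau_letter /=.
    by rewrite mulVr // burau_gen_unit.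
  by rewrite mulrV // burau_gen_unit.
all: rewrite !big_cons big_nil !mulr1 /burau_letter /= /burau_gen /= !inordK //=.
all: rewrite !mx3M; congr mx3; do !congr (_ :: _); ring.
Qed.

End Burau.

(* The entries of the matrices over Z[t, t^-1] are polynomials in t with
   coefficients 0, 1, -1, so that reducing them modulo p gives the matrices
   burau_gen over F_p[t, t^-1].  Matrices act on row vectors from the right, so that a
   product of braids is sent to the product of matrices in the same order. *)
Definition burau4 (p : nat) (b : B4) : 'M[laurent 'F_p]_3 :=
  burau_word laurentX (repr b).

Lemma burau4_word p w : burau4 p (braid_of_word w) = burau_word laurentX w.
Proof. by apply: burau_word_eq; [exact: laurentX_unit | exact: braid_eq_repr]. Qed.

Lemma burau4_1 p : burau4 p 1%g = 1.
Proof. by rewrite burau4_word /burau_word big_nil. Qed.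

Lemma burau4M p a b : burau4 p (a * b)%g = burau4 p a * burau4 p b.
Proof. by rewrite burau4_word /burau_word big_cat. Qed.

Lemma burau4_unit p b : burau4 p b \in unitmx.
Proof.
have E : burau4 p b *m burau4 p b^-1%g = 1%:M.
  by rewrite [LHS](esym (burau4M p b _)) mulgV burau4_1.
by have [] := mulmx1_unit E.
Qed.

Definition burau4_ker (p : nat) : set B4 := [set b | burau4 p b = 1].

Definition normal_subgroup (G : groupType) (N : set G) : Prop :=
  [/\ N 1%g,
      forall x y, N x -> N y -> N (x / y)%g
    & forall x y, N x -> N (x ^ y)%g].

Section MappingClasses.
Variable T : topologicalType.
(* F is the part of the surface fixed pointwise and Q the set of punctures,
   treated as marked points that may be permuted. *)
Variables F Q : set T.

Definition mod_homeo (f : T -> T) : Prop :=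
  [/\ continuous f,
      exists g, [/\ continuous g, cancel f g & cancel g f],
      forall x, F x -> f x = x
    & f @` Q = Q].

Definition isotopic (R : realType) (f g : T -> T) : Prop :=
  exists H : R -> T -> T,
    [/\ {within `[0, 1]%classic `*` [set: T],
          continuous (fun z : R * T => H z.1 z.2)},
        forall s, s \in `[0, 1] -> mod_homeo (H s),
        H 0 = f & H 1 = g].
End MappingClasses.

(* Forgetting a puncture q amounts to replacing Q by Q `\ q. *)
Definition Brunnian_homeo (R : realType) (T : topologicalType) (F Q : set T)
    (f : T -> T) : Prop :=
  (forall q, Q q -> f q = q) /\
  (forall q, Q q -> isotopic F (Q `\ q) R f id).

Section PuncturedDisk.
Variable R : realType.
Local Notation plane := (R * R)%type.

(* The punctures are (1, 0), (2, 0), (3, 0), (4, 0) and the disk is the closed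
   disk having [(0, 0), (5, 0)] as a diameter. *)
Definition puncture (i : 'I_4) : plane := (i.+1%:R, 0).
Definition punctures : set plane := range puncture.

Definition disk : set plane :=
  [set z | (z.1 - 5 / 2) ^+ 2 + z.2 ^+ 2 <= (5 / 2) ^+ 2].
Definition open_disk : set plane :=
  [set z | (z.1 - 5 / 2) ^+ 2 + z.2 ^+ 2 < (5 / 2) ^+ 2].

(* A homeomorphism of the disk fixing its boundary pointwise is identified with
   its extension to the plane by the identity. *)
Definition disk_homeo : (plane -> plane) -> Prop :=
  mod_homeo (~` open_disk) punctures.
Definition disk_isotopic : (plane -> plane) -> (plane -> plane) -> Prop :=
  isotopic (~` open_disk) punctures R.

(* Half twist exchanging the punctures i+1 and i+2: about their midpoint, it is
   the rotation by +/- pi at radius <= 1/2, slowing down linearly to the identity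
   at radius 1. *)
Definition half_twist (x : letter) (z : plane) : plane :=
  let c : R := x.2%:R + 3 / 2 in
  let u := z.1 - c in
  let v := z.2 in
  let a := (-1) ^+ x.1 * pi *
    Num.min 1 (Num.max 0 (2 - 2 * Num.sqrt (u ^+ 2 + v ^+ 2))) in
  (c + (u * cos a - v * sin a), u * sin a + v * cos a).

(* The leftmost letter is applied first, as for matrices acting on rows. *)
Fixpoint word_homeo (w : word) : plane -> plane :=
  if w is x :: w' then word_homeo w' \o half_twist x else id.

Lemma half_twist_far (x : letter) (z : plane) :
  1 <= (z.1 - (x.2%:R + 3/2)) ^+ 2 + z.2 ^+ 2 -> half_twist x z = z.
Proof.
move=> h; rewrite /half_twist; set s := Num.sqrt _.
have s1 : 1 <= s by rewrite -(@sqrtr1 R) ler_wsqrtr.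
have -> : Num.max 0 (2 - 2 * s) = 0 by apply/max_idPl; lra.
have -> : Num.min 1 0 = 0 :> R by apply/min_idPr; lra.
rewrite mulr0 cos0 sin0 [RHS]surjective_pairing; congr pair; ring.
Qed.

Lemma half_twistK x : cancel (half_twist x) (half_twist (inv_letter x)).
Proof.
move=> z; rewrite [RHS]surjective_pairing /half_twist /=.
set c := x.2%:R + 3/2; set u := z.1 - c; set v := z.2.
set a := (-1) ^+ x.1 * pi * _.
have e : u ^+ 2 + v ^+ 2 = (c + (u * cos a - v * sin a) - c) ^+ 2 + (u * sin a + v * cos a) ^+ 2.
  have := cos2Dsin2 a => h.
  transitivity ((u ^+ 2 + v ^+ 2) * (cos a ^+ 2 + sin a ^+ 2)); first by rewrite h mulr1.
  ring.
rewrite -e.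
have -> : (-1) ^+ (~~ x.1) * pi * Num.min 1 (Num.max 0 (2 - 2 * Num.sqrt (u ^+ 2 + v ^+ 2))) = - a.
  by rewrite /a; case: (x.1) => /=; ring.
rewrite cosN sinN.
have h := cos2Dsin2 a.
congr pair.
  transitivity (c + u * (cos a ^+ 2 + sin a ^+ 2)); first by ring.
  by rewrite h /u; ring.
transitivity (v * (cos a ^+ 2 + sin a ^+ 2)); first by ring.
by rewrite h mulr1.
Qed.

Lemma half_twist_puncture (x : letter) (k : 'I_4) :
  punctures (half_twist x (puncture k)).
Proof.
have [ki|ki|ki|ki] : [\/ (k < x.2)%N, (k = x.2 :> nat)%N, (k = x.2.+1 :> nat)%N | (x.2.+1 < k)%N].
  case: (ltngtP k x.2) => h; [by constructor 1| |by constructor 2].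
  by case: (ltngtP k x.2.+1) => h'; [lia|constructor 4|constructor 3].
- rewrite half_twist_far; first by exists k.
  rewrite /puncture /= expr0n addr0.
  have : k.+1%:R <= x.2%:R :> R by rewrite ler_nat.
  nra.
- exists (lift ord0 x.2) => //.
  rewrite /puncture /half_twist /= ki expr0n /= addr0 !mul0r subr0 addr0.
  have -> : x.2.+1%:R - (x.2%:R + 3/2) = - (1/2) :> R by rewrite -addn1 natrD; lra.
  rewrite sqrtr_sqr normrN ger0_norm; last lra.
  have -> : 2 - 2 * (1/2) = 1 :> R by lra.
  have -> : Num.max 0 1 = 1 :> R by apply/max_idPr; lra.
  rewrite minxx mulr1 /bump /= add1n.
  have [-> ->] : cos ((-1) ^+ x.1 * pi) = -1 :> R /\ sin ((-1) ^+ x.1 * pi) = 0 :> R.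
    by case: (x.1); rewrite /= ?expr1 ?expr0 ?mulN1r ?mul1r ?cosN ?sinN cospi sinpi ?oppr0.
  rewrite -[x.2.+2]addn2 natrD; congr pair; lra.
- exists (widen_ord (leqnSn 3) x.2) => //.
  rewrite /puncture /half_twist /= ki expr0n /= addr0 !mul0r subr0 addr0.
  have -> : x.2.+2%:R - (x.2%:R + 3/2) = 1/2 :> R by rewrite -addn2 natrD; lra.
  rewrite sqrtr_sqr ger0_norm; last lra.
  have -> : 2 - 2 * (1/2) = 1 :> R by lra.
  have -> : Num.max 0 1 = 1 :> R by apply/max_idPr; lra.
  rewrite minxx mulr1 /=.
  have [-> ->] : cos ((-1) ^+ x.1 * pi) = -1 :> R /\ sin ((-1) ^+ x.1 * pi) = 0 :> R.
    by case: (x.1); rewrite /= ?expr1 ?expr0 ?mulN1r ?mul1r ?cosN ?sinN cospi sinpi ?oppr0.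
  rewrite -[x.2.+1]addn1 natrD; congr pair; lra.
- rewrite half_twist_far; first by exists k.
  rewrite /puncture /= expr0n addr0.
  have : x.2.+3%:R <= k.+1%:R :> R by rewrite ler_nat.
  rewrite -[x.2.+3]addn3 natrD; nra.
Qed.

Lemma half_twist_continuous x : continuous (half_twist x).
Proof.
move=> z; rewrite /half_twist /=.
have c1 : {for z, continuous (fun z : plane => z.1 - (x.2%:R + 3 / 2) : R)}.
  by apply: cvgB; [exact: cvg_fst | exact: cvg_cst].
have c2 : {for z, continuous (fun z : plane => z.2 : R)} by exact: cvg_snd.
pose a (z : plane) : R := (-1) ^+ x.1 * pi *
    Num.min 1 (Num.max 0 (2 - 2 * Num.sqrt ((z.1 - (x.2%:R + 3 / 2)) ^+ 2 + z.2 ^+ 2))).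
pose q (z : plane) : R := (z.1 - (x.2%:R + 3 / 2)) ^+ 2 + z.2 ^+ 2.
have cq : {for z, continuous q}.
  apply: cvgD; [exact: (cvgM c1 c1) | exact: (cvgM c2 c2)].
have cs : {for z, continuous (Num.sqrt \o q)}.
  by apply: continuous_comp => //; exact: sqrt_continuous.
pose b (z : plane) : R := 2 - 2 * Num.sqrt (q z).
have cb : {for z, continuous b}.
  by apply: cvgB; [exact: cvg_cst | apply: cvgM; [exact: cvg_cst | exact: cs]].
have k (r : R) : {for z, continuous (fun _ : plane => r)} by exact: cvg_cst.
have cm := continuous_min (k 1) (continuous_max (k 0) cb).
have ca : {for z, continuous a} by apply: cvgM; [exact: cvg_cst | exact: cm].
have {cs} cs : {for z, continuous (sin \o a)} by apply: continuous_comp => //; exact: continuous_sin.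
have cc : {for z, continuous (cos \o a)} by apply: continuous_comp => //; exact: continuous_cos.
have cf1 : {for z, continuous (fun z : plane => x.2%:R + 3 / 2 + ((z.1 - (x.2%:R + 3 / 2)) * cos (a z) - z.2 * sin (a z)) : R)}.
  apply: cvgD; first exact: cvg_cst.
  by apply: cvgB; apply: cvgM.
have cf2 : {for z, continuous (fun z : plane => (z.1 - (x.2%:R + 3 / 2)) * sin (a z) + z.2 * cos (a z) : R)}.
  by apply: cvgD; apply: cvgM.
have := cvg_pair cf1 cf2; exact.
Qed.

Lemma half_twist_homeo x : disk_homeo (half_twist x).
Proof.
split.
- exact: half_twist_continuous.
- exists (half_twist (inv_letter x)); split.
  + exact: half_twist_continuous.
  + exact: half_twistK.
  + by move=> z; rewrite -{1}(inv_letterK x) half_twistK.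
- move=> z /= /negP; rewrite -leNgt => h; apply: half_twist_far.
  case: x => e [[|[|[|//]]] ?] /=; nra.
- apply/seteqP; split=> [_ [_ [k _ <-] <-]|_ [k _ <-]]; first exact: half_twist_puncture.
  have [j _ jE] := half_twist_puncture (inv_letter x) k.
  exists (puncture j); first by exists j.
  by rewrite jE -{1}(inv_letterK x) half_twistK.
Qed.
Lemma word_homeo_disk w : disk_homeo (word_homeo w).
Proof.
elim: w => [|x w [cw [g [cg wK gK]] Fw Qw]] /=.
  split=> //; [by move=> z; exact: cvg_id | | exact: image_id].
  by exists id; split=> // z; exact: cvg_id.
have [cx [h [ch xK hK]] Fx Qx] := half_twist_homeo x.
split.
- by move=> z; apply: continuous_comp; [exact: cx | exact: cw].
- exists (h \o g); split; [|exact: can_comp|exact: can_comp].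
  by move=> z; apply: continuous_comp; [exact: cg | exact: ch].
- by move=> z Fz /=; rewrite Fx // Fw.
- by rewrite -image_comp Qx Qw.
Qed.

Lemma disk_isotopic_refl h : disk_homeo h -> disk_isotopic h h.
Proof.
move=> hh; exists (fun _ => h); split=> //.
apply: continuous_subspaceT => z.
by apply: continuous_comp; [exact: cvg_snd | case: hh => + _ _ _; apply].
Qed.

(* By Artin's theorem, w |-> word_homeo w induces an isomorphism (up to the order
   of composition) from the presented group B4 onto the group of isotopy classes
   of disk_homeo; h represents b when it lies in the class realizing b. *)
Definition represents (h : plane -> plane) (b : B4) : Prop :=
  exists2 w : word, braid_of_word w = b & disk_isotopic h (word_homeo w).

Lemma represents_word w : represents (word_homeo w) (braid_of_word w).
Proof. by exists w => //; apply/disk_isotopic_refl/word_homeo_disk. Qed.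

Definition simple_closed_curve (c : set plane) : Prop :=
  exists g : R -> plane,
    [/\ {within `[0, 1], continuous g},
        g 0 = g 1,
        {in `[0, 1[ &, injective g}
      & c = g @` `[0, 1]].

Definition encloses (c : set plane) (z : plane) : Prop :=
  ~ c z /\ bounded_set (connected_component (~` c) z).

Definition essential_curve (c : set plane) : Prop :=
  [/\ simple_closed_curve c,
      c `<=` disk `\` punctures
    & (2 <= #|[set i | `[< encloses c (puncture i) >]]%SET| < 4)%N].

Definition reducible (b : B4) : Prop :=
  exists (h : plane -> plane) (C : set (set plane)),
    [/\ represents h b,
        C !=set0,
        forall c, C c -> essential_curve c,
        forall c d, C c -> C d -> c <> d -> c `&` d = set0
      & [set h @` c | c in C] = C].

Definition periodic (b : B4) : Prop :=
  exists2 n : nat, (0 < n)%N & forall a : B4, commute (b ^+ n)%g a.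

Definition pseudo_Anosov (b : B4) : Prop := ~ periodic b /\ ~ reducible b.

Definition all_pseudo_Anosov (N : set B4) : Prop :=
  forall b, N b -> b <> 1%g -> pseudo_Anosov b.

Definition Brunnian_braid (b : B4) : Prop :=
  exists2 h, represents h b & Brunnian_homeo R (~` open_disk) punctures h.

(* The sphere is the one-point compactification of the plane; the complement of
   the open disk, collapsed to the fifth puncture, is represented by the point
   at infinity. *)
Local Notation sphere := (one_point_compactification plane).

Definition sphere_punctures : set sphere := Some @` punctures `|` [set None].

Definition sphere_homeo (h : plane -> plane) : sphere -> sphere := omap h.

(* The braids whose mapping class on the 5-punctured sphere is Brunnian. *)
Definition sphere_Brunnian (b : B4) : Prop :=
  exists2 h, represents h b &
    Brunnian_homeo R set0 sphere_punctures (sphere_homeo h).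
End PuncturedDisk.

(* Main.v *)
(** Order the four labelled points of a configuration in the plane along a line of small
positive slope.  Comparing this order with the lexicographic one gives positive permutation
braids, whose quotients form a locally constant cocycle with values in B4 itself; its
monodromy along paths of configurations is invariant under homotopy, and recovers [b] from an
isotopy ending at a homeomorphism that represents [b].

A kernel element [b] is pure (put t = 1).  Let [h] represent [b] and permute a family of
disjoint curves, one of which is [c].  Then [c] and [h c] enclose the same punctures, and they
are equal or disjoint, hence nested.  If they enclose three punctures, sending the fourth one to
infinity shows that [b] is conjugate to [x g^k] with [x] in <s1, s2> and [g = s3 s2 s1 s1 s2 s3]
(shrink the three punctures to a cluster inside the smaller curve).  If they enclose two, bringing
these close together shows that [b] is conjugate into <s1, s3, s2 s1 s1 s2>.  On both subgroups
the Burau representation modulo p is faithful: the normal forms coming from PSL2(Z) = Z/2 * Z/3,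
respectively from <x, z | z^2 central>, have nonscalar leading terms at t = 0.

If a power of [b] is central, the normal form for <s1, s2> shows that the map s3 -> s1 from B4
onto <s1, s2> kills [b]; the kernel of this map is generated by a = s3 s1^-1 and
c = s2 a s2^-1, and acts on the free group of rank two by left translations, so [b] = 1.

Deleting the first strand of a Brunnian braid gives a braid that commutes with a half twist of the
remaining strands, which fails for explicit kernel elements by the Burau matrices over F_5 at
t = -1. *)

Require Import Defs.
From HB Require Import structures.
From mathcomp Require Import all_boot all_order all_algebra.
From mathcomp Require Import all_classical all_reals all_analysis.
From mathcomp Require Import zify ring lra.

Set Implicit Arguments.
Unset Strict Implicit.
Unset Printing Implicit Defensive.

Import Order.TTheory GRing.Theory Num.Theory.
Import numFieldNormedType.Exports.

Local Open Scope classical_set_scope.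
Local Open Scope ring_scope.

(** * Local cocycles and monodromy *)

(** The transition braids take values in the presented group from the start, so the isotopy of an
    arbitrary representative gives back its word directly. Multiplying them by a gauge, a braid
    depending on the current order of the points, turns a geometric constraint on a motion (three
    points staying in a cluster, two staying adjacent) into membership in an explicit subgroup, by a
    finite check over the 24 orders.

    For reducible elements the obstacle is that h is controlled on curves only as sets, and the
    isotopy from the identity to h not at all. So the punctures are first moved: the motion and its
    image under h form a square with the isotopy, and the curves provide room avoiding both motions.
    This room is the inside of the inner curve, or the outside of the outer one; hence the role of
    nesting.

    Leading terms leave the central parts of the normal forms and their torsion modulo the center.
    These are settled by the exponent sum, which vanishes on the kernel, and by the power of t
    through which central elements act.

    A forgotten strand is replaced by a point parked far to the right, so the same group and the
    same Burau matrices serve after deletion. *)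

Section LocalCocycles.
Variable G : groupType.
Local Open Scope group_scope.

(** Additivity is demanded only between nearby points, because the transition braid [tau] below is
    meaningful only for configurations that share a generic slope. *)
Definition lcocycle (Y : topologicalType) (O : set Y) (tau : Y -> Y -> G) :=
  forall y, O y -> exists2 V, nbhs y V &
    forall a b c, V a -> V b -> V c -> tau a b * tau b c = tau a c.

Lemma lcocycle_comp (X Y : topologicalType) (O : set Y) tau (f : X -> Y) :
  continuous f -> (forall x, O (f x)) -> lcocycle O tau ->
  lcocycle setT (fun a b => tau (f a) (f b)).
Proof.
move=> cf fO tO x _; have [V nV VP] := tO _ (fO x).
exists (f @^-1` V); first exact: cf.
by move=> a b c Va Vb Vc; apply: VP.
Qed.

Lemma cocycle_diag (Y : Type) (V : set Y) (tau : Y -> Y -> G) :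
  (forall a b c, V a -> V b -> V c -> tau a b * tau b c = tau a c) ->
  forall a, V a -> tau a a = 1.
Proof.
move=> VP a Va; have := VP a a a Va Va Va.
by rewrite -[X in _ = X]mulg1 => /mulgI.
Qed.

Lemma cocycle_opp (Y : Type) (V : set Y) (tau : Y -> Y -> G) :
  (forall a b c, V a -> V b -> V c -> tau a b * tau b c = tau a c) ->
  forall a b, V a -> V b -> tau b a = (tau a b)^-1.
Proof.
move=> VP a b Va Vb; apply/esym/mulg1_eq; rewrite VP //.
exact: (cocycle_diag VP).
Qed.

End LocalCocycles.

Lemma continuous_pair (X Y Z : topologicalType) (f : X -> Y) (g : X -> Z) :
  continuous f -> continuous g -> continuous (fun x => (f x, g x)).
Proof. by move=> cf cg x; have := cvg_pair (cf x) (cg x); exact. Qed.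

Lemma continuous_fst (X Y Z : topologicalType) (f : X -> Y * Z) :
  continuous f -> continuous (fun x => (f x).1).
Proof.
by move=> cf x; apply: (@continuous_comp _ _ _ f fst x (cf x)); exact: cvg_fst.
Qed.

Lemma continuous_snd (X Y Z : topologicalType) (f : X -> Y * Z) :
  continuous f -> continuous (fun x => (f x).2).
Proof.
by move=> cf x; apply: (@continuous_comp _ _ _ f snd x (cf x)); exact: cvg_snd.
Qed.

Lemma continuous_proj1 (Y Z : topologicalType) : continuous (fun y : Y * Z => y.1).
Proof. by move=> y; exact: cvg_fst. Qed.

Lemma continuous_proj2 (Y Z : topologicalType) : continuous (fun y : Y * Z => y.2).
Proof. by move=> y; exact: cvg_snd. Qed.

Lemma continuous_compf (X Y Z : topologicalType) (f : X -> Y) (g : Y -> Z) :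
  continuous f -> continuous g -> continuous (fun x => g (f x)).
Proof. by move=> cf cg x; exact: (@continuous_comp _ _ _ f g x (cf x) (cg _)). Qed.

Section Paths.
Variables (R : realType) (G : groupType).
Implicit Types (sigma : R -> R -> G) (L : R -> G).

(** Continuous induction: the hypothesis is symmetric in [a] and [b], so both [P] and its complement
    are open, and the line is connected. It stands in for subdividing a path into small pieces. *)
Lemma real_induct (P : R -> Prop) :
  (forall s : R, exists2 V, nbhs s V & forall a b, V a -> V b -> P a -> P b) ->
  forall a b, P a -> P b.
Proof.
move=> loc a b Pa; suff -> : P = setT by [].
have : connected [set: R] by apply/connected_intervalP => x y ? ? z.
apply; first by exists a.
- exists P; last by rewrite setTI.
  rewrite openE => s Ps; have [V nV VP] := loc s.
  by apply: filterS (nV) => t Vt; apply: (VP s) => //; exact: nbhs_singleton.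
- exists P; last by rewrite setTI.
  rewrite -openC openE => s nPs; have [V nV VP] := loc s.
  apply: filterS (nV) => t Vt Pt; apply: nPs; apply: (VP t) => //.
  exact: nbhs_singleton.
Qed.

Local Open Scope group_scope.

(** The analogue of an antiderivative: locally [sigma] is the coboundary of [L], and the monodromy
    will be the total increment of [L]. *)
Definition primitive (b : R) sigma L := forall y, 0 <= y <= b ->
  exists2 V, nbhs y V & forall u v, V u -> V v -> 0 <= u <= b -> 0 <= v <= b ->
    sigma u v = (L u)^-1 * L v.

(** Retraction of the line onto [0, b]. It lets paths and cocycles live on the whole line, away from
    subspace topologies. *)
Definition clamp (b s : R) : R := Num.max 0%R (Num.min b s).

Lemma clampP b s : (0 <= b)%R -> (0 <= clamp b s <= b)%R.
Proof.
rewrite /clamp => b0; case: (lerP b s) => bs.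
  by case: (lerP 0%R b) => ?; apply/andP; split; lra.
by case: (lerP 0%R s) => ?; apply/andP; split; lra.
Qed.

Lemma clamp_id b s : (0 <= s <= b)%R -> clamp b s = s.
Proof.
move=> /andP[s0 sb]; rewrite /clamp.
have /min_idPr -> := sb; exact/max_idPr.
Qed.

Lemma clamp_continuous b : continuous (clamp b).
Proof.
move=> s; apply: (@continuous_max R R (cst 0%R) (fun s => Num.min b s) s).
  exact: cvg_cst.
apply: (@continuous_min R R (cst b) id s); first exact: cvg_cst.
exact: cvg_id.
Qed.

Lemma clamp_induct (b : R) (P : R -> Prop) : (0 <= b)%R ->
  (forall s : R, (0 <= s <= b)%R -> exists2 V, nbhs s V &
    forall u v, V u -> V v -> (0 <= u <= b)%R -> (0 <= v <= b)%R -> P u -> P v) ->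
  forall u v, (0 <= u <= b)%R -> (0 <= v <= b)%R -> P u -> P v.
Proof.
move=> b0 loc u v ub vb.
rewrite -{1}(clamp_id ub) -{1}(clamp_id vb).
apply: (@real_induct (fun s => P (clamp b s))) => s.
have [V nV VP] := loc _ (clampP s b0).
exists (clamp b @^-1` V); first exact: clamp_continuous.
by move=> x y Vx Vy; apply: VP => //; exact: clampP.
Qed.

(** [L v * (L' v)^-1] is locally constant, hence constant on [0, b]. *)
Lemma primitive_unique b sigma L L' : primitive b sigma L ->
  primitive b sigma L' -> forall u v, (0 <= u <= b)%R -> (0 <= v <= b)%R ->
  (L u)^-1 * L v = (L' u)^-1 * L' v.
Proof.
move=> pL pL' u v ub vb; have b0 : (0 <= b)%R by lra.
suff : L v * (L' v)^-1 = L u * (L' u)^-1.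
  move=> E; apply: (mulgI (L u)); rewrite mulVKg mulgA -E.
  by rewrite -mulgA mulVg mulg1.
apply: (@clamp_induct b (fun x => L x * (L' x)^-1 = L u * (L' u)^-1) b0 _ u v ub vb) => //.
move=> s sb; have [V nV VP] := pL _ sb; have [V' nV' VP'] := pL' _ sb.
exists (V `&` V'); first exact: filterI.
move=> x y [Vx V'x] [Vy V'y] xb yb <-.
have := VP x y Vx Vy xb yb; rewrite VP' // => /(congr1 (fun z => L x * z)).
rewrite mulVKg => <-.
by rewrite -!mulgA mulgV mulg1.
Qed.

(** Continuous induction on the length of the interval that carries a primitive. *)
Lemma primitive_ex (b : R) sigma : (0 <= b)%R -> lcocycle setT sigma ->
  exists L, primitive b sigma L.
Proof.
move=> b0 ls; pose P t := exists L, primitive t sigma L.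
suff : P b by [].
apply: (@clamp_induct b P b0 _ 0%R b); rewrite ?lexx ?b0 //; last first.
  exists (fun=> 1) => y y0; have -> : y = 0%R by lra.
  have [V nV VP] := ls 0%R I.
  exists V => // u v Vu Vv u0 v0; have -> : u = 0%R by lra.
  have -> : v = 0%R by lra.
  by rewrite invg1 mulg1 (cocycle_diag VP) //; exact: nbhs_singleton.
move=> s sb; have [V nV VP] := ls s I.
have [e /= e0 eV] := (nbhs_ballP s V).1 nV.
exists (ball s e); first exact: nbhsx_ballx.
move=> t1 t2 st1 st2 t1b t2b [L pL].
have [t12|t12] := lerP t2 t1.
  exists L => y yt2; have [|W nW WP] := pL y; first by lra.
  by exists W => // u v Wu Wv ut vt; apply: WP => //; lra.
have inV x : (t1 <= x <= t2)%R -> V x.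
  move=> x12; apply: eV; move: st1 st2; rewrite /ball /= !ltr_norml; lra.
have Vt1 : V t1 by apply: inV; lra.
(* Past [t1] the primitive is continued by the cocycle itself, which is additive on the ball around
   [s] that contains [t1] and [t2]. *)
exists (fun x => if (x <= t1)%R then L x else L t1 * sigma t1 x).
move=> y yt2; have [yt1|t1y|->] := ltgtP y t1.
- have [|W nW WP] := pL y; first by lra.
  exists (W `&` [set x | (x < t1)%R]).
    by apply: filterI => //; apply: open_nbhs_nbhs; split; [exact: open_lt|].
  move=> u v [Wu /= ut1] [Wv /= vt1] u2 v2; rewrite !ltW //; apply: WP => //; lra.
- exists [set x | (t1 < x)%R].
    by apply: open_nbhs_nbhs; split; [exact: open_gt|].
  move=> u v /= ut1 vt1 u2 v2; rewrite !leNgt ut1 vt1 /= invgM -mulgA mulKg.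
  have Vu : V u by apply: inV; lra.
  have Vv : V v by apply: inV; lra.
  apply: (mulgI (sigma t1 u)); rewrite mulVKg; exact: VP.
- have [|W nW WP] := pL t1; first by lra.
  have nV1 : nbhs t1 (ball s e).
    by apply: open_nbhs_nbhs; split => //; exact: ball_open.
  exists (W `&` ball s e); first exact: filterI.
  move=> u v [Wu /eV Vu] [Wv /eV Vv] u2 v2.
  have Wt1 := nbhs_singleton nW.
  case: (lerP u t1) => ut; case: (lerP v t1) => vt.
  + by apply: WP => //; lra.
  + rewrite mulgA -WP //; [|lra|lra].
    by rewrite VP.
  + rewrite invgM -mulgA -WP //; [|lra|lra].
    by rewrite -(cocycle_opp VP) ?VP.
  + rewrite invgM -mulgA mulKg -(cocycle_opp VP) ?VP //.
Qed.

(** For a local cocycle the default of [xget] is never reached, by [primitive_ex]. *)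
Definition mono sigma : G :=
  let L := xget (fun=> 1) (primitive 1 sigma) in (L 0%R)^-1 * L 1%R.

Lemma mono_eq sigma L : primitive 1 sigma L -> mono sigma = (L 0%R)^-1 * L 1%R.
Proof.
move=> pL; rewrite /mono; apply: (@primitive_unique 1 sigma) => //; try lra.
by apply: (@xgetPex _ (fun=> 1) (primitive 1 sigma)); exists L.
Qed.

Lemma mono1 sigma : (forall y : R, exists2 V, nbhs y V &
  forall u v, V u -> V v -> sigma u v = 1) -> mono sigma = 1.
Proof.
move=> s1; rewrite (@mono_eq _ (fun=> 1)) ?invg1 ?mulg1 // => y _.
by have [V nV VP] := s1 y; exists V => // u v Vu Vv _ _; rewrite VP // invg1 mulg1.
Qed.

(** Increments gauged by [kappa] telescope, so membership in a multiplicative set propagates from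
    short to long intervals. This is how a constraint on a motion becomes membership in a
    subgroup. *)
Lemma mono_mem sigma (kappa : R -> G) (H : G -> Prop) :
  lcocycle setT sigma -> H 1 -> (forall x y, H x -> H y -> H (x * y)) ->
  (forall y : R, (0 <= y <= 1)%R -> exists2 V, nbhs y V &
    forall u v, V u -> V v -> (0 <= u <= 1)%R -> (0 <= v <= 1)%R ->
    H (kappa u * sigma u v * (kappa v)^-1)) ->
  H (kappa 0%R * mono sigma * (kappa 1%R)^-1).
Proof.
move=> ls H1 HM loc; have [L pL] := @primitive_ex 1 sigma ler01 ls.
rewrite (mono_eq pL).
apply: (@clamp_induct 1 (fun t => H (kappa 0%R * ((L 0%R)^-1 * L t) * (kappa t)^-1))
  ler01 _ 0%R 1%R); rewrite ?lexx ?ler01 //; last first.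
  by rewrite mulVg mulg1 mulgV.
move=> s sb; have [V nV VP] := loc s sb; have [W nW WP] := pL s sb.
exists (V `&` W); first exact: filterI.
move=> u v [Vu Wu] [Vv Wv] ub vb Hu; have := HM _ _ Hu (VP u v Vu Vv ub vb).
by rewrite (WP u v) // !mulgA mulgVK mulgK.
Qed.

(** The comparison runs along the retraction [c] onto the interval between [u] and [v], so that it
    never leaves [V]. *)
Lemma primitive_local b sigma L (V : set R) : primitive b sigma L ->
  (forall x y z, V x -> V y -> V z -> sigma x y * sigma y z = sigma x z) ->
  forall u v, (0 <= u <= b)%R -> (0 <= v <= b)%R ->
  (forall x, (Num.min u v <= x <= Num.max u v)%R -> V x) ->
  (L u)^-1 * L v = sigma u v.
Proof.
move=> pL VP u v ub vb VI; have b0 : (0 <= b)%R by lra.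
pose c x := Num.min u v + clamp (Num.max u v - Num.min u v) (x - Num.min u v).
have mM : (Num.min u v <= Num.max u v)%R by rewrite /Num.min /Num.max; case: ifP => h; lra.
have cI x : (Num.min u v <= c x <= Num.max u v)%R.
  have : (0 <= Num.max u v - Num.min u v)%R by lra.
  by move=> /(clampP (x - Num.min u v)); rewrite /c; lra.
have cc : continuous c.
  move=> x; apply: cvgD; first exact: cvg_cst.
  apply: (@continuous_comp _ _ _ (fun x => x - Num.min u v)%R (clamp _)); last exact: clamp_continuous.
  by apply: cvgB; [exact: cvg_id|exact: cvg_cst].
have cid x : (Num.min u v <= x <= Num.max u v)%R -> c x = x.
  by move=> xI; rewrite /c clamp_id; lra.
have ub' : (Num.min u v <= u <= Num.max u v)%R by rewrite /Num.min /Num.max; case: ifP => h; lra.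
have vb' : (Num.min u v <= v <= Num.max u v)%R by rewrite /Num.min /Num.max; case: ifP => h; lra.
have cb x : (0 <= c x <= b)%R.
  have := cI x; rewrite /Num.min /Num.max; case: ifP => h; lra.
suff : L (c v) = L u * sigma u (c v).
  by rewrite cid // => ->; rewrite mulKg.
pose P x := L (c x) = L u * sigma u (c x).
refine (@real_induct P _ u v _); last first.
  rewrite /P cid // (cocycle_diag VP) ?mulg1 //; exact: VI.
move=> s; have [W nW WP] := pL _ (cb s).
exists (c @^-1` W); first exact: cc.
rewrite /P => x y /= Wx Wy E; apply: (mulgI (L (c x))^-1); rewrite -WP //.
rewrite E invgM -mulgA mulKg; apply: (mulgI (sigma u (c x))).
by rewrite mulVKg; apply: VP; apply: VI.
Qed.

(** Homotopy invariance. Horizontal primitives on two nearby levels are compared through vertical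
    increments ([good]), the neighbourhood of the level shrinking during the induction on [s]. *)
Lemma mono_square (sigma : R * R -> R * R -> G) : lcocycle setT sigma ->
  mono (fun s s' => sigma (s, 0%R) (s', 0%R)) *
  mono (fun r r' => sigma (1%R, r) (1%R, r')) =
  mono (fun r r' => sigma (0%R, r) (0%R, r')) *
  mono (fun s s' => sigma (s, 1%R) (s', 1%R)).
Proof.
move=> ls.
have lh r : lcocycle setT (fun s s' => sigma (s, r) (s', r)).
  apply: (lcocycle_comp (f := fun s => (s, r)) _ _ ls) => //.
  by apply: continuous_pair => ?; [exact: cvg_id|exact: cvg_cst].
have lv s : lcocycle setT (fun r r' => sigma (s, r) (s, r')).
  apply: (lcocycle_comp (f := fun r => (s, r)) _ _ ls) => //.
  by apply: continuous_pair => ?; [exact: cvg_cst|exact: cvg_id].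
have [L pL] := choice (fun r => primitive_ex ler01 (lh r)).
have [Lft pLft] := primitive_ex ler01 (lv 0%R).
have [Rgt pRgt] := primitive_ex ler01 (lv 1%R).
rewrite (mono_eq (pL 0%R)) (mono_eq (pL 1%R)) (mono_eq pLft) (mono_eq pRgt).
pose M r := (L r 0%R)^-1 * L r 1%R.
pose N r s := (L r 0%R)^-1 * L r s.
have good r0 s : (0 <= s <= 1)%R -> exists2 V, nbhs r0 V & forall r, V r ->
    sigma (0%R, r0) (0%R, r) * N r s = N r0 s * sigma (s, r0) (s, r).
  move=> sb; pose P s := exists2 V, nbhs r0 V & forall r, V r ->
    sigma (0%R, r0) (0%R, r) * N r s = N r0 s * sigma (s, r0) (s, r).
  apply: (@clamp_induct 1 P ler01 _ 0%R s) => //; rewrite ?lexx ?ler01 //; last first.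
    by exists setT; [exact: filterT|move=> r _; rewrite /N !mulVg mulg1 mul1g].
  move=> s1 s1b; have [V [[B1 B2] /= [nB1 nB2] BV] VP] := ls (s1, r0) I.
  have [e /= e0 eB1] := (nbhs_ballP s1 B1).1 nB1.
  exists (ball s1 e); first exact: nbhsx_ballx.
  move=> x y bx bw xb yb [W nW WP].
  exists (W `&` B2); first exact: filterI.
  move=> r [Wr Br].
  have Br0 := nbhs_singleton nB2.
  have loc r' : B2 r' -> N r' y = N r' x * sigma (x, r') (y, r').
    move=> Br'; rewrite -(@primitive_local 1 _ _ (ball s1 e) (pL r')) //.
    - by rewrite /N mulgA mulgK.
    - by move=> a b c ba bb bc; apply: VP; apply: BV; split => //; apply: eB1.
    - move=> z; move: bx bw; rewrite /ball /= !ltr_norml /Num.min /Num.max.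
      by case: ifP => h; lra.
  have VV a r' : ball s1 e a -> B2 r' -> V (a, r').
    by move=> /eB1 ba br; apply: BV.
  rewrite !loc // mulgA WP // -!mulgA; congr (_ * _).
  by rewrite !VP //; apply: VV.
(* The vertical primitives transport the horizontal monodromy of every level to a common frame,
   where [good] makes it locally constant in [r]. *)
have E : Lft 0%R * M 0%R * (Rgt 0%R)^-1 = Lft 1%R * M 1%R * (Rgt 1%R)^-1.
  apply: (@clamp_induct 1 (fun r => Lft 0%R * M 0%R * (Rgt 0%R)^-1 =
    Lft r * M r * (Rgt r)^-1) ler01 _ 0%R 1%R) => //; rewrite ?lexx ?ler01 //.
  move=> r0 r0b; have [|V nV VP] := good r0 1%R; first by rewrite lexx ler01.
  have [W nW WP] := pLft r0 r0b; have [W' nW' WP'] := pRgt r0 r0b.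
  have [U nU UP] := lv 0%R r0 I; have [U' nU' UP'] := lv 1%R r0 I.
  exists (V `&` W `&` W'); first by do 2?[apply: filterI => //].
  have key r : V r -> W r -> W' r -> (0 <= r <= 1)%R ->
      Lft r * M r * (Rgt r)^-1 = Lft r0 * M r0 * (Rgt r0)^-1.
    move=> Vr Wr W'r rb; have := VP r Vr.
    rewrite (WP r0 r) //; [|exact: nbhs_singleton].
    rewrite (WP' r0 r) //; [|exact: nbhs_singleton].
    rewrite -[N r _]/(M r) -[N r0 _]/(M r0) => /(congr1 (fun z => Lft r0 * z)).
    by rewrite !mulgA mulgV mul1g => ->; rewrite mulgK.
  by move=> x y [[Vx Wx] W'x] [[Vy Wy] W'y] xb yb ->; rewrite !key.
apply: (mulgI (Lft 0%R)); apply: (mulIg (Rgt 1%R)^-1).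
by rewrite /M !mulgA in E *; rewrite mulgK E mulgV mul1g.
Qed.

End Paths.

(** * Positive words, permutation braids and orders of four labels *)

Definition pos_word (s : seq nat) : word := [seq (false, inord k : 'I_3) | k <- s].
Definition pos_braid (s : seq nat) : B4 := braid_of_word (pos_word s).

Lemma pos_braid_cat s t : pos_braid (s ++ t) = (pos_braid s * pos_braid t)%g.
Proof. by rewrite /pos_braid /pos_word map_cat braid_of_word_cat. Qed.

Definition head_moves (s : seq nat) : seq (seq nat) :=
  match s with
  | 0 :: 2 :: s1 => [:: 2 :: 0 :: s1]
  | 2 :: 0 :: s1 => [:: 0 :: 2 :: s1]
  | 0 :: 1 :: 0 :: s1 => [:: 1 :: 0 :: 1 :: s1]
  | 1 :: 0 :: 1 :: s1 => [:: 0 :: 1 :: 0 :: s1]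
  | 1 :: 2 :: 1 :: s1 => [:: 2 :: 1 :: 2 :: s1]
  | 2 :: 1 :: 2 :: s1 => [:: 1 :: 2 :: 1 :: s1]
  | _ => [::]
  end%N.

Fixpoint moves (s : seq nat) : seq (seq nat) :=
  head_moves s ++ (if s is x :: s1 then [seq x :: t | t <- moves s1] else [::]).

(** Closure under the relations for [n] rounds, meant for evaluation. Only soundness is proved, so
    the number of rounds just has to be large enough in each computed instance. *)
Fixpoint braid_class (n : nat) (ss : seq (seq nat)) : seq (seq nat) :=
  if n is n'.+1 then braid_class n' (undup (ss ++ flatten (map moves ss))) else ss.

Lemma head_moves_sound s t :
  t \in head_moves s -> braid_eq (pos_word s) (pos_word t).
Proof.
have r2 i j k l s1 : braid_eq (pos_word [:: i; j]) (pos_word [:: k; l]) ->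
    braid_eq (pos_word [:: i, j & s1]) (pos_word [:: k, l & s1]).
  by move=> h; apply: (@braid_cat (pos_word [:: _; _]) (pos_word [:: _; _]));
    [|exact: braid_refl].
have r3 i j k l m n s1 : braid_eq (pos_word [:: i; j; k]) (pos_word [:: l; m; n]) ->
    braid_eq (pos_word [:: i, j, k & s1]) (pos_word [:: l, m, n & s1]).
  by move=> h; apply: (@braid_cat (pos_word [:: _; _; _]) (pos_word [:: _; _; _]));
    [|exact: braid_refl].
case: s => [|[|[|[|?]]] [|[|[|[|?]]] s]] //=.
- case: s => [|[|?] s] //; rewrite inE => /eqP ->.
  exact/r3/braid_near12.
- by rewrite inE => /eqP ->; exact/r2/braid_far.
- case: s => [|[|[|?]] s] //; rewrite inE => /eqP ->.
  exact/r3/braid_sym/braid_near12.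
- case: s => [|[|[|?]] s] //; rewrite inE => /eqP ->.
  exact/r3/braid_near23.
- by rewrite inE => /eqP ->; exact/r2/braid_sym/braid_far.
- case: s => [|[|[|[|?]]] s] //; rewrite inE => /eqP ->.
  exact/r3/braid_sym/braid_near23.
Qed.

Lemma moves_sound s t : t \in moves s -> braid_eq (pos_word s) (pos_word t).
Proof.
elim: s t => [|x s IH] t //.
rewrite -[moves _]/(head_moves (x :: s) ++ [seq x :: t | t <- moves s]) mem_cat => /orP[/head_moves_sound//|/mapP[u /IH su ->]].
by apply: (@braid_cat [:: _] [:: _]); [exact: braid_refl|].
Qed.

Lemma braid_class_sound n s t : t \in braid_class n [:: s] ->
  pos_braid s = pos_braid t.
Proof.
move=> h; apply/braid_of_wordP.
have : exists2 u, u \in [:: s] & braid_eq (pos_word u) (pos_word t).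
  elim: n [:: s] h => [|n IH] ss /=; first by exists t => //; exact: braid_refl.
  move=> /IH[u]; rewrite mem_undup mem_cat => /orP[us ut|]; first by exists u.
  move=> /flatten_mapP[v vs /moves_sound vu] ut; exists v => //.
  exact: braid_trans vu ut.
by case=> u; rewrite inE => /eqP ->.
Qed.

Definition pos_equiv s t := t \in braid_class 12 [:: s].

Definition swap_at (k : nat) (q : seq nat) : seq nat :=
  set_nth 0%N (set_nth 0%N q k (nth 0%N q k.+1)) k.+1 (nth 0%N q k).

(** Bubble sort spells a positive permutation braid. The fuel 6 of [perm_word] is the maximal number
    of inversions of four points. *)
Fixpoint bubble (n : nat) (q : seq nat) : seq nat :=
  if n is n'.+1 then
    if (nth 0 q 1 < nth 0 q 0)%N then 0 :: bubble n' (swap_at 0 q)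
    else if (nth 0 q 2 < nth 0 q 1)%N then 1 :: bubble n' (swap_at 1 q)
    else if (nth 0 q 3 < nth 0 q 2)%N then 2 :: bubble n' (swap_at 2 q)
    else [::]
  else [::].

Definition perms4 := Eval vm_compute in permutations (iota 0 4).

(* Orders of the four labels are encoded by the list of their ranks. *)
Definition perm_word (r r' : seq nat) : seq nat :=
  bubble 6 [seq nth 0%N r' (index k r) | k <- iota 0 4].

Definition perm_braid (r r' : seq nat) : B4 := pos_braid (perm_word r r').

Definition rlt (r : seq nat) (i j : nat) : bool := (nth 0 r i < nth 0 r j)%N.

Definition pairs4 : seq (nat * nat) :=
  [:: (0, 1); (0, 2); (0, 3); (1, 2); (1, 3); (2, 3)]%N.

Definition no_double_inv (r r' r'' : seq nat) : bool :=
  all (fun p => (rlt r p.1 p.2 == rlt r' p.1 p.2) ||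
                (rlt r' p.1 p.2 == rlt r'' p.1 p.2)) pairs4.

(** Without a double inversion the two words concatenate to a reduced word of the composite
    permutation, hence to the same positive braid. The check runs over all triples of orders. *)
Lemma perm_braid_additive r r' r'' : r \in perms4 -> r' \in perms4 ->
  r'' \in perms4 -> no_double_inv r r' r'' ->
  perm_braid r r'' = (perm_braid r r' * perm_braid r' r'')%g.
Proof.
move=> pr pr' pr'' nd; rewrite /perm_braid -pos_braid_cat.
apply: (@braid_class_sound 12).
suff /allP /(_ _ pr) /allP /(_ _ pr'') /allP /(_ _ pr') : all (fun r => all (fun r'' =>
   let cl := braid_class 12 [:: perm_word r r''] in all (fun r' =>
   if no_double_inv r r' r'' then perm_word r r' ++ perm_word r' r'' \in cl else true)
   perms4) perms4) perms4 by rewrite nd.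
by vm_cast_no_check (erefl true).
Qed.

Definition swap_ranks (k : nat) (r : seq nat) : seq nat :=
  [seq if n == k then k.+1 else if n == k.+1 then k else n | n <- r].

Lemma perm_braid_swap k r : (k < 3)%N -> r \in perms4 ->
  (perm_braid r (swap_ranks k r) = pos_braid [:: k]) *
  (swap_ranks k r \in perms4).
Proof.
move=> k3 pr; rewrite /perm_braid.
have /allP /(_ k) : all (fun k => all (fun r =>
  (perm_word r (swap_ranks k r) == [:: k]) && (swap_ranks k r \in perms4)) perms4) (iota 0 3).
  by vm_compute.
by rewrite mem_iota => /(_ k3) /allP /(_ _ pr) /andP[/eqP -> ->].
Qed.

Definition ranks (c : rel 'I_4) : seq nat :=
  [seq count (fun j => c j i) (enum 'I_4) | i <- enum 'I_4].

Definition strict_total (c : rel 'I_4) : Prop :=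
  (forall i j, i != j -> c j i = ~~ c i j) /\ (forall i, c i i = false) /\
  (forall i j k, c i j -> c j k -> c i k).

Definition o4 (k : nat) : 'I_4 := inord k.

Lemma enum4 : enum 'I_4 = [:: o4 0; o4 1; o4 2; o4 3].
Proof.
apply: (inj_map val_inj); rewrite val_enum_ord /= !inordK //.
Qed.

(** A tournament on four labels is a list of six bits, so the claim reduces to 64 evaluations. *)
Lemma ranksP c : strict_total c ->
  (ranks c \in perms4) /\ (forall i j : 'I_4, rlt (ranks c) i j = c i j).
Proof.
case=> anti [irr tr].
pose C (b : seq bool) (i j : nat) := if (i < j)%N
  then nth false b (index (i, j) pairs4) else (j < i)%N && ~~ nth false b (index (j, i) pairs4).
pose b := [seq c (o4 p.1) (o4 p.2) | p <- pairs4].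
have cC i j : (i < 4)%N -> (j < 4)%N -> c (o4 i) (o4 j) = C b i j.
  have n01 : o4 0 != o4 1 by rewrite -val_eqE /= !inordK.
  have n02 : o4 0 != o4 2 by rewrite -val_eqE /= !inordK.
  have n03 : o4 0 != o4 3 by rewrite -val_eqE /= !inordK.
  have n12 : o4 1 != o4 2 by rewrite -val_eqE /= !inordK.
  have n13 : o4 1 != o4 3 by rewrite -val_eqE /= !inordK.
  have n23 : o4 2 != o4 3 by rewrite -val_eqE /= !inordK.
  by case: i => [|[|[|[|i]]]] //; case: j => [|[|[|[|j]]]] // _ _;
    rewrite ?irr //= ?(anti _ _ n01) ?(anti _ _ n02) ?(anti _ _ n03)
      ?(anti _ _ n12) ?(anti _ _ n13) ?(anti _ _ n23).
pose rk (b : seq bool) := [seq count (fun j => C b j i) (iota 0 4) | i <- iota 0 4].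
have rE : ranks c = rk b.
  by rewrite /ranks enum4 /= !cC.
have trb : all (fun i => all (fun j => all (fun k => C b i j ==> C b j k ==> C b i k)
    (iota 0 4)) (iota 0 4)) (iota 0 4).
  apply/allP => i; rewrite mem_iota => /andP[_ i4].
  apply/allP => j; rewrite mem_iota => /andP[_ j4].
  apply/allP => k; rewrite mem_iota => /andP[_ k4]; rewrite -!cC //.
  by apply/implyP => h1; apply/implyP => h2; exact: tr h1 h2.
have : (rk b \in perms4) && all (fun i => all (fun j => rlt (rk b) i j == C b i j)
    (iota 0 4)) (iota 0 4).
  move: (b) (erefl : size b = 6%N) trb; clear.
  case=> [|b0 [|b1 [|b2 [|b3 [|b4 [|b5 [|//]]]]]]] // _.
  by case: b0; case: b1; case: b2; case: b3; case: b4; case: b5; vm_compute.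
case/andP => h1 /allP h2; rewrite rE; split => // i j.
have : (i : nat) \in iota 0 4 by rewrite mem_iota /= ltn_ord.
move=> /h2 /allP /(_ (j : nat)); rewrite mem_iota /= ltn_ord => /(_ isT) /eqP ->.
by rewrite -cC // /o4 !inord_val.
Qed.

Lemma ranks_eq c c' : (forall i j, c i j = c' i j) -> ranks c = ranks c'.
Proof.
by move=> E; rewrite /ranks; apply: eq_map => i; apply: eq_count => j; exact: E.
Qed.

Lemma ranks_nth c (i : 'I_4) : nth 0%N (ranks c) i = count (fun j => c j i) (enum 'I_4).
Proof.
by rewrite /ranks (nth_map i) ?size_enum_ord ?ltn_ord // nth_ord_enum.
Qed.

#[global] Opaque ranks perm_braid.

(** * The braid of a path of configurations *)

Section OrderCocycle.
Variable R : realType.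
Local Notation plane := (R * R)%type.
Local Notation config := ('I_4 -> plane).

(** A linear form close to the abscissa when [a] is small. Its order is stable under small motions
    as long as no two values agree, whereas the lexicographic order can jump. *)
Definition key (a : R) (z : config) (i : 'I_4) : R := (z i).1 - a * (z i).2.

Definition slope_lt (a : R) (z : config) : rel 'I_4 :=
  fun i j => key a z i < key a z j.

(* The order by [key a] for infinitesimal [a > 0]. *)
Definition lex_lt (z : config) : rel 'I_4 :=
  fun i j => ((z i).1 < (z j).1) || (((z i).1 == (z j).1) && ((z j).2 < (z i).2)).

Definition generic (a : R) (z : config) : Prop :=
  forall i j, i != j -> key a z i != key a z j.

Lemma slope_total a z : generic a z -> strict_total (slope_lt a z).
Proof.
move=> g; split=> [i j /g ij|]; first by rewrite /slope_lt -leNgt le_eqVlt eq_sym (negbTE ij).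
split=> [i|i j k]; rewrite /slope_lt ?ltxx //; exact: lt_trans.
Qed.

Lemma config_neq (z : config) i j : injective z -> i != j ->
  ((z i).1 == (z j).1) && ((z i).2 == (z j).2) = false.
Proof.
move=> zi ij; apply/negbTE/negP => /andP[/eqP e1 /eqP e2]; move/eqP: ij; apply.
by apply: zi; rewrite [LHS]surjective_pairing e1 e2 -surjective_pairing.
Qed.

Lemma lex_total z : injective z -> strict_total (lex_lt z).
Proof.
move=> zi; split=> [i j ij|].
  have := config_neq zi ij; rewrite /lex_lt.
  by case: ltgtP => //= _; case: ltgtP.
split=> [i|i j k]; first by rewrite /lex_lt !ltxx eqxx.
rewrite /lex_lt => /orP[h1|/andP[/eqP h1 h1']] /orP[h2|/andP[/eqP h2 h2']].
- by rewrite (lt_trans h1 h2).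
- by rewrite -h2 h1.
- by rewrite h1 h2.
- by rewrite h1 h2 eqxx (lt_trans h2' h1') orbT.
Qed.

Definition slope_ok (z z' : config) (a : R) : Prop :=
  [/\ 0 < a, generic a z & forall i j, slope_lt a z i j = slope_lt a z' i j].

Lemma slope_ok_generic z z' a : slope_ok z z' a -> generic a z'.
Proof.
move=> [a0 g E] i j ij; have := g i j ij; have := E i j; have := E j i.
by rewrite /slope_lt; case: (ltgtP (key a z' i)) => //; case: ltgtP.
Qed.

Lemma generic_inj z a : generic a z -> injective z.
Proof.
move=> g i j E; apply/eqP/negPn/negP => /g.
by rewrite /key E eqxx.
Qed.

Lemma slope_ok_sym z z' a : slope_ok z z' a -> slope_ok z' z a.
Proof. by move=> h; have g' := slope_ok_generic h; case: h => a0 g E; split. Qed.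

(** Each configuration is compared with an order common to both, which gives a quotient of two
    positive permutation braids. Configurations without a common slope receive a meaningless value,
    computed with slope 0. *)
Definition tau (z z' : config) : B4 :=
  let a := xget 0 (slope_ok z z') in
  (perm_braid (ranks (lex_lt z)) (ranks (slope_lt a z)) *
   (perm_braid (ranks (lex_lt z')) (ranks (slope_lt a z')))^-1)%g.

(** The difference of two keys is affine in the slope, so it changes sign at most once between an
    infinitesimal slope and [a']. *)
Lemma lex_slope_slope a a' z i j : injective z -> 0 < a -> a < a' -> i != j ->
  generic a' z ->
  (lex_lt z i j == slope_lt a z i j) || (slope_lt a z i j == slope_lt a' z i j).
Proof.
move=> zi a0 aa' ij g'; have := config_neq zi ij; have := g' i j ij.
rewrite /slope_lt /lex_lt /key.
case: (ltgtP (z i).1 (z j).1) => x; case: (ltgtP (z i).2 (z j).2) => y //= _ _; rewrite ?x ?y;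
  case: ltP => h; case: ltP => h' //=; exfalso; nra.
Qed.

Lemma perm_braid_slopes a a' z : injective z -> 0 < a -> a < a' ->
  generic a z -> generic a' z ->
  perm_braid (ranks (lex_lt z)) (ranks (slope_lt a' z)) =
  (perm_braid (ranks (lex_lt z)) (ranks (slope_lt a z)) *
   perm_braid (ranks (slope_lt a z)) (ranks (slope_lt a' z)))%g.
Proof.
move=> zi a0 aa' g g'.
have [p1 e1] := ranksP (lex_total zi).
have [p2 e2] := ranksP (slope_total g).
have [p3 e3] := ranksP (slope_total g').
apply: perm_braid_additive => //.
have k i j : (i < 4)%N -> (j < 4)%N -> i != j ->
    (rlt (ranks (lex_lt z)) i j == rlt (ranks (slope_lt a z)) i j) ||
    (rlt (ranks (slope_lt a z)) i j == rlt (ranks (slope_lt a' z)) i j).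
  move=> i4 j4 ij.
  have [-> ->] : i = o4 i /\ j = o4 j by rewrite /o4 !inordK.
  by rewrite !e1 !e2 !e3; apply: lex_slope_slope; rewrite // -val_eqE /= !inordK.
by rewrite /no_double_inv /= !k.
Qed.

(** Raising the slope from [a] to [b] multiplies both permutation braids on the right by the same
    braid, since the two configurations have the same order at each of these slopes. The factor
    cancels in the quotient. *)
Lemma tauE z z' a : slope_ok z z' a -> tau z z' =
  (perm_braid (ranks (lex_lt z)) (ranks (slope_lt a z)) *
   (perm_braid (ranks (lex_lt z')) (ranks (slope_lt a z')))^-1)%g.
Proof.
move=> ok; rewrite /tau; have : slope_ok z z' (xget 0 (slope_ok z z')).
  by apply: xgetPex; exists a.
move: (xget _ _) => b okb; wlog : a b ok okb / a < b.
  move=> W; have [ab|ba|->//] := ltgtP a b; first exact: W.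
  by apply/esym; apply: W.
move=> ab; have ok' := slope_ok_generic ok; have okb' := slope_ok_generic okb.
case: ok okb => [a0 g E] [b0 gb Eb].
have zi := generic_inj g; have z'i := generic_inj ok'.
have e1 : ranks (slope_lt a z) = ranks (slope_lt a z') by exact: ranks_eq.
have e2 : ranks (slope_lt b z) = ranks (slope_lt b z') by exact: ranks_eq.
have -> := perm_braid_slopes zi a0 ab g gb.
have -> := perm_braid_slopes z'i a0 ab ok' okb'.
rewrite -e1 -e2; move: (perm_braid _ _) (perm_braid _ _) (perm_braid _ _) => x y w.
by rewrite invgM mulgA mulgK.
Qed.

(** The slopes to avoid are finitely many quotients of coordinate differences; one plus the sum of
    their absolute values exceeds them all. *)
Lemma generic_ex z : injective z -> exists2 a, 0 < a & generic a z.
Proof.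
move=> zi; pose bad i j := `|((z i).1 - (z j).1) / ((z i).2 - (z j).2)|.
pose a := 1 + \sum_i \sum_j bad i j; exists a.
  by rewrite ltr_pwDl // sumr_ge0 // => i _; rewrite sumr_ge0 // => j _; exact: normr_ge0.
move=> i j ij; apply/eqP => E.
have {}E : (z i).1 - (z j).1 = a * ((z i).2 - (z j).2).
  by move: E; rewrite /key; lra.
have [y|y] := eqVneq ((z i).2 - (z j).2) 0.
  move: E; rewrite y mulr0 => x; have := config_neq zi ij.
  by rewrite -(subr_eq0 (z i).1) -(subr_eq0 (z i).2) x y eqxx.
have : a <= `|a| by exact: ler_norm.
have -> : `|a| = bad i j by rewrite /bad E mulfK.
rewrite /a (bigD1 i) //= (bigD1 j) //=.
have p1 : 0 <= \sum_(k < 4 | k != j) bad i k.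
  by rewrite sumr_ge0 // => k _; exact: normr_ge0.
have p2 : 0 <= \sum_(k < 4 | k != i) \sum_l bad k l.
  by rewrite sumr_ge0 // => k _; rewrite sumr_ge0 // => l _; exact: normr_ge0.
by move: p1 p2; set u := \sum_(_ | _) _; set v := \sum_(_ | _) _; lra.
Qed.

Section Family.
Variables (Y : topologicalType) (f : Y -> config).
Hypothesis cf : forall i, continuous (fun y => f y i).

Lemma key_continuous a i : continuous (fun y => key a (f y) i).
Proof.
have c1 := continuous_fst (cf (i := i)); have c2 := continuous_snd (cf (i := i)).
move=> y; have c3 : {for y, continuous (fun y => a * (f y i).2)}.
  by apply: cvgM; [exact: cvg_cst|exact: c2].
exact: (cvgB (c1 y) c3).
Qed.

Lemma generic_near a y : generic a (f y) -> exists2 V, nbhs y V &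
  forall x, V x -> forall i j, slope_lt a (f y) i j = slope_lt a (f x) i j.
Proof.
move=> g.
have n1 i j : \forall x \near y, slope_lt a (f y) i j = slope_lt a (f x) i j.
  have [->|ij] := eqVneq i j; first by near=> x; rewrite /slope_lt !ltxx.
  have := g i j ij; rewrite /slope_lt neq_lt => /orP[] h; near=> x.
    rewrite h.
    suff -> : key a (f x) i < key a (f x) j by [].
    rewrite -subr_gt0; near: x.
    have c : {for y, continuous (fun x => key a (f x) j - key a (f x) i)}.
      by apply: cvgB; exact: key_continuous.
    apply: (c [set r | 0 < r]); apply: open_nbhs_nbhs; split; first exact: open_gt.
    by rewrite /= subr_gt0.
  have -> : (key a (f y) i < key a (f y) j) = false by apply/negbTE; rewrite -leNgt ltW.
  apply/esym/negbTE; rewrite -leNgt ltW //.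
  rewrite -subr_gt0; near: x.
  have c : {for y, continuous (fun x => key a (f x) i - key a (f x) j)}.
    by apply: cvgB; exact: key_continuous.
  apply: (c [set r | 0 < r]); apply: open_nbhs_nbhs; split; first exact: open_gt.
  by rewrite /= subr_gt0.
have n2 : \forall x \near y, forall i j, slope_lt a (f y) i j = slope_lt a (f x) i j.
  by apply: filter_forall => i; apply: filter_forall => j; exact: n1.
by eexists; first exact: n2.
Unshelve. all: by end_near. Qed.

Lemma generic_local y : injective (f y) -> exists a, exists2 V, nbhs y V &
  forall u v, V u -> V v -> slope_ok (f u) (f v) a.
Proof.
move=> fi; have [a a0 g] := generic_ex fi; have [V nV VP] := generic_near g.
have ok u : V u -> slope_ok (f y) (f u) a by move=> /VP E; split.
exists a, V => // u v /ok ou /ok ov; split=> //; first exact: slope_ok_generic ou.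
by case: ou => _ _ E i j; case: ov => _ _ E' ; rewrite -E -E'.
Qed.

Lemma tau_lcocycle O : (forall y, O y -> injective (f y)) ->
  lcocycle O (fun a b => tau (f a) (f b)).
Proof.
move=> fi y /fi/generic_local[a [V nV VP]]; exists V => // u v w Vu Vv Vw.
rewrite (tauE (VP _ _ Vu Vv)) (tauE (VP _ _ Vv Vw)) (tauE (VP _ _ Vu Vw)).
by rewrite mulgA mulgVK.
Qed.

End Family.

Definition mconf (f : R -> config) : B4 := mono (fun s t => tau (f s) (f t)).

Lemma eq_mconf f g : f =1 g -> mconf f = mconf g.
Proof. by move=> /funext ->. Qed.

(** With a constant lexicographic order the two factors of every local [tau] agree: no crossing is
    seen. *)
Lemma mconf_lex f : (forall i, continuous (fun s => f s i)) ->
  (forall s, injective (f s)) ->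
  (forall s t i j, lex_lt (f s) i j = lex_lt (f t) i j) -> mconf f = 1%g.
Proof.
move=> cf fi E; apply: mono1 => y; have [a [V nV VP]] := generic_local cf (fi y).
exists V => // u v Vu Vv; rewrite (tauE (VP _ _ Vu Vv)).
rewrite (ranks_eq (E u v)); have [_ _ /ranks_eq ->] := VP _ _ Vu Vv.
by rewrite mulgV.
Qed.

Lemma mconf_square (f : R * R -> config) :
  (forall i, continuous (fun y => f y i)) -> (forall y, injective (f y)) ->
  (mconf (fun s => f (s, 0%R)) * mconf (fun r => f (1%R, r)) =
   mconf (fun r => f (0%R, r)) * mconf (fun s => f (s, 1%R)))%g.
Proof.
move=> cf fi; apply: (mono_square (sigma := fun a b => tau (f a) (f b))).
by apply: tau_lcocycle.
Qed.

End OrderCocycle.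

Lemma ranks_inj r r' : r \in perms4 -> r' \in perms4 ->
  (forall i j : 'I_4, rlt r i j = rlt r' i j) -> r = r'.
Proof.
move=> pr pr' E; apply/eqP.
have : all (fun r => all (fun r' => all (fun p => rlt r p.1 p.2 == rlt r' p.1 p.2) pairs4
   ==> (r == r')) perms4) perms4 by vm_compute.
move=> /allP /(_ _ pr) /allP /(_ _ pr') /implyP; apply.
have e k l : (k < 4)%N -> (l < 4)%N -> rlt r k l = rlt r' k l.
  by move=> k4 l4; have := E (o4 k) (o4 l); rewrite /= !inordK.
by rewrite /= !e // !eqxx.
Qed.

Lemma swap_ranksK k r : (k < 3)%N -> r \in perms4 -> swap_ranks k (swap_ranks k r) = r.
Proof.
move=> k3 pr; apply/eqP.
have /allP /(_ k) : all (fun k => all (fun r => swap_ranks k (swap_ranks k r) == r) perms4)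
  (iota 0 3) by vm_compute.
by rewrite mem_iota => /(_ k3) /allP /(_ _ pr).
Qed.

Lemma rlt_swap k r i j l m : (k < 3)%N -> r \in perms4 -> (i < 4)%N -> (j < 4)%N ->
  (l < 4)%N -> (m < 4)%N -> nth 0%N r i = k -> nth 0%N r j = k.+1 ->
  rlt (swap_ranks k r) l m =
  if ((l == i) && (m == j)) || ((l == j) && (m == i)) then ~~ rlt r l m else rlt r l m.
Proof.
move=> k3 pr i4 j4 l4 m4 /eqP ri /eqP rj.
have mi n : (n < 4)%N -> n \in iota 0 4 by move=> n4; rewrite mem_iota.
have : all (fun k => all (fun r => all (fun i => all (fun j => all (fun l => all (fun m =>
   (nth 0%N r i == k) ==> (nth 0%N r j == k.+1) ==> (rlt (swap_ranks k r) l m ==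
   if ((l == i) && (m == j)) || ((l == j) && (m == i)) then ~~ rlt r l m else rlt r l m))
   (iota 0 4)) (iota 0 4)) (iota 0 4)) (iota 0 4)) perms4) (iota 0 3) by vm_compute.
move=> /allP /(_ k); rewrite mem_iota => /(_ k3) /allP /(_ _ pr).
move=> /allP /(_ _ (mi _ i4)) /allP /(_ _ (mi _ j4)) /allP /(_ _ (mi _ l4)).
by move=> /allP /(_ _ (mi _ m4)) /=; rewrite ri rj => /eqP.
Qed.

Section Tracks.
Variable R : realType.
Local Notation plane := (R * R)%type.
Local Notation config := ('I_4 -> plane).

(** On the pair [i], [j] the common slope order agrees with exactly one of the two lexicographic
    orders, and the permutation braid issuing from the other one is one letter longer. This decides
    the sign of the crossing. *)
Lemma tau_swap (z z' : config) a r k (i j : 'I_4) : slope_ok z z' a -> (k < 3)%N ->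
  ranks (lex_lt z) = r -> ranks (lex_lt z') = swap_ranks k r ->
  nth 0%N r i = k -> nth 0%N r j = k.+1 ->
  tau z z' = if slope_lt a z i j then (pos_braid [:: k])^-1%g else pos_braid [:: k].
Proof.
move=> ok k3 rz rz' ri rj; rewrite (tauE ok) rz rz'.
have g := slope_ok_generic ok; have zi := generic_inj (slope_ok_generic (slope_ok_sym ok)).
case: ok => a0 gz E.
have [pr er] := ranksP (lex_total zi); rewrite rz in pr er.
have [pa ea] := ranksP (slope_total gz).
rewrite -(ranks_eq E); move: pa ea; set ra := ranks _ => pa ea.
have [sE ps] := perm_braid_swap k3 pr.
have [sE' _] := perm_braid_swap k3 ps; rewrite swap_ranksK // in sE'.
have rij : rlt r i j by rewrite /rlt ri rj.
have rji : rlt r j i = false by rewrite /rlt ri rj ltnNge leqnSn.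
have ij : (i == j) = false by apply/eqP => e; move: rij; rewrite e /rlt ltnn.
have aji : rlt ra j i = ~~ rlt ra i j.
  by have [an _] := slope_total gz; rewrite !ea an // ij.
have gen n m : (n < 4)%N -> (m < 4)%N -> n != m ->
    (rlt r n m == rlt (swap_ranks k r) n m) ||
    (if rlt ra i j then rlt r n m == rlt ra n m else rlt (swap_ranks k r) n m == rlt ra n m).
  move=> n4 m4 nm; rewrite (rlt_swap (i := i) (j := j) k3 pr) // ?ltn_ord //.
  case: ifP; last by rewrite eqxx.
  case/orP => /andP[/eqP -> /eqP ->]; rewrite ?aji ?rij ?rji; by case: (rlt ra i j).
rewrite -ea; case: ifP => sl.
  have -> : perm_braid (swap_ranks k r) ra = (perm_braid (swap_ranks k r) r * perm_braid r ra)%g.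
    apply: perm_braid_additive => //; apply/allP => -[n m]; rewrite /pairs4 => h.
    have : (n < 4)%N && (m < 4)%N && (n != m).
      by have /allP /(_ _ h) : all (fun p => (p.1 < 4)%N && (p.2 < 4)%N && (p.1 != p.2)) pairs4 by [].
    case/andP => /andP[n4 m4] nm; have := gen n m n4 m4 nm.
    by rewrite sl /= [X in X || _]eq_sym.
  by rewrite sE' invgM mulgA mulgV mul1g.
have -> : perm_braid r ra = (perm_braid r (swap_ranks k r) * perm_braid (swap_ranks k r) ra)%g.
  apply: perm_braid_additive => //; apply/allP => -[n m]; rewrite /pairs4 => h.
  have : (n < 4)%N && (m < 4)%N && (n != m).
    by have /allP /(_ _ h) : all (fun p => (p.1 < 4)%N && (p.2 < 4)%N && (p.1 != p.2)) pairs4 by [].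
  case/andP => /andP[n4 m4] nm; have := gen n m n4 m4 nm.
  by rewrite sl.
by rewrite sE mulgK.
Qed.

End Tracks.

(** * Half twists and isotopies *)

Section Twists.
Variable R : realType.
Local Notation plane := (R * R)%type.
Local Notation config := ('I_4 -> plane).

Implicit Types (x : letter) (s : R) (z : plane).

Definition center (x : letter) : R := x.2%:R + 3 / 2.

Definition twist_angle (x : letter) (z : plane) : R := (-1) ^+ x.1 * pi *
  Num.min 1 (Num.max 0 (2 - 2 * Num.sqrt ((z.1 - center x) ^+ 2 + z.2 ^+ 2))).

Definition partial_twist (x : letter) (s : R) (z : plane) : plane :=
  let a := s * twist_angle x z in
  (center x + ((z.1 - center x) * cos a - z.2 * sin a),
   (z.1 - center x) * sin a + z.2 * cos a).

Lemma partial_twist1 x : partial_twist x 1 = half_twist x.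
Proof. by apply/funext => z; rewrite /partial_twist mul1r. Qed.

Lemma partial_twist0 x : partial_twist x 0 = id.
Proof.
apply/funext => z; rewrite /partial_twist mul0r cos0 sin0 [RHS]surjective_pairing.
congr pair; ring.
Qed.

Lemma partial_twist_far x s z :
  1 <= (z.1 - center x) ^+ 2 + z.2 ^+ 2 -> partial_twist x s z = z.
Proof.
move=> h; rewrite /partial_twist /twist_angle; set r := Num.sqrt _.
have r1 : 1 <= r by rewrite -(@sqrtr1 R) ler_wsqrtr.
have -> : Num.max 0 (2 - 2 * r) = 0 by apply/max_idPl; lra.
have -> : Num.min 1 0 = 0 :> R by apply/min_idPr; lra.
rewrite !mulr0 cos0 sin0 [RHS]surjective_pairing; congr pair; ring.
Qed.

(** A rotation about the center preserves the radius, hence the angle by which the inverse has to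
    turn. *)
Lemma partial_twistK x s : cancel (partial_twist x s) (partial_twist x (- s)).
Proof.
move=> z; rewrite [RHS]surjective_pairing /partial_twist.
set a := s * twist_angle x z; set c := center x.
have h := cos2Dsin2 a.
have -> : twist_angle x (c + ((z.1 - c) * cos a - z.2 * sin a), (z.1 - c) * sin a + z.2 * cos a)
    = twist_angle x z.
  rewrite /twist_angle /= -/c; do 5!congr (_ _); congr (_ * Num.sqrt _).
  transitivity (((z.1 - c) ^+ 2 + z.2 ^+ 2) * (cos a ^+ 2 + sin a ^+ 2)); first by ring.
  by rewrite h mulr1.
rewrite mulNr -/a cosN sinN /=; congr pair.
  transitivity (c + (z.1 - c) * (cos a ^+ 2 + sin a ^+ 2)); first by ring.
  by rewrite h; ring.
transitivity (z.2 * (cos a ^+ 2 + sin a ^+ 2)); first by ring.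
by rewrite h mulr1.
Qed.

Lemma partial_twist_inj x s : injective (partial_twist x s).
Proof. exact: can_inj (partial_twistK x s). Qed.

Lemma partial_twist_out x s z : (~` @open_disk R) z -> partial_twist x s z = z.
Proof.
move=> /= /negP; rewrite -leNgt => h; apply: partial_twist_far.
by rewrite /center; case: x => e [[|[|[|//]]] ?] /=; nra.
Qed.

Section Continuity.
Variable Y : topologicalType.
Implicit Types (u v : Y -> R).

Lemma contD u v : continuous u -> continuous v -> continuous (fun y => u y + v y).
Proof. by move=> cu cv y; exact: (cvgD (cu y) (cv y)). Qed.
Lemma contB u v : continuous u -> continuous v -> continuous (fun y => u y - v y).
Proof. by move=> cu cv y; exact: (cvgB (cu y) (cv y)). Qed.
Lemma contM u v : continuous u -> continuous v -> continuous (fun y => u y * v y).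
Proof. by move=> cu cv y; exact: (cvgM (cu y) (cv y)). Qed.
Lemma contC (r : R) : continuous (fun _ : Y => r).
Proof. by move=> y; exact: cvg_cst. Qed.
Lemma cont1 (g : R -> R) u : continuous g -> continuous u -> continuous (fun y => g (u y)).
Proof. by move=> cg cu y; exact: (continuous_comp (cu y) (cg _)). Qed.

Lemma contMax u v : continuous u -> continuous v ->
  continuous (fun y => Num.max (u y) (v y)).
Proof. by move=> cu cv y; exact: (continuous_max (cu y) (cv y)). Qed.
Lemma contMin u v : continuous u -> continuous v ->
  continuous (fun y => Num.min (u y) (v y)).
Proof. by move=> cu cv y; exact: (continuous_min (cu y) (cv y)). Qed.

End Continuity.
Arguments contC {Y} r.

Lemma twist_angle_continuous x : continuous (twist_angle x).
Proof.
rewrite /twist_angle; apply: contM; first exact: contC.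
have cq : continuous (fun z : plane => 2 - 2 * Num.sqrt ((z.1 - center x) ^+ 2 + z.2 ^+ 2)).
  apply: contB; first exact: contC.
  apply: contM; first exact: contC.
  apply: cont1; first exact: sqrt_continuous.
  have c1 : continuous (fun z : plane => z.1 - center x).
    by apply: contB; [exact: continuous_fst (fun z => cvg_id)|exact: contC].
  have c2 : continuous (fun z : plane => z.2) by exact: continuous_snd (fun z => cvg_id).
  by apply: contD; [exact: (contM c1 c1)|exact: (contM c2 c2)].
apply: contMin; first exact: contC.
by apply: contMax; first exact: contC.
Qed.

Lemma partial_twist_continuous (Y : topologicalType) x (s : Y -> R) (g : Y -> plane) :
  continuous s -> continuous g -> continuous (fun y => partial_twist x (s y) (g y)).
Proof.
move=> cs cg; rewrite /partial_twist.
have ca : continuous (fun y => s y * twist_angle x (g y)).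
  apply: contM => // y; apply: (continuous_comp (cg y)); exact: twist_angle_continuous.
have cC := cont1 (@continuous_cos R) ca; have cS := cont1 (@continuous_sin R) ca.
have c1 := contB (continuous_fst cg) (contC (center x)); have c2 := continuous_snd cg.
apply: continuous_pair; last exact: (contD (contM c1 cS) (contM c2 cC)).
exact: (contD (contC (center x)) (contB (contM c1 cC) (contM c2 cS))).
Qed.

(** All letters run simultaneously; [mconf_word] separates them by a homotopy. *)
Fixpoint word_track (w : word) (s : R) : plane -> plane :=
  if w is x :: w' then word_track w' s \o partial_twist x s else id.

Lemma word_track0 w : word_track w 0 = id.
Proof. by elim: w => //= x w ->; rewrite partial_twist0. Qed.

Lemma word_track1 w : word_track w 1 = @word_homeo R w.
Proof. by elim: w => //= x w ->; rewrite partial_twist1. Qed.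

Lemma word_track_inj w s : injective (word_track w s).
Proof. by elim: w => [|x w IH] //=; apply: inj_comp => //; exact: partial_twist_inj. Qed.

Lemma word_track_out w s z : (~` @open_disk R) z -> word_track w s z = z.
Proof. by move=> zo; elim: w => [|x w IH] //=; rewrite partial_twist_out. Qed.

Lemma word_track_continuous (Y : topologicalType) w (s : Y -> R) (g : Y -> plane) :
  continuous s -> continuous g -> continuous (fun y => word_track w (s y) (g y)).
Proof.
move=> cs; elim: w g => [|x w IH] g cg //=.
by apply: (IH (fun y => partial_twist x (s y) (g y))); exact: partial_twist_continuous.
Qed.

(* Configurations of points [(n, 0)]: the punctures and points outside the disk. *)
Definition int_config (n : 'I_4 -> nat) : config := fun i => ((n i)%:R, 0).

Lemma int_config_inj n : injective n -> injective (int_config n).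
Proof. by move=> ni i j [/eqP]; rewrite eqr_nat => /eqP/ni. Qed.

Definition swap_nat (x : letter) (m : nat) : nat :=
  if m == x.2.+1 then x.2.+2 else if m == x.2.+2 then x.2.+1 else m.

Lemma swap_nat_inj x : injective (swap_nat x).
Proof.
by move=> m m'; rewrite /swap_nat; do ![case: eqP => ?]; lia.
Qed.

Lemma partial_twist_nat x s m : m != x.2.+1 -> m != x.2.+2 ->
  partial_twist x s (m%:R, 0) = (m%:R, 0).
Proof.
move=> m1 m2; apply: partial_twist_far => /=.
have [h|h] : (m <= x.2)%N \/ (x.2.+3 <= m)%N by lia.
  have : m%:R <= x.2%:R :> R by rewrite ler_nat.
  by rewrite /center; nra.
have : x.2.+3%:R <= m%:R :> R by rewrite ler_nat.
by rewrite -[x.2.+3]addn3 natrD /center; nra.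
Qed.

Lemma twist_angle_pair x (u : R) : u ^+ 2 = 1 / 4 ->
  twist_angle x (center x + u, 0) = (-1) ^+ x.1 * pi.
Proof.
move=> u2; rewrite /twist_angle /= [center x + u]addrC addrK u2 expr0n /= addr0.
have -> : 1 / 4 = (1 / 2) ^+ 2 :> R by field.
rewrite sqrtr_sqr ger0_norm; last lra.
have -> : 2 - 2 * (1 / 2) = 1 :> R by lra.
have -> : Num.max 0 1 = 1 :> R by apply/max_idPr; lra.
by rewrite minxx mulr1.
Qed.

Definition sg (x : letter) : R := (-1) ^+ x.1.

Lemma twist_cos x s : cos (s * (sg x * pi)) = cos (s * pi).
Proof.
by rewrite /sg; case: x.1; rewrite ?expr1 ?expr0 ?mul1r // mulN1r mulrN cosN.
Qed.

Lemma twist_sin x s : sin (s * (sg x * pi)) = sg x * sin (s * pi).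
Proof.
by rewrite /sg; case: x.1; rewrite ?expr1 ?expr0 ?mul1r // !mulN1r mulrN sinN.
Qed.

Lemma partial_twist_left x s : partial_twist x s (x.2.+1%:R, 0) =
  (center x - cos (s * pi) / 2, - (sg x * sin (s * pi) / 2)).
Proof.
have E : x.2.+1%:R = center x + - (1 / 2) :> R by rewrite -addn1 natrD /center; lra.
rewrite E /partial_twist twist_angle_pair /=; last by field.
by rewrite -/(sg x) twist_cos twist_sin; congr pair; field.
Qed.

Lemma partial_twist_right x s : partial_twist x s (x.2.+2%:R, 0) =
  (center x + cos (s * pi) / 2, sg x * sin (s * pi) / 2).
Proof.
have E : x.2.+2%:R = center x + 1 / 2 :> R by rewrite -addn2 natrD /center; lra.
rewrite E /partial_twist twist_angle_pair /=; last by field.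
by rewrite -/(sg x) twist_cos twist_sin; congr pair; field.
Qed.

Lemma partial_twist_end x n :
  (fun i => partial_twist x 1 (int_config n i)) = int_config (swap_nat x \o n).
Proof.
apply/funext => i; rewrite /int_config /swap_nat /=.
case: eqP => [->|/eqP n1]; last case: eqP => [->|/eqP n2]; last exact: partial_twist_nat.
  rewrite partial_twist_left mul1r cospi sinpi /center -[x.2.+2]addn2 natrD.
  by congr pair; field.
rewrite partial_twist_right mul1r cospi sinpi /center -[x.2.+1]addn1 natrD.
by congr pair; field.
Qed.

(** The index of a crossing counts positions among the labelled points only, so it can differ from
    the index of the half twist when some puncture carries no label. *)
Definition letter_at (x : letter) (k : nat) : B4 := braid_of_word [:: (x.1, inord k)].

Definition num_lt (n : 'I_4 -> nat) : rel 'I_4 := fun i j => (n i < n j)%N.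

Lemma num_lt_total n : injective n -> strict_total (num_lt n).
Proof.
move=> ni; split=> [i j ij|].
  by rewrite /num_lt -leqNgt [RHS]leq_eqVlt (inj_eq ni) eq_sym (negbTE ij).
by split=> [i|i j k]; rewrite /num_lt ?ltnn //; exact: ltn_trans.
Qed.

Section HalfTwistTrack.
Variables (n : 'I_4 -> nat) (x : letter).
Hypothesis ni : injective n.
Let f (s : R) : config := fun i => partial_twist x s (int_config n i).

Let cf i : continuous (fun s => f s i).
Proof.
have c1 : continuous (@id R) by move=> s; exact: cvg_id.
have c2 : continuous (fun _ : R => int_config n i) by move=> s; exact: cvg_cst.
exact: (partial_twist_continuous c1 c2).
Qed.

Let fi s : injective (f s).
Proof. by move=> i j /partial_twist_inj /(int_config_inj ni). Qed.

Let pos_bounds i s : if (n i == x.2.+1) || (n i == x.2.+2)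
  then (x.2.+1%:R <= (f s i).1 <= x.2.+2%:R : Prop) else (f s i).1 = (n i)%:R.
Proof.
have := cos_geN1 (s * pi); have := cos_le1 (s * pi).
have e1 : x.2.+1%:R = x.2%:R + 1 :> R by rewrite -addn1 natrD.
have e2 : x.2.+2%:R = x.2%:R + 2 :> R by rewrite -addn2 natrD.
rewrite /f /int_config; case: eqP => [->|/eqP n1].
  by rewrite partial_twist_left e1 e2 /center /=; lra.
case: eqP => [->|/eqP n2]; last by rewrite partial_twist_nat.
by rewrite partial_twist_right e1 e2 /center /=; lra.
Qed.

Let lex_other i j s : i != j ->
  ~~ [&& (n i == x.2.+1) || (n i == x.2.+2) & (n j == x.2.+1) || (n j == x.2.+2)] ->
  lex_lt (f s) i j = num_lt n i j.
Proof.
move=> ij; have nij : n i != n j by rewrite (inj_eq ni).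
have := pos_bounds i s; have := pos_bounds j s; rewrite /lex_lt /num_lt.
have [h|h|/eqP] := ltngtP (n i) (n j); last by rewrite (negbTE nij).
  case: ifP => pj; case: ifP => pi // bj bi _.
  - suff -> : (f s i).1 < (f s j).1 by [].
    rewrite bi; apply: (@lt_le_trans _ _ x.2.+1%:R); last by case/andP: bj.
    by rewrite ltr_nat; move: pi pj; lia.
  - suff -> : (f s i).1 < (f s j).1 by [].
    rewrite bj; apply: (@le_lt_trans _ _ x.2.+2%:R); first by case/andP: bi.
    by rewrite ltr_nat; move: pi pj; lia.
  - by rewrite bi bj ltr_nat h.
case: ifP => pj; case: ifP => pi // bj bi _.
- have lt : (f s j).1 < (f s i).1.
    rewrite bi; apply: (@le_lt_trans _ _ x.2.+2%:R); first by case/andP: bj.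
    by rewrite ltr_nat; move: pi pj; lia.
  by rewrite ltNge ltW //= gt_eqF.
- have lt : (f s j).1 < (f s i).1.
    rewrite bj; apply: (@lt_le_trans _ _ x.2.+1%:R); last by case/andP: bi.
    by rewrite ltr_nat; move: pi pj; lia.
  by rewrite ltNge ltW //= gt_eqF.
- by rewrite bi bj ltr_nat eqr_nat (negbTE nij) ltnNge ltnW.
Qed.

(** A moving point without partner stays between the abscissas of the two punctures, where no other
    labelled point lies. *)
Lemma half_twist_track_skip :
  ~ (exists i, n i = x.2.+1) \/ ~ (exists i, n i = x.2.+2) -> mconf f = 1%g.
Proof.
move=> skip; apply: mconf_lex => // s t i j.
have [->|ij] := eqVneq i j.
  by rewrite /lex_lt !ltxx !eqxx.
have nij : n i != n j by rewrite (inj_eq ni).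
rewrite !lex_other //; apply/negP => /andP[].
- move=> /orP[/eqP e1|/eqP e1] /orP[/eqP e2|/eqP e2]; try by rewrite e1 e2 eqxx in nij.
    by case: skip; apply; [exists i|exists j].
  by case: skip; apply; [exists j|exists i].
- move=> /orP[/eqP e1|/eqP e1] /orP[/eqP e2|/eqP e2]; try by rewrite e1 e2 eqxx in nij.
    by case: skip; apply; [exists i|exists j].
  by case: skip; apply; [exists j|exists i].
Qed.

(** The primitive is explicit: trivial while [i] precedes [j] lexicographically and equal to the
    letter afterwards, since a single adjacent swap takes place. *)
Lemma half_twist_track i j : n i = x.2.+1 -> n j = x.2.+2 ->
  mconf f = letter_at x (nth 0%N (ranks (num_lt n)) i).
Proof.
move=> nI nJ; have ij : i != j by rewrite -(inj_eq ni) nI nJ; apply/eqP; lia.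
set r := ranks (num_lt n); set k := nth 0%N r i.
have [pr er] := ranksP (num_lt_total ni); rewrite -/r in pr er.
have rj : nth 0%N r j = k.+1.
  have c1 : count (pred1 i) (enum 'I_4) = 1%N.
    by rewrite count_uniq_mem ?enum_uniq // mem_enum.
  rewrite /k /r !ranks_nth.
  transitivity (count (fun l => num_lt n l i) (enum 'I_4) + count (pred1 i) (enum 'I_4))%N;
    last by rewrite c1 addn1.
  rewrite -count_predUI (@eq_count _ (predI _ _) pred0) ?count_pred0 ?addn0; last first.
    move=> l /=; apply/negbTE/negP => /andP[]; rewrite /num_lt => h /eqP e.
    by move: h; rewrite e ltnn.
  apply: eq_count => l /=; rewrite /num_lt nJ nI ltnS leq_eqVlt orbC -nI (inj_eq ni).
  by rewrite nI.
have k3 : (k < 3)%N.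
  have /allP /(_ _ pr) /andP[/eqP sr /allP ar] :
    all (fun r => (size r == 4) && all (fun m => m < 4)%N r) perms4 by vm_compute.
  by have := ar (nth 0%N r j); rewrite rj -rj mem_nth ?sr // => /(_ isT).
have sE := (perm_braid_swap k3 pr).2.
(* [P s] says that [i] still precedes [j]. At the vertical moment, where the cosine vanishes, the
   higher point comes first, which for [i] means a negative twist. *)
pose P s := (0 < cos (s * pi)) || ((cos (s * pi) == 0) && (sg x < 0)).
have sgE : sg x = 1 \/ sg x = -1 by rewrite /sg; case: (x.1); [right|left].
have fI s : f s i = (center x - cos (s * pi) / 2, - (sg x * sin (s * pi) / 2)).
  by rewrite /f /int_config nI partial_twist_left.
have fJ s : f s j = (center x + cos (s * pi) / 2, sg x * sin (s * pi) / 2).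
  by rewrite /f /int_config nJ partial_twist_right.
have S0 s : 0 <= s <= 1 -> 0 <= sin (s * pi).
  move=> /andP[s0 s1]; apply: sin_ge0_pi; rewrite mulr_ge0 ?pi_ge0 //=.
  by rewrite ler_piMl ?pi_ge0.
have CS s : cos (s * pi) ^+ 2 + sin (s * pi) ^+ 2 = 1 by exact: cos2Dsin2.
have lexP s : 0 <= s <= 1 -> lex_lt (f s) i j = P s.
  move=> /S0 s0; have cs := CS s; rewrite /lex_lt fI fJ /P /=.
  move: (cos (s * pi)) (sin (s * pi)) s0 cs => C S s0 cs; have [c0|c0|c0] := ltgtP C 0.
  - have h : center x + C / 2 < center x - C / 2 by lra.
    by rewrite ltNge ltW //= gt_eqF.
  - by have -> : center x - C / 2 < center x + C / 2 by lra.
  - have Spos : 0 < S by rewrite c0 in cs; nra.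
    rewrite c0 mul0r subr0 addr0 !ltxx !eqxx /=; case: sgE => ->.
      by rewrite ltr10; apply/negbTE; rewrite -leNgt; lra.
    by rewrite ltrN10; apply/idP; lra.
have ranksE s : 0 <= s <= 1 -> ranks (lex_lt (f s)) = if P s then r else swap_ranks k r.
  move=> sb; have [pl el] := ranksP (lex_total (@fi s)).
  apply: ranks_inj => //; first by case: ifP.
  move=> l m; rewrite el; have [->|lm] := eqVneq l m; first by rewrite /lex_lt /rlt !ltxx !eqxx ltnn.
  case: (boolP [&& (n l == x.2.+1) || (n l == x.2.+2) & (n m == x.2.+1) || (n m == x.2.+2)]); last first.
    move=> h; rewrite lex_other //; case: ifP => _; first by rewrite er.
    rewrite (rlt_swap (i := i) (j := j) k3 pr) ?ltn_ord // er; case: ifP => // /orP[] /andP[/eqP e1 /eqP e2].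
      by move: h; rewrite (val_inj e1) (val_inj e2) nI nJ !eqxx orbT.
    by move: h; rewrite (val_inj e1) (val_inj e2) nI nJ !eqxx orbT.
  rewrite -nJ -nI !(inj_eq ni) => /andP[].
  have [an _] := lex_total (@fi s); have [an' _] := num_lt_total ni.
  have rij : rlt r i j by rewrite /rlt rj.
  have rji : rlt r j i = false by rewrite /rlt rj ltnNge leqnSn.
  move=> /orP[/eqP e1|/eqP e1] /orP[/eqP e2|/eqP e2]; subst l m; rewrite ?eqxx // in lm.
    rewrite lexP //; case: ifP => _; first by rewrite rij.
    by rewrite (rlt_swap (i := i) (j := j) k3 pr) ?ltn_ord // !eqxx rij.
  rewrite an // lexP //; case: ifP => _; first by rewrite rji.
  by rewrite (rlt_swap (i := i) (j := j) k3 pr) ?ltn_ord // !eqxx orbT rji.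
have xE : letter_at x k = if sg x < 0 then (pos_braid [:: k])^-1%g else pos_braid [:: k].
  rewrite /letter_at /sg; case: (x.1) => /=; rewrite ?expr1 ?expr0 ?ltrN10 ?ltr10.
    apply/esym; apply: mulg1_eq; rewrite /pos_braid -braid_of_word_cat.
    by apply/braid_of_wordP; exact: (braid_inv (false, inord k)).
  by [].
have key2 s t a : 0 <= s <= 1 -> 0 <= t <= 1 -> slope_ok (f s) (f t) a -> P s -> ~~ P t ->
    tau (f s) (f t) = letter_at x k.
  move=> sb tb ok Ps Pt; rewrite (tau_swap (i := i) (j := j) (r := r) (k := k) ok) //; last 2 first.
  - by rewrite ranksE // Ps.
  - by rewrite ranksE // (negbTE Pt).
  rewrite xE; congr (if _ then _ else _).
  have [a0 g E] := ok; have := E i j; have gij := g _ _ ij.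
  rewrite /slope_lt; move: gij; rewrite /key !fI !fJ /=.
  move: Ps Pt (S0 _ sb) (S0 _ tb) (CS s) (CS t); rewrite /P.
  move: (cos (s * pi)) (sin (s * pi)) (cos (t * pi)) (sin (t * pi)) => C S C' S'.
  move=> Ps Pt s0 t0 cs ct gij.
  case: sgE Ps Pt gij => -> Ps Pt gij.
    have C'0 : C' <= 0 by rewrite leNgt; apply/negP => h; move: Pt; rewrite h.
    move=> ->; rewrite ltr10; apply/negbTE; rewrite -leNgt; nra.
  have C0 : 0 <= C by case/orP: Ps => [/ltW//|/andP[/eqP -> _]].
  move=> _; rewrite ltrN10; rewrite lt_neqAle gij; nra.
pose L s := if P s then 1%g else letter_at x k.
have P0 : P 0 by rewrite /P mul0r cos0 ltr01.
have P1 : ~~ P 1.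
  by rewrite /P mul1r cospi negb_or; apply/andP; split; [rewrite -leNgt; lra|];
    rewrite negb_and; apply/orP; left; apply/eqP; lra.
rewrite /mconf (@mono_eq _ _ _ L); last first.
  move=> y yb; have [a [V nV VP]] := generic_local cf (@fi y).
  exists V => // s t Vs Vt sb tb; rewrite /L; have ok := VP _ _ Vs Vt.
  have eqc : P s = P t -> tau (f s) (f t) = 1%g.
    move=> e; rewrite (tauE ok) !ranksE // e; have [_ _ /ranks_eq ->] := ok.
    by rewrite mulgV.
  case: (boolP (P s)) => Ps; case: (boolP (P t)) => Pt.
  - by rewrite invg1 mulg1 eqc // Ps Pt.
  - by rewrite invg1 mul1g (key2 s t a).
  - rewrite mulg1 -(key2 t s a) ?(tauE ok) ?(tauE (VP _ _ Vt Vs)) ?invgM ?invgK //.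
    exact: VP.
  - by rewrite mulVg eqc // (negbTE Ps) (negbTE Pt).
by rewrite /L P0 (negbTE P1) invg1 mul1g.
Qed.
End HalfTwistTrack.
End Twists.

Lemma continuous_within_comp (X Y Z : topologicalType) (A : set Y) (f : Y -> Z)
    (g : X -> Y) :
  {within A, continuous f} -> continuous g -> (forall x, A (g x)) ->
  continuous (fun x => f (g x)).
Proof.
move=> /subspace_continuousP cf cg Ag x U nU.
have := cf _ (Ag x) U nU; rewrite /within /= => nV.
have h := cg x _ nV.
apply: (@filterS _ (nbhs x) _ (g @^-1` [set t | A t -> U (f t)])); last exact: h.
by move=> t /=; apply.
Qed.

Section WordTracks.
Variable R : realType.
Local Notation plane := (R * R)%type.
Local Notation config := ('I_4 -> plane).
Implicit Types (x : letter) (s : R) (w : word) (n : 'I_4 -> nat).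

(** Two simultaneous motions may be performed one after the other. *)
Lemma mconf_diag (f : R * R -> config) :
  (forall i, continuous (fun y => f y i)) -> (forall y, injective (f y)) ->
  mconf (fun t => f (t, t)) =
  (mconf (fun v => f (0%R, v)) * mconf (fun u => f (u, 1%R)))%g.
Proof.
(* Multiplying the first coordinate by the second collapses the bottom side to a point and puts the
   diagonal on the right side of the square. *)
move=> cf fi; pose g (y : R * R) := f (y.1 * y.2, y.2).
have c1 : continuous (fun y : R * R => y.1).
  exact: continuous_proj1.
have c2 : continuous (fun y : R * R => y.2).
  exact: continuous_proj2.
have cg i : continuous (fun y => g y i).
  have ch := continuous_pair (contM c1 c2) c2.
  exact: (continuous_compf ch (cf i)).
have := mconf_square cg (fun y => fi _); rewrite /g /=.
have -> : mconf (fun s => f (s * 0, 0)) = 1%g.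
  by apply: mconf_lex => // [i s|s t i j]; [rewrite /= (_ : (fun _ => _) = cst (f (0, 0) i));
    [exact: cvg_cst|apply/funext => t; rewrite mulr0]|rewrite !mulr0].
rewrite mul1g (_ : (fun r => f (1 * r, r)) = fun t => f (t, t)); last first.
  by apply/funext => r; rewrite mul1r.
have -> : (fun r => f (0 * r, r)) = fun v => f (0, v) by apply/funext => r; rewrite mul0r.
by have -> : (fun s => f (s * 1, 1)) = fun u => f (u, 1) by apply/funext => r; rewrite mulr1.
Qed.

Definition letter_track n x : B4 :=
  if [exists i, n i == x.2.+1] && [exists j, n j == x.2.+2]
  then letter_at x (count (fun l => n l <= x.2)%N (enum 'I_4)) else 1%g.

(** One word yields a braid for every choice of four starting abscissas, some of which may lie
    outside the disk: this is the device for forgetting a strand. *)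
Fixpoint track_braid n w : B4 :=
  if w is x :: w' then (letter_track n x * track_braid (swap_nat x \o n) w')%g else 1%g.

Lemma mconf_letter n x : injective n ->
  mconf (fun s i => partial_twist x s (int_config R n i)) = letter_track n x.
Proof.
move=> ni; rewrite /letter_track.
case: existsP => [[i /eqP nI]|h]; last first.
  by apply: half_twist_track_skip => //; left => -[i nI]; apply: h; exists i; apply/eqP.
case: existsP => [[j /eqP nJ]|h] /=; last first.
  by apply: half_twist_track_skip => //; right => -[j nJ]; apply: h; exists j; apply/eqP.
rewrite (half_twist_track R ni nI nJ) ranks_nth; congr letter_at.
by apply: eq_count => l; rewrite /num_lt nI ltnS.
Qed.

Lemma swap_nat_comp_inj n x : injective n -> injective (swap_nat x \o n).
Proof. by move=> ni; apply: inj_comp => //; exact: swap_nat_inj. Qed.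

Lemma mconf_word n w : injective n ->
  mconf (fun s i => word_track w s (int_config R n i)) = track_braid n w.
Proof.
elim: w n => [|x w IH] n ni /=.
  apply: mconf_lex => // [i s|s]; first exact: cvg_cst.
  exact: int_config_inj.
pose f (y : R * R) : config := fun i => word_track w y.1 (partial_twist x y.2 (int_config R n i)).
have c1 : continuous (fun y : R * R => y.1).
  exact: continuous_proj1.
have c2 : continuous (fun y : R * R => y.2).
  exact: continuous_proj2.
have cf i : continuous (fun y => f y i).
  apply: word_track_continuous => //; apply: partial_twist_continuous => // y.
  exact: cvg_cst.
have fi y : injective (f y).
  by move=> i j /word_track_inj/partial_twist_inj/(int_config_inj ni).
have := mconf_diag cf fi; rewrite /f /= => ->.
rewrite word_track0 /= mconf_letter //; congr (_ * _)%g.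
rewrite -IH; last exact: swap_nat_comp_inj.
by rewrite -partial_twist_end.
Qed.

(** Four points filling the punctures see every letter, at the position equal to its own index. *)
Lemma track_braid_full n w : injective n -> (forall i, 1 <= n i <= 4)%N ->
  track_braid n w = braid_of_word w.
Proof.
elim: w n => [|x w IH] n ni nb //=.
rewrite IH; [|exact: swap_nat_comp_inj|]; last first.
  move=> i /=; rewrite /swap_nat; have := nb i; have := ltn_ord x.2.
  by case: (n i =P _) => [?|?]; [lia|case: (n i =P _) => ?; lia].
rewrite -[x :: w]cat1s braid_of_word_cat; congr (_ * _)%g.
have pn : perm_eq [seq n i | i <- enum 'I_4] (iota 1 4).
  have un : uniq [seq n i | i <- enum 'I_4] by rewrite map_inj_uniq ?enum_uniq.
  have sub : {subset [seq n i | i <- enum 'I_4] <= iota 1 4}.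
    by move=> m /mapP[i _ ->]; rewrite mem_iota; have := nb i; lia.
  have [|_ e] := uniq_min_size un sub; first by rewrite size_map size_enum_ord.
  exact: (uniq_perm un (iota_uniq 1 4) e).
have ex m : (1 <= m <= 4)%N -> [exists i, n i == m].
  move=> mb; have : m \in [seq n i | i <- enum 'I_4].
    by rewrite (perm_mem pn) mem_iota; lia.
  by case/mapP => i _ ->; apply/existsP; exists i.
rewrite /letter_track !ex; [|by have := ltn_ord x.2; lia..].
have -> : count (fun l => n l <= x.2)%N (enum 'I_4) = x.2.
  rewrite -(count_map n (fun m => m <= x.2)%N) (permP pn).
  by case: x.2 => -[|[|[|]]].
by rewrite /letter_at inord_val -surjective_pairing.
Qed.

(** Parametrized by the whole line and starting at the identity, so the punctures travel at
    intermediate times and trace the braid. *)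
Definition isotopy_to (K : R -> plane -> plane) (h : plane -> plane) : Prop :=
  [/\ continuous (fun p : R * plane => K p.1 p.2),
      forall s, injective (K s),
      forall s z, (~` @open_disk R) z -> K s z = z,
      K 0 = id & K 1 = h].

Lemma int_config_cases n i : (1 <= n i)%N ->
  punctures (int_config R n i) \/ (~` @open_disk R) (int_config R n i).
Proof.
move=> n1; have [n4|n5] := leqP (n i) 4.
  left; have k4 : ((n i).-1 < 4)%N by lia.
  by exists (Ordinal k4) => //; rewrite /puncture /int_config /= prednK.
right; rewrite /open_disk /= /int_config /=; apply/negP; rewrite -leNgt.
have : 5 <= (n i)%:R :> R by rewrite (ler_nat R 5).
nra.
Qed.

Lemma puncture_track_constant (H : R -> plane -> plane) (z : plane) :
  continuous (fun s => H s z) -> (forall s, punctures (H s z)) ->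
  forall s, H s z = H 0 z.
Proof.
move=> cH pH s; apply: (@real_induct R (fun s => H s z = H 0 z) _ 0 s) => // t.
have c1 := continuous_fst cH.
have [k _ kE] := pH t.
exists [set u | `|(H u z).1 - (H t z).1| < 1 / 2].
  have := c1 t; move=> /cvgrPdist_lt /(_ (1 / 2)); rewrite divr_gt0 // => /(_ isT).
  by apply: filterS => u /=; rewrite distrC.
move=> u v /= hu hv <-; have [i _ iE] := pH u; have [j _ jE] := pH v.
move: hu hv; rewrite -iE -jE -kE /puncture /= => hu hv.
suff -> : i = j by [].
have {hu hv} : `|i.+1%:R - j.+1%:R| < 1 :> R.
  have := ler_normB (i.+1%:R - k.+1%:R : R) (j.+1%:R - k.+1%:R).
  have -> : i.+1%:R - k.+1%:R - (j.+1%:R - k.+1%:R) = i.+1%:R - j.+1%:R :> R by ring.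
  lra.
apply: contraPeq => ij; apply/negP; rewrite -leNgt.
wlog lt : i j {iE jE} ij / (i < j)%N.
  move=> W; have [|h|h] := ltngtP i j; [exact: W| |by case/eqP: ij; apply: val_inj].
  by rewrite distrC; apply: W; rewrite // eq_sym.
have : i.+2%:R <= j.+1%:R :> R by rewrite ler_nat.
by rewrite -addn1 natrD distrC => h; apply: le_trans (ler_norm _); lra.
Qed.

(** The given isotopy preserves the set of punctures, while the word track moves them. The family
    [F] runs both, and its diagonal leads from the identity to [h]. *)
Lemma represents_isotopy (h : plane -> plane) b : represents h b ->
  exists w K, [/\ braid_of_word w = b, isotopy_to K h &
    forall n, injective n -> (forall i, 1 <= n i)%N ->
    mconf (fun s i => K s (int_config R n i)) = track_braid n w].
Proof.
case=> w wb [H [cH hH H0 H1]].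
have [_ [winv [cwinv wK Kw]] Fw Qw] := word_homeo_disk R w.
pose c (u : R) := clamp 1 (1 - u).
have cb u : c u \in `[0, 1] by rewrite in_itv /= clampP.
have cc : continuous c.
  by apply: cont1; [exact: clamp_continuous|apply: contB; [exact: contC|move=> ?; exact: cvg_id]].
have c0 : c 0 = 1 by rewrite /c clamp_id; lra.
have c1 : c 1 = 0 by rewrite /c clamp_id; lra.
have cHc (Y : topologicalType) (u : Y -> R) (g : Y -> plane) : continuous u ->
    continuous g -> continuous (fun y => H (c (u y)) (g y)).
  move=> cu cg; have cp := continuous_pair (cont1 cc cu) cg.
  apply: (continuous_within_comp cH cp) => y; split => //=.
(* [c] reverses time: [H] ends at the word homeomorphism, so at [u = 0] it cancels against [winv]
   and only the word track remains. *)
pose F (u v : R) z := H (c u) (winv (word_track w v z)).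
have Fi u v : injective (F u v).
  have [_ [g [_ HK _]] _ _] := hH _ (cb u).
  move=> z z' /(can_inj HK) /(can_inj Kw) /word_track_inj; exact.
have cF (Y : topologicalType) (u v : Y -> R) (g : Y -> plane) : continuous u ->
    continuous v -> continuous g -> continuous (fun y => F (u y) (v y) (g y)).
  move=> cu cv cg; apply: cHc => //.
  exact: (continuous_compf (word_track_continuous (w := w) cv cg) cwinv).
exists w, (fun s => F s s); split => //.
  split.
  - apply: cF; [exact: continuous_proj1|exact: continuous_proj1|exact: continuous_proj2].
  - by move=> s; exact: Fi.
  - move=> s z zo; rewrite /F word_track_out //.
    have [_ _ FH _] := hH _ (cb s); rewrite (_ : winv z = z) ?FH //.
    by rewrite -{1}(Fw z zo) wK.
  - by apply/funext => z; rewrite /F c0 H1 word_track0 Kw.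
  - by apply/funext => z; rewrite /F c1 H0 word_track1 wK.
move=> n ni n1; pose f (y : R * R) : config := fun i => F y.1 y.2 (int_config R n i).
have cf i : continuous (fun y => f y i).
  apply: cF; first exact: continuous_proj1.
    exact: continuous_proj2.
  by move=> y; exact: cvg_cst.
have fi y : injective (f y) by move=> i j /Fi /(int_config_inj ni).
have E0 : (fun v => f (0, v)) = fun s i => word_track w s (int_config R n i).
  by apply/funext => v; apply/funext => i; rewrite /f /F /= c0 H1 Kw.
rewrite -[LHS]/(mconf (fun t => f (t, t))) (mconf_diag cf fi) E0 (mconf_word _ ni).
rewrite -[RHS]mulg1; congr (_ * _)%g.
have e u i : F u 1 (int_config R n i) = H (c u) (int_config R n i).
  by rewrite /F word_track1 wK.
(* Along the second side nothing moves: a puncture travels continuously in a discrete set, and the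
   outer points are fixed. *)
have cst u i : F u 1 (int_config R n i) = F 0 1 (int_config R n i).
  rewrite !e; have [pn|pn] := int_config_cases (n1 i).
    apply: (puncture_track_constant (H := fun u => H (c u))) => [|s].
      by apply: cHc => y; [exact: cvg_id|exact: cvg_cst].
    by have [_ _ _ <-] := hH _ (cb s); exists (int_config R n i).
  by have [_ _ -> //] := hH _ (cb u); have [_ _ -> //] := hH _ (cb 0).
apply: mconf_lex => [i|s|s t i j].
- by apply: cF => y; [exact: cvg_id|exact: cvg_cst|exact: cvg_cst].
- exact: (fi (s, 1)).
- by rewrite /lex_lt /f /= !(cst s) !(cst t).
Qed.

End WordTracks.

#[local] Opaque mconf track_braid.

(** * Forgetting a strand, and the commutation that results *)

Section Deletion.
Variable R : realType.
Local Notation plane := (R * R)%type.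
Local Notation config := ('I_4 -> plane).

(* Forgetting the point of label 3: it is sent far to the right of the others, so that
   a motion of three points defines a 4-braid. *)
Definition send_far (z : config) : config := fun i =>
  if i == ord_max then
    (6 + \sum_(j < 4 | j != ord_max) Num.max 0 ((z j).1 - 5), 0) else z i.

Lemma send_far_inj z : injective z -> injective (send_far z).
Proof.
have far z' i : i != ord_max -> (z' i).1 < (send_far z' ord_max).1.
  move=> iM; rewrite /send_far eqxx (bigD1 i) //=.
  have : 0 <= \sum_(j < 4 | (j != ord_max) && (j != i)) Num.max 0 ((z' j).1 - 5).
    by rewrite sumr_ge0 // => j _; rewrite le_max lexx.
  have : (z' i).1 - 5 <= Num.max 0 ((z' i).1 - 5) by rewrite le_max lexx orbT.
  lra.
move=> zi i j; have [->|iM] := eqVneq i ord_max; have [->|jM] := eqVneq j ord_max => //.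
- by move=> e; have := far z j jM; rewrite e /send_far (negbTE jM) ltxx.
- by move=> e; have := far z i iM; rewrite -e /send_far (negbTE iM) ltxx.
- by rewrite /send_far (negbTE iM) (negbTE jM) => /zi.
Qed.

Lemma send_far_id z : z ord_max = (6, 0) ->
  (forall i, i != ord_max -> (z i).1 <= 5) -> send_far z = z.
Proof.
move=> zM zi; apply/funext => i; rewrite /send_far; case: eqP => // ->.
rewrite big1 ?addr0 // => j /zi zj; apply/max_idPl; lra.
Qed.

Lemma send_far_continuous (Y : topologicalType) (f : Y -> config) :
  (forall i, i != ord_max -> continuous (fun y => f y i)) ->
  forall i, continuous (fun y => send_far (f y) i).
Proof.
move=> cf i; rewrite /send_far; case: eqP => [_|/eqP]; last exact: cf.
apply: continuous_pair; last exact: contC.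
apply: contD; first exact: contC.
have : forall s : seq 'I_4, continuous (fun y => \sum_(j <- s | j != ord_max)
    Num.max 0 ((f y j).1 - 5)).
  elim=> [|j s IH].
    rewrite (_ : (fun _ => _) = fun=> 0); first exact: contC.
    by apply/funext => y; rewrite big_nil.
  case: (boolP (j == ord_max)) => jM.
    rewrite (_ : (fun _ => _) = fun y => \sum_(j <- s | j != ord_max) Num.max 0 ((f y j).1 - 5)) //.
    by apply/funext => y; rewrite big_cons jM.
  rewrite (_ : (fun _ => _) = fun y => Num.max 0 ((f y j).1 - 5) +
     \sum_(j <- s | j != ord_max) Num.max 0 ((f y j).1 - 5)).
    apply: contD => //; apply: contMax; first exact: contC.
    by apply: contB; [exact: (continuous_fst (cf j jM))|exact: contC].
  by apply/funext => y; rewrite big_cons jM.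
exact.
Qed.

Lemma isotopy_inside (K : R -> plane -> plane) h s z : isotopy_to K h ->
  open_disk z -> open_disk (K s z).
Proof.
move=> [_ Ki Ko _ _] dz; apply: contrapT => nd; have := Ko s _ nd.
by move=> /Ki e; apply: nd; rewrite e.
Qed.

Lemma open_disk_lt z : @open_disk R z -> z.1 < 5.
Proof.
rewrite /open_disk /= => h; rewrite ltNge; apply/negP => z5; nra.
Qed.

Section Commutation.
Variables (K L : R -> plane -> plane) (h : plane -> plane) (w : word).
Variables (n : 'I_4 -> nat) (x : letter).
Hypothesis Kh : isotopy_to K h.
Hypothesis KM : forall n, injective n -> (forall i, 1 <= n i)%N ->
  mconf (fun s i => K s (int_config R n i)) = track_braid n w.
Hypothesis cL : continuous (fun p : R * plane => L p.1 p.2).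
Hypothesis Li : forall s, injective (L s).
Hypotheses (L0 : L 0 = h) (L1 : L 1 = id).
Hypothesis ni : injective n.
Hypothesis nM : n ord_max = 6%N.
Hypothesis nb : forall i, i != ord_max -> (1 <= n i <= 4)%N.
Let n' : 'I_4 -> nat := swap_nat x \o n.
Hypothesis Ln : forall s i, i != ord_max -> L s (int_config R n i) = int_config R n i.
Hypothesis Ln' : forall s i, i != ord_max -> L s (int_config R n' i) = int_config R n' i.

Let n'M : n' ord_max = 6%N.
Proof. by rewrite /n' /= nM /swap_nat; have := ltn_ord x.2; case: eqP => [?|?]; [lia|case: eqP; lia]. Qed.

Let n'b i : i != ord_max -> (1 <= n' i <= 4)%N.
Proof.
move=> /nb; rewrite /n' /= /swap_nat; have := ltn_ord x.2.
by case: (n i =P _) => [?|?]; [lia|case: (n i =P _) => ?; lia].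
Qed.

Let n'i : injective n'. Proof. exact: swap_nat_comp_inj. Qed.

Let inside (m : 'I_4 -> nat) i : (1 <= m i <= 4)%N -> open_disk (int_config R m i).
Proof.
rewrite /open_disk /int_config /= => /andP[m1 m4].
have : 1 <= (m i)%:R :> R by rewrite (ler_nat R 1).
have : (m i)%:R <= 4 :> R by rewrite (ler_nat R _ 4).
nra.
Qed.

Let Ktrack m : injective m -> m ord_max = 6%N ->
  (forall i, i != ord_max -> (1 <= m i <= 4)%N) ->
  mconf (fun s => send_far (fun i => K s (int_config R m i))) = track_braid m w.
Proof.
move=> mi mM mb; have m1 i : (1 <= m i)%N.
  by have [->|/mb] := eqVneq i ord_max; [rewrite mM|lia].
rewrite -(KM mi m1); apply: eq_mconf => s; apply: send_far_id.
  have [_ _ Ko _ _] := Kh; rewrite /int_config mM Ko //= /open_disk /=; apply/negP.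
  rewrite -leNgt; nra.
by move=> i /mb /inside /(isotopy_inside s Kh) /open_disk_lt /ltW.
Qed.

Let twist_inside s i : i != ord_max -> open_disk (partial_twist x s (int_config R n i)).
Proof.
move=> /nb /inside d; apply: contrapT => nd; have := partial_twist_out x s nd.
by move=> /partial_twist_inj e; apply: nd; rewrite e.
Qed.

Let twist_track : mconf (fun r => send_far (fun i => partial_twist x r (int_config R n i)))
  = letter_track n x.
Proof.
rewrite -(mconf_letter R x ni); apply: eq_mconf => s; apply: send_far_id.
  rewrite /int_config nM partial_twist_out // /open_disk /=; apply/negP.
  rewrite -leNgt; nra.
by move=> i /(twist_inside s) /open_disk_lt /ltW.
Qed.

(** The twist path and its image under [h] have the same braid, because [L] leads from [h] to the
    identity and fixes the three remaining points at both ends of the twist. Sweeping the twist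
    along [K] then gives the commutation. *)
Lemma deletion_commutes :
  (track_braid n w * letter_track n x = letter_track n x * track_braid n' w)%g.
Proof.
(* One square serves both [K] and [L]. Sending the fourth point beyond the current abscissas keeps
   the family injective even when [L] leaves the disk. *)
have square (J : R -> plane -> plane) : continuous (fun p : R * plane => J p.1 p.2) ->
   (forall s, injective (J s)) ->
   (mconf (fun s => send_far (fun i => J s (int_config R n i))) *
    mconf (fun r => send_far (fun i => J 1%R (partial_twist x r (int_config R n i)))) =
    mconf (fun r => send_far (fun i => J 0%R (partial_twist x r (int_config R n i)))) *
    mconf (fun s => send_far (fun i => J s (int_config R n' i))))%g.
  move=> cJ Ji; pose f (y : R * R) : config := send_far
    (fun i => J y.1 (partial_twist x y.2 (int_config R n i))).
  have cf i : continuous (fun y => f y i).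
    apply: send_far_continuous => {}i iM.
    have ct : continuous (fun y : R * R => partial_twist x y.2 (int_config R n i)).
      apply: partial_twist_continuous; first exact: continuous_proj2.
      by move=> y; exact: cvg_cst.
    exact: (continuous_compf (continuous_pair (@continuous_proj1 _ _) ct) cJ).
  have fi y : injective (f y).
    by apply: send_far_inj => i j /Ji/partial_twist_inj/(int_config_inj ni).
  have := mconf_square cf fi; rewrite /f /=.
  rewrite -(partial_twist_end R x n).
  by rewrite partial_twist0.
have cst (m : 'I_4 -> nat) : injective m -> (forall s i, i != ord_max ->
    L s (int_config R m i) = int_config R m i) ->
    mconf (fun s => send_far (fun i => L s (int_config R m i))) = 1%g.
  move=> mi Lm.
  have e s : send_far (fun i => L s (int_config R m i)) = send_far (int_config R m).
    apply/funext => i; rewrite /send_far; case: eqP => [_|/eqP/Lm //].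
    by congr (_ + _, _); apply: eq_bigr => j /Lm ->.
  apply: mconf_lex => [i|s|s t i j].
  - by under eq_fun do rewrite e; move=> s0; exact: cvg_cst.
  - by rewrite e; apply: send_far_inj; exact: int_config_inj.
  - by rewrite /lex_lt !e.
have [cK Ki _ K0 K1] := Kh.
have s1 := square K cK Ki; have s2 := square L cL Li.
rewrite (cst n ni Ln) (cst n' n'i Ln') mul1g mulg1 L1 L0 in s2.
rewrite K0 K1 -s2 in s1.
have := s1; rewrite (Ktrack ni nM nb) (Ktrack n'i n'M n'b).
by rewrite -[mconf (fun r => send_far (fun i => id _))]/(mconf (fun r =>
  send_far (fun i => partial_twist x r (int_config R n i)))) twist_track.
Qed.

End Commutation.

End Deletion.

(** * Brunnian isotopies in the disk and on the sphere *)

Section BrunnianLoops.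
Variable R : realType.
Local Notation plane := (R * R)%type.
Local Notation sphere := (one_point_compactification plane).

(** The common outcome of the two notions of Brunnian when the first puncture is forgotten. The
    boundary of the disk may move, as it does in an isotopy of the sphere. *)
Definition loop_fixing (L : R -> plane -> plane) (h : plane -> plane) : Prop :=
  [/\ continuous (fun p : R * plane => L p.1 p.2), forall s, injective (L s),
      L 0 = h, L 1 = id
    & forall s (k : 'I_4), k != ord0 -> L s (puncture R k) = puncture R k].

Lemma puncture_neq0 (k : 'I_4) : k != ord0 -> puncture R k != puncture R ord0.
Proof.
apply: contraNneq => -[/eqP]; rewrite -subr_eq0 -natrB // subn1 /= pnatr_eq0 => /eqP k0.
by apply/eqP/val_inj.
Qed.

(** The remaining punctures form a discrete set preserved at all times, so each of them stays at its
    final place, where the isotopy is the identity. *)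
Lemma disk_loop (h : plane -> plane) :
  Brunnian_homeo R (~` @open_disk R) (@punctures R) h -> exists L, loop_fixing L h.
Proof.
case=> _ /(_ (puncture R ord0)) [|H [cH hH H0 H1]]; first by exists ord0.
have cb s : clamp 1 s \in `[0, 1 : R] by rewrite in_itv /= clampP.
have cL : continuous (fun p : R * plane => H (clamp 1 p.1) p.2).
  have c1 := continuous_compf (@continuous_proj1 R plane) (@clamp_continuous R 1).
  apply: (continuous_within_comp cH (continuous_pair c1 (@continuous_proj2 R plane))).
  by move=> y; split => //=; exact: cb.
have L0 : H (clamp 1 0) = h by rewrite clamp_id ?lexx ?ler01.
have L1 : H (clamp 1 1) = id by rewrite clamp_id ?lexx ?ler01.
exists (fun s => H (clamp 1 s)); split => // [s|s k k0].
  by have [_ [g [_ Hg _]] _ _] := hH _ (cb s); exact: can_inj Hg.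
have e t : H (clamp 1 t) (puncture R k) = H (clamp 1 0) (puncture R k).
  apply: (puncture_track_constant (H := fun t => H (clamp 1 t))) => [|u].
    have c2 : continuous (fun s : R => (s, puncture R k)).
      by apply: continuous_pair => ?; [exact: cvg_id|exact: cvg_cst].
    exact: (continuous_compf c2 cL).
  have [_ _ _ E] := hH _ (cb u).
  have : [set H (clamp 1 u) z | z in @punctures R `\ puncture R ord0] (H (clamp 1 u) (puncture R k)).
    by exists (puncture R k) => //; split; [exists k|exact/eqP/puncture_neq0].
  by rewrite E => -[].
by rewrite e -(e 1) L1.
Qed.

Lemma some_continuous (Y : topologicalType) (f : Y -> plane) :
  continuous (fun y => Some (f y) : sphere) -> continuous f.
Proof.
move=> cf y U nU.
have h : nbhs y [set t | (Some @` U) (Some (f t))].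
  exact: cf y _ (one_point_compactification_some_nbhs _ _ nU).
change (nbhs y (f @^-1` U)); apply: filterS h.
by move=> t /= [u Uu [<-]].
Qed.

Lemma finite_track_constant (Y : topologicalType) (g : R -> Y) (D : set Y) (v : Y) :
  continuous g -> (forall s, D (g s)) ->
  (forall d, D d -> exists2 U, nbhs d U & forall d', D d' -> U d' -> d' = d) ->
  forall s, g s = g 0.
Proof.
move=> cg Dg sep s; apply: (@real_induct R (fun s => g s = g 0) _ 0 s) => // t.
have [U nU UP] := sep _ (Dg t); exists (g @^-1` U); first exact: cg.
by move=> a b /= Ua Ub <-; rewrite (UP _ (Dg a) Ua) (UP _ (Dg b) Ub).
Qed.

(** At infinity the isolating neighbourhood is the complement of the finite, hence compact, set of
    planar punctures. *)
Lemma sphere_puncture_sep (d : sphere) : sphere_punctures d ->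
  exists2 U, nbhs d U & forall d', sphere_punctures d' -> U d' -> d' = d.
Proof.
move=> [[_ [k _ <-] <-]|->].
  exists (Some @` [set z : plane | `|z.1 - (puncture R k).1| < 1 / 2]).
    apply: one_point_compactification_some_nbhs.
    have := @continuous_proj1 R R (puncture R k).
    move=> /cvgrPdist_lt /(_ (1 / 2)); rewrite divr_gt0 // => /(_ isT).
    by apply: filterS => u /=; rewrite distrC.
  move=> _ [[_ [l _ <-] <-]|->]; last by case.
  case=> _ /[swap] -[->] /=; rewrite /puncture /= => h.
  have [->//|kl] := eqVneq k l.
  exfalso; move: h; apply/negP; rewrite -leNgt.
  wlog lt : k l kl / (k < l)%N.
    move=> W; have [h|h|h] := ltngtP k l; first exact: W.
      by rewrite distrC; apply: W => //; rewrite eq_sym.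
    by case/eqP: kl; apply: val_inj.
  have : k.+2%:R <= l.+1%:R :> R by rewrite ler_nat.
  by rewrite -addn1 natrD => h; apply: le_trans (ler_norm _); lra.
have fC : finite_set (@punctures R) by apply: finite_image; exact: finite_finset.
exists (Some @` (~` @punctures R) `|` [set None]).
  exists (@punctures R) => //; split; first exact: finite_compact.
  have /accessible_finite_set_closed : accessible_space plane.
    exact: (hausdorff_accessible (@norm_hausdorff R plane)).
  exact.
move=> _ [[_ [l _ <-] <-]|->] //; case => // -[z /= nC [e]]; exfalso; apply: nC.
by rewrite e; exists l.
Qed.

(** Infinity is itself one of the remaining punctures, hence fixed throughout, so the isotopy
    restricts to the plane. *)
Lemma sphere_loop (h : plane -> plane) :
  Brunnian_homeo R set0 (@sphere_punctures R) (sphere_homeo h) ->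
  exists L, loop_fixing L h.
Proof.
case=> _ /(_ (Some (puncture R ord0))) [|H [cH hH H0 H1]].
  by left; exists (puncture R ord0) => //; exists ord0.
have cb s : clamp 1 s \in `[0, 1 : R] by rewrite in_itv /= clampP.
have cL : continuous (fun p : R * sphere => H (clamp 1 p.1) p.2).
  have c1 := continuous_compf (@continuous_proj1 R sphere) (@clamp_continuous R 1).
  apply: (continuous_within_comp cH (continuous_pair c1 (@continuous_proj2 R sphere))).
  by move=> y; split => //=; exact: cb.
have L0 : H (clamp 1 0) = sphere_homeo h by rewrite clamp_id ?lexx ?ler01.
have L1 : H (clamp 1 1) = id by rewrite clamp_id ?lexx ?ler01.
have Hi s : injective (H (clamp 1 s)).
  by have [_ [g [_ Hg _]] _ _] := hH _ (cb s); exact: can_inj Hg.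
have fixed d : sphere_punctures d -> d <> Some (puncture R ord0) ->
    forall s, H (clamp 1 s) d = d.
  move=> Dd d0 s.
  have e t : H (clamp 1 t) d = H (clamp 1 0) d.
    apply: (@finite_track_constant _ (fun t => H (clamp 1 t) d) (@sphere_punctures R)) => //.
    - have c2 : continuous (fun s : R => (s, d)).
        by apply: continuous_pair => ?; [exact: cvg_id|exact: cvg_cst].
      exact: (continuous_compf c2 cL).
    - move=> u; have [_ _ _ E] := hH _ (cb u).
      have : [set H (clamp 1 u) z | z in @sphere_punctures R `\ Some (puncture R ord0)]
        (H (clamp 1 u) d) by exists d.
      by rewrite E => -[].
    - exact: sphere_puncture_sep.
  by rewrite e -(e 1) L1.
have HN s : H (clamp 1 s) None = None by apply: fixed => //; right.
pose L s z : plane := odflt z (H (clamp 1 s) (Some z)).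
have LE s z : H (clamp 1 s) (Some z) = Some (L s z).
  rewrite /L; case E : (H _ _) => [//|]; exfalso.
  by have := Hi s (Some z) None; rewrite E HN => /(_ erefl).
exists L; split => [||||s k k0].
- apply: some_continuous; under eq_fun do rewrite -LE.
  have c2 : continuous (fun p : R * plane => (p.1, Some p.2 : sphere)).
    apply: continuous_pair; first exact: continuous_proj1.
    exact: (continuous_compf (@continuous_proj2 R plane) (@one_point_compactification_some_continuous _)).
  exact: (continuous_compf c2 cL).
- by move=> s z z' e; have := Hi s (Some z) (Some z'); rewrite !LE e => /(_ erefl) [].
- by apply/funext => z; have := LE 0 z; rewrite L0 /sphere_homeo /= => -[].
- by apply/funext => z; have := LE 1 z; rewrite L1 => -[].
- have p1 : sphere_punctures (Some (puncture R k)).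
    by left; exists (puncture R k) => //; exists k.
  have p2 : Some (puncture R k) <> Some (puncture R ord0).
    by move=> e; have := puncture_neq0 k0; rewrite (Some_inj e) eqxx.
  by have := fixed _ p1 p2 s; rewrite LE => -[].
Qed.

(** Three labels sit at positions 2, 3, 4 before and after the half twist, the punctures fixed by
    the loop; the fourth label starts at 6, outside the disk. *)
Lemma Brunnian_braid_commutes b x : Brunnian_braid R b \/ sphere_Brunnian R b ->
  exists w, braid_of_word w = b /\
    forall n, injective n -> n ord_max = 6%N ->
    (forall i, i != ord_max -> 2 <= n i <= 4)%N ->
    (forall i, i != ord_max -> 2 <= swap_nat x (n i) <= 4)%N ->
    (track_braid n w * letter_track n x =
     letter_track n x * track_braid (swap_nat x \o n) w)%g.
Proof.
have main h L : loop_fixing L h -> represents h b -> exists w, braid_of_word w = b /\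
    forall n, injective n -> n ord_max = 6%N ->
    (forall i, i != ord_max -> 2 <= n i <= 4)%N ->
    (forall i, i != ord_max -> 2 <= swap_nat x (n i) <= 4)%N ->
    (track_braid n w * letter_track n x =
     letter_track n x * track_braid (swap_nat x \o n) w)%g.
  move=> [cL Li L0 L1 Lp] /represents_isotopy[w [K [wb Kh KM]]]; exists w; split=> // n ni nM nb nb'.
  have Lint (m : 'I_4 -> nat) s i : (2 <= m i <= 4)%N ->
      L s (int_config R m i) = int_config R m i.
    move=> mb; have k4 : ((m i).-1 < 4)%N by lia.
    have -> : int_config R m i = puncture R (Ordinal k4).
      by rewrite /int_config /puncture /= prednK //; lia.
    by apply: Lp; rewrite -val_eqE /=; lia.
  apply: (@deletion_commutes R K L h w n x) => //.
  - by move=> i /nb; lia.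
  - by move=> s i iM; apply: Lint; exact: nb.
  - by move=> s i iM; apply: Lint; exact: nb'.
by case=> -[h rh] => [/disk_loop|/sphere_loop] [L Lh]; exact: (main h L).
Qed.

End BrunnianLoops.

#[local] Transparent track_braid.

(** * Forgetting strands on words *)

Definition spell (s : seq (bool * nat)) : word := [seq (x.1, inord x.2 : 'I_3) | x <- s].

Definition small (s : seq (bool * nat)) : bool := all (fun x => x.2 < 3)%N s.

Lemma spell_surj w : exists2 s, small s & w = spell s.
Proof.
elim: w => [|[e i] w [s s3 ->]]; first by exists [::].
by exists ((e, i : nat) :: s); rewrite /= ?ltn_ord // /spell /= inord_val.
Qed.

Definition swap_k (k m : nat) : nat :=
  if m == k.+1 then k.+2 else if m == k.+2 then k.+1 else m.

(** The form of [track_braid] made for evaluation: [p] marks the occupied positions, and a surviving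
    crossing is renumbered by the occupied positions to its left. *)
Fixpoint delete (p : nat -> bool) (s : seq (bool * nat)) : seq (bool * nat) :=
  if s is x :: s' then
    (if p x.2.+1 && p x.2.+2 then [:: (x.1, count p (iota 1 x.2))] else [::]) ++
    delete (p \o swap_k x.2) s'
  else [::].

Lemma delete_ext p q s : p =1 q -> delete p s = delete q s.
Proof.
elim: s p q => //= x s IH p q pq; rewrite !pq (eq_count pq); congr (_ ++ _).
by apply: IH => m; exact: pq.
Qed.

Definition present (n : 'I_4 -> nat) (m : nat) : bool := m \in [seq n i | i <- enum 'I_4].

Lemma presentP n m : reflect (exists i, n i = m) (present n m).
Proof.
apply: (iffP mapP) => [[i _ ->]|[i <-]]; first by exists i.
by exists i; rewrite ?mem_enum.
Qed.

Lemma swap_kK k : involutive (swap_k k).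
Proof.
move=> m; rewrite /swap_k; case: (m =P k.+1) => [->|h1].
  by rewrite eqxx; case: (k.+2 =P k.+1) => //; lia.
case: (m =P k.+2) => [->|h2]; first by rewrite eqxx.
by case: (m =P k.+1) => // _; case: (m =P k.+2).
Qed.

Lemma present_swap n (x : letter) : present (swap_nat x \o n) =1 present n \o swap_k x.2.
Proof.
move=> m; apply/presentP/presentP => -[i e]; exists i.
  by rewrite -e -[LHS](swap_kK x.2).
by rewrite /= -(swap_kK x.2 m) -e.
Qed.

Lemma count_present n k : injective n -> (forall i, 1 <= n i)%N ->
  count (fun l => n l <= k)%N (enum 'I_4) = count (present n) (iota 1 k).
Proof.
move=> ni n1; rewrite -(count_map n (fun m => m <= k)%N).
have un : uniq [seq n i | i <- enum 'I_4] by rewrite map_inj_uniq ?enum_uniq.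
rewrite -!size_filter; apply/perm_size/uniq_perm; rewrite ?filter_uniq ?iota_uniq // => m.
rewrite !mem_filter /present mem_iota andbC.
case: (boolP (m \in _)) => //= /mapP[i _ ->]; have := n1 i.
by rewrite add1n ltnS => ->.
Qed.

Lemma letter_track_spell n (e : bool) k : injective n -> (forall i, 1 <= n i)%N -> (k < 3)%N ->
  letter_track n (e, inord k) = if present n k.+1 && present n k.+2
    then braid_of_word (spell [:: (e, count (present n) (iota 1 k))]) else 1%g.
Proof.
move=> ni n1 k3; rewrite /letter_track /= inordK // count_present //.
have E m : [exists i, n i == m] = present n m.
  by apply/existsP/presentP => -[i /eqP]; exists i => //; apply/eqP.
by rewrite !E.
Qed.

Lemma swap_nat_ge1 (x : letter) m : (1 <= m)%N -> (1 <= swap_nat x m)%N.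
Proof. by rewrite /swap_nat; do ![case: ifP => ?]; lia. Qed.

Lemma track_braid_spell n s : injective n -> (forall i, 1 <= n i)%N -> small s ->
  track_braid n (spell s) = braid_of_word (spell (delete (present n) s)).
Proof.
elim: s n => [|[e k] s IH] n ni n1 //= /andP[k3 s3].
rewrite letter_track_spell // /spell map_cat braid_of_word_cat -/(spell _); congr (_ * _)%g.
  by case: ifP.
rewrite IH //; [|exact: swap_nat_comp_inj|by move=> i; exact: swap_nat_ge1].
by congr (braid_of_word (spell _)); apply: delete_ext => m; rewrite present_swap /= inordK.
Qed.

Definition word_perm (w : word) (m : nat) : nat := foldl (fun m x => swap_nat x m) m w.

Lemma word_perm_inj w : injective (word_perm w).
Proof.
elim: w => [|x w IH] //= m m'; rewrite /word_perm /= => /IH; exact: swap_nat_inj.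
Qed.

Lemma word_perm_ge1 w m : (1 <= m)%N -> (1 <= word_perm w m)%N.
Proof. by elim: w m => [|x w IH] m //= m1; apply/IH/swap_nat_ge1. Qed.

Lemma track_braid_cat n v w :
  track_braid n (v ++ w) = (track_braid n v * track_braid (word_perm v \o n) w)%g.
Proof.
by elim: v n => [|x v IH] n /=; [rewrite mul1g|rewrite IH mulgA].
Qed.

Lemma swap_natE (x : letter) : swap_nat x = swap_k x.2.
Proof. by []. Qed.

(** Forgetting is well defined on braids. For each relation the deleted words depend only on which
    positions are occupied, so finitely many patterns are compared by rewriting. The permutations
    are carried along because later letters see permuted positions. *)
Lemma track_braid_eq v w : braid_eq v w -> (forall m, word_perm v m = word_perm w m) /\
  (forall n, injective n -> (forall i, 1 <= n i)%N -> track_braid n v = track_braid n w).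
Proof.
have pos (a b : seq nat) : all (fun k => k < 3)%N (a ++ b) ->
    (forall p, pos_equiv [seq x.2 | x <- delete p [seq (false, k) | k <- a]]
                         [seq x.2 | x <- delete p [seq (false, k) | k <- b]]) ->
    forall n, injective n -> (forall i, 1 <= n i)%N ->
    track_braid n (pos_word a) = track_braid n (pos_word b).
  rewrite all_cat => /andP[a3 b3] ab n ni n1.
  have sp c : pos_word c = spell [seq (false, k) | k <- c] by rewrite /spell -map_comp.
  have sm c : all (fun k => k < 3)%N c -> small [seq (false, k) | k <- c].
    by rewrite /small all_map.
  rewrite !sp !track_braid_spell ?sm //.
  have de p c : spell (delete p [seq (false, k) | k <- c]) =
      pos_word [seq x.2 | x <- delete p [seq (false, k) | k <- c]].
    rewrite /spell /pos_word -map_comp; apply/eq_in_map => -[e k].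
    suff : forall c p, all (fun x => ~~ x.1) (delete p [seq (false, k) | k <- c]).
      by move=> /(_ c p) /allP h /h /= /negbTE ->.
    by elim=> //= x d IH q; rewrite all_cat IH andbT; case: ifP.
  rewrite !de; exact: braid_class_sound (ab _).
elim=> {v w}.
- by [].
- by move=> v w _ [h1 h2]; split=> [m|n ni n1]; rewrite ?h1 ?h2.
- move=> u v w _ [h1 h2] _ [h3 h4]; split=> [m|n ni n1]; first by rewrite h1 h3.
  by rewrite h2 // h4.
- move=> u u' v v' _ [h1 h2] _ [h3 h4]; split=> [m|n ni n1].
    by rewrite /word_perm !foldl_cat -!/(word_perm _ _) h1 h3.
  rewrite !track_braid_cat h2 // (_ : word_perm u' \o n = word_perm u \o n).
    congr (_ * _)%g; apply: h4; last by move=> i; exact: word_perm_ge1.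
    by apply: inj_comp => //; exact: word_perm_inj.
  by apply/funext => i /=; rewrite h1.
- case=> e i; split=> [m|n ni n1]; first by rewrite /word_perm /= !swap_natE /= swap_kK.
  have i3 := ltn_ord i; rewrite /= mulg1 -(inord_val i) !letter_track_spell //; first last.
  - by move=> j; exact: swap_nat_ge1.
  - exact: swap_nat_comp_inj.
  rewrite !(present_swap n (e, inord i)) /= inordK //.
  have -> : swap_k i i.+1 = i.+2 by rewrite /swap_k eqxx.
  have -> : swap_k i i.+2 = i.+1 by rewrite /swap_k eqxx; case: ifP => //; lia.
  rewrite [X in ((if X then _ else _) * _)%g]andbC; case: ifP => // _; last by rewrite mulg1.
  rewrite -braid_of_word_cat (_ : count (present (swap_nat _ \o n)) _ = count (present n) (iota 1 i)).
    by apply/braid_of_wordP; exact: (braid_inv (e, inord _)).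
  apply: eq_in_count => m; rewrite mem_iota present_swap /= inordK // => mi.
  by congr present; rewrite /swap_k; do ![case: ifP => ?]; lia.
- split=> [m|]; last apply: (pos [:: 0; 2] [:: 2; 0])%N => // p.
    by rewrite /word_perm /= !swap_natE /= !inordK //; case: m => [|[|[|[|[|m]]]]].
  by rewrite /=; case: (p 1%N); case: (p 2%N); case: (p 3%N); case: (p 4%N).
- split=> [m|]; last apply: (pos [:: 0; 1; 0] [:: 1; 0; 1])%N => // p.
    by rewrite /word_perm /= !swap_natE /= !inordK //; case: m => [|[|[|[|[|m]]]]].
  by rewrite /=; case: (p 1%N); case: (p 2%N); case: (p 3%N); case: (p 4%N).
- split=> [m|]; last apply: (pos [:: 1; 2; 1] [:: 2; 1; 2])%N => // p.
    by rewrite /word_perm /= !swap_natE /= !inordK //; case: m => [|[|[|[|[|m]]]]].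
  by rewrite /=; case: (p 1%N); case: (p 2%N); case: (p 3%N); case: (p 4%N).
Qed.

(** * Explicit kernel elements *)

Section MatrixReflection.
Variables (S : comUnitRingType) (C : Type) (c0 : C) (ad mu : C -> C -> C) (phi : C -> S).
Hypotheses (phi0 : phi c0 = 0) (phiD : {morph phi : x y / ad x y >-> x + y})
  (phiM : {morph phi : x y / mu x y >-> x * y}).

Definition entry (M : seq (seq C)) (i j : nat) : C := nth c0 (nth [::] M i) j.

(** Matrix products are computed on tables of codes that [phi] interprets in the ring; the codes
    will be residues or lists of coefficients. *)
Definition mul_table (M N : seq (seq C)) : seq (seq C) :=
  [seq [seq ad (ad (mu (entry M i 0) (entry N 0 j)) (mu (entry M i 1) (entry N 1 j)))
            (mu (entry M i 2) (entry N 2 j)) | j <- iota 0 3] | i <- iota 0 3]%N.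

Definition table_mx (M : seq (seq C)) : 'M[S]_3 := mx3 (map (map phi) M).

Lemma table_mxE M (i j : 'I_3) : table_mx M i j = phi (entry M i j).
Proof.
rewrite mxE /entry; have [iM|Mi] := ltnP i (size M).
  rewrite (nth_map [::]) //; have [jM|Mj] := ltnP j (size (nth [::] M i)).
    by rewrite (nth_map c0).
  by rewrite nth_default ?size_map // nth_default // phi0.
by rewrite (nth_default _ (s := map _ M)) ?size_map // (nth_default _ (s := M)) // !nth_nil phi0.
Qed.

Lemma table_mxM M N : table_mx (mul_table M N) = table_mx M * table_mx N.
Proof.
apply/matrixP => i j; rewrite table_mxE !mxE !big_ord_recl big_ord0 !table_mxE /= addr0 addrA.
by case: i => [[|[|[|//]]] ?]; case: j => [[|[|[|//]]] ?]; rewrite /entry /= !phiD !phiM.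
Qed.

Variables (one : seq (seq C)) (tab : bool * nat -> seq (seq C)) (t : S).
Hypothesis one_mx : table_mx one = 1.

Definition eval_table (s : seq (bool * nat)) : seq (seq C) :=
  foldl (fun M x => mul_table M (tab x)) one s.

Lemma eval_tableE s :
  (forall x, x \in s -> burau_letter t (x.1, inord x.2) = table_mx (tab x)) ->
  burau_word t (spell s) = table_mx (eval_table s).
Proof.
move=> tabE; rewrite -[LHS]mul1r -one_mx /eval_table.
elim: s one tabE => [|x s IH] M tabE /=; first by rewrite /burau_word big_nil mulr1.
rewrite -IH; last by move=> y ys; apply: tabE; rewrite inE ys orbT.
by rewrite /burau_word /= big_cons table_mxM mulrA tabE ?mem_head.
Qed.

End MatrixReflection.

(** Burau at t = -1 over F_5, with 4 for -1. Entries of generators and of inverses become small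
    residues, so words of any sign can be evaluated. *)
Definition burau_table5 (x : bool * nat) : seq (seq nat) :=
  (match x with
   | (false, 0) => [:: [:: 1; 0; 0]; [:: 1; 1; 0]; [:: 0; 0; 1]]
   | (false, 1) => [:: [:: 1; 4; 0]; [:: 0; 1; 0]; [:: 0; 1; 1]]
   | (false, _) => [:: [:: 1; 0; 0]; [:: 0; 1; 4]; [:: 0; 0; 1]]
   | (true, 0) => [:: [:: 1; 0; 0]; [:: 4; 1; 0]; [:: 0; 0; 1]]
   | (true, 1) => [:: [:: 1; 1; 0]; [:: 0; 1; 0]; [:: 0; 4; 1]]
   | (true, _) => [:: [:: 1; 0; 0]; [:: 0; 1; 1]; [:: 0; 0; 1]]
   end)%N.

Definition id_table : seq (seq nat) := [:: [:: 1; 0; 0]; [:: 0; 1; 0]; [:: 0; 0; 1]]%N.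

Definition eval5 := eval_table 0%N (fun x y => (x + y) %% 5)%N (fun x y => (x * y) %% 5)%N
  id_table burau_table5.

Lemma burau_gen_invE (S : comUnitRingType) (t : S) i : t \is a GRing.unit ->
  (burau_gen t i)^-1 = burau_gen_inv t i.
Proof.
move=> tU; rewrite -[LHS]mulr1 -(burau_gen_mulV tU i) mulKr //.
exact: burau_gen_unit.
Qed.

Lemma eval5E s : small s -> burau_word (-1 : 'F_5) (spell s) =
  table_mx (fun n => n%:R) (eval5 s).
Proof.
move=> s3; have mod5 n : (n %% 5)%:R = n%:R :> 'F_5.
  by rewrite (@GRing.natr_mod_pchar _ 5) // pchar_Fp.
have tU : (-1 : 'F_5) \is a GRing.unit by rewrite unitrN unitr1.
have m4 : 4%:R = -1 :> 'F_5 by apply/val_inj.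
apply: (eval_tableE (c0 := 0%N)).
- by [].
- by move=> x y /=; rewrite mod5 natrD.
- by move=> x y /=; rewrite mod5 natrM.
- exact: esym (mx3_1 _).
move=> x xs; have {xs s3} : (x.2 < 3)%N by have /allP := s3; apply.
case: x => -[] k /= k3; rewrite /burau_letter /=.
  rewrite burau_gen_invE // /burau_gen_inv /= inordK // invrN1 opprK.
  by case: k k3 => [|[|[|]]] //= _; rewrite /table_mx /= m4.
rewrite /burau_gen /= inordK // opprK.
by case: k k3 => [|[|[|]]] //= _; rewrite /table_mx /= m4.
Qed.

Lemma burau5_neq s s' : small s -> small s' -> eval5 s != eval5 s' ->
  all (all (fun n => n < 5)%N) (eval5 s) && all (all (fun n => n < 5)%N) (eval5 s') ->
  map size (eval5 s) = [:: 3; 3; 3]%N -> map size (eval5 s') = [:: 3; 3; 3]%N ->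
  braid_of_word (spell s) <> braid_of_word (spell s').
Proof.
move=> s3 s3' ne /andP[b b'] sz sz' /braid_of_wordP e.
have tU : (-1 : 'F_5) \is a GRing.unit by rewrite unitrN unitr1.
have := burau_word_eq tU e; rewrite !eval5E // => /matrixP E.
case/eqP: ne; apply: (@eq_from_nth _ [::]).
  by have /(congr1 size) := sz; have /(congr1 size) := sz'; rewrite !size_map => -> ->.
have e3 (M : seq (seq nat)) : map size M = [:: 3; 3; 3]%N -> size M = 3.
  by move=> /(congr1 size); rewrite size_map.
have e33 (M : seq (seq nat)) i : map size M = [:: 3; 3; 3]%N -> (i < 3)%N ->
    size (nth [::] M i) = 3.
  move=> h i3; rewrite -(nth_map _ 0%N size) ?e3 // h.
  by case: i i3 => [|[|[|]]].
move=> i; rewrite e3 // => i3; apply: (@eq_from_nth _ 0%N); first by rewrite !e33.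
move=> j; rewrite e33 // => j3; have := E (Ordinal i3) (Ordinal j3).
rewrite !(table_mxE (c0 := 0%N)) // /entry /= => /(congr1 (fun z : 'F_5 => z : nat)).
have lt5 (M : seq (seq nat)) : all (all (fun n => n < 5)%N) M -> map size M = [:: 3; 3; 3]%N ->
    (nth 0%N (nth [::] M i) j < 5)%N.
  move=> /allP h sM; have im : (i < size M)%N by rewrite e3.
  by have /allP h1 := h _ (mem_nth [::] im); apply: h1; rewrite mem_nth ?e33.
by rewrite !val_Fp_nat // !modn_small // lt5.
Qed.

Section PolynomialTables.
Variable p : nat.
Hypothesis pp : prime p.
Local Notation L := (laurent 'F_p).

Fixpoint add_coef (x y : seq nat) : seq nat :=
  match x, y with
  | [::], _ => y
  | _, [::] => x
  | a :: x', b :: y' => ((a + b) %% p)%N :: add_coef x' y'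
  end.

Fixpoint mul_coef (x y : seq nat) : seq nat :=
  if x is a :: x' then
    add_coef [seq ((a * b) %% p)%N | b <- y]
      (if x' is [::] then [::] else 0%N :: mul_coef x' y)
  else [::].

Definition eval_coef (x : seq nat) : L := foldr (fun a z => a%:R + laurentX * z) 0 x.

Lemma laurent_natp : p%:R = 0 :> L.
Proof.
apply: val_inj; rewrite rmorph_nat rmorph0 /=.
have -> : p%:R = tofrac (p%:R : {poly 'F_p}) by rewrite rmorph_nat.
have -> : p%:R = (p%:R : 'F_p)%:P :> {poly 'F_p} by rewrite rmorph_nat.
by rewrite pchar_Fp_0 // polyC0 rmorph0.
Qed.

Lemma laurent_mod n : (n %% p)%:R = n%:R :> L.
Proof.
by rewrite {2}(divn_eq n p) natrD natrM laurent_natp mulr0 add0r.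
Qed.

Lemma eval_add x y : eval_coef (add_coef x y) = eval_coef x + eval_coef y.
Proof.
elim: x y => [|a x IH] [|b y] /=; rewrite ?add0r ?addr0 //.
by rewrite IH laurent_mod natrD; ring.
Qed.

Lemma eval_mul x y : eval_coef (mul_coef x y) = eval_coef x * eval_coef y.
Proof.
have sc a z : eval_coef [seq ((a * b) %% p)%N | b <- z] = a%:R * eval_coef z.
  by elim: z => [|b z IH] /=; rewrite ?mulr0 // IH laurent_mod natrM; ring.
elim: x => [|a x IH] /=; first by rewrite mul0r.
rewrite eval_add sc; case: x IH => [|b x] IH; first by rewrite /=; ring.
by rewrite [eval_coef (0%N :: _)]/= IH; ring.
Qed.

(** Trailing zero coefficients are removed so that equality of polynomials can be tested on
    lists. *)
Definition strip (x : seq nat) : seq nat :=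
  foldr (fun a y => if (a == 0)%N && nilp y then [::] else a :: y) [::] x.

Lemma eval_strip x : eval_coef (strip x) = eval_coef x.
Proof.
elim: x => [|a x IH] //=; case: ifP => [/andP[/eqP -> /nilP e]|_] /=; last by rewrite IH.
by rewrite -IH e /= mulr0 addr0.
Qed.

#[local] Arguments eval_coef : simpl never.

(** The sign of the letter is ignored: only positive words are evaluated, the inverse letters being
    gathered in a denominator. *)
Definition burau_poly_table (x : bool * nat) : seq (seq (seq nat)) :=
  let m := [:: 0; p.-1]%N in let t := [:: 0; 1]%N in let o := [:: 1]%N in let z := [::] in
  match x.2 with
  | 0 => [:: [:: m; z; z]; [:: o; o; z]; [:: z; z; o]]
  | 1 => [:: [:: o; t; z]; [:: z; m; z]; [:: z; o; o]]
  | _ => [:: [:: o; z; z]; [:: z; o; t]; [:: z; z; m]]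
  end%N.

Definition eval_poly := eval_table [::] add_coef mul_coef
  [:: [:: [:: 1]; [::]; [::]]; [:: [::]; [:: 1]; [::]]; [:: [::]; [::]; [:: 1]]]%N
  burau_poly_table.

Definition positive (s : seq nat) : seq (bool * nat) := [seq (false, k) | k <- s].

Lemma eval_polyE s : all (fun k => k < 3)%N s ->
  burau_word laurentX (pos_word s) = table_mx eval_coef (eval_poly (positive s)).
Proof.
move=> s3; have -> : pos_word s = spell (positive s) by rewrite /spell -map_comp.
have o1 : eval_coef [:: 1]%N = 1 by rewrite /eval_coef /= mulr0 addr0.
have et : eval_coef [:: 0; 1]%N = laurentX by rewrite /eval_coef /= mulr0 addr0 add0r mulr1.
have em : eval_coef [:: 0; p.-1]%N = - laurentX.
  rewrite /eval_coef /= mulr0 addr0 add0r; have : (p.-1 + 1)%:R = 0 :> L.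
    by rewrite addn1 prednK ?prime_gt0 // laurent_natp.
  rewrite natrD => /eqP; rewrite addr_eq0 => /eqP ->.
  by rewrite mulrN mulr1.
apply: (eval_tableE (c0 := [::])).
- by [].
- exact: eval_add.
- exact: eval_mul.
- by rewrite /table_mx /= o1 -mx3_1.
move=> _ /mapP[k /(allP s3) k3 ->]; rewrite /burau_letter /= /burau_gen /= inordK //.
rewrite /table_mx /burau_poly_table.
by case: k k3 => [|[|[|]]] //= _; rewrite ?o1 ?et ?em.
Qed.

Lemma burau4_ker_pos s s' : all (fun k => k < 3)%N s -> all (fun k => k < 3)%N s' ->
  map (map strip) (eval_poly (positive s)) = map (map strip) (eval_poly (positive s')) ->
  burau4_ker p (pos_braid s * (pos_braid s')^-1)%g.
Proof.
move=> s3 s3' E; rewrite /burau4_ker /= burau4M.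
have -> : burau4 p (pos_braid s) = burau4 p (pos_braid s').
  rewrite /pos_braid !burau4_word !eval_polyE // /table_mx; congr mx3.
  have norm M : map (map eval_coef) M = map (map eval_coef) (map (map strip) M).
    rewrite -map_comp; apply: eq_map => r /=; rewrite -map_comp.
    by apply: eq_map => x /=; rewrite eval_strip.
  by rewrite norm E -norm.
by rewrite -burau4M mulgV burau4_1.
Qed.

End PolynomialTables.

(** Garside's half twist on four strands, whose square generates the center. Its powers in the
    denominators make the numerators positive words. *)
Definition half_twist3 : seq nat := [:: 0; 1; 0; 2; 1; 0]%N.

(* The quotients [kernel_num / kernel_den] were found by a computer search. *)
Definition kernel_num (p : nat) : seq nat := if p == 2%N then
[:: 2; 1; 1; 2; 0; 2; 0; 1; 1; 2; 0; 2; 0; 2; 0; 1; 1; 2; 0; 2; 0; 1; 1; 0]%N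
else
[:: 1; 2; 1; 0; 2; 0; 1; 1; 2; 0; 0; 1; 1; 2; 0; 2; 0; 1; 0; 0; 1; 2; 0; 1; 1; 2; 0; 2; 0; 1; 1; 1; 2; 0; 2; 1; 1; 2; 0; 2; 0; 1; 0; 1; 2; 0; 2; 0; 2; 0; 1; 1; 2; 2; 1; 1; 2; 0; 1; 1]%N.

Definition kernel_den (p : nat) : seq nat := if p == 2%N then
  flatten (nseq 4 half_twist3)
else flatten (nseq 8 half_twist3) ++
[:: 0; 1; 2; 1; 1; 1; 2; 0; 1; 1; 1; 0]%N.

Definition kernel_spell (p : nat) : seq (bool * nat) :=
  positive (kernel_num p) ++ [seq (true, k) | k <- rev (kernel_den p)].

Lemma spell_cat s s' : spell (s ++ s') = spell s ++ spell s'.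
Proof. exact: map_cat. Qed.

Lemma kernel_spellE p : braid_of_word (spell (kernel_spell p)) =
  (pos_braid (kernel_num p) * (pos_braid (kernel_den p))^-1)%g.
Proof.
rewrite /kernel_spell spell_cat braid_of_word_cat; congr (_ * _)%g.
  by rewrite /positive /spell -map_comp.
have -> : spell [seq (true, k) | k <- rev (kernel_den p)] = inv_word (pos_word (kernel_den p)).
  by rewrite /inv_word /spell /pos_word -!map_comp map_rev.
apply/esym/mulg1_eq; rewrite -braid_of_word_cat; apply/braid_of_wordP; exact: braid_eq_catV.
Qed.

Lemma kernel_element p : p = 2%N \/ p = 3 -> burau4_ker p (braid_of_word (spell (kernel_spell p))).
Proof.
rewrite kernel_spellE => hp.
have E : map (map strip) (eval_poly p (positive (kernel_num p))) =
    map (map strip) (eval_poly p (positive (kernel_den p))).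
  by case: hp => ->; vm_compute.
apply: burau4_ker_pos E; case: hp => ->; by vm_compute.
Qed.

(** The strand starting at position 1 is dropped; 6 is the abscissa where the fourth label is
    parked. *)
Definition kept (m : nat) : bool := m \in [:: 2; 3; 4; 6]%N.

(** The letter 0 is the half twist of positions 2 and 3, renumbered after the loss of position 1. *)
Lemma delete_kernel_noncommuting p : p = 2%N \/ p = 3 ->
  braid_of_word (spell (delete kept (kernel_spell p) ++ [:: (false, 0%N)])) <>
  braid_of_word (spell ((false, 0%N) :: delete kept (kernel_spell p))).
Proof. by case=> ->; apply: burau5_neq; vm_compute. Qed.

Lemma kernel_not_Brunnian (R : realType) p : p = 2%N \/ p = 3 ->
  ~ (Brunnian_braid R (braid_of_word (spell (kernel_spell p))) \/
     sphere_Brunnian R (braid_of_word (spell (kernel_spell p)))).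
Proof.
move=> hp /(Brunnian_braid_commutes (false, inord 1)) [w [/braid_of_wordP/track_braid_eq[_ wE]]].
pose n (i : 'I_4) := nth 0%N [:: 2; 3; 4; 6]%N i.
have ni : injective n by move=> [[|[|[|[|//]]]] ?] [[|[|[|[|//]]]] ?] // _; apply: val_inj.
have n1 i : (1 <= n i)%N by case: i => [[|[|[|[|//]]]] ?].
have nM : n ord_max = 6 by [].
have nb i : i != ord_max -> (2 <= n i <= 4)%N by case: i => [[|[|[|[|//]]]] ?].
have nb' i : i != ord_max -> (2 <= swap_nat (false, inord 1 : 'I_3) (n i) <= 4)%N.
  by rewrite swap_natE /= inordK //; case: i => [[|[|[|[|//]]]] ?].
move=> /(_ n ni nM nb nb').
have n'i := swap_nat_comp_inj (x := (false, inord 1)) ni.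
have n'1 i : (1 <= (swap_nat (false, inord 1 : 'I_3) \o n) i)%N by exact: swap_nat_ge1.
have pn : present n =1 kept by move=> m; rewrite /present enum4 /= /n /= !inordK.
have pn' : present (swap_nat (false, inord 1 : 'I_3) \o n) =1 kept.
  move=> m; rewrite present_swap /= inordK // pn /kept /swap_k.
  by case: m => [|[|[|[|[|[|[|m]]]]]]].
have s3 : small (kernel_spell p) by case: hp => ->; vm_compute.
have lt : letter_track n (false, inord 1) = braid_of_word (spell [:: (false, 0%N)]).
  by rewrite letter_track_spell // !pn (eq_count pn).
rewrite !wE // !track_braid_spell // lt (delete_ext _ pn) (delete_ext _ pn').
rewrite -!braid_of_word_cat -!spell_cat.
exact: delete_kernel_noncommuting.
Qed.

(** A trivial braid would stay trivial after forgetting a strand, and so commute with the half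
    twist. *)
Lemma kernel_element_neq1 p : p = 2%N \/ p = 3 ->
  braid_of_word (spell (kernel_spell p)) <> 1%g.
Proof.
move=> hp /braid_of_wordP/track_braid_eq[_ wE]; apply: (delete_kernel_noncommuting hp).
pose n (i : 'I_4) := nth 0%N [:: 2; 3; 4; 6]%N i.
have ni : injective n by move=> [[|[|[|[|//]]]] ?] [[|[|[|[|//]]]] ?] // _; apply: val_inj.
have n1 i : (1 <= n i)%N by case: i => [[|[|[|[|//]]]] ?].
have pn : present n =1 kept by move=> m; rewrite /present enum4 /= /n /= !inordK.
have s3 : small (kernel_spell p) by case: hp => ->; vm_compute.
have := wE n ni n1; rewrite track_braid_spell // (delete_ext _ pn) => E.
rewrite -[(_, _) :: delete _ _]cat1s !spell_cat !braid_of_word_cat {}E /=.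
by rewrite mul1g mulg1.
Qed.

(** * Leading terms of Burau matrices *)

Section Reduction.
Variable F : fieldType.
Local Notation L := (laurent F).
Local Notation X := (laurentX : L).

Lemma plift_subproof (P : {poly F}) : tofrac P \in @is_laurent F.
Proof. by apply/asboolP; exists 0%N, P; rewrite expr0 mulr1. Qed.

Definition plift (P : {poly F}) : L := Laurent (plift_subproof P).

Lemma pliftD P Q : plift (P + Q) = plift P + plift Q.
Proof. by apply: val_inj; rewrite rmorphD /= rmorphD. Qed.

Lemma pliftM P Q : plift (P * Q) = plift P * plift Q.
Proof. by apply: val_inj; rewrite rmorphM /= rmorphM. Qed.

Lemma plift0 : plift 0 = 0.
Proof. by apply: val_inj; rewrite rmorph0 /= rmorph0. Qed.

Lemma plift1 : plift 1 = 1.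
Proof. by apply: val_inj; rewrite rmorph1 /= rmorph1. Qed.

Lemma pliftN P : plift (- P) = - plift P.
Proof. by apply: val_inj; rewrite rmorphN /= rmorphN. Qed.

Lemma pliftX : plift 'X = X.
Proof. exact: val_inj. Qed.

Lemma plift_sum I (r : seq I) (f : I -> {poly F}) :
  plift (\sum_(i <- r) f i) = \sum_(i <- r) plift (f i).
Proof. exact: (big_morph _ pliftD plift0). Qed.

Lemma plift_inj : injective plift.
Proof. by move=> P Q /(congr1 val) /= /eqP; rewrite tofrac_eq => /eqP. Qed.

Lemma plift_mulXI k P Q : X ^+ k * plift P = X ^+ k * plift Q -> P = Q.
Proof. by move/(mulrI (unitrX k (laurentX_unit F)))/plift_inj. Qed.

(* [M] is, up to a power of t, a matrix of polynomials with value [N] at t = a. *)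
Definition reduces (a : F) n (M : 'M[L]_n) (N : 'M[F]_n) : Prop :=
  exists k l (P : 'I_n -> 'I_n -> {poly F}), forall i j,
    X ^+ k * M i j = X ^+ l * plift (P i j) /\ (P i j).[a] = N i j.

Lemma reducesM a n (M M' : 'M[L]_n) N N' :
  reduces a M N -> reduces a M' N' -> reduces a (M *m M') (N *m N').
Proof.
move=> [k [l [P PM]]] [k' [l' [P' PM']]].
exists (k + k')%N, (l + l')%N, (fun i j => \sum_m P i m * P' m j) => i j; split.
  rewrite !mxE plift_sum !mulr_sumr; apply: eq_bigr => m _.
  rewrite pliftM !exprD mulrACA (PM i m).1 (PM' m j).1; ring.
rewrite !mxE horner_sum; apply: eq_bigr => m _.
by rewrite hornerM (PM i m).2 (PM' m j).2.
Qed.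

Lemma reduces1 a n : reduces a (1%:M : 'M[L]_n) 1%:M.
Proof.
exists 0%N, 0%N, (fun i j => (i == j)%:R) => i j; rewrite !expr0 !mul1r !mxE.
by case: eqP => _; rewrite ?plift1 ?plift0 ?hornerC.
Qed.

(** All entries are normalized by the same powers of t, so equal entries have equal polynomials and
    equal values at [a]. *)
Lemma reduces_eq a n (M : 'M[L]_n) N i j i' j' :
  reduces a M N -> M i j = M i' j' -> N i j = N i' j'.
Proof.
move=> [k [l [P PM]]] E; rewrite -(PM i j).2 -(PM i' j').2; congr _.[_].
by apply: (@plift_mulXI l); rewrite -!(PM _ _).1 E.
Qed.

Lemma reduces_mul_eq a n (M M' : 'M[L]_n) N N' : reduces a M N -> reduces a M' N' ->
  M *m M' = M' *m M -> N *m N' = N' *m N.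
Proof.
move=> [k [l [P PM]]] [k' [l' [P' PM']]] E; apply/matrixP => i j.
rewrite !mxE -[LHS](_ : (\sum_m P i m * P' m j).[a] = _); last first.
  by rewrite horner_sum; apply: eq_bigr => m _; rewrite hornerM (PM i m).2 (PM' m j).2.
rewrite -[RHS](_ : (\sum_m P' i m * P m j).[a] = _); last first.
  by rewrite horner_sum; apply: eq_bigr => m _; rewrite hornerM (PM' i m).2 (PM m j).2.
congr _.[_]; apply: (@plift_mulXI (l + l')).
have /matrixP /(_ i j) := E; rewrite !mxE => {}E.
transitivity (X ^+ (k + k') * \sum_m M i m * M' m j).
  rewrite plift_sum !mulr_sumr; apply: eq_bigr => m _.
  by rewrite pliftM !exprD mulrACA -(PM i m).1 -(PM' m j).1; ring.
rewrite E plift_sum !mulr_sumr; apply: eq_bigr => m _.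
by rewrite (addnC l l') pliftM !exprD [RHS]mulrACA -(PM' i m).1 -(PM m j).1; ring.
Qed.

Lemma laurentX_pow (n : nat) : (- X) ^+ n = 1 -> n = 0%N.
Proof.
rewrite -pliftX -pliftN; have -> : plift (- 'X) ^+ n = plift ((- 'X) ^+ n).
  by elim: n => [|n IH]; rewrite ?expr0 ?plift1 // !exprS IH pliftM.
rewrite -plift1 => /plift_inj /(congr1 (fun P : {poly F} => size P)).
by rewrite -[- 'X]mulN1r -polyC1 -polyCN exprMn -polyC_exp size_Cmul
  ?size_polyXn ?size_poly1 ?expf_neq0 ?oppr_eq0 ?oner_neq0 // => -[].
Qed.

End Reduction.

(** * Exponent sums and determinants *)

Section ReducedBurau.
Variable p : nat.
Local Notation L := (laurent 'F_p).
Local Notation X := (laurentX : L).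

Lemma burau4_letter (e : bool) k : burau4 p (braid_of_word [:: (e, inord k)]) =
  burau_letter X (e, inord k).
Proof. by rewrite burau4_word /burau_word big_cons big_nil mulr1. Qed.

Definition sig (k : nat) : B4 := pos_braid [:: k].

Lemma burau4_sig k : (k < 3)%N -> burau4 p (sig k) = burau_gen X (inord k).
Proof. by rewrite /sig /pos_braid /pos_word /= burau4_letter /burau_letter. Qed.

Lemma burau4V b : burau4 p b^-1%g = (burau4 p b)^-1.
Proof.
have U : burau4 p b \is a GRing.unit by exact: burau4_unit.
by rewrite -[LHS](mulKr U) -burau4M mulgV burau4_1 mulr1.
Qed.

Lemma burau4_sigV k : (k < 3)%N -> burau4 p (sig k)^-1%g = burau_gen_inv X (inord k).
Proof.
move=> k3; rewrite burau4V burau4_sig // -[LHS]mulr1 -(burau_gen_mulV (laurentX_unit _) (inord k)).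
by rewrite mulKr // burau_gen_unit // laurentX_unit.
Qed.

Fixpoint sign_sum (w : word) : int :=
  if w is x :: w' then (if x.1 then -1 else 1) + sign_sum w' else 0.

Lemma sign_sum_cat v w : sign_sum (v ++ w) = sign_sum v + sign_sum w.
Proof. by elim: v => [|x v IH] /=; rewrite ?add0r // IH addrA. Qed.

Lemma sign_sum_eq v w : braid_eq v w -> sign_sum v = sign_sum w.
Proof.
elim=> {v w} [//|v w _ -> //|u v w _ -> _ -> //|u u' v v' _ uv _ vw|[[] i]|||] //=.
  by rewrite !sign_sum_cat uv vw.
Qed.

Definition expo (b : B4) : int := sign_sum (repr b).

Lemma expo_word w : expo (braid_of_word w) = sign_sum w.
Proof. exact/sign_sum_eq/braid_eq_repr. Qed.

Lemma expoM a b : expo (a * b)%g = expo a + expo b.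
Proof. by rewrite [(a * b)%g]/(B4_mul a b) /B4_mul expo_word sign_sum_cat. Qed.

Lemma expo1 : expo 1%g = 0.
Proof. exact: expo_word. Qed.

Lemma expoV a : expo a^-1%g = - expo a.
Proof. by apply/eqP; rewrite -addr_eq0 -expoM mulVg expo1. Qed.

Lemma expoX a n : expo (a ^+ n)%g = expo a *+ n.
Proof. by elim: n => [|n IH]; rewrite ?expg0 ?expo1 // expgS expoM IH mulrS. Qed.

Lemma expo_sig k : expo (sig k) = 1.
Proof. by rewrite /sig /pos_braid expo_word. Qed.

Lemma det_burau_gen (i : 'I_3) : \det (burau_gen X i) = - X.
Proof.
have det2 (A : 'M[L]_2) : \det A = A ord0 ord0 * A ord_max ord_max - A ord0 ord_max * A ord_max ord0.
  rewrite (expand_det_row _ ord0) !big_ord_recl big_ord0 /cofactor !det_mx11 !mxE /=.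
  have e0 : lift (ord0 : 'I_2) ord0 = ord_max by apply: val_inj.
  have e1 : lift (ord_max : 'I_2) ord0 = ord0 by apply: val_inj.
  by rewrite ?e0 ?e1 expr0 expr1; ring.
rewrite (expand_det_row _ ord0) !big_ord_recl big_ord0 /cofactor !det2 /burau_gen.
by case: i => [[|[|[|//]]] ?] /=; rewrite !mxE /=; ring.
Qed.

Lemma det_burau_word w : (- X) ^ (sign_sum w) = \det (burau_word X w).
Proof.
have U : - X \is a GRing.unit by rewrite unitrN laurentX_unit.
elim: w => [|[e i] w IH]; first by rewrite /burau_word big_nil expr0z det1.
rewrite /burau_word big_cons det_mulmx -/(burau_word X w) -IH /= exprzDr //; congr (_ * _).
rewrite /burau_letter /=; case: e; last by rewrite det_burau_gen expr1z.
have iU : burau_gen X i \is a GRing.unit by rewrite burau_gen_unit // laurentX_unit.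
by rewrite exprN1 det_inv det_burau_gen.
Qed.

(** Every generator has determinant -t, so the exponent sum is read from the determinant. *)
Lemma ker_expo b : burau4_ker p b -> expo b = 0.
Proof.
rewrite /burau4_ker /= /expo /burau4; move: (repr b) => w E.
have := det_burau_word w; rewrite E det1; case: (sign_sum w) => n.
  by rewrite -exprnP => /laurentX_pow ->.
rewrite NegzE -exprnN => /(congr1 GRing.inv); rewrite invr1 invrK.
by move/laurentX_pow.
Qed.

End ReducedBurau.

Section IntPowers.
Variable G : groupType.
Local Open Scope group_scope.
Implicit Types (x y : G) (k : int).

Definition zexp x k : G := match k with Posz n => x ^+ n | Negz n => (x ^+ n.+1)^-1 end.

Lemma zexpS x k : zexp x (k + 1)%R = zexp x k * x.
Proof.
case: k => [n|[|n]].
- by rewrite (_ : (Posz n + 1)%R = Posz n.+1); [rewrite /= expgSr | lia].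
- by rewrite (_ : (Negz 0 + 1)%R = Posz 0); [rewrite /= mulVg | lia].
rewrite (_ : (Negz n.+1 + 1)%R = Negz n); last by lia.
by rewrite /= [in RHS]expgS invgM mulgVK.
Qed.

Lemma zexpP x k : zexp x (k - 1)%R = zexp x k * x^-1.
Proof. by apply: (mulIg x); rewrite -zexpS mulgVK subrK. Qed.

Lemma zexp_commute x y k : commute x y -> commute (zexp x k) y.
Proof.
move=> xy; case: k => n /=; first exact/commute_sym/commuteX/commute_sym.
exact/commute_sym/commuteV/commuteX/commute_sym.
Qed.

End IntPowers.

Lemma pos_relation s t : pos_equiv s t -> pos_braid s = pos_braid t.
Proof. exact: braid_class_sound. Qed.

Ltac pos_eq := rewrite -?pos_braid_cat; apply: pos_relation; by vm_compute.

(** * Normal forms in the 3-braid group *)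

Section ThreeBraids.
Local Open Scope group_scope.

Lemma pos_sig k s : pos_braid (k :: s) = sig k * pos_braid s.
Proof. by rewrite -pos_braid_cat. Qed.

Lemma pos_nil : pos_braid [::] = 1.
Proof. by []. Qed.

(** Modulo the center of the 3-braid group [cyc3] has order 3 and [delta3] order 2; [sq3], the full
    twist, is their common power. [around] takes the fourth strand once around the other three. *)
Definition cyc3 : B4 := pos_braid [:: 0; 1]%N.
Definition delta3 : B4 := pos_braid [:: 0; 1; 0]%N.
Definition sq3 : B4 := pos_braid [:: 0; 1; 0; 0; 1; 0]%N.
Definition around : B4 := pos_braid [:: 2; 1; 0; 0; 1; 2]%N.

Lemma delta3_sq : delta3 * delta3 = sq3. Proof. by rewrite -pos_braid_cat. Qed.
Lemma cyc3_cube : cyc3 * cyc3 * cyc3 = sq3. Proof. by pos_eq. Qed.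
Lemma sq3_sig k : (k < 2)%N -> commute sq3 (sig k).
Proof. by case: k => [|[|]] // _; rewrite /commute; pos_eq. Qed.
Lemma around_sig k : (k < 2)%N -> commute around (sig k).
Proof. by case: k => [|[|]] // _; rewrite /commute; pos_eq. Qed.

Inductive in12 : B4 -> Prop :=
| in12_1 : in12 1
| in12_sig k b : (k < 2)%N -> in12 b -> in12 (sig k * b)
| in12_sigV k b : (k < 2)%N -> in12 b -> in12 ((sig k)^-1 * b).

Lemma in12M a b : in12 a -> in12 b -> in12 (a * b).
Proof.
elim=> [|k c k2 _ IH|k c k2 _ IH] hb; rewrite ?mul1g // -mulgA.
  by apply: in12_sig => //; exact: IH.
by apply: in12_sigV => //; exact: IH.
Qed.

Lemma in12_gen k : (k < 2)%N -> in12 (sig k).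
Proof. by move=> k2; rewrite -[sig k]mulg1; apply: in12_sig => //; exact: in12_1. Qed.

Lemma in12V b : in12 b -> in12 b^-1.
Proof.
elim=> [|k c k2 _ IH|k c k2 _ IH]; first by rewrite invg1; exact: in12_1.
  rewrite invgM; apply: in12M => //; rewrite -[_^-1]mulg1; apply: in12_sigV => //.
  exact: in12_1.
by rewrite invgM invgK; apply: in12M => //; exact: in12_gen.
Qed.

Lemma in12_pos s : all (fun k => k < 2)%N s -> in12 (pos_braid s).
Proof.
elim: s => [|k s IH] /=; first by move=> _; exact: in12_1.
by move=> /andP[k2 /IH h]; rewrite pos_sig; exact: in12_sig.
Qed.

Lemma commute_in12 x : (forall k, (k < 2)%N -> commute x (sig k)) ->
  forall b, in12 b -> commute x b.
Proof.
move=> h b; elim=> [|k c k2 _ IH|k c k2 _ IH]; first exact: commute1.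
  by apply: commuteM => //; exact: h.
by apply: commuteM => //; apply: commuteV; exact: h.
Qed.

(** In Z/2 * Z/3 a reduced word alternates between [delta3] and nontrivial powers of [cyc3]. Each
    block formed by [delta3] and such a power is, up to [sq3], one of these two letters
    ([alt_letterE]), so normal forms become arbitrary words in s1^-1 and s2. *)
Definition alt_letter (b : bool) : B4 := if b then (sig 0)^-1 else sig 1.
Fixpoint alt_word (l : seq bool) : B4 := if l is b :: l' then alt_letter b * alt_word l' else 1.

Lemma alt_word_cat l l' : alt_word (l ++ l') = alt_word l * alt_word l'.
Proof. by elim: l => [|b l IH] /=; rewrite ?mul1g // IH mulgA. Qed.

Lemma alt_word_in12 l : in12 (alt_word l).
Proof.
elim: l => [|[] l IH] /=; first exact: in12_1; [exact: in12_sigV|exact: in12_sig].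
Qed.

Lemma alt_letterE b : delta3 * cyc3 * (if b then 1 else cyc3) = sq3 * alt_letter b.
Proof.
case: b; rewrite /alt_letter ?mulg1; last by rewrite /sig; pos_eq.
by apply: (mulIg (sig 0)); rewrite mulgVK; rewrite /sig; pos_eq.
Qed.

Definition sq3_pow (c : B4) : Prop := exists k, c = zexp sq3 k.

Lemma sq3_powS c : sq3_pow c -> sq3_pow (c * sq3).
Proof. by case=> k ->; exists (k + 1)%R; rewrite zexpS. Qed.

Lemma sq3_powP c : sq3_pow c -> sq3_pow (c * sq3^-1).
Proof. by case=> k ->; exists (k - 1)%R; rewrite zexpP. Qed.

Lemma sq3_pow1 : sq3_pow 1. Proof. by exists 0%R. Qed.

Lemma sq3_pow_commute c b : sq3_pow c -> in12 b -> commute c b.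
Proof.
case=> k -> hb; apply: zexp_commute; apply: commute_in12 hb => j; exact: sq3_sig.
Qed.

Definition cyc_pow (a : nat) : B4 := match a with 0 => 1 | 1 => cyc3 | _ => cyc3 * cyc3 end.

Definition normal3 (x : B4) : Prop := exists c (a : nat) l (d : bool),
  [/\ sq3_pow c, (a < 3)%N & x = c * (cyc_pow a * alt_word l * (if d then delta3 else 1))].

Lemma cyc3_in12 : in12 cyc3. Proof. exact: in12_pos. Qed.
Lemma delta3_in12 : in12 delta3. Proof. exact: in12_pos. Qed.
Lemma sq3_in12 : in12 sq3. Proof. exact: in12_pos. Qed.
Lemma cyc_pow_in12 a : in12 (cyc_pow a).
Proof.
by case: a => [|[|a]]; [exact: in12_1|exact: cyc3_in12|exact: in12M cyc3_in12 cyc3_in12].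
Qed.

Lemma sq3_powM c d : sq3_pow c -> sq3_pow d -> sq3_pow (c * d).
Proof.
move=> [k ->] [m ->]; have cm : commute (zexp sq3 m) sq3 by exact: zexp_commute.
elim/int_rec: k => [|n [j IH]|n [j IH]]; first by rewrite mul1g; exists m.
  exists (j + 1)%R; rewrite (_ : Posz n.+1 = (Posz n + 1)%R); last by lia.
  by rewrite !zexpS -IH -!mulgA cm.
exists (j - 1)%R; rewrite (_ : (- Posz n.+1)%R = (- Posz n - 1)%R); last by lia.
rewrite !zexpP -IH -!mulgA; congr (_ * _); exact/commute_sym/commuteV.
Qed.

Lemma normal3_central c x : sq3_pow c -> normal3 x -> normal3 (c * x).
Proof.
move=> cc [c' [a [l [d [cc' a3 ->]]]]].
by exists (c * c'), a, l, d; split; [exact: sq3_powM|by []|rewrite mulgA].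
Qed.

(** A leading power of [cyc3] is absorbed into a new letter. Without one, the first letter is opened
    and its [delta3] meets the new one. *)
Lemma normal3_delta x : normal3 x -> normal3 (delta3 * x).
Proof.
case=> c [a [l [d [cc a3 ->]]]]; have cd := sq3_pow_commute cc delta3_in12.
rewrite mulgA -cd -mulgA; case: a a3 => [|a] a3; last first.
  exists (c * sq3), 0%N, ((a == 0)%N :: l), d; split => //; first exact: sq3_powS.
  rewrite /= mul1g !mulgA -[c * sq3 * _]mulgA -alt_letterE -!mulgA; congr (_ * (_ * _)).
  by case: a a3 => [|[|a]] //= _; rewrite ?mul1g ?mulgA.
case: l => [|b l] /=; rewrite ?mul1g ?mulg1.
  case: d; first by exists (c * sq3), 0%N, [::], false; rewrite /= !mulg1 delta3_sq; split=> //; exact: sq3_powS.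
  by exists c, 0%N, [::], true; rewrite /= ?mul1g mulg1.
exists c, (if b then 1 else 2)%N, l, d; split => //; first by case: b.
congr (_ * _); rewrite !mulgA; congr (_ * _ * _).
apply: (mulgI delta3); rewrite !mulgA delta3_sq -alt_letterE.
by case: b; rewrite /= ?mulg1 ?mulgA.
Qed.

Lemma normal3_cyc x : normal3 x -> normal3 (cyc3 * x).
Proof.
case=> c [a [l [d [cc a3 ->]]]]; have cd := sq3_pow_commute cc cyc3_in12.
rewrite mulgA -cd -mulgA; case: a a3 => [|[|[|a]]] // _ /=.
- by exists c, 1%N, l, d; rewrite /= mul1g !mulgA.
- by exists c, 2%N, l, d; rewrite /= !mulgA.
- exists (c * sq3), 0%N, l, d; split => //; first exact: sq3_powS.
  by rewrite /= mul1g -cyc3_cube !mulgA.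
Qed.

Lemma in12_normal3 x : in12 x -> normal3 x.
Proof.
have V : sq3_pow sq3^-1 by rewrite -[_^-1]mul1g; exact: sq3_powP sq3_pow1.
elim=> [|k b k2 _ IH|k b k2 _ IH].
- by exists 1, 0%N, [::], false; rewrite /= !mulg1; split => //; exact: sq3_pow1.
- case: k k2 => [|[|]] // _.
    have -> : sig 0 = sq3^-1 * (cyc3 * (cyc3 * delta3)).
      by apply: (mulgI sq3); rewrite mulVKg /sig; pos_eq.
    rewrite -!mulgA; apply: normal3_central => //.
    by do 2!apply: normal3_cyc; exact: normal3_delta.
  have -> : sig 1 = sq3^-1 * (delta3 * (cyc3 * cyc3)).
    by apply: (mulgI sq3); rewrite mulVKg /sig; pos_eq.
  rewrite -!mulgA; apply: normal3_central => //; apply: normal3_delta.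
  by do 2!apply: normal3_cyc.
- case: k k2 => [|[|]] // _.
    have -> : (sig 0)^-1 = sq3^-1 * (delta3 * cyc3).
      by apply: (mulgI sq3); rewrite mulVKg; apply: (mulIg (sig 0)); rewrite mulgVK /sig; pos_eq.
    rewrite -!mulgA; apply: normal3_central => //; apply: normal3_delta.
    exact: normal3_cyc.
  have -> : (sig 1)^-1 = sq3^-1 * (cyc3 * delta3).
    by apply: (mulgI sq3); rewrite mulVKg; apply: (mulIg (sig 1)); rewrite mulgVK /sig; pos_eq.
  rewrite -!mulgA; apply: normal3_central => //; apply: normal3_cyc.
  exact: normal3_delta.
Qed.

(** A cyclically reduced form up to conjugation; the exceptional values are the elements of finite
    order modulo the center. *)
Definition tame (x : B4) : Prop := exists h c y, [/\ in12 h, sq3_pow c,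
  x = h * (c * y) * h^-1 &
  (y \in [:: 1; delta3; cyc3; cyc3 * cyc3]) \/ exists2 l, l <> [::] & y = alt_word l].

Lemma tame_rot c A B : sq3_pow c -> in12 A -> tame (c * (B * A)) -> tame (c * (A * B)).
Proof.
move=> cc hA [h [c' [y [hh cc' E Y]]]]; exists (A * h), c', y; split=> //; first exact: in12M.
rewrite invgM -!mulgA [h * _]mulgA [h * c' * _]mulgA -[h * c' * y]mulgA mulgA.
by have -> : c * (A * B) = A * (c * (B * A)) * A^-1;
  [rewrite !mulgA mulgK (sq3_pow_commute cc hA)|rewrite E !mulgA].
Qed.

Lemma tame_direct c y : sq3_pow c -> (y \in [:: 1; delta3; cyc3; cyc3 * cyc3]) \/
  (exists2 l, l <> [::] & y = alt_word l) -> tame (c * y).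
Proof.
by move=> cc Y; exists 1, c, y; split; rewrite ?mul1g ?invg1 ?mulg1 //; exact: in12_1.
Qed.

Lemma rcons_neq_nil T (l : seq T) b : rcons l b <> [::].
Proof. by case: l. Qed.

(** Cyclic reduction by induction on the number of letters: rotation brings the two ends of the word
    together, and a letter is lost when they cancel. *)
Lemma tame_normal n c a l (d : bool) : (size l <= n)%N -> sq3_pow c -> (a < 3)%N ->
  tame (c * (cyc_pow a * alt_word l * (if d then delta3 else 1))).
Proof.
elim: n c a l d => [|n IH] c a l d ln cc a3.
all: have altE b : alt_letter b = sq3^-1 * (delta3 * cyc_pow (if b then 1 else 2)%N)
  by apply: (mulgI sq3); rewrite mulVKg -alt_letterE; case: b; rewrite /= ?mulg1 ?mulgA.
all: have da : (0 < a)%N -> delta3 * cyc_pow a = sq3 * alt_letter (a == 1)%N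
  by move=> a0; rewrite -alt_letterE; case: (a) a0 a3 => [|[|[|?]]] //= _ _; rewrite ?mulg1 ?mulgA.
- case: l ln => // _ /=; rewrite mulg1; case: a a3 da => [|a] a3 da; rewrite ?mul1g.
    by apply: tame_direct => //; left; case: d; rewrite !inE eqxx ?orbT.
  case: d; last first.
    rewrite mulg1; apply: tame_direct => //; left.
    by case: a a3 {da} => [|[|a]] //= _; rewrite !inE eqxx ?orbT.
  apply: tame_rot => //; first exact: cyc_pow_in12.
  rewrite da // mulgA; apply: tame_direct; first exact: sq3_powS.
  by right; exists [:: (a.+1 == 1)%N]; rewrite //= mulg1.
case: a a3 da => [|a] a3 da; rewrite ?mul1g.
  case: d; last first.
    rewrite mulg1; apply: tame_direct => //.
    case: l ln => [|b l] ln; [by left; rewrite inE eqxx|by right; exists (b :: l)].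
  case: l ln => [|b l] ln; first by rewrite /= mul1g; apply: tame_direct => //; left; rewrite !inE eqxx orbT.
  apply: tame_rot; rewrite ?alt_word_in12 //; first exact: alt_word_in12.
  rewrite /= altE [delta3 * _]mulgA.
  have -> : delta3 * (sq3^-1 * (delta3 * cyc_pow (if b then 1 else 2)%N)) = cyc_pow (if b then 1 else 2)%N.
    have cm : commute delta3 sq3^-1.
      by apply: commuteV; apply/commute_sym/(commute_in12 sq3_sig)/delta3_in12.
    by rewrite mulgA cm -mulgA [delta3 * (_ * _)]mulgA delta3_sq mulKg.
  have := IH c (if b then 1 else 2)%N l false; rewrite mulg1; apply => //.
  by case: (b).
have sc : sq3_pow (c * sq3) by exact: sq3_powS.
case: d.
  rewrite -mulgA; apply: tame_rot => //; first exact: cyc_pow_in12.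
  rewrite -mulgA da // [alt_word l * _]mulgA.
  have -> : alt_word l * sq3 = sq3 * alt_word l.
    by apply/commute_sym/(commute_in12 sq3_sig)/alt_word_in12.
  rewrite -!mulgA [c * _]mulgA; apply: tame_direct => //; right.
  exists (rcons l (a.+1 == 1)%N); first exact: rcons_neq_nil.
  by rewrite -cats1 alt_word_cat /= mulg1.
rewrite mulg1; apply: tame_rot => //; first exact: cyc_pow_in12.
case/lastP: l ln => [|l b] ln.
  rewrite /= mul1g; apply: tame_direct => //; left.
  by case: a a3 {da} => [|[|a]] //= _; rewrite !inE eqxx ?orbT.
rewrite -cats1 alt_word_cat /= mulg1.
(* The exponents of [cyc3] in the last letter and in the prefix add up: they change the letter (sum
   2), cancel it down to [delta3] (sum 3), or wrap around and release [sq3] (sum 4). *)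
have [|[e|e]] : (alt_letter b * cyc_pow a.+1 = alt_letter (~~ b)) \/ (alt_letter b * cyc_pow a.+1 = delta3
   \/ alt_letter b * cyc_pow a.+1 = sq3 * alt_letter true).
- have sA b' : sq3 * alt_letter b' = delta3 * cyc_pow (if b' then 1 else 2)%N.
    by rewrite -alt_letterE; case: b'; rewrite /= ?mulg1 ?mulgA.
  clear ln da; case: b; case: a a3 => [|[|a]] // _.
  + left; apply: (mulgI sq3); rewrite mulgA !sA /=; by pos_eq.
  + right; left; apply: (mulgI sq3); rewrite mulgA !sA /=; by pos_eq.
  + right; left; apply: (mulgI sq3); rewrite mulgA !sA /=; by pos_eq.
  + right; right; apply: (mulgI sq3); rewrite mulgA !sA /=; by pos_eq.
- move=> e; rewrite -mulgA e; apply: tame_direct => //; right.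
  exists (rcons l (~~ b)); first exact: rcons_neq_nil.
  by rewrite -cats1 alt_word_cat /= mulg1.
- rewrite -mulgA e; have := IH c 0%N l true; rewrite /= mul1g; apply => //.
  by move: ln; rewrite size_rcons.
- rewrite -mulgA e [alt_word l * _]mulgA.
  have -> : alt_word l * sq3 = sq3 * alt_word l.
    by apply/commute_sym/(commute_in12 sq3_sig)/alt_word_in12.
  rewrite -!mulgA [c * _]mulgA; apply: tame_direct => //; right.
  exists (rcons l true); first exact: rcons_neq_nil.
  by rewrite -cats1 alt_word_cat /= mulg1.
Qed.

Lemma in12_tame x : in12 x -> tame x.
Proof. by move/in12_normal3 => [c [a [l [d [cc a3 ->]]]]]; exact: (@tame_normal (size l)). Qed.

End ThreeBraids.

(** * Leading terms at t = 0 on the subgroup of s1 and s2 *)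

Section AltWords.
Variable p : nat.
Local Notation L := (laurent 'F_p).
Local Notation X := (laurentX : L).

(** Multiplying by t clears the denominators of s1^-1 and sends its diagonal ones to 0, so only the
    first column survives. *)
Lemma reduces_s1V : reduces 0 (burau4 p (sig 0)^-1%g) (mx3 [:: [:: -1; 0; 0]; [:: 1; 0; 0]; [:: 0; 0; 0]]).
Proof.
have U := laurentX_unit 'F_p.
rewrite burau4_sigV // /burau_gen_inv /= inordK //=.
exists 1%N, 0%N, (fun i j => nth 0 (nth [::]
  [:: [:: -1; 0; 0]; [:: 1; 'X; 0]; [:: 0; 0; 'X]] i) j) => i j.
rewrite !mxE expr1 expr0 mul1r.
case: i => [[|[|[|//]]] ?]; case: j => [[|[|[|//]]] ?]; split;
  by rewrite /= ?mulrN ?(divrr U) ?mulr0 ?mulr1 ?pliftN ?plift1 ?plift0 ?pliftX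
   ?hornerN ?hornerX ?hornerC.
Qed.

Lemma reduces_s2 : reduces 0 (burau4 p (sig 1)) (mx3 [:: [:: 1; 0; 0]; [:: 0; 0; 0]; [:: 0; 1; 1]]).
Proof.
rewrite burau4_sig // /burau_gen /= inordK //=.
exists 0%N, 0%N, (fun i j => nth 0 (nth [::]
  [:: [:: 1; 'X; 0]; [:: 0; - 'X; 0]; [:: 0; 1; 1]] i) j) => i j.
rewrite !mxE !expr0 !mul1r.
case: i => [[|[|[|//]]] ?]; case: j => [[|[|[|//]]] ?]; split;
  by rewrite /= ?pliftN ?plift1 ?plift0 ?pliftX ?hornerN ?hornerX ?hornerC ?oppr0.
Qed.

Lemma mx3_inj (S : comUnitRingType) (r r' : seq (seq S)) : mx3 r = mx3 r' ->
  forall i j, (i < 3)%N -> (j < 3)%N -> nth 0 (nth [::] r i) j = nth 0 (nth [::] r' i) j.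
Proof.
by move=> /matrixP E i j i3 j3; have := E (Ordinal i3) (Ordinal j3); rewrite !mxE.
Qed.

(** The shape is stable under left multiplication by both leading matrices: the corner [e] changes
    at most its sign, and either factor puts a zero at the middle place. *)
Lemma alt_reduces l : exists e a b c d f g, [/\ reduces 0 (burau4 p (alt_word l))
  (mx3 [:: [:: e; 0; 0]; [:: a; b; c]; [:: d; f; g]]), e != 0 & l != [::] -> b = 0].
Proof.
elim: l => [|x l [e [a [b [c [d [f [g [rN e0 _]]]]]]]]].
  exists 1, 0, 1, 0, 0, 0, 1; split=> //.
  by rewrite burau4_1 -[mx3 _]mx3_1; exact: reduces1.
rewrite [alt_word _]/= burau4M; case: x; rewrite /alt_letter.
  have := reducesM reduces_s1V rN; rewrite [_ *m mx3 _]mx3M.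
  rewrite !mul0r !mulN1r !mul1r !addr0 oppr0 => rM.
  by exists (- e), e, 0, 0, 0, 0, 0; split=> //; rewrite oppr_eq0.
have := reducesM reduces_s2 rN; rewrite [_ *m mx3 _]mx3M.
rewrite !mul0r !mul1r !addr0 !add0r => rM.
by exists e, 0, 0, 0, (a + d), (b + f), (c + g).
Qed.

(** At t = 0 the entries (1, 0) of the relations with s1^-1 and s2 give [- a = e] and [a = 0],
    against [e != 0]. *)
Lemma alt_not_central l : l != [::] ->
  ~ (commute (alt_word l) (sig 0) /\ commute (alt_word l) (sig 1)).
Proof.
move=> l0 [c0 c1]; have [e [a [b [c [d [f [g [rN e0 /(_ l0) b0]]]]]]]] := alt_reduces l.
have /(congr1 (burau4 p)) := commuteV c0; rewrite !burau4M => E0.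
have /(congr1 (burau4 p)) := c1; rewrite !burau4M => E1.
have := reduces_mul_eq rN reduces_s1V E0; rewrite ![_ *m mx3 _]mx3M => /mx3_inj /(_ 1%N 0%N isT isT) /=.
have := reduces_mul_eq rN reduces_s2 E1; rewrite ![_ *m mx3 _]mx3M => /mx3_inj /(_ 1%N 0%N isT isT) /=.
rewrite !mulr0 !mulr1 !mul0r !mul1r !addr0 b0 addr0 mulrN1 => -> /eqP.
by rewrite oppr0 eq_sym (negbTE e0).
Qed.

(** Restricted to the first two rows, because the third row of [sq3] and of [around] is not that of
    a scalar matrix. *)
Definition scales (x : B4) (k : int) := forall i j : 'I_3, (i < 2)%N ->
  burau4 p x i j = X ^ k * (i == j)%:R.

Lemma scalesM x y k m : scales x k -> scales y m -> scales (x * y)%g (k + m).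
Proof.
move=> sx sy i j i2; rewrite burau4M mxE (bigD1 i) //= big1 => [|n ni].
  by rewrite addr0 sx // sy // eqxx mulr1 mulrA exprzDr ?laurentX_unit.
by rewrite sx // [i == n]eq_sym (negbTE ni) mulr0 mul0r.
Qed.

Lemma scales1 : scales 1%g 0.
Proof. by move=> i j i2; rewrite burau4_1 mxE expr0z mul1r. Qed.

Lemma scalesV x k : scales x k -> scales x^-1%g (- k).
Proof.
move=> sx i j i2; have : burau4 p (x * x^-1)%g i j = (i == j)%:R by rewrite mulgV burau4_1 mxE.
rewrite burau4M mxE (bigD1 i) //= big1 => [|n ni]; last first.
  by rewrite sx // [i == n]eq_sym (negbTE ni) mulr0 mul0r.
rewrite addr0 sx // eqxx mulr1 => <-; rewrite mulrA -exprzDr ?laurentX_unit //.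
by rewrite addNr expr0z mul1r.
Qed.

Lemma scales_zexp x k n : scales x k -> scales (zexp x n) (k * n).
Proof.
move=> sx; elim/int_rec: n => [|n IH|n IH]; first by rewrite mulr0; exact: scales1.
  rewrite (_ : Posz n.+1 = n%:Z + 1); last by lia.
  by rewrite zexpS mulrDr mulr1; exact: scalesM.
rewrite (_ : - Posz n.+1 = - n%:Z - 1); last by lia.
by rewrite zexpP mulrDr mulrN1; apply: scalesM => //; exact: scalesV.
Qed.

Lemma burau4_pos s : all (fun k => k < 3)%N s ->
  burau4 p (pos_braid s) = \prod_(k <- s) burau_gen X (inord k).
Proof.
elim: s => [|k s IH] /=; first by rewrite big_nil burau4_1.
by move=> /andP[k3 /IH h]; rewrite pos_sig burau4M h big_cons burau4_sig.
Qed.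

Lemma scales_sq3 : scales sq3 3.
Proof.
move=> i j; rewrite burau4_pos // !big_cons big_nil mulr1 /burau_gen /= !inordK //= !mx3M !mxE.
case: i => [[|[|[|//]]] ?]; case: j => [[|[|[|//]]] ?] //= _; rewrite -[3]/(Posz 3) -exprnP; ring.
Qed.

Lemma scales_around : scales around 1.
Proof.
move=> i j; rewrite burau4_pos // !big_cons big_nil mulr1 /burau_gen /= !inordK //= !mx3M !mxE.
case: i => [[|[|[|//]]] ?]; case: j => [[|[|[|//]]] ?] //= _; rewrite expr1z; ring.
Qed.

End AltWords.

Section ThreeStrands.
Variable p : nat.
Local Notation L := (laurent 'F_p).
Local Notation X := (laurentX : L).

Lemma laurentX_int (k : int) : X ^ (2 * k) = 1 -> k = 0.
Proof.
have E (n : nat) : X ^+ (2 * n) = (- X) ^+ (2 * n) by rewrite [LHS]exprM [RHS]exprM sqrrN.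
case: k => n.
  by rewrite (_ : 2 * Posz n = Posz (2 * n)) ?PoszM // -exprnP E => /laurentX_pow ; lia.
rewrite (_ : 2 * Negz n = - Posz (2 * n.+1)); last by rewrite NegzE PoszM mulrN.
rewrite -exprnN E => /(congr1 GRing.inv); rewrite invr1 invrK => /laurentX_pow; lia.
Qed.

Lemma in12_zexp x k : in12 x -> in12 (zexp x k).
Proof.
have X n : in12 x -> in12 (x ^+ n)%g.
  by move=> hx; elim: n => [|n IH]; rewrite ?expg0 ?expgS; [exact: in12_1|exact: in12M].
by case: k => n hx /=; [exact: X|exact/in12V/X].
Qed.

Lemma expo_zexp x k : expo (zexp x k) = expo x * k.
Proof.
case: k => n; rewrite /= ?expoV expoX -mulr_natr ?NegzE ?natz // mulrN //.
Qed.

Lemma expo_pos s : expo (pos_braid s) = (size s)%:Z.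
Proof.
elim: s => [|k s IH]; first exact: expo1.
by rewrite pos_sig expoM IH expo_sig /=; lia.
Qed.

Lemma expoJ x h : expo (h * x * h^-1)%g = expo x.
Proof. by rewrite !expoM expoV; lia. Qed.

(** For a nonempty alternating word the first two diagonal entries would agree, against their
    leading terms [e] and 0. Otherwise the exponent sum, divisible by 6 on the central part, forces
    [y = 1] and [n = - k], and then t^(2k) = 1. *)
Lemma ker_in12_around w n : in12 w -> burau4_ker p (w * zexp around n)%g ->
  (w * zexp around n)%g = 1%g.
Proof.
have arC x : in12 x -> commute (zexp around n) x.
  move=> hx; apply: zexp_commute; apply: commute_in12 hx => j; exact: around_sig.
move=> /in12_tame [h [c [y [hh [k ->] -> Y]]]].
have -> : (h * (zexp sq3 k * y) * h^-1 * zexp around n = h * (zexp sq3 k * zexp around n * y) * h^-1)%g.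
  have -> : (zexp sq3 k * zexp around n * y = zexp sq3 k * y * zexp around n)%g.
    rewrite -!mulgA; congr (_ * _)%g; apply: arC; case: Y => [|[l _ ->]]; last exact: alt_word_in12.
    have h1 := in12_1; have h2 := delta3_in12; have h3 := cyc3_in12.
    by rewrite !inE => /or4P[] /eqP -> //; exact: in12M.
  rewrite -!mulgA; congr (_ * (_ * (_ * _)))%g.
  exact/commute_sym/arC/in12V.
move=> K; have {K} : burau4_ker p (zexp sq3 k * zexp around n * y)%g.
  move: K; rewrite /burau4_ker /= !burau4M => K.
  have hU : burau4 p h \is a GRing.unit by exact: burau4_unit.
  apply: (mulrI hU); rewrite mulr1 !mulrA; apply: (mulIr (burau4_unit p h^-1%g)).
  rewrite -!mulrA in K *; rewrite K -burau4M mulgV burau4_1 //.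
move=> K; suff -> : (zexp sq3 k * zexp around n * y = 1)%g by rewrite mulg1 mulgV.
have S := scalesM (scales_zexp k (scales_sq3 p)) (scales_zexp n (scales_around p)).
have X0 := ker_expo K; rewrite !expoM !expo_zexp !expo_pos /= in X0.
case: Y => [|[l l0 yE]]; last first.
  have rowE (i : 'I_3) : (i < 2)%N -> burau4 p y i i * X ^ (3 * k + 1 * n) = 1.
    move=> i2; have : burau4 p (zexp sq3 k * zexp around n * y)%g i i = 1 by rewrite K mxE eqxx.
    rewrite burau4M mxE (bigD1 i) //= big1 => [|m ni]; last first.
      by rewrite S // [i == m]eq_sym (negbTE ni) mulr0 mul0r.
    by rewrite addr0 S // eqxx mulr1 mulrC.
  have [e [a [b [c' [d [f [g [rN e0 bE]]]]]]]] := alt_reduces p l.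
  have E : burau4 p (alt_word l) ord0 ord0 = burau4 p (alt_word l) (inord 1) (inord 1).
    have U : X ^ (3 * k + 1 * n) \is a GRing.unit by rewrite unitrXz ?laurentX_unit.
    by apply: (mulIr U); rewrite -yE !rowE // inordK.
  have := reduces_eq rN E; rewrite !mxE /= inordK //= bE; last exact/eqP.
  by move=> e00; rewrite e00 eqxx in e0.
have [y1|ne] := eqVneq (y : B4) (1%g : B4); last first.
  rewrite !inE (negbTE ne) /= => Y; exfalso; move: Y X0.
  by case/or3P => /eqP ->; rewrite ?expoM !expo_pos /=; lia.
rewrite y1 expo1 in X0; rewrite y1 mulg1.
have kn : n = - k by lia.
have := K; rewrite y1 mulg1 => /matrixP /(_ ord0 ord0); rewrite S // mxE eqxx mulr1 => Xk.
have k0 : k = 0 by apply: laurentX_int; rewrite -[RHS]Xk; congr (_ ^ _); lia.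
by rewrite kn k0 /= mulg1.
Qed.

Lemma expg_conj (h z : B4) m : ((h * z * h^-1) ^+ m = h * z ^+ m * h^-1)%g.
Proof.
elim: m => [|m IH]; first by rewrite !expg0 mulg1 mulgV.
by rewrite !expgS IH -!mulgA mulKg.
Qed.

(** A positive power of a nonempty alternating word is again one, hence not central; among the
    exceptional values the exponent sum leaves only the identity. *)
Lemma in12_torsion x n : in12 x -> expo x = 0 -> (0 < n)%N ->
  commute (x ^+ n)%g (sig 0) -> commute (x ^+ n)%g (sig 1) -> x = 1%g.
Proof.
move=> /in12_tame [h [c [y [hh cc -> Y]]]]; rewrite expoJ => X0 n0 c0 c1.
have yin : in12 y.
  case: Y => [|[l _ ->]]; last exact: alt_word_in12.
  have h1 := in12_1; have h2 := delta3_in12; have h3 := cyc3_in12.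
  by rewrite !inE => /or4P[] /eqP -> //; exact: in12M.
have xin : in12 (h * (c * y) * h^-1)%g.
  apply: in12M (in12V hh); apply: in12M => //; apply: in12M => //.
  by case: cc => k ->; apply: in12_zexp; exact: sq3_in12.
clear x; set x := (h * (c * y) * h^-1)%g in c0 c1 xin *.
have xC : forall z, in12 z -> commute (x ^+ n)%g z.
  by apply: commute_in12 => -[|[|]].
have E : (y ^+ n = c^-1 ^+ n * x ^+ n)%g.
  have -> : (x ^+ n = h^-1 * x ^+ n * h)%g by rewrite -mulgA xC // mulKg.
  have -> : (h^-1 * x ^+ n * h = (c * y) ^+ n)%g.
    by rewrite expg_conj -!mulgA mulKg mulVg mulg1.
  rewrite expgMn; last exact: sq3_pow_commute.
  by rewrite expVgn mulKg.
have yC z : in12 z -> commute (y ^+ n)%g z.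
  move=> hz; rewrite E; apply/commute_sym/commuteM; last exact/commute_sym/xC.
  by apply/commuteX/commuteV/commute_sym/sq3_pow_commute.
case: Y => [Y|[l l0 yE]]; last first.
  have altX m : exists2 l', alt_word l' = (y ^+ m)%g & (0 < m)%N -> l' != [::].
    elim: m => [|m [l' IH _]]; first by exists [::].
    exists (l ++ l'); first by rewrite alt_word_cat IH expgS yE.
    by case: (l) l0.
  have [l' e /(_ n0) ne] := altX n.
  exfalso; apply: (@alt_not_central p _ ne); rewrite e.
  by split; apply: yC; exact: in12_gen.
have [k ck] := cc; move: X0; rewrite ck expoM expo_zexp expo_pos /= => X0.
have [y1|ne] := eqVneq (y : B4) (1%g : B4); last first.
  move: Y X0; rewrite !inE (negbTE ne) /= => /or3P[] /eqP ->; rewrite ?expoM !expo_pos /=; lia.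
have k0 : k = 0 by move: X0; rewrite y1 expo1; lia.
by rewrite /x y1 ck k0 /= !mulg1 mulgV.
Qed.
End ThreeStrands.

(** * Braids with a doubled strand *)

Section PairStabilizer.
Local Open Scope group_scope.

(** [tau3] carries the third strand around the pair of the first two; [rot] is s3 times it, and its
    square [rot2] commutes with all cabled braids. *)
Definition tau3 : B4 := pos_braid [:: 1; 0; 0; 1]%N.
Definition rot : B4 := pos_braid [:: 2; 1; 0; 0; 1]%N.
Definition rot2 : B4 := pos_braid [:: 2; 1; 0; 0; 1; 2; 1; 0; 0; 1]%N.

Inductive cabled : B4 -> Prop :=
| cabled1 : cabled 1
| cabled_sig0 : cabled (sig 0)
| cabled_sig2 : cabled (sig 2)
| cabled_tau3 : cabled tau3
| cabledM a b : cabled a -> cabled b -> cabled (a * b)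
| cabledV a : cabled a -> cabled a^-1.

Definition cab_letter (a : option bool) : B4 :=
  match a with Some true => sig 2 | Some false => (sig 2)^-1 | None => rot end.
Definition cab_word (l : seq (option bool)) : B4 := foldr (fun a b => cab_letter a * b) 1 l.
(** Reduced words of Z * Z/2, the quotient by the central part: no [rot] after [rot] and no
    cancelling pair. *)
Definition can_follow (a b : option bool) : bool :=
  match a, b with None, None => false | Some e, Some e' => e == e' | _, _ => true end.

Definition cab_central (c : B4) := exists m k, c = zexp (sig 0) m * zexp rot2 k.

Lemma zexpM (G : groupType) (x : G) k m : zexp x k * zexp x m = zexp x (k + m)%R.
Proof.
elim/int_rec: m => [|n IH|n IH]; first by rewrite /= mulg1 addr0.
  rewrite (_ : Posz n.+1 = (Posz n + 1)%R); last by lia.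
  by rewrite addrA !zexpS mulgA IH.
rewrite (_ : (- Posz n.+1)%R = (- Posz n - 1)%R); last by lia.
by rewrite addrA !zexpP mulgA IH.
Qed.

Lemma rot2E : rot * rot = rot2. Proof. by pos_eq. Qed.
Lemma rot2_sig2 : commute rot2 (sig 2).
Proof.
rewrite /commute /rot2 pos_sig -mulgA; congr (_ * _); rewrite /sig -!pos_braid_cat.
by apply: (@braid_class_sound 18); vm_compute.
Qed.
Lemma rot2_rot : commute rot2 rot. Proof. by rewrite -rot2E /commute -!mulgA. Qed.
Lemma sig0_sig2 : commute (sig 0) (sig 2). Proof. by rewrite /commute /sig; pos_eq. Qed.
Lemma sig0_rot : commute (sig 0) rot. Proof. by rewrite /commute /sig; pos_eq. Qed.
Lemma sig0_rot2 : commute (sig 0) rot2. Proof. by rewrite -rot2E; exact: commuteM sig0_rot sig0_rot. Qed.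
Lemma rotE : rot = sig 2 * tau3. Proof. by rewrite -pos_sig. Qed.

Lemma cab_central_letter c a : cab_central c -> commute c (cab_letter a).
Proof.
case=> m [k ->]; have H x : commute (sig 0) x -> commute rot2 x ->
    commute (zexp (sig 0) m * zexp rot2 k) x.
  by move=> h0 h2; apply/commute_sym/commuteM; apply/commute_sym/zexp_commute.
case: a => [[]|]; [exact: (H _ sig0_sig2 rot2_sig2)|apply: H; apply: commuteV; [exact: sig0_sig2|exact: rot2_sig2]|exact: (H _ sig0_rot rot2_rot)].
Qed.

Lemma cab_centralM c d : cab_central c -> cab_central d -> cab_central (c * d).
Proof.
move=> [m [k ->]] [m' [k' ->]]; exists (m + m')%R, (k + k')%R.
rewrite -!zexpM -!mulgA; congr (_ * _); rewrite !mulgA; congr (_ * _).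
have : commute (zexp rot2 k) (zexp (sig 0) m'); last by [].
apply: zexp_commute; apply: commute_sym; apply: zexp_commute; exact: sig0_rot2.
Qed.

Definition cab_normal (y : B4) := exists c l,
  [/\ cab_central c, sorted can_follow l & y = c * cab_word l].

Lemma cab_normal_central c y : cab_central c -> cab_normal y -> cab_normal (c * y).
Proof.
move=> cc [c' [l [cc' sl ->]]]; exists (c * c'), l.
by split; [exact: cab_centralM| |rewrite mulgA].
Qed.

Lemma rot2_central k : cab_central (zexp rot2 k).
Proof. by exists 0%R, k; rewrite mul1g. Qed.

Lemma cab_normal_letter a y : cab_normal y -> cab_normal (cab_letter a * y).
Proof.
case=> c [l [cc sl ->]]; rewrite mulgA -(cab_central_letter a cc) -mulgA.
apply: cab_normal_central => //.
have c1 : cab_central 1 by exact: (rot2_central 0).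
case: l sl => [|b l] sl; first by exists 1, [:: a]; split; rewrite ?mul1g.
have [ab|ab] := boolP (can_follow a b).
  by exists 1, [:: a, b & l]; split; rewrite ?mul1g //= ab.
have sl' : sorted can_follow l by move: sl; rewrite /= => /path_sorted.
case: a b ab {sl} => [[]|] [[]|] //= _; rewrite ?mulKg ?mulVKg.
- by exists 1, l; split; rewrite ?mul1g.
- by exists 1, l; split; rewrite ?mul1g.
- exists rot2, l; split => //; last by rewrite mulgA rot2E.
  have := rot2_central 1; by rewrite /=.
Qed.

Lemma cabled_normal y : cabled y -> cab_normal y.
Proof.
(* Left multiplication by [y] and by its inverse are treated together, because [cabled] is closed
   under inverses. *)
suff H : cabled y -> forall n, (cab_normal n -> cab_normal (y * n)) /\ (cab_normal n -> cab_normal (y^-1 * n)).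
  move=> /H /(_ 1) [+ _]; rewrite mulg1; apply.
  by exists 1, [::]; split; rewrite ?mul1g //; exact: (rot2_central 0).
have xI n : cab_normal n -> cab_normal ((sig 2)^-1 * n) by exact: (@cab_normal_letter (Some false)).
have zI n : cab_normal n -> cab_normal (rot^-1 * n).
  move=> h; have -> : rot^-1 = rot2^-1 * rot by rewrite -rot2E invgM mulgVK.
  rewrite -mulgA; apply: cab_normal_central; first exact: (rot2_central (-1)).
  exact: (@cab_normal_letter None).
elim=> {y} [|||||].
- by move=> n; rewrite invg1 mul1g.
- move=> n; split; apply: cab_normal_central.
    by exists 1%R, 0%R; rewrite /= mulg1.
  by exists (-1)%R, 0%R; rewrite /= mulg1.
- by move=> n; split; [exact: (@cab_normal_letter (Some true))|exact: xI].
- have -> : tau3 = (sig 2)^-1 * rot by rewrite rotE mulKg.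
  move=> n; split; first by rewrite -mulgA => h; exact/xI/(@cab_normal_letter None).
  by rewrite invgM invgK -mulgA => h; apply: zI; exact: (@cab_normal_letter (Some true)).
- move=> a b _ IHa _ IHb n; split=> h; first by rewrite -mulgA; apply (IHa _).1, (IHb _).1.
  by rewrite invgM -mulgA; apply (IHb _).2, (IHa _).2.
- by move=> a _ IHa n; split=> h; [exact: (IHa n).2 h|rewrite invgK; exact: (IHa n).1].
Qed.

End PairStabilizer.

(** * A two-dimensional representation of the cabled braids *)

Section PairMatrices.
Variable p : nat.
Local Notation L := (laurent 'F_p).
Local Notation X := (laurentX : L).

Definition mx2 (S : nzRingType) (a b c d : S) : 'M[S]_2 :=
  \matrix_(i, j) (if i == 0 then if j == 0 then a else b else if j == 0 then c else d).

Lemma mx2M (S : nzRingType) (a b c d a' b' c' d' : S) : mx2 a b c d *m mx2 a' b' c' d' =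
  mx2 (a * a' + b * c') (a * b' + b * d') (c * a' + d * c') (c * b' + d * d').
Proof.
apply/matrixP => i j; rewrite !mxE !big_ord_recl big_ord0 !mxE /= addr0.
by case: i => [[|[|//]] ?]; case: j => [[|[|//]] ?].
Qed.

(** The two rows span a plane that is stable under the Burau matrices of cabled braids acting on the
    right, and on which s1 acts trivially. *)
Definition pair_rows : 'M[L]_(2, 3) :=
  \matrix_(i, j) nth 0 (nth [::] [:: [:: 1; 1 + X; X]; [:: 0; 0; 1]] i) j.

Definition pair_acts (y : B4) (M : 'M[L]_2) := pair_rows *m burau4 p y = M *m pair_rows.

Lemma pair_actsM x y M N : pair_acts x M -> pair_acts y N -> pair_acts (x * y)%g (M *m N).
Proof.
rewrite /pair_acts => hx hy; rewrite burau4M.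
have -> : burau4 p x * burau4 p y = burau4 p x *m burau4 p y by [].
by rewrite mulmxA hx -mulmxA hy mulmxA.
Qed.

Lemma pair_acts1 : pair_acts 1%g 1%:M.
Proof. by rewrite /pair_acts burau4_1 mulmx1 mul1mx. Qed.

Lemma pair_rows_inj (M N : 'M[L]_2) : M *m pair_rows = N *m pair_rows -> M = N.
Proof.
move=> /matrixP E; apply/matrixP => i j.
have E0 := E i ord0; have E2 := E i (inord 2); move: E0 E2.
rewrite !mxE !big_ord_recl !big_ord0 !mxE /= !inordK //= !mulr0 !mulr1 !addr0.
move=> e0; rewrite e0 => /addrI e1.
case: j => [[|[|//]] j2]; first by rewrite (_ : Ordinal j2 = ord0) //; exact: val_inj.
by rewrite (_ : Ordinal j2 = lift ord0 ord0) //; exact: val_inj.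
Qed.

Lemma pair_acts_fun y M N : pair_acts y M -> pair_acts y N -> M = N.
Proof. by rewrite /pair_acts => -> /pair_rows_inj. Qed.

Lemma pair_acts_sig0 : pair_acts (sig 0) 1%:M.
Proof.
rewrite /pair_acts mul1mx burau4_sig // /burau_gen /= inordK //=.
apply/matrixP => i j; rewrite !mxE !big_ord_recl big_ord0 !mxE /=.
by case: i => [[|[|//]] ?]; case: j => [[|[|[|//]]] ?] /=; ring.
Qed.

Lemma pair_acts_sig2 : pair_acts (sig 2) (mx2 1 0 0 (- X)).
Proof.
rewrite /pair_acts burau4_sig // /burau_gen /= inordK //=.
apply/matrixP => i j; rewrite !mxE !big_ord_recl !big_ord0 !mxE /=.
by case: i => [[|[|//]] ?]; case: j => [[|[|[|//]]] ?] /=; ring.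
Qed.

Lemma pair_acts_rot : pair_acts rot (mx2 (X * (1 - X + X ^+ 2)) (X * (1 - X) * (1 + X ^+ 2))
   (- (X * (1 - X))) (- (X * (1 - X + X ^+ 2)))).
Proof.
rewrite /pair_acts burau4_pos // !big_cons big_nil mulr1 /burau_gen /= !inordK //= !mx3M.
apply/matrixP => i j; rewrite !mxE !big_ord_recl !big_ord0 !mxE /=.
by case: i => [[|[|//]] ?]; case: j => [[|[|[|//]]] ?] /=; ring.
Qed.

Lemma pair_acts_sig2V : pair_acts (sig 2)^-1%g (mx2 1 0 0 (- X^-1)).
Proof.
have U := laurentX_unit 'F_p.
rewrite /pair_acts burau4_sigV // /burau_gen_inv /= inordK //=.
apply/matrixP => i j; rewrite !mxE !big_ord_recl !big_ord0 !mxE /=.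
case: i => [[|[|//]] ?]; case: j => [[|[|[|//]]] ?] /=;
  rewrite ?mulr0 ?mul0r ?mulr1 ?mul1r ?addr0 ?add0r ?mulrN ?(divrr U) //; ring.
Qed.

End PairMatrices.

Section PairKernel.
Variable p : nat.
Local Notation L := (laurent 'F_p).
Local Notation X := (laurentX : L).

(** At t = 0 the matrix of each letter has rank one: it is the product of this column and of
    [first_row]. *)
Definition first_col (a : option bool) : 'F_p * 'F_p :=
  match a with Some true => (1, 0) | Some false => (0, 1) | None => (1, -1) end.

Definition outer (u r : 'F_p * 'F_p) : 'M['F_p]_2 :=
  mx2 (u.1 * r.1) (u.1 * r.2) (u.2 * r.1) (u.2 * r.2).

Definition first_row (a : option bool) : 'F_p * 'F_p :=
  match a with Some true => (1, 0) | Some false => (0, -1) | None => (1, 1) end.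

Lemma cab_letter_reduces a : exists2 M, pair_acts (cab_letter a) M &
  reduces (0 : 'F_p) M (outer (first_col a) (first_row a)).
Proof.
have U := laurentX_unit 'F_p; case: a => [[]|]; rewrite /cab_letter.
- exists (mx2 1 0 0 (- X)); first exact: pair_acts_sig2.
  exists 0%N, 0%N, (fun i j => mx2 1 0 0 (- 'X) i j) => i j; rewrite !expr0 !mul1r !mxE.
  case: i => [[|[|//]] ?]; case: j => [[|[|//]] ?]; split;
  by rewrite /= ?pliftN ?plift1 ?plift0 ?pliftX ?hornerN ?hornerX ?hornerC ?oppr0 ?mulr0 ?mulr1 ?mul0r.
- exists (mx2 1 0 0 (- X^-1)); first exact: pair_acts_sig2V.
  exists 1%N, 0%N, (fun i j => mx2 'X 0 0 (- 1) i j) => i j; rewrite expr1 expr0 mul1r !mxE.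
  case: i => [[|[|//]] ?]; case: j => [[|[|//]] ?]; split;
  rewrite /= ?[X * - _]mulrN ?(divrr U) ?pliftN ?plift1 ?plift0 ?pliftX ?hornerN ?hornerX ?hornerC; ring.
- eexists; first exact: pair_acts_rot.
  exists 0%N, 1%N, (fun i j => mx2 (1 - 'X + 'X * 'X) ((1 - 'X) * (1 + 'X * 'X)) (- (1 - 'X)) (- (1 - 'X + 'X * 'X)) i j) => i j.
  rewrite expr1 expr0 mul1r !mxE.
  case: i => [[|[|//]] ?]; case: j => [[|[|//]] ?]; split;
  rewrite /= ?(pliftM, pliftD, pliftN, plift1, plift0, pliftX) ?(hornerM, hornerD, hornerN, hornerX, hornerC);
  ring.
Qed.

Lemma outerM u r v s : outer u r *m outer v s = outer u ((r.1 * v.1 + r.2 * v.2) * s.1, (r.1 * v.1 + r.2 * v.2) * s.2).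
Proof. by rewrite mx2M /outer /=; congr mx2; ring. Qed.

(** The pairing of a row with the next column vanishes exactly for the forbidden successions, so
    leading terms of reduced words do not cancel. *)
Lemma follow_neq0 a b : can_follow a b ->
  (first_row a).1 * (first_col b).1 + (first_row a).2 * (first_col b).2 != 0.
Proof.
have o : (1 : 'F_p) != 0 by exact: oner_neq0.
by case: a => [[]|]; case: b => [[]|] //= _;
  rewrite ?(mulr0, mulr1, mul0r, addr0, add0r, mulN1r, opprK, oppr_eq0).
Qed.

Lemma cab_word_reduces a l : sorted can_follow (a :: l) -> exists M r,
  [/\ pair_acts (cab_word (a :: l)) M, reduces (0 : 'F_p) M (outer (first_col a) r) & r != (0, 0)].
Proof.
elim: l a => [|b l IH] a.
  move=> _; have [M aM rM] := cab_letter_reduces a; exists M, (first_row a); split=> //.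
    by rewrite /cab_word /= mulg1.
  have o : (1 : 'F_p) != 0 by exact: oner_neq0.
  by case: (a) => [[]|]; rewrite -pair_eqE /pair_eq /= ?oppr_eq0 ?(negbTE o) ?andbF.
rewrite /= => /andP[ab /IH [M [r [aM rM r0]]]]; have [N aN rN] := cab_letter_reduces a.
exists (N *m M); eexists; split; first exact: pair_actsM.
  by have := reducesM rN rM; rewrite outerM; exact.
have k0 := follow_neq0 ab; move: r0; by rewrite -!pair_eqE /pair_eq /= !mulf_eq0 (negbTE k0) /=.
Qed.

Lemma pair_acts_zexp x c k : c \is a GRing.unit -> pair_acts x (c%:M : 'M[L]_2) -> pair_acts (zexp x k) (c ^ k)%:M.
Proof.
move=> cU hx.
have hV : pair_acts x^-1%g (c^-1%:M : 'M[L]_2).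
  have := hx; rewrite /pair_acts !mul_scalar_mx => /(congr1 (mulmx^~ (burau4 p x^-1%g))).
  rewrite -mulmxA (_ : burau4 p x *m _ = 1%:M); last first.
    by rewrite -[1%:M](burau4_1 p) -(mulgV x) burau4M.
  rewrite mulmx1 -scalemxAl => /(congr1 (fun M => c^-1 *: M)).
  by rewrite scalerA mulVr // scale1r.
elim/int_rec: k => [|n IH|n IH]; first by rewrite expr0z; exact: pair_acts1.
  rewrite (_ : Posz n.+1 = n%:Z + 1); last by lia.
  have -> : (c ^ (n%:Z + 1))%:M = (c ^ n%:Z)%:M *m c%:M :> 'M[L]_2.
    by rewrite -scalar_mxM exprzDr // expr1z.
  by rewrite zexpS; exact: pair_actsM IH hx.
rewrite (_ : - Posz n.+1 = - n%:Z - 1); last by lia.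
have -> : (c ^ (- n%:Z - 1))%:M = (c ^ (- n%:Z))%:M *m c^-1%:M :> 'M[L]_2.
  by rewrite -scalar_mxM exprzDr // exprN1.
by rewrite zexpP; exact: pair_actsM IH hV.
Qed.

Lemma pair_acts_rot2 : pair_acts rot2 ((X ^+ 4)%:M : 'M[L]_2).
Proof.
rewrite -rot2E; have := pair_actsM (pair_acts_rot p) (pair_acts_rot p); rewrite mx2M.
set M := mx2 _ _ _ _; have -> // : M = (X ^+ 4)%:M.
apply/matrixP => i j; rewrite !mxE.
by case: i => [[|[|//]] ?]; case: j => [[|[|//]] ?] /=; ring.
Qed.

(** A nonempty reduced word has a leading term of rank one, which a scalar matrix cannot have. For
    the empty word [rot2] acts as t^4 and s1 trivially, so the power of [rot2] is read from t and
    that of s1 from the exponent sum. *)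
Lemma ker_cabled y : cabled y -> burau4_ker p y -> y = 1%g.
Proof.
have U := laurentX_unit 'F_p.
move=> /cabled_normal [c [l [[m [k ->]] sl ->]]] K.
have := pair_actsM (pair_acts_zexp m (unitr1 L) (pair_acts_sig0 p)) (pair_acts_zexp k (unitrX 4 U) pair_acts_rot2).
rewrite exp1rz mul1mx => ac.
have a1 := pair_acts1 p; rewrite /pair_acts burau4_1 in a1.
case: l sl K => [|a l] sl K.
  move: K; rewrite /= mulg1 => K; move: ac; rewrite /pair_acts K -[1 in X in X -> _]/(1%:M) mulmx1 -[LHS]mul1mx.
  move=> /pair_rows_inj /matrixP /(_ ord0 ord0); rewrite !mxE /= => Xk.
  have k0 : k = 0.
    have e4 : X ^+ 4 = X ^ 4%:Z by [].
    suff : 2 * k = 0 by lia.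
    apply: (@laurentX_int p); rewrite mulrA -[2 * 2]/4%:Z -exprz_exp -e4.
    by move: Xk; rewrite !mulr1n => <-.
  have := ker_expo K; rewrite k0 expoM !expo_zexp expo_sig !expo_pos /= => E.
  have -> : m = 0 by lia.
  by rewrite /= !mulg1.
have [M [r [aM rM r0]]] := cab_word_reduces sl.
have aK := pair_actsM ac aM.
have E : (X ^+ 4) ^ k *: M = 1%:M.
  rewrite -mul_scalar_mx; apply: pair_acts_fun aK _.
  by rewrite /pair_acts K mul1mx -[1]/(1%:M) mulmx1.
have W : (X ^+ 4) ^ k \is a GRing.unit by rewrite unitrXz ?unitrX.
have M01 : M ord0 ord_max = 0.
  by have /matrixP /(_ ord0 ord_max) := E; rewrite !mxE /= => /(canRL (mulKr W)); rewrite mulr0.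
have M10 : M ord_max ord0 = 0.
  by have /matrixP /(_ ord_max ord0) := E; rewrite !mxE /= => /(canRL (mulKr W)); rewrite mulr0.
have M11 : M ord0 ord0 = M ord_max ord_max.
  have /matrixP E' := E; apply: (mulrI W).
  by have := E' ord0 ord0; have := E' ord_max ord_max; rewrite !mxE /= => -> ->.
have e1 := reduces_eq rM (etrans M01 (esym M10)); have e2 := reduces_eq rM M11.
have e3 : outer (first_col a) r ord0 ord_max = 0.
  case: rM => kk [ll [P PM]]; have [P1 P2] := PM ord0 ord_max; rewrite -P2.
  rewrite M01 mulr0 in P1; have -> : P ord0 ord_max = 0.
    by apply: (@plift_mulXI _ ll); rewrite plift0 -P1 mulr0.
  by rewrite horner0.
exfalso; move: r0 e1 e2 e3; rewrite !mxE /=; case: (r) => u v /=.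
case: (a) => [[]|] /=; rewrite ?mul0r ?mul1r ?mulN1r => /eqP ne.
- by move=> v0 u0 _; apply: ne; rewrite v0 u0.
- by move=> u0 v0 _; apply: ne; rewrite -v0 -u0.
- by move=> _ uv v0; apply: ne; rewrite uv v0 oppr0.
Qed.
End PairKernel.

(** * Free words and periodic braids *)

Section FreeWords.

(** The first bit marks an inverse, the second selects one of two generators. *)
Definition fletter := (bool * bool)%type.
Implicit Types (x y : fletter) (s u v : seq fletter).
Definition finv x : fletter := (~~ x.1, x.2).
Definition fcons x s := if s is y :: s' then (if y == finv x then s' else x :: s) else [:: x].
Definition freduce u := foldr fcons [::] u.
Definition fadj x y := y != finv x.
Definition freduced s := sorted fadj s.
Definition fequiv u v := freduce u = freduce v.
Definition finv_word u := rev (map finv u).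

Lemma finvK : involutive finv. Proof. by case=> -[] []. Qed.
Lemma finv_neq x : finv x != x. Proof. by case: x => -[] []. Qed.

Lemma fcons_reduced x s : freduced s -> freduced (fcons x s).
Proof.
case: s => [|y s] //= sy; case: eqP => [_|/eqP ne]; first exact: path_sorted sy.
by rewrite /freduced /= sy andbT.
Qed.

Lemma freduce_reduced u : freduced (freduce u).
Proof. by elim: u => //= x u; exact: fcons_reduced. Qed.

Lemma fconsK x s : freduced s -> fcons (finv x) (fcons x s) = s.
Proof.
case: s => [|y s] /= sy; first by rewrite finvK eqxx.
case: eqP => [e|/eqP ne] /=; last by rewrite finvK eqxx.
rewrite e in sy *; case: s sy => [|z s] //= /andP[zy _].
by rewrite ifN.
Qed.

Lemma freduceK s : freduced s -> freduce s = s.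
Proof.
elim: s => //= x s IH sx; rewrite IH; last exact: path_sorted sx.
by case: s sx {IH} => [|y s] //= /andP[/negbTE ->].
Qed.

Lemma foldr_fcons_freduce u s : freduced s -> foldr fcons s (freduce u) = foldr fcons s u.
Proof.
move=> rs; elim: u => //= x u <-; have := freduce_reduced u.
have R v : freduced (foldr fcons s v) by elim: v => //= y v; exact: fcons_reduced.
case: (freduce u) => [|y v] //= _; case: eqP => [->|_] //=.
by rewrite -{1}(finvK x) fconsK.
Qed.

Lemma freduce_cat u v : freduce (u ++ v) = freduce (freduce u ++ freduce v).
Proof.
rewrite /freduce !foldr_cat -/(freduce _) -/(freduce (freduce v)).
by rewrite foldr_fcons_freduce ?freduce_reduced // (freduceK (freduce_reduced v)).
Qed.

Lemma fequiv_cat u u' v v' : fequiv u u' -> fequiv v v' -> fequiv (u ++ v) (u' ++ v').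
Proof. by rewrite /fequiv => uu vv; rewrite freduce_cat uu vv -freduce_cat. Qed.

Lemma fequiv_cancel x u : fequiv [:: finv x, x & u] u.
Proof. by rewrite /fequiv /= fconsK // freduce_reduced. Qed.

(** Reduction uses only prefixing and the cancellation of a leading pair, so a function that
    respects both does not see it. *)
Lemma freduce_ind (T : Type) (f : seq fletter -> T) :
  (forall x u v, f u = f v -> f (x :: u) = f (x :: v)) ->
  (forall x u, f [:: x, finv x & u] = f u) -> forall u, f (freduce u) = f u.
Proof.
move=> fc fx; elim=> //= x u IH; have := fc x _ _ IH; rewrite /freduce /= -/(freduce u).
by case: (freduce u) => [|y v] //= <-; case: eqP => [->|//]; rewrite fx.
Qed.

Definition fsubst (f : fletter -> seq fletter) u := flatten (map f u).

Lemma fsubst_cat f u v : fsubst f (u ++ v) = fsubst f u ++ fsubst f v.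
Proof. by rewrite /fsubst map_cat flatten_cat. Qed.

Lemma fsubst_equiv f u v : (forall x, fequiv (f x ++ f (finv x)) [::]) ->
  fequiv u v -> fequiv (fsubst f u) (fsubst f v).
Proof.
move=> ff uv; have H w : freduce (fsubst f (freduce w)) = freduce (fsubst f w).
  apply: (freduce_ind (f := fun w => freduce (fsubst f w))) => [x a b ab|x a].
    by rewrite /fsubst /=; exact: fequiv_cat.
  by rewrite /fsubst /= catA; exact: (@fequiv_cat _ [::]).
by rewrite /fequiv -H uv H.
Qed.

(** Induction on the length: when the ends of [u] cancel, a conjugation strips them; otherwise the
    powers of [u] are reduced as written and a suitable letter tells the two products apart. *)
Lemma fpower_noncentral u n : freduced u -> u != [::] -> (0 < n)%N ->
  ~ (forall x, fequiv (x :: flatten (nseq n u)) (rcons (flatten (nseq n u)) x)).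
Proof.
have [k] := ubnP (size u); elim: k u => // k IH [//|x u] su ru _ n0 C.
have [|ne] := eqVneq (last x u) (finv x).
  case/lastP: u su ru C => [|u z]; first by move=> _ _ _ e; have := finv_neq x; rewrite /= -e eqxx.
  rewrite last_rcons => su ru C e; rewrite {z}e in su ru C.
  have E m : fequiv (flatten (nseq m (x :: rcons u (finv x)))) (x :: rcons (flatten (nseq m u)) (finv x)).
    elim: m => [|m IHm] /=; first by rewrite /fequiv /= eqxx.
    rewrite -cats1 -/(cat _ _) -catA /=.
    have h : fequiv (finv x :: flatten (nseq m (x :: u ++ [:: finv x]))) (rcons (flatten (nseq m u)) (finv x)).
      rewrite cats1; apply: (@etrans _ _ (freduce [:: finv x, x & rcons (flatten (nseq m u)) (finv x)])).
        exact: (@fequiv_cat [:: finv x] [:: finv x]).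
      exact: fequiv_cancel.
    by rewrite rcons_cat; apply: (@fequiv_cat [:: x] [:: x]) => //; exact: fequiv_cat.
  apply: (IH u _ _ _ n0).
  - by move: su; rewrite /= size_rcons; lia.
  - by move: ru; rewrite /freduced /= rcons_path => /andP[/path_sorted].
  - apply/eqP => u0; move: ru; rewrite u0 /freduced /= andbT /fadj eqxx //.
  move=> y.
  set V := flatten (nseq n u) in E *.
  have Cy w : fequiv (w ++ flatten (nseq n (x :: rcons u (finv x)))) (flatten (nseq n (x :: rcons u (finv x))) ++ w).
    elim: w => [|z w IHw] /=; first by rewrite cats0.
    rewrite -cat_rcons; apply: (@etrans _ _ (freduce (z :: flatten (nseq n (x :: rcons u (finv x))) ++ w))).
      exact: (@fequiv_cat [:: z] [:: z]).
    by rewrite -cat_cons; apply: fequiv_cat.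
  have := Cy [:: x; y; finv x] => K.
  have K1 : fequiv ([:: x; y; finv x] ++ x :: rcons V (finv x)) ((x :: rcons V (finv x)) ++ [:: x; y; finv x]).
    apply: etrans (etrans K _); first exact/esym/fequiv_cat/E.
    exact/fequiv_cat.
  have K2 : fequiv ([:: finv x] ++ ([:: x; y; finv x] ++ x :: rcons V (finv x)) ++ [:: x])
     ([:: finv x] ++ ((x :: rcons V (finv x)) ++ [:: x; y; finv x]) ++ [:: x]).
    by apply: fequiv_cat => //; exact: fequiv_cat.
  have S w : fequiv ([:: finv x] ++ (x :: w)) w by exact: fequiv_cancel.
  have T w : fequiv (rcons w (finv x) ++ [:: x]) w.
    rewrite -cats1 -catA; rewrite -[X in fequiv _ X]cats0; apply: fequiv_cat => //=.
    exact: fequiv_cancel.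
  have L : fequiv ([:: finv x] ++ ([:: x; y; finv x] ++ x :: rcons V (finv x)) ++ [:: x]) (y :: V).
    apply: etrans (fequiv_cancel x (y :: finv x :: x :: rcons V (finv x) ++ [:: x])) _.
    apply: (@fequiv_cat [:: y] [:: y] (finv x :: x :: rcons V (finv x) ++ [:: x]) V erefl).
    exact: etrans (fequiv_cancel x _) (T V).
  apply: etrans (etrans (esym L) K2) _.
  apply: etrans (fequiv_cancel x ((rcons V (finv x) ++ [:: x; y; finv x]) ++ [:: x])) _.
  rewrite -catA -[[:: x; y; finv x] ++ [:: x]]/([:: x] ++ (rcons [:: y] (finv x) ++ [:: x])) catA.
  by rewrite -[rcons V y]cats1; apply: fequiv_cat; [exact: T|exact: (T [:: y])].
have ly (m : nat) : (0 < m)%N -> exists v, [/\ flatten (nseq m (x :: u)) = x :: v, freduced (x :: v) & last x v = last x u].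
  elim: m => // -[|m] IHm _; first by exists u; rewrite /= cats0.
  have [v [e rv lv]] := IHm isT; exists (u ++ x :: v).
  have -> : flatten (nseq m.+2 (x :: u)) = (x :: u) ++ flatten (nseq m.+1 (x :: u)) by [].
  rewrite e.
  split=> //; last by rewrite last_cat /= lv.
  rewrite /freduced /= cat_path; apply/andP; split; first exact: ru.
  rewrite /=; apply/andP; split; last exact: rv.
  by rewrite /fadj; apply: contra ne => /eqP e'; apply/eqP; rewrite -[LHS]finvK -e'.
have [v [e rv lv]] := ly n n0; rewrite e in C.
(* [y] uses the generator other than that of the first letter and has the sign of the last letter,
   so nothing cancels at either end, and the first letters of the two words differ. *)
pose y : fletter := ((last x u).1, ~~ x.2).
have yl : y != finv (last x v).
  by rewrite lv /y; case: (last x u) => -[] []; case: (x.2).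
have := C y; rewrite /fequiv freduceK; last first.
  rewrite /freduced /=; apply/andP; split; last exact: rv.
  by rewrite /fadj /y /finv; apply/eqP => /(congr1 snd) /=; case: (x.2).
rewrite freduceK; last first.
  by rewrite /freduced /= rcons_path; apply/andP; split; [exact: rv | exact: yl].
by move=> [/(congr1 snd)] /=; case: (x.2).
Qed.

End FreeWords.

(** * Conjugation formulas for a = s3 s1^-1 and c = s2 a s2^-1 *)

Section SignedWord.
Variable G : groupType.
Local Open Scope group_scope.
Variables x y s : G.
Hypotheses (xy : x * y = y * x) (sx : s * x * s = x * s * x) (sy : s * y * s = y * s * y).

Lemma braid_conj1 (z : G) : s * z * s = z * s * z -> z^-1 * s^-1 * z = s * z^-1 * s^-1.
Proof.
move=> sz; apply: (mulgI (s * z)); rewrite -!mulgA mulVKg mulVKg.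
by rewrite (mulgA z s) (mulgA s) (mulgA s) sz -!mulgA mulVKg mulgV mulg1.
Qed.

Lemma braid_conj2 (z : G) : s * z * s = z * s * z -> z^-1 * s * z = s * z * s^-1.
Proof.
move=> sz; apply: (mulgI z); apply: (mulIg s).
by rewrite !mulgA mulgV mul1g mulgVK -sz.
Qed.

Variables a c : G.
Hypotheses (aE : a = x * y^-1) (cE : c = s * a * s^-1).

(** With [x], [y], [s] for s3, s1, s2, these formulas show that conjugation by s1 and s2 preserves
    the group generated by [a] and [c]. They are the source of [braid_auto]. *)
Lemma commute_a : y * a = a * y.
Proof. by rewrite aE mulgVK mulgA -xy mulgK. Qed.

Lemma conj_y_c : y * c = a^-1 * c * y.
Proof.
apply: (mulgI a); rewrite !mulgA mulgV mul1g aE mulgVK cE aE.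
have e1 : y^-1 * (s^-1 * y) = s * (y^-1 * s^-1) by rewrite !mulgA braid_conj1.
by rewrite -!mulgA e1 !mulgA sx.
Qed.

Lemma conj_s_c : s * c = c * a^-1 * c * s.
Proof.
have e1 := braid_conj1 sy; have e2 := braid_conj2 sx.
rewrite cE !mulgA mulgVK -!mulgA; congr (s * _).
have yx : x^-1 * y = y * x^-1 by apply: (mulgI x); rewrite mulVKg mulgA xy mulgK.
suff : s * a * s^-1 = a * s^-1 * a^-1 * s * a.
  by rewrite -!mulgA.
rewrite aE invgM invgK -!mulgA.
have -> : y^-1 * (s^-1 * (y * (x^-1 * (s * (x * y^-1))))) = s * y^-1 * s^-1 * (s * x * s^-1) * y^-1.
  by rewrite -e1 -e2 -!mulgA.
have e3 : y^-1 * s^-1 * y^-1 = s^-1 * y^-1 * s^-1.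
  by have := congr1 (fun g => g^-1) sy; rewrite !invgM -!mulgA.
rewrite -!mulgA mulKg.
have -> : y^-1 * (x * (s^-1 * y^-1)) = x * (s^-1 * (y^-1 * s^-1)).
  have -> : y^-1 * (x * (s^-1 * y^-1)) = x * (y^-1 * s^-1 * y^-1).
    rewrite !mulgA; congr (_ * _ * _); apply: (mulgI y); rewrite mulVKg mulgA -xy mulgK //.
  by rewrite e3 -!mulgA.
by rewrite !mulgA -sx mulgK.
Qed.

Lemma conj_yV_c : y^-1 * c = a * c * y^-1.
Proof.
apply: (mulgI y); rewrite mulVKg; apply: (mulIg y); rewrite -!mulgA mulVg mulg1.
by rewrite [y * _]mulgA commute_a -mulgA conj_y_c -mulgA mulVKg.
Qed.

Lemma conj_sV_a : s^-1 * a = a * c^-1 * a * s^-1.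
Proof.
have h : c * a^-1 * c = s * c * s^-1 by rewrite conj_s_c mulgK.
apply: (mulgI s); rewrite mulVKg.
have -> : s * (a * c^-1 * a * s^-1) = (s * a * s^-1) * (s * c * s^-1)^-1 * (s * a * s^-1).
  by rewrite !invgM invgK -!mulgA !mulKg.
rewrite -h -cE !invgM invgK -!mulgA mulVKg.
by rewrite mulVg mulg1.
Qed.

End SignedWord.

Section FreeAction.
Implicit Types (u v : seq fletter).

(* The letters (false, false) and (false, true) of the free group stand for the braids
   a = s3 s1^-1 and c = s2 a s2^-1. *)
Definition ffwd (f g : seq fletter) (x : fletter) : seq fletter :=
  let w := if x.2 then g else f in if x.1 then finv_word w else w.

Notation la := (false, false).
Notation lc := (false, true).
Notation laV := (true, false).
Notation lcV := (true, true).

(** Conjugation by s2 for the index 1 and by s1 for both other indices: s3 is folded onto s1, and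
    the difference is kept in [braid_shift]. *)
Definition braid_auto (x : bool * nat) : fletter -> seq fletter :=
  if x.2 == 1%N then if x.1 then ffwd [:: la; lcV; la] [:: la] else ffwd [:: lc] [:: lc; laV; lc]
  else if x.1 then ffwd [:: la] [:: la; lc] else ffwd [:: la] [:: laV; lc].

Definition braid_shift (x : bool * nat) : seq fletter :=
  if x.2 == 2 then [:: (x.1, false)] else [::].

(** B4 acts on the free group by affine maps, as a semidirect product of left translations and of
    the automorphisms induced by 3-braids. *)
Definition free_act (s : seq (bool * nat)) u :=
  foldr (fun x v => braid_shift x ++ fsubst (braid_auto x) v) u s.

Definition free_lin (s : seq (bool * nat)) u := foldr (fun x v => fsubst (braid_auto x) v) u s.

Lemma free_lin_cat s u v : free_lin s (u ++ v) = free_lin s u ++ free_lin s v.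
Proof. by elim: s => //= x s ->; rewrite fsubst_cat. Qed.

Lemma free_actE s u : free_act s u = free_act s [::] ++ free_lin s u.
Proof. by elim: s => //= x s ->; rewrite fsubst_cat catA. Qed.

Lemma braid_auto_inv x y : fequiv (braid_auto x y ++ braid_auto x (finv y)) [::].
Proof.
by case: x => e k; rewrite /braid_auto /=; case: eqP => _; case: e; case: y => -[] []; vm_compute.
Qed.

Lemma free_act_equiv s u v : fequiv u v -> fequiv (free_act s u) (free_act s v).
Proof.
move=> uv; elim: s => //= x s IH; apply: fequiv_cat => //.
by apply: fsubst_equiv => // y; exact: braid_auto_inv.
Qed.

Lemma free_act_cat s t u : free_act (s ++ t) u = free_act s (free_act t u).
Proof. by rewrite /free_act foldr_cat. Qed.

Definition fletters : seq fletter := [:: la; lc; laV; lcV].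

Lemma free_lin_nil s : free_lin s [::] = [::].
Proof. by elim: s => //= x s ->. Qed.

(** An affine map is determined by its value at the empty word and by its linear part on letters. *)
Lemma free_act_check s t :
  freduce (free_act s [::]) == freduce (free_act t [::]) ->
  all (fun y => freduce (free_lin s [:: y]) == freduce (free_lin t [:: y])) fletters ->
  forall u, fequiv (free_act s u) (free_act t u).
Proof.
move=> /eqP st /allP h u; rewrite (free_actE s) (free_actE t); apply: fequiv_cat => //.
elim: u => [|y u IH].
  by rewrite !free_lin_nil.
rewrite -cat1s !free_lin_cat; apply: fequiv_cat => //; apply/eqP/h.
by case: y {IH} => -[] [].
Qed.

Definition letters_of (w : word) : seq (bool * nat) := [seq (x.1, nat_of_ord x.2) | x <- w].

Lemma letters_of_cat (v w : word) : letters_of (v ++ w) = letters_of v ++ letters_of w.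
Proof. exact: map_cat. Qed.

Lemma letters_of_spell s : small s -> letters_of (spell s) = s.
Proof.
rewrite /letters_of /spell -map_comp => /allP h; rewrite -[RHS]map_id.
by apply/eq_in_map => -[e k] /h /= k3; rewrite inordK.
Qed.

Lemma free_act_eq (v w : word) : braid_eq v w ->
  forall u, fequiv (free_act (letters_of v) u) (free_act (letters_of w) u).
Proof.
have S (s : seq nat) : all (fun k => k < 3)%N s ->
    letters_of [seq sigma k.+1 | k <- s] = [seq (false, k) | k <- s].
  rewrite /letters_of -map_comp => /allP h; apply/eq_in_map => k /h k3.
  by rewrite /= inordK.
elim=> {v w} [//|v w _ IH u|u v w _ IH1 _ IH2 r|u u' v v' _ IH1 _ IH2 r|||| ].
- by rewrite /fequiv IH.
- exact: etrans (IH1 r) (IH2 r).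
- rewrite !letters_of_cat !free_act_cat; apply: etrans (IH1 _); exact: free_act_equiv.
- case=> e [[|[|[|//]]] ?]; case: e => u; apply: free_act_check; by vm_compute.
- move=> u; rewrite (S [:: 0; 2]%N) // (S [:: 2; 0]%N) //; apply: free_act_check; by vm_compute.
- move=> u; rewrite (S [:: 0; 1; 0]%N) // (S [:: 1; 0; 1]%N) //; apply: free_act_check; by vm_compute.
- move=> u; rewrite (S [:: 1; 2; 1]%N) // (S [:: 2; 1; 2]%N) //; apply: free_act_check; by vm_compute.
Qed.

Definition braid_a : B4 := (sig 2 * (sig 0)^-1)%g.
Definition braid_c : B4 := (sig 1 * braid_a * (sig 1)^-1)%g.

Definition fval (x : fletter) : B4 :=
  let g := if x.2 then braid_c else braid_a in if x.1 then g^-1%g else g.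
Definition feval u : B4 := foldr (fun x g => fval x * g)%g 1%g u.

Lemma feval_cat u v : feval (u ++ v) = (feval u * feval v)%g.
Proof. by elim: u => [|x u IH] /=; rewrite ?mul1g // IH mulgA. Qed.

Lemma fval_inv x : fval (finv x) = (fval x)^-1%g.
Proof. by case: x => -[] [] //=; rewrite /fval /= invgK. Qed.

Lemma feval_reduce u : feval (freduce u) = feval u.
Proof.
apply: freduce_ind => [x v w /= -> //|x v] /=.
by rewrite fval_inv mulVKg.
Qed.

Lemma feval_finv u : feval (finv_word u) = (feval u)^-1%g.
Proof.
elim: u => [|x u IH]; first by rewrite invg1.
by rewrite /finv_word /= rev_cons -cats1 feval_cat -/(finv_word u) IH /= mulg1 fval_inv invgM.
Qed.

Definition one (x : bool * nat) : B4 := if x.1 then (sig x.2)^-1%g else sig x.2.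
Definition fold_letter (x : bool * nat) := (x.1, if x.2 == 2 then 0%N else x.2).

Lemma one_spell x : (x.2 < 3)%N -> one x = braid_of_word (spell [:: x]).
Proof.
case: x => -[] k k3; rewrite /one //=.
apply: (mulIg (sig k)); rewrite mulVg -[sig k]/(braid_of_word [:: (false, inord k)]) -braid_of_word_cat.
by apply/braid_of_wordP/braid_sym; exact: (braid_inv (true, inord k)).
Qed.

Lemma braid_aE : braid_a = (sig 2 * (sig 0)^-1)%g. Proof. by []. Qed.
Lemma braid_cE : braid_c = (sig 1 * braid_a * (sig 1)^-1)%g. Proof. by []. Qed.

#[local] Opaque braid_a braid_c.

(** The actual braids obey the combinatorial automorphism; for inverse letters of the free group
    this follows from the positive ones. *)
Lemma one_fval x y : (x.2 < 3)%N ->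
  (one (fold_letter x) * fval y = feval (braid_auto x y) * one (fold_letter x))%g.
Proof.
have aE := braid_aE; have cE := braid_cE.
have s02 : (sig 2 * sig 0 = sig 0 * sig 2)%g by rewrite /sig; pos_eq.
have s21 : (sig 1 * sig 2 * sig 1 = sig 2 * sig 1 * sig 2)%g by rewrite /sig; pos_eq.
have s01 : (sig 1 * sig 0 * sig 1 = sig 0 * sig 1 * sig 0)%g by rewrite /sig; pos_eq.
have ca : (sig 0 * braid_a = braid_a * sig 0)%g by apply: (commute_a (x := sig 2)).
have yc : (sig 0 * braid_c = braid_a^-1 * braid_c * sig 0)%g.
  by apply: (conj_y_c (x := sig 2) (s := sig 1)).
have sc : (sig 1 * braid_c = braid_c * (braid_a^-1 * braid_c) * sig 1)%g.
  by rewrite [(braid_c * _)%g]mulgA; apply: (conj_s_c (x := sig 2) (y := sig 0)).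
have yVc : ((sig 0)^-1 * braid_c = braid_a * braid_c * (sig 0)^-1)%g.
  by apply: (conj_yV_c (x := sig 2) (s := sig 1)).
have sVa : ((sig 1)^-1 * braid_a = braid_a * (braid_c^-1 * braid_a) * (sig 1)^-1)%g.
  by rewrite [(braid_a * (_ * _))%g]mulgA; apply: (conj_sV_a (x := sig 2) (y := sig 0)).
have sa : (sig 1 * braid_a = braid_c * sig 1)%g by rewrite braid_cE mulgVK.
have sVc : ((sig 1)^-1 * braid_c = braid_a * (sig 1)^-1)%g by rewrite braid_cE -mulgA mulKg.
have yVa : ((sig 0)^-1 * braid_a = braid_a * (sig 0)^-1)%g.
  by apply: (mulgI (sig 0)); rewrite mulVKg mulgA ca mulgK.
have pos d : (d < 3)%N -> forall e b, (one (fold_letter (e, d)) * fval (false, b) =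
   feval (braid_auto (e, d) (false, b)) * one (fold_letter (e, d)))%g.
  by case: d => [|[|[|//]]] _ [] []; rewrite /one /= ?mulg1 /fval /=.
move=> x3; case: y => -[] d; last by have := pos _ x3 x.1 d; rewrite -surjective_pairing.
have inv : feval (braid_auto x (true, d)) = (feval (braid_auto x (false, d)))^-1%g.
  by rewrite -feval_finv; case: x {x3} => e k; rewrite /braid_auto /=; case: eqP; case: e.
rewrite inv; have -> : fval (true, d) = (fval (false, d))^-1%g by rewrite -fval_inv.
apply: (mulgI (feval (braid_auto x (false, d)))); rewrite mulVKg mulgA.
have := pos _ x3 x.1 d; rewrite -surjective_pairing => <-.
by rewrite mulgK.
Qed.

Lemma one_feval x u : (x.2 < 3)%N ->
  (one (fold_letter x) * feval u = feval (fsubst (braid_auto x) u) * one (fold_letter x))%g.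
Proof.
move=> x3; elim: u => [|y u IH] /=; first by rewrite mulg1 mul1g.
by rewrite mulgA one_fval // -mulgA IH /fsubst /= feval_cat mulgA.
Qed.

Lemma one_shift x : (x.2 < 3)%N -> one x = (feval (braid_shift x) * one (fold_letter x))%g.
Proof.
have aE := braid_aE.
have ca : commute (sig 0) braid_a.
  by apply: (commute_a (x := sig 2)) => //; rewrite /sig; pos_eq.
have h : sig 2 = (braid_a * sig 0)%g by rewrite aE mulgVK.
have hV : ((sig 2)^-1 = braid_a^-1 * (sig 0)^-1)%g by rewrite h -ca invgM.
by case: x => -[] [|[|[|//]]] _; rewrite /one /braid_shift /= ?mul1g ?mulg1.
Qed.

(** Pushing the free factors to the left past the folded letters applies [braid_auto], which is how
    [free_act] collects the free part. *)
Lemma braid_split s : small s ->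
  braid_of_word (spell s) = (feval (free_act s [::]) * braid_of_word (spell (map fold_letter s)))%g.
Proof.
elim: s => [|x s IH] /=; first by rewrite mulg1.
move=> /andP[x3 s3]; rewrite feval_cat.
have E y t : (y.2 < 3)%N -> braid_of_word (spell (y :: t)) = (one y * braid_of_word (spell t))%g.
  by move=> y3; rewrite one_spell // -braid_of_word_cat.
have f3 : ((fold_letter x).2 < 3)%N by case: (x) x3 => ? [|[|[|]]].
rewrite (E _ _ x3) (E _ _ f3) IH // one_shift // -!mulgA; congr (_ * _)%g; rewrite !mulgA; congr (_ * _)%g.
by rewrite one_feval.
Qed.

Definition fspell u : seq (bool * nat) := flatten [seq
  (let s := if x.2 then [:: (false, 1); (false, 2); (true, 0); (true, 1)]%N
            else [:: (false, 2); (true, 0)]%N in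
   if x.1 then rev [seq (~~ y.1, y.2) | y <- s] else s) | x <- u].

Lemma fspell_small u : small (fspell u).
Proof. by elim: u => [|[[] []] u IH] //=. Qed.

(** The translation applied to the empty word recovers [u] up to reduction: distinct reduced words
    are distinct braids. *)
Lemma fspell_act u v : fequiv (free_act (fspell u) v) (u ++ v).
Proof.
elim: u => [|x u IH] //; rewrite /fspell /= -/(fspell u) free_act_cat.
apply: etrans (_ : freduce (x :: free_act (fspell u) v) = _); last exact: (@fequiv_cat [:: x] [:: x]).
have H t : (freduce (free_act t [::]) == freduce [:: x]) ->
  all (fun y => freduce (free_lin t [:: y]) == freduce [:: y]) fletters ->
  forall w, fequiv (free_act t w) (x :: w).
  move=> /eqP h0 /allP hl w; rewrite free_actE -cat1s; apply: fequiv_cat => //.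
  elim: w => [|y w IHw]; first by rewrite free_lin_nil.
  rewrite -cat1s free_lin_cat; apply: fequiv_cat => //; apply/eqP/hl.
  by case: y {IHw} => -[] [].
by apply: H; case: x => -[] []; vm_compute.
Qed.

Lemma fspell_eval u : braid_of_word (spell (fspell u)) = feval u.
Proof.
elim: u => [|x u IH] //; rewrite /fspell /= -/(fspell u) spell_cat braid_of_word_cat IH; congr (_ * _)%g.
have P s : small s -> braid_of_word (spell s) = foldr (fun y g => one y * g)%g 1%g s.
  elim: s => //= y s IHs /andP[y3 s3]; rewrite -IHs // one_spell // -braid_of_word_cat //.
rewrite P; last by case: x => -[] [].
by case: x => -[] [] /=; rewrite mulg1 /one /fval /= ?braid_cE ?braid_aE ?invgM ?invgK ?mulgA.
Qed.

Lemma fpower_eval u n : feval (flatten (nseq n u)) = (feval u ^+ n)%g.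
Proof. by elim: n => //= n IH; rewrite feval_cat IH expgS. Qed.

Lemma feval_torsion u n : (0 < n)%N -> (forall b, commute (feval u ^+ n)%g b) -> feval u = 1%g.
Proof.
move=> n0 C; rewrite -feval_reduce; set v := freduce u.
have [-> //|v0] := eqVneq v [::].
case: (@fpower_noncentral v n (freduce_reduced u) v0 n0) => x.
have := C (fval x); rewrite -feval_reduce -/v -fpower_eval; set V := flatten _ => cx.
have : braid_of_word (spell (fspell (x :: V))) = braid_of_word (spell (fspell (rcons V x))).
  by rewrite !fspell_eval -cats1 feval_cat /= mulg1.
move=> /braid_of_wordP /free_act_eq /(_ [::]); rewrite !letters_of_spell ?fspell_small //.
move=> h; have e1 := fspell_act (x :: V) [::]; have e2 := fspell_act (rcons V x) [::].
by rewrite !cats0 in e1 e2; exact: etrans (esym e1) (etrans h e2).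
Qed.

End FreeAction.

(** * Folding s3 onto s1, and periodic kernel elements *)

Section Fold.

Definition fold_word (w : word) : word := spell [seq fold_letter x | x <- letters_of w].

Lemma fold_word_cat v w : fold_word (v ++ w) = fold_word v ++ fold_word w.
Proof. by rewrite /fold_word letters_of_cat map_cat spell_cat. Qed.

(** The far relation becomes an identity, and the relation of s2 and s3 becomes that of s1 and
    s2. *)
Lemma fold_word_eq v w : braid_eq v w -> braid_eq (fold_word v) (fold_word w).
Proof.
have S (s : seq nat) : all (fun k => k < 3)%N s ->
    fold_word [seq sigma k.+1 | k <- s] = spell [seq (false, if k == 2 then 0%N else k) | k <- s].
  rewrite /fold_word /letters_of -!map_comp => /allP h; congr spell; apply/eq_in_map => k /h k3.
  by rewrite /= /fold_letter /= inordK.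
elim=> {v w} [w|v w _|u v w _ IH1 _ IH2|u u' v v' _ IH1 _ IH2|x|||].
- exact: braid_refl.
- exact: braid_sym.
- exact: braid_trans IH1 IH2.
- by rewrite !fold_word_cat; exact: braid_cat.
- exact: (braid_inv (_, _)).
- rewrite (S [:: 0; 2]%N) // (S [:: 2; 0]%N) //; exact: braid_refl.
- rewrite (S [:: 0; 1; 0]%N) // (S [:: 1; 0; 1]%N) //; exact: braid_near12.
- rewrite (S [:: 1; 2; 1]%N) // (S [:: 2; 1; 2]%N) //; exact/braid_sym/braid_near12.
Qed.

Definition fold_braid (b : B4) : B4 := braid_of_word (fold_word (repr b)).

Lemma fold_braid_word w : fold_braid (braid_of_word w) = braid_of_word (fold_word w).
Proof. exact/braid_of_wordP/fold_word_eq/braid_eq_repr. Qed.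

Lemma fold_braidM a b : fold_braid (a * b)%g = (fold_braid a * fold_braid b)%g.
Proof.
by rewrite -[a]braid_of_wordK -[b]braid_of_wordK -braid_of_word_cat !fold_braid_word fold_word_cat
  braid_of_word_cat.
Qed.

Lemma fold_braid1 : fold_braid 1%g = 1%g.
Proof. exact: (fold_braid_word [::]). Qed.

Lemma fold_braidX a n : fold_braid (a ^+ n)%g = (fold_braid a ^+ n)%g.
Proof. by elim: n => [|n IH]; rewrite ?expg0 ?fold_braid1 // !expgS fold_braidM IH. Qed.

Lemma fold_braid_sig k : (k < 2)%N -> fold_braid (sig k) = sig k.
Proof.
move=> k2; rewrite /sig /pos_braid fold_braid_word /fold_word /letters_of /= inordK; last by lia.
by case: k k2 => [|[|]].
Qed.

Lemma fold_braid_in12 b : in12 (fold_braid b).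
Proof.
rewrite -[b]braid_of_wordK fold_braid_word; elim: (repr b) => [|[e i] w IH]; first exact: in12_1.
rewrite -cat1s fold_word_cat braid_of_word_cat; apply: in12M => //.
have := one_spell (x := fold_letter (e, nat_of_ord i)).
rewrite /fold_word /= => <-; last by case: i => [[|[|[|]]]].
rewrite /one /fold_letter /=; set k : nat := (if _ == 2%N then _ else _).
have k2 : (k < 2)%N by rewrite /k; case: i @k => [[|[|[|]]]].
by case: e; [exact/in12V/in12_gen|exact: in12_gen].
Qed.

Lemma fold_braid_expo b : expo (fold_braid b) = expo b.
Proof.
rewrite -[b]braid_of_wordK fold_braid_word !expo_word; elim: (repr b) => //= x w ->.
by [].
Qed.

Lemma fold_split b : exists u, b = (feval u * fold_braid b)%g.
Proof.
have [s s3 e] := spell_surj (repr b); rewrite -[b]braid_of_wordK fold_braid_word e.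
exists (free_act s [::]); rewrite /fold_word letters_of_spell //; exact: braid_split.
Qed.

Lemma ker_torsion p b n : burau4_ker p b -> (0 < n)%N -> (forall a, commute (b ^+ n)%g a) -> b = 1%g.
Proof.
move=> kb n0 C; have f1 : fold_braid b = 1%g.
  apply: (in12_torsion p (n := n)) => //; first exact: fold_braid_in12.
  - by rewrite fold_braid_expo; exact: ker_expo kb.
  - rewrite -fold_braidX -(fold_braid_sig (k := 0)) // /commute -!fold_braidM; congr fold_braid; exact: C.
  - rewrite -fold_braidX -(fold_braid_sig (k := 1)) // /commute -!fold_braidM; congr fold_braid; exact: C.
have [u e] := fold_split b; rewrite f1 mulg1 in e; rewrite e in C *.
exact: feval_torsion n0 C.
Qed.

End Fold.

(** * Purity of kernel elements *)

Section Purity.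
Variable p : nat.
Hypothesis hp : p = 2 \/ p = 3.
Local Notation L := (laurent 'F_p).

(** At t = 1 the generators are involutions, so one matrix serves both signs. *)
Definition table_at1 (x : bool * nat) : seq (seq nat) :=
  (match x.2 with
   | 0 => [:: [:: p.-1; 0; 0]; [:: 1; 1; 0]; [:: 0; 0; 1]]
   | 1 => [:: [:: 1; 1; 0]; [:: 0; p.-1; 0]; [:: 0; 1; 1]]
   | _ => [:: [:: 1; 0; 0]; [:: 0; 1; 1]; [:: 0; 0; p.-1]]
   end)%N.

Definition eval_at1 := eval_table 0%N (fun x y => (x + y) %% p)%N (fun x y => (x * y) %% p)%N
  id_table table_at1.

Lemma prime_p : prime p. Proof. by case: hp => ->. Qed.

Lemma burau_gen_inv1 (i : 'I_3) : burau_gen_inv (1 : 'F_p) i = burau_gen 1 i.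
Proof. by rewrite /burau_gen_inv /burau_gen invr1; case: i => [[|[|[|]]]]. Qed.

Lemma eval_at1E s : small s -> burau_word (1 : 'F_p) (spell s) = table_mx (fun n => n%:R) (eval_at1 s).
Proof.
move=> s3; have modp n : (n %% p)%:R = n%:R :> 'F_p.
  by rewrite (@GRing.natr_mod_pchar _ p) // pchar_Fp ?prime_p.
have mp : p.-1%:R = -1 :> 'F_p.
  apply/eqP; rewrite -addr_eq0 -[1]/(1%:R) -natrD addn1 prednK ?prime_gt0 ?prime_p //.
  by rewrite -[p in p%:R]addn0 -modp modnDl mod0n.
apply: (eval_tableE (c0 := 0%N)).
- by [].
- by move=> x y /=; rewrite modp natrD.
- by move=> x y /=; rewrite modp natrM.
- by rewrite /table_mx mx3_1.
move=> [e k] xs; have k3 : (k < 3)%N by have /allP /(_ _ xs) := s3.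
rewrite /burau_letter /= burau_gen_invE ?unitr1 // burau_gen_inv1 if_same /burau_gen /= inordK //.
by case: k {xs} k3 => [|[|[|//]]] _; rewrite /table_mx /= mp.
Qed.

Lemma reduces_letter x : reduces (1 : 'F_p) (burau_letter (laurentX : L) x) (burau_letter 1 x).
Proof.
have U := laurentX_unit 'F_p; case: x => e i.
rewrite /burau_letter /=; case: e; last first.
  exists 0%N, 0%N, (fun j k => burau_gen ('X : {poly 'F_p}) i j k) => j k; rewrite !expr0 !mul1r.
  rewrite /burau_gen; case: i => [[|[|[|//]]] ?]; rewrite !mxE;
  case: j => [[|[|[|//]]] ?]; case: k => [[|[|[|//]]] ?]; split;
  by rewrite /= ?pliftN ?plift1 ?plift0 ?pliftX ?hornerN ?hornerX ?hornerC.
rewrite !burau_gen_invE ?unitr1 //.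
exists 1%N, 0%N, (fun j k => nth 0 (nth [::] (match val i with
  | 0%N => [:: [:: -1; 0; 0]; [:: 1; 'X; 0]; [:: 0; 0; 'X]]
  | 1%N => [:: [:: 'X; 'X; 0]; [:: 0; -1; 0]; [:: 0; 1; 'X]]
  | _ => [:: [:: 'X; 0; 0]; [:: 0; 'X; 'X]; [:: 0; 0; -1]] end) j) k) => j k.
rewrite expr1 expr0 mul1r /burau_gen_inv; case: i => [[|[|[|//]]] ?]; rewrite !mxE;
  case: j => [[|[|[|//]]] ?]; case: k => [[|[|[|//]]] ?]; split;
  by rewrite /= ?[X in X = _]mulrN ?(divrr U) ?mulr0 ?mulr1 ?pliftN ?plift1 ?plift0 ?pliftX ?invr1 ?hornerN ?hornerX ?hornerC.
Qed.

Lemma reduces_word w : reduces (1 : 'F_p) (burau_word (laurentX : L) w) (burau_word 1 w).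
Proof.
elim: w => [|x w IH]; first by rewrite /burau_word !big_nil; exact: reduces1.
by rewrite /burau_word !big_cons; apply: reducesM => //; exact: reduces_letter.
Qed.

(** The normalizing powers of t become 1, so evaluation at 1 is unambiguous. *)
Lemma reduces_at1 n (N : 'M['F_p]_n) : reduces (1 : 'F_p) (1%:M : 'M[L]_n) N -> N = 1%:M.
Proof.
move=> [k [l [P PM]]]; apply/matrixP => i j; have [e <-] := PM i j.
have X n' : (laurentX : L) ^+ n' = plift ('X ^+ n').
  by elim: n' => [|m IH]; rewrite ?expr0 ?plift1 // !exprS pliftM pliftX IH.
have : plift ('X^k * (i == j)%:R) = plift ('X^l * P i j).
  by rewrite !pliftM -!X -e mxE; case: (i == j); rewrite ?plift1 ?plift0.
move=> /plift_inj /(congr1 (fun Q => Q.[1])); rewrite !hornerM !hornerXn !expr1n !mul1r => <-.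
by rewrite mxE; case: (i == j); rewrite ?hornerC.
Qed.

Definition perm_row (w : word) : seq nat := [seq word_perm w m | m <- [:: 1; 2; 3; 4]]%N.

Definition state : Type := (seq nat * seq (seq nat))%type.
Definition next (st : state) (k : nat) : state :=
  ([seq swap_k k m | m <- st.1], mul_table 0%N (fun x y => (x + y) %% p)%N
     (fun x y => (x * y) %% p)%N st.2 (table_at1 (false, k))).

Definition start : state := ([:: 1; 2; 3; 4]%N, id_table).

(** Reachable pairs of a permutation and a matrix modulo [p]. Eight rounds exceed the length 6 of
    the longest permutation of four points. *)
Definition states : seq state :=
  iter 8 (fun S => undup (S ++ flatten [seq [seq next st k | k <- [:: 0; 1; 2]%N] | st <- S])) [:: start].

Lemma states_closed st k : st \in states -> (k < 3)%N -> next st k \in states.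
Proof.
have : all (fun st => all (fun k => next st k \in states) [:: 0; 1; 2]%N) states.
  by rewrite /states /next /table_at1; case: hp => ->; vm_compute.
by move=> /allP h /h /allP h' k3; apply: h'; case: k k3 => [|[|[|]]].
Qed.

Lemma states_id st : st \in states ->
  (forall i j, (i < 3)%N -> (j < 3)%N -> entry 0%N st.2 i j = (i == j) %[mod p]) -> st.1 = [:: 1; 2; 3; 4]%N.
Proof.
move=> sS H; have : all (fun st => if all (fun i => all (fun j => entry 0%N st.2 i j %% p == (i == j) %% p)
    (iota 0 3)) (iota 0 3) then st.1 == [:: 1; 2; 3; 4] else true)%N states.
  by rewrite /states /next /table_at1; case: hp => ->; vm_compute.
move=> /allP /(_ _ sS); case: ifP => [_ /eqP //|/negP []].
apply/allP => i i3; apply/allP => j j3; apply/eqP.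
by rewrite !mem_iota in i3 j3; apply: H; lia.
Qed.

Lemma state_word s : small s -> (perm_row (spell s), eval_at1 s) \in states.
Proof.
elim/last_ind: s => [|s x IH]; first by rewrite /states /next /table_at1; case: hp => ->; vm_compute.
rewrite /small all_rcons => /andP[x3 /IH h].
have -> : (perm_row (spell (rcons s x)), eval_at1 (rcons s x)) = next (perm_row (spell s), eval_at1 s) x.2.
  rewrite /next -cats1; congr pair; last by rewrite /eval_at1 /eval_table foldl_cat.
  rewrite /perm_row -map_comp; apply: eq_map => m.
  by rewrite spell_cat /word_perm foldl_cat /= -/(word_perm _ _) swap_natE /= inordK.
exact: states_closed.
Qed.

Lemma ker_pure w m : burau4_ker p (braid_of_word w) -> (1 <= m <= 4)%N -> word_perm w m = m.
Proof.
rewrite /burau4_ker /= burau4_word; have [s s3 ->] := spell_surj w => K m4.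
have N1 : burau_word (1 : 'F_p) (spell s) = 1%:M.
  by apply: reduces_at1; have := reduces_word (spell s); rewrite K.
have : perm_row (spell s) = [:: 1; 2; 3; 4]%N.
  have -> : perm_row (spell s) = (perm_row (spell s), eval_at1 s).1 by [].
  apply: states_id; first exact: state_word.
  move=> i j i3 j3 /=; have /matrixP /(_ (Ordinal i3) (Ordinal j3)) := N1.
  rewrite eval_at1E // (table_mxE (c0 := 0%N)) ?mxE //= => /(congr1 (fun x : 'F_p => nat_of_ord x)).
  by rewrite (_ : (Ordinal i3 == Ordinal j3) = (i == j)) // !val_Fp_nat ?prime_p.
by case=> *; case: m m4 => [|[|[|[|[|]]]]] //.
Qed.

End Purity.

#[local] Opaque mconf.

(** * Motions of clusters of points *)

Section OrderClasses.
Variable R : realType.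
Local Notation plane := (R * R)%type.
Local Notation config := ('I_4 -> plane).

(** The slope is the reciprocal of a sum that beats every ratio of vertical to horizontal
    separation, so abscissas decide first and only ties reach the ordinates. *)
Lemma small_slope (z : config) : injective z -> exists2 a, 0 < a &
  generic a z /\ forall i j, slope_lt a z i j = lex_lt z i j.
Proof.
move=> zi; pose bad i j := (`|(z i).2 - (z j).2| + 1) / `|(z i).1 - (z j).1|.
have bad0 i j : 0 <= bad i j by rewrite divr_ge0 // ?addr_ge0.
pose s := 1 + \sum_i \sum_j bad i j.
have s0 : 0 < s by rewrite ltr_pwDl // sumr_ge0 // => i _; rewrite sumr_ge0.
have badlt i j : bad i j < s.
  rewrite /s (bigD1 i) //= (bigD1 j) //=.
  have p1 : 0 <= \sum_(k < 4 | k != j) bad i k by rewrite sumr_ge0.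
  have p2 : 0 <= \sum_(k < 4 | k != i) \sum_l bad k l.
    by rewrite sumr_ge0 // => k _; rewrite sumr_ge0.
  by move: p1 p2; set u := \sum_(_ | _) _; set v := \sum_(_ | _) _; lra.
have a0 : 0 < s^-1 by rewrite invr_gt0.
have close i j : (z i).1 != (z j).1 -> `|s^-1 * ((z i).2 - (z j).2)| < `|(z i).1 - (z j).1|.
  rewrite -subr_eq0 -normr_gt0 => d0; rewrite normrM gtr0_norm // mulrC ltr_pdivrMr //.
  have := badlt i j; rewrite /bad ltr_pdivrMr //; lra.
have lt_lex i j : slope_lt s^-1 z i j = lex_lt z i j.
  rewrite /slope_lt /lex_lt /key; have := @close i j.
  case: (ltrgtP (z i).1 (z j).1) => h /= h1.
  - by have := h1 isT; rewrite ltr_norml => /andP[h2 _]; apply/idP; lra.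
  - by have := h1 isT; rewrite ltr_norml => /andP[_ h2]; apply/negbTE; rewrite -leNgt; lra.
  - by rewrite h ltrD2l ltrN2 ltr_pM2l.
exists s^-1 => //; split => // i j ij; have [_ _] := lex_total zi.
have [anti _] := lex_total zi; have := anti i j ij; rewrite -!lt_lex /slope_lt.
by case: (ltrgtP (key s^-1 z i) (key s^-1 z j)).
Qed.

Lemma rlt_lex (z : config) (i j : 'I_4) : injective z -> rlt (ranks (lex_lt z)) i j = lex_lt z i j.
Proof. by move=> zi; have [_ ->] := ranksP (lex_total zi). Qed.

Lemma lex_perms4 (z : config) : injective z -> ranks (lex_lt z) \in perms4.
Proof. by move=> zi; have [] := ranksP (lex_total zi). Qed.

(** Between nearby times the transition passes through the order [o] of a middle time, which lies in
    the class as well. Both halves are gauged braids between orders of the class, so a finite check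
    controls the whole motion. *)
Lemma mconf_class (Cl : seq nat -> bool) (kappa : seq nat -> B4) (H : B4 -> Prop) (f : R -> config) :
  H 1%g -> (forall x y, H x -> H y -> H (x * y)%g) -> (forall x, H x -> H x^-1%g) ->
  (forall r o, r \in perms4 -> o \in perms4 -> Cl r -> Cl o ->
     H (kappa r * perm_braid r o * (kappa o)^-1)%g) ->
  (forall i, continuous (fun s => f s i)) -> (forall s, injective (f s)) ->
  (forall s, 0 <= s <= 1 -> Cl (ranks (lex_lt (f s)))) ->
  H (kappa (ranks (lex_lt (f 0%R))) * mconf f * (kappa (ranks (lex_lt (f 1%R))))^-1)%g.
Proof.
move=> H1 HM HV cls cf fi fC.
have lc : lcocycle setT (fun s t => tau (f s) (f t)) by exact: (@tau_lcocycle R R f cf setT).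
apply: (mono_mem (kappa := fun s => kappa (ranks (lex_lt (f s)))) lc H1 HM) => y y01.
have [a a0 [g E]] := small_slope (fi y); have [V nV VP] := generic_near cf g.
exists V => // u v Vu Vv u01 v01.
have ok w : V w -> slope_ok (f y) (f w) a by move=> /VP Ew; split.
have okuv : slope_ok (f u) (f v) a.
  split=> //; first exact: slope_ok_generic (ok u Vu).
  by move=> i j; rewrite -(VP _ Vu) -(VP _ Vv).
rewrite (tauE okuv).
have eo w : V w -> ranks (slope_lt a (f w)) = ranks (lex_lt (f y)).
  by move=> Vw; apply: ranks_eq => i j; rewrite -(VP _ Vw) E.
rewrite !eo //; set o := ranks (lex_lt (f y)).
have P w : 0 <= w <= 1 -> H (kappa (ranks (lex_lt (f w))) * perm_braid (ranks (lex_lt (f w))) o * (kappa o)^-1)%g.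
  by move=> w01; apply: cls; rewrite ?lex_perms4 ?fC.
have := HM _ _ (P u u01) (HV _ (P v v01)).
by rewrite !invgM invgK !mulgA mulgVK.
Qed.

Definition last_class (r : seq nat) : bool := all (fun k => rlt r k 3) [:: 0; 1; 2]%N.

(** While label 3 stays rightmost, the permutation braids use the first two generators only. *)
Lemma mconf_last (f : R -> config) : (forall i, continuous (fun s => f s i)) ->
  (forall s, injective (f s)) ->
  (forall s, 0 <= s <= 1 -> forall i : 'I_4, i != ord_max -> (f s i).1 < (f s ord_max).1) ->
  in12 (mconf f).
Proof.
move=> cf fi fl.
have := @mconf_class last_class (fun=> 1%g) in12 f in12_1 in12M in12V.
rewrite mul1g invg1 mulg1; apply=> //.
  move=> r o pr po lr lo; rewrite mul1g mulg1; apply: in12_pos.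
  have /allP /(_ _ pr) /allP /(_ _ po) : all (fun r => all (fun o => if last_class r && last_class o
    then all (fun k => k < 2)%N (perm_word r o) else true) perms4) perms4 by vm_compute.
  by rewrite lr lo.
move=> s s01; apply/allP => k k3; have k4 : (k < 4)%N by move: k3; rewrite !inE; lia.
have -> : rlt (ranks (lex_lt (f s))) k 3 = lex_lt (f s) (Ordinal k4) ord_max by rewrite -rlt_lex.
rewrite /lex_lt fl //; rewrite -val_eqE /=; move: k3; rewrite !inE; lia.
Qed.

Definition last2_class (r : seq nat) : bool := last_class r && all (fun k => rlt r k 2) [:: 0; 1]%N.

Lemma mconf_last2 (f : R -> config) : (forall i, continuous (fun s => f s i)) ->
  (forall s, injective (f s)) ->
  (forall s, 0 <= s <= 1 -> forall i : 'I_4, i != ord_max -> (f s i).1 < (f s ord_max).1) ->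
  (forall s, 0 <= s <= 1 -> forall i : 'I_4, (i < 2)%N -> (f s i).1 < (f s (o4 2)).1) ->
  cabled (mconf f).
Proof.
move=> cf fi fl fl2.
have := @mconf_class last2_class (fun=> 1%g) cabled f cabled1 cabledM cabledV.
rewrite mul1g invg1 mulg1; apply=> //.
  move=> r o pr po lr lo; rewrite mul1g mulg1 -[perm_braid r o]/(pos_braid (perm_word r o)).
  have /allP /(_ _ pr) /allP /(_ _ po) : all (fun r => all (fun o => if last2_class r && last2_class o
    then (perm_word r o == [::]) || (perm_word r o == [:: 0]%N) else true) perms4) perms4 by vm_compute.
  rewrite lr lo => /orP[/eqP ->|/eqP ->]; first exact: cabled1.
  exact: cabled_sig0.
move=> s s01; apply/andP; split; apply/allP => k k3.
  have k4 : (k < 4)%N by move: k3; rewrite !inE; lia.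
  have -> : rlt (ranks (lex_lt (f s))) k 3 = lex_lt (f s) (Ordinal k4) ord_max by rewrite -rlt_lex.
  rewrite /lex_lt fl //; rewrite -val_eqE /=; move: k3; rewrite !inE; lia.
have k4 : (k < 4)%N by move: k3; rewrite !inE; lia.
have -> : rlt (ranks (lex_lt (f s))) k 2 = lex_lt (f s) (Ordinal k4) (o4 2) by rewrite -rlt_lex // /o4 /= inordK.
rewrite /lex_lt fl2 //=; move: k3; rewrite !inE; lia.
Qed.

Definition pair_class (r : seq nat) : bool :=
  rlt r 0 1 && all (fun k => rlt r 0 k == rlt r 1 k) [:: 2; 3]%N.

(* These braids carry an adjacent pair to the two leftmost positions. *)
Definition pair_word (r : seq nat) : seq nat :=
  match nth 0 r 0 with 0 => [::] | 1 => [:: 1; 0] | _ => [:: 1; 0; 2; 1] end%N.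

Definition pair_gauge (r : seq nat) : B4 := pos_braid (pair_word r).

(* Pairs [(u, v)] such that [u^-1 v] rewrites the transition braids between positions of the pair. *)
Definition pair_factors : seq (seq nat * seq (seq nat)) := let t := [:: 1; 0; 0; 1]%N in
  [:: ([::], [::]); ([::], [:: [:: 2]]); ([::], [:: t]); ([::], [:: t; [:: 2]]);
      ([::], [:: t; [:: 2]; t]); ([:: 2], [:: t; [:: 2]]); ([:: 2], [:: t; [:: 2]; t])]%N.

Definition cabled_gens : seq (seq nat) := [:: [::]; [:: 2]; [:: 1; 0; 0; 1]]%N.

Lemma cabled_flatten l : all (mem cabled_gens) l -> cabled (pos_braid (flatten l)).
Proof.
elim: l => [|a l IH] /=; first by move=> _; exact: cabled1.
move=> /andP[ag /IH h]; rewrite pos_braid_cat; apply: cabledM => //.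
move: ag; rewrite !inE => /or3P[] /eqP ->; [exact: cabled1|exact: cabled_sig2|exact: cabled_tau3].
Qed.

Lemma pair_class_cabled r o : r \in perms4 -> o \in perms4 -> pair_class r -> pair_class o ->
  cabled (pair_gauge r * perm_braid r o * (pair_gauge o)^-1)%g.
Proof.
move=> pr po cr co.
have /allP /(_ _ pr) /allP /(_ _ po) : all (fun r => all (fun o => if pair_class r && pair_class o
    then has (fun q => pos_equiv (q.1 ++ pair_word r ++ perm_word r o) (flatten q.2 ++ pair_word o))
      pair_factors else true) perms4) perms4 by vm_compute.
rewrite cr co => /hasP[[a b] ab /pos_relation]; rewrite !pos_braid_cat /= => E.
have -> : (pair_gauge r * perm_braid r o * (pair_gauge o)^-1 =
    (pos_braid a)^-1 * pos_braid (flatten b))%g.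
  apply: (mulgI (pos_braid a)); apply: (mulIg (pair_gauge o)).
  by rewrite mulVKg -[RHS]E -!mulgA mulVg mulg1.
have /allP /(_ _ ab) /andP[/= ha hb] : all (fun q => all (mem cabled_gens) [:: q.1] &&
    all (mem cabled_gens) q.2) pair_factors by vm_compute.
apply: cabledM; last exact: cabled_flatten.
by apply: cabledV; rewrite -[a]cats0 -[a ++ _]/(flatten [:: a]); exact: cabled_flatten.
Qed.

Lemma pair_class_lex (z : config) e : injective z -> 0 < e ->
  z (o4 0) = ((z (o4 1)).1, (z (o4 1)).2 + e) ->
  (forall i : 'I_4, (1 < i)%N -> ~ ((z i).1 = (z (o4 1)).1 /\ (z (o4 1)).2 <= (z i).2 <= (z (o4 1)).2 + e)) ->
  pair_class (ranks (lex_lt z)).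
Proof.
move=> zi e0 z0 zk.
have rl (i j : nat) (i4 : (i < 4)%N) (j4 : (j < 4)%N) :
    rlt (ranks (lex_lt z)) i j = lex_lt z (o4 i) (o4 j) by rewrite -rlt_lex // /o4 /= !inordK.
apply/andP; split; first by rewrite rl // /lex_lt z0 /= eqxx ltxx ltrDl e0.
apply/allP => k k23; have k4 : (k < 4)%N by move: k23; rewrite !inE; lia.
have k1 : (1 < o4 k)%N by rewrite /o4 /= inordK //; move: k23; rewrite !inE; lia.
rewrite !rl // /lex_lt z0 /=; have := zk _ k1.
case: (ltrgtP (z (o4 1)).1 (z (o4 k)).1) => //= h nb; apply/eqP; apply/idP/idP => h'.
  by rewrite ltNge; apply/negP => h2; apply: nb; split=> //; rewrite h2 /=; lra.
by lra.
Qed.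

Lemma mconf_pair (f : R -> config) e : (forall i, continuous (fun s => f s i)) ->
  (forall s, injective (f s)) -> 0 < e ->
  (forall s, 0 <= s <= 1 -> f s (o4 0) = ((f s (o4 1)).1, (f s (o4 1)).2 + e)) ->
  (forall s, 0 <= s <= 1 -> forall i : 'I_4, (1 < i)%N ->
     ~ ((f s i).1 = (f s (o4 1)).1 /\ (f s (o4 1)).2 <= (f s i).2 <= (f s (o4 1)).2 + e)) ->
  cabled (pair_gauge (ranks (lex_lt (f 0%R))) * mconf f * (pair_gauge (ranks (lex_lt (f 1%R))))^-1)%g.
Proof.
move=> cf fi e0 f0 fk; apply: (mconf_class (Cl := pair_class) cabled1 cabledM cabledV) => //.
  exact: pair_class_cabled.
by move=> s s01; apply: (pair_class_lex (e := e)); [|  |exact: f0|exact: fk].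
Qed.

Definition triple_class (r : seq nat) : bool :=
  [&& rlt r 0 1, rlt r 1 2, rlt r 0 3 == rlt r 1 3 & rlt r 0 3 == rlt r 2 3]%N.

(** Carries the fourth label from the right of the cluster, its reference position, to the left. *)
Definition triple_gauge (r : seq nat) : B4 := if rlt r 0 3 then 1%g else pos_braid [:: 2; 1; 0]%N.

Definition around_pow (g : B4) : Prop := exists k, g = zexp around k.

Lemma around_pow1 : around_pow 1%g. Proof. by exists 0. Qed.

Lemma around_powM a b : around_pow a -> around_pow b -> around_pow (a * b)%g.
Proof. by move=> [k ->] [m ->]; exists (k + m); rewrite zexpM. Qed.

Lemma around_powV a : around_pow a -> around_pow a^-1%g.
Proof.
move=> [k ->]; exists (- k); apply: (mulgI (zexp around k)).
by rewrite mulgV zexpM addrN.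
Qed.

(** In this gauge a passage of the fourth point to the left costs nothing, and a passage back is one
    full turn around the cluster. *)
Lemma triple_class_around r o : r \in perms4 -> o \in perms4 -> triple_class r -> triple_class o ->
  around_pow (triple_gauge r * perm_braid r o * (triple_gauge o)^-1)%g.
Proof.
move=> pr po cr co; rewrite -[perm_braid r o]/(pos_braid (perm_word r o)) /triple_gauge.
have /allP /(_ _ pr) /allP /(_ _ po) : all (fun r => all (fun o => if triple_class r && triple_class o
    then perm_word r o == (if rlt r 0 3 then if rlt o 0 3 then [::] else [:: 2; 1; 0]
       else if rlt o 0 3 then [:: 0; 1; 2] else [::]) else true) perms4) perms4 by vm_compute.
rewrite cr co => /eqP ->; case: (rlt r 0 3); case: (rlt o 0 3).
- by rewrite mulg1 invg1 mulg1; exact: around_pow1.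
- by rewrite mul1g mulgV; exact: around_pow1.
- by rewrite invg1 mulg1 -pos_braid_cat; exists 1; rewrite /= expg1.
- by rewrite mulg1 mulgV; exact: around_pow1.
Qed.

Lemma triple_class_lex (z : config) : injective z -> (z (o4 0)).1 = (z (o4 2)).1 ->
  (z (o4 1)).1 = (z (o4 2)).1 -> (z (o4 2)).2 < (z (o4 1)).2 -> (z (o4 1)).2 < (z (o4 0)).2 ->
  ~ ((z (o4 3)).1 = (z (o4 2)).1 /\ (z (o4 2)).2 <= (z (o4 3)).2 <= (z (o4 0)).2) ->
  triple_class (ranks (lex_lt z)).
Proof.
move=> zi x0 x1 y21 y10 n3.
have rl (i j : nat) (i4 : (i < 4)%N) (j4 : (j < 4)%N) :
    rlt (ranks (lex_lt z)) i j = lex_lt z (o4 i) (o4 j) by rewrite -rlt_lex // /o4 /= !inordK.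
rewrite /triple_class !rl // /lex_lt x0 x1 !eqxx !ltxx y21 y10 /=.
case: (ltrgtP (z (o4 2)).1 (z (o4 3)).1) => //= h; move: n3; rewrite -h => n3.
have [h1|h1] := ltP (z (o4 3)).2 (z (o4 0)).2; have [h2|h2] := ltP (z (o4 3)).2 (z (o4 1)).2;
  have [h3|h3] := ltP (z (o4 3)).2 (z (o4 2)).2 => //=; try lra; exfalso; apply: n3; split=> //; lra.
Qed.

Lemma mconf_triple (f : R -> config) : (forall i, continuous (fun s => f s i)) ->
  (forall s, injective (f s)) ->
  (forall s, 0 <= s <= 1 -> [/\ (f s (o4 0)).1 = (f s (o4 2)).1, (f s (o4 1)).1 = (f s (o4 2)).1,
    (f s (o4 2)).2 < (f s (o4 1)).2 & (f s (o4 1)).2 < (f s (o4 0)).2]) ->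
  (forall s, 0 <= s <= 1 ->
  ~ ((f s (o4 3)).1 = (f s (o4 2)).1 /\ (f s (o4 2)).2 <= (f s (o4 3)).2 <= (f s (o4 0)).2)) ->
  around_pow (triple_gauge (ranks (lex_lt (f 0%R))) * mconf f * (triple_gauge (ranks (lex_lt (f 1%R))))^-1)%g.
Proof.
move=> cf fi f0 fk; apply: (mconf_class (Cl := triple_class) around_pow1 around_powM around_powV) => //.
  exact: triple_class_around.
by move=> s s01; have [? ? ? ?] := f0 s s01; apply: triple_class_lex => //; exact: fk.
Qed.

End OrderClasses.

(** * Paths in open subsets of the plane *)

Section Joined.
Variable R : realType.
Local Notation plane := (R * R)%type.
Implicit Types (V : set plane) (x y z : plane).

Definition joined V x y : Prop := exists g : R -> plane,
  [/\ continuous g, g 0 = x, g 1 = y & forall s, V (g s)].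

Lemma continuous_coords (Y : topologicalType) (f g : Y -> R) :
  continuous f -> continuous g -> continuous (fun u => (f u, g u) : plane).
Proof. exact: continuous_pair. Qed.

Lemma joined_in V x y : joined V x y -> V x /\ V y.
Proof. by case=> g [_ <- <- Vg]. Qed.

Lemma joined_sub V V' x y : V `<=` V' -> joined V x y -> joined V' x y.
Proof. by move=> VV' [g [cg g0 g1 Vg]]; exists g; split=> // s; exact: VV'. Qed.

Lemma joined_refl V x : V x -> joined V x x.
Proof. by move=> Vx; exists (fun=> x); split=> // s; exact: cvg_cst. Qed.

Lemma joined_sym V x y : joined V x y -> joined V y x.
Proof.
move=> [g [cg g0 g1 Vg]]; exists (fun s => g (1 - s)).
have c1 : continuous (fun s : R => 1 - s) by apply: contB; [exact: contC|move=> s; exact: cvg_id].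
by split=> //; [exact: (continuous_compf c1 cg)|rewrite subr0|rewrite subrr].
Qed.

Lemma joined_trans V y x z : joined V x y -> joined V y z -> joined V x z.
Proof.
move=> [g [cg g0 g1 Vg]] [k [ck k0 k1 Vk]].
have c2 : continuous (fun s : R => clamp 1 (2 * s)).
  by apply: cont1; [exact: clamp_continuous|apply: contM; [exact: contC|move=> s; exact: cvg_id]].
have c3 : continuous (fun s : R => clamp 1 (2 * s - 1)).
  apply: cont1; [exact: clamp_continuous|apply: contB; last exact: contC].
  by apply: contM; [exact: contC|move=> s; exact: cvg_id].
have cg2 := continuous_compf c2 cg; have ck3 := continuous_compf c3 ck.
have cl0 (s : R) : s <= 0 -> clamp 1 s = 0.
  by move=> s0; rewrite /clamp; apply/max_idPl; rewrite ge_min s0 orbT.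
have cl1 (s : R) : 1 <= s -> clamp 1 s = 1.
  by move=> s1; rewrite /clamp (min_idPl s1); apply/max_idPr.
(* At every time one of the two paths rests at [y], so their sum minus [y] is the concatenation,
   visibly continuous. *)
pose m (s : R) : plane := ((g (clamp 1 (2 * s))).1 + (k (clamp 1 (2 * s - 1))).1 - y.1,
  (g (clamp 1 (2 * s))).2 + (k (clamp 1 (2 * s - 1))).2 - y.2).
have mE s : m s = if s <= 1 / 2 then g (clamp 1 (2 * s)) else k (clamp 1 (2 * s - 1)).
  rewrite /m; case: (lerP s (1 / 2)) => h.
    by rewrite (cl0 (2 * s - 1)) ?k0; [rewrite !addrK; case: (g _) | lra].
  rewrite (cl1 (2 * s)) ?g1; last lra.
  by case: (k _) => a b /=; congr pair; ring.
exists m; split.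
- apply: continuous_coords; (apply: contB; last exact: contC); apply: contD.
  + exact: (continuous_fst cg2).
  + exact: (continuous_fst ck3).
  + exact: (continuous_snd cg2).
  + exact: (continuous_snd ck3).
- rewrite mE ifT; last by lra.
  by rewrite cl0 ?mulr0 // g0.
- rewrite mE ifF; last by apply/negbTE; rewrite -ltNge; lra.
  by rewrite cl1 ?k1 //; lra.
- by move=> s; rewrite mE; case: ifP.
Qed.

Definition between (x y : plane) (t : R) : plane := (x.1 + t * (y.1 - x.1), x.2 + t * (y.2 - x.2)).

Lemma joined_segment V x y : (forall t, 0 <= t <= 1 -> V (between x y t)) -> joined V x y.
Proof.
move=> H; exists (fun s => between x y (clamp 1 s)).
have c2 : continuous (fun s : R => clamp 1 s) by exact: clamp_continuous.
split.
- apply: continuous_coords; apply: contD; first exact: contC.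
    by apply: contM; [exact: c2|exact: contC].
  exact: contC.
  by apply: contM; [exact: c2|exact: contC].
- by rewrite clamp_id ?lexx ?ler01 // /between !mul0r !addr0; case: (x).
- rewrite clamp_id ?lexx ?ler01 // /between !mul1r; case: (y) => a b /=; congr pair; ring.
- by move=> s; apply: H; exact: clampP.
Qed.

Definition box (z : plane) (e : R) : set plane := [set w | `|w.1 - z.1| < e /\ `|w.2 - z.2| < e].

Lemma box_nbhs z e : 0 < e -> nbhs z (box z e).
Proof.
move=> e0; have := @continuous_proj1 R R z; have := @continuous_proj2 R R z.
move=> /cvgrPdist_lt /(_ e e0) h2 /cvgrPdist_lt /(_ e e0) h1.
by apply: filterS2 h1 h2 => w /=; rewrite !(distrC z.1, distrC z.2).
Qed.

Lemma nbhs_box z V : nbhs z V -> exists2 e, 0 < e & box z e `<=` V.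
Proof.
move=> [[A B]] /= [/nbhs_ballP[e /= e0 eA] /nbhs_ballP[d /= d0 dB]] AB.
exists (Num.min e d); first by rewrite lt_min e0.
move=> w [] ; rewrite !lt_min => /andP[h1 _] /andP[_ h2]; apply: AB; split.
  by apply: eA; rewrite /ball /= distrC.
by apply: dB; rewrite /ball /= distrC.
Qed.

Lemma mid_gt (c a b t : R) : c < a -> c < b -> 0 <= t <= 1 -> c < a + t * (b - a).
Proof.
move=> ca cb /andP[t0 t1]; have [ab|ab] := lerP a b.
  have : 0 <= t * (b - a) by rewrite mulr_ge0 // subr_ge0.
  by lra.
have : b - a <= t * (b - a) by rewrite ler_niMl // subr_le0 ltW.
by lra.
Qed.

Lemma mid_lt (c a b t : R) : a < c -> b < c -> 0 <= t <= 1 -> a + t * (b - a) < c.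
Proof.
move=> ca cb t01; have := @mid_gt (- c) (- a) (- b) t; rewrite !ltrN2 => /(_ ca cb t01).
have -> : - a + t * (- b - - a) = - (a + t * (b - a)) by ring.
by rewrite ltrN2.
Qed.

Lemma box_convex z e x y t : box z e x -> box z e y -> 0 <= t <= 1 -> box z e (between x y t).
Proof.
have conv (a b c : R) : `|a - c| < e -> `|b - c| < e -> 0 <= t <= 1 -> `|a + t * (b - a) - c| < e.
  rewrite !ltr_norml => /andP[a1 a2] /andP[b1 b2] t01; apply/andP; split.
    by have := @mid_gt (c - e) a b t; rewrite t01 => h; lra.
  by have := @mid_lt (c + e) a b t; rewrite t01 => h; lra.
by move=> [x1 x2] [y1 y2] t01; split; apply: conv.
Qed.

Lemma joined_near V x y : open V -> V y -> exists2 B, nbhs y B &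
  B `<=` V /\ forall z z', B z -> B z' -> joined V z z'.
Proof.
move=> oV Vy; have [e e0 eV] := nbhs_box (open_nbhs_nbhs (conj oV Vy)).
exists (box y e); first exact: box_nbhs.
split=> // z z' Bz Bz'; apply: joined_segment => t t01; apply: eV; exact: box_convex.
Qed.

(** Every point is led to [ne] through half-boxes that miss [z], with a detour by [nw] or [se] where
    one half-box is not enough. *)
Lemma punctured_box z e x y : box z e x -> box z e y -> x <> z -> y <> z ->
  joined (box z e `\ z) x y.
Proof.
move=> Bx By xz yz.
have e0 : 0 < e by case: Bx => h _; exact: le_lt_trans (normr_ge0 _) h.
pose ne : plane := (z.1 + e / 2, z.2 + e / 2).
suff H w : box z e w -> w <> z -> joined (box z e `\ z) w ne.
  by apply: joined_trans (H x Bx xz) _; apply: joined_sym; exact: H.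
have cb (a b : R) : `|a| < e -> `|b| < e -> box z e (z.1 + a, z.2 + b).
  by move=> ha hb; split => /=; rewrite [_ + _ - _]addrC addKr.
have h2 : `|e / 2| < e by rewrite gtr0_norm; lra.
have h2n : `|- (e / 2)| < e by rewrite normrN.
have nez : box z e ne by exact: cb.
pose nw : plane := (z.1 - e / 2, z.2 + e / 2).
pose se : plane := (z.1 + e / 2, z.2 - e / 2).
have nwz : box z e nw by exact: cb.
have sez : box z e se by exact: cb.
have seg a b : box z e a -> box z e b -> (forall t, 0 <= t <= 1 -> between a b t <> z) ->
    joined (box z e `\ z) a b.
  move=> Ba Bb ab; apply: joined_segment => t t01; split; first exact: box_convex.
  exact: ab.
have right a b : box z e a -> box z e b -> z.1 < a.1 -> z.1 < b.1 -> joined (box z e `\ z) a b.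
  move=> Ba Bb ha hb; apply: seg => // t t01; rewrite /between => /(congr1 fst) /= E; by have := mid_gt ha hb t01; rewrite E ltxx.
have left a b : box z e a -> box z e b -> a.1 < z.1 -> b.1 < z.1 -> joined (box z e `\ z) a b.
  move=> Ba Bb ha hb; apply: seg => // t t01; rewrite /between => /(congr1 fst) /= E; by have := mid_lt ha hb t01; rewrite E ltxx.
have up a b : box z e a -> box z e b -> z.2 < a.2 -> z.2 < b.2 -> joined (box z e `\ z) a b.
  move=> Ba Bb ha hb; apply: seg => // t t01; rewrite /between => /(congr1 snd) /= E; by have := mid_gt ha hb t01; rewrite E ltxx.
have down a b : box z e a -> box z e b -> a.2 < z.2 -> b.2 < z.2 -> joined (box z e `\ z) a b.
  move=> Ba Bb ha hb; apply: seg => // t t01; rewrite /between => /(congr1 snd) /= E; by have := mid_lt ha hb t01; rewrite E ltxx.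
move=> Bw wz; case: (ltrgtP w.1 z.1) => h1.
- apply: (@joined_trans _ nw); first by apply: left; rewrite //= ; lra.
  by apply: up; rewrite //=; lra.
- by apply: right; rewrite //=; lra.
case: (ltrgtP w.2 z.2) => h3.
- apply: (@joined_trans _ se); first by apply: down; rewrite //=; lra.
  by apply: right; rewrite //=; lra.
- by apply: up; rewrite //=; lra.
- by exfalso; apply: wz; case: (w) (z) h1 h3 => ? ? [? ?] /= -> ->.
Qed.

(** The invariant [P] follows the path; while the path sits at [z], it records instead that the
    whole punctured box around [z] can be reached. *)
Lemma joined_remove V x y z : open V -> joined V x y -> x <> z -> y <> z -> joined (V `\ z) x y.
Proof.
move=> oV Jxy xz yz; have [Vz|nVz] := pselect (V z); last first.
  by apply: joined_sub Jxy => w Vw; split=> // wz; apply: nVz; rewrite -wz.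
have [e e0 eV] := nbhs_box (open_nbhs_nbhs (conj oV Vz)).
have oW : open (V `\ z).
  rewrite setDE; apply: openI => //; apply: closed_openC; apply: accessible_closed_set1.
  exact: (hausdorff_accessible (@norm_hausdorff R plane)).
have [g [cg g0 g1 Vg]] := Jxy.
pose W := V `\ z.
have BW w w' : box z e w -> box z e w' -> w <> z -> w' <> z -> joined W w w'.
  move=> Bw Bw' wz wz'; apply: joined_sub (punctured_box Bw Bw' wz wz') => v [Bv vz].
  by split=> //; exact: eV.
pose P s := joined W x (g s) \/ (g s = z /\ forall w, box z e w -> w <> z -> joined W x w).
have : P 0 -> P 1.
  apply: (@real_induct R P) => s; have [gz|gz] := pselect (g s = z).
    exists (g @^-1` box z e); first by apply: cg; rewrite gz; exact: box_nbhs.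
    move=> a b /= Ba Bb Pa.
    have all w : box z e w -> w <> z -> joined W x w.
      case: Pa => [Ja|[_ h]] Bw wz; last exact: h.
      have [_ [_ gaz]] := joined_in Ja.
      by apply: joined_trans Ja _; exact: BW.
    have [gb|gb] := pselect (g b = z); first by right.
    by left; exact: all.
  have [B nB [BV BJ]] := joined_near x oW (conj (Vg s) gz : (V `\ z) (g s)).
  exists (g @^-1` B); first exact: cg.
  move=> a b /= Ba Bb [Ja|[az _]]; last by have [_ []] := BV _ Ba.
  by left; apply: joined_trans Ja _; exact: BJ.
case; first by left; rewrite g0; apply: joined_refl; split=> //; have [] := joined_in Jxy.
  by rewrite g1.
by rewrite g1 => -[].
Qed.

Lemma joined_component V x y : joined V x y -> connected_component V x y.
Proof.
move=> [g [cg <- <- Vg]].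
have cI : connected (g @` `[0, 1]).
  apply: connected_continuous_connected; first exact: segment_connected.
  exact: continuous_subspaceT.
apply: (connected_component_max (B := g @` `[0, 1])) => //.
- by exists 0 => //; rewrite /= in_itv /= lexx ler01.
- by move=> _ [s _ <-]; exact: Vg.
- by exists 1 => //; rewrite /= in_itv /= lexx ler01.
Qed.

Lemma component_joined V x y : open V -> connected_component V x y -> joined V x y.
Proof.
move=> oV [C [Cx CV Cc] Cy].
have JVy z : V z -> exists2 B, nbhs z B & B `<=` V /\ forall w w', B w -> B w' -> joined V w w'.
  exact: joined_near.
suff E : C `&` [set z | joined V x z] = C by move: Cy; rewrite -E => -[].
apply: Cc.
- by exists x; split=> //; apply: joined_refl; exact: CV.
- exists [set z | joined V x z] => //; rewrite openE => z /= Jz.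
  have [B nB [BV BJ]] := JVy z (joined_in Jz).2.
  apply: filterS (nB) => w Bw /=; apply: joined_trans Jz _; apply: BJ => //.
  by apply: nbhs_singleton; apply: filterS nB.
- exists (~` [set z | V z /\ ~ joined V x z]); last first.
    apply/seteqP; split=> z /= [Cz Jz]; split=> //; first by case.
    by apply: contrapT => nJ; apply: Jz; split=> //; exact: CV.
  apply: open_closedC; rewrite openE => z /= [Vz nJ].
  have [B nB [BV BJ]] := JVy z Vz; apply: filterS (nB) => w Bw; split; first exact: BV.
  move=> Jw; apply: nJ; apply: joined_trans Jw _; apply: BJ => //.
  by apply: nbhs_singleton; apply: filterS nB.
Qed.

End Joined.

(** * Points inside and outside a loop *)

Section Outside.
Variable R : realType.
Local Notation plane := (R * R)%type.
Implicit Types (c V : set plane) (x y z : plane).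

(** Stands for infinity. The bound 50 used later lies between the disk and this point. *)
Definition far : plane := (100, 0).

Definition outside c y : Prop := joined (~` c) far y.

(** The properties of a simple closed curve used for separation. A point counts as inside when it is
    not [outside], so the curve itself is inside. *)
Definition loop_like c : Prop :=
  [/\ closed c, c `<=` @disk R & forall u v, c u -> c v -> joined c u v].

Lemma closed_loop_like c : simple_closed_curve c -> c `<=` @disk R -> loop_like c.
Proof.
move=> [g [cg g01 _ ->]] cd; split=> //.
  have : compact (g @` `[0, 1]) by apply: continuous_compact => //; exact: segment_compact.
  by apply: compact_closed; exact: (@norm_hausdorff R plane).
move=> _ _ [a a01 <-] [b b01 <-]; move: a01 b01; rewrite /= !in_itv /= => a01 b01.
pose u (s : R) := a + clamp 1 s * (b - a).
have u01 s : `[0, 1]%classic (u s).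
  have := @clampP R 1 s ler01; move: a01 b01 => /andP[a0 a1] /andP[b0 b1] cs.
  rewrite /= in_itv /= /u; apply/andP; split.
    case: (ltrgtP 0 a) a0 => // [a0|<-] _; last by rewrite add0r subr0 mulr_ge0 //; case/andP: cs.
    have /andP[c0 c1] := cs; have : 0 <= (1 - clamp 1 s) * a + clamp 1 s * b.
      by rewrite addr_ge0 // mulr_ge0 //; lra.
    have -> : (1 - clamp 1 s) * a + clamp 1 s * b = a + clamp 1 s * (b - a) by ring.
    by [].
  have /andP[c0 c1] := cs; have : 0 <= (1 - clamp 1 s) * (1 - a) + clamp 1 s * (1 - b).
    by rewrite addr_ge0 // mulr_ge0 //; lra.
  have -> : (1 - clamp 1 s) * (1 - a) + clamp 1 s * (1 - b) = 1 - (a + clamp 1 s * (b - a)) by ring.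
  by rewrite subr_ge0.
have cu : continuous u.
  apply: contD; first exact: contC.
  by apply: contM; [exact: clamp_continuous|exact: contC].
exists (fun s => g (u s)); split.
- exact: (continuous_within_comp cg cu u01).
- by rewrite /u clamp_id ?lexx ?ler01 // mul0r addr0.
- by rewrite /u clamp_id ?lexx ?ler01 // mul1r addrC subrK.
- by move=> s; exists (u s).
Qed.

Lemma disk_bounds z : disk z -> [/\ 0 <= z.1, z.1 <= 5, - (5 / 2) <= z.2 & z.2 <= 5 / 2].
Proof.
rewrite /disk /= => h.
have h1 : (z.1 - 5 / 2) ^+ 2 <= (5 / 2) ^+ 2 by apply: le_trans h; rewrite lerDl sqr_ge0.
have h2 : z.2 ^+ 2 <= (5 / 2) ^+ 2 by apply: le_trans h; rewrite lerDr sqr_ge0.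
have p : 0 <= 5 / 2 :> R by lra.
move: h1 h2; rewrite -!(ler_sqrt (_ ^+ 2)) ?sqr_ge0 // !sqrtr_sqr (ger0_norm p) !ler_norml.
by move=> /andP[? ?] /andP[? ?]; split; lra.
Qed.

Lemma far_outside c y : c `<=` @disk R -> (5 < y.1) || (10 < `|y.1|) || (10 < `|y.2|) -> outside c y.
Proof.
move=> cd; have right (a b : plane) : 5 < a.1 -> 5 < b.1 -> joined (~` c) a b.
  move=> ha hb; apply: joined_segment => t t01 /cd/disk_bounds[_ + _ _].
  by rewrite /= leNgt mid_gt.
have left (a b : plane) : a.1 < 0 -> b.1 < 0 -> joined (~` c) a b.
  move=> ha hb; apply: joined_segment => t t01 /cd/disk_bounds[+ _ _ _].
  by rewrite /= leNgt mid_lt.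
have up (a b : plane) : 3 < a.2 -> 3 < b.2 -> joined (~` c) a b.
  move=> ha hb; apply: joined_segment => t t01 /cd/disk_bounds[_ _ _ +].
  by have := mid_gt ha hb t01; rewrite /=; lra.
have down (a b : plane) : a.2 < -3 -> b.2 < -3 -> joined (~` c) a b.
  move=> ha hb; apply: joined_segment => t t01 /cd/disk_bounds[_ _ + _].
  by have := mid_lt ha hb t01; rewrite /=; lra.
have L : joined (~` c) far ((-20, 20) : plane).
  by apply: (@joined_trans R _ ((100, 20) : plane)); [apply: right|apply: up]; rewrite /far /=; lra.
case/orP => [/orP[h|]|].
- by apply: right; rewrite /far //=; lra.
- case: (ger0P y.1) => h0 h; first by apply: right; rewrite /far /=; lra.
  by apply: joined_trans L _; apply: left; rewrite /far /=; lra.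
- case: (ger0P y.2) => h0 h.
    by apply: (@joined_trans R _ ((100, 20) : plane)); [apply: right|apply: up]; rewrite /far /=; lra.
  by apply: (@joined_trans R _ ((100, -20) : plane)); [apply: right|apply: down]; rewrite /far /=; lra.
Qed.

Lemma far_far c : c `<=` @disk R -> outside c far.
Proof.
move=> cd; apply: (far_outside cd); rewrite /far /=; apply/orP; left; apply/orP; left; lra.
Qed.

(** Points at a large distance are joined to [far] off [c], so an unbounded component must be that
    of [far]. *)
Lemma enclosesP c p : loop_like c -> ~ c p -> (encloses c p <-> ~ outside c p).
Proof.
move=> [cc cd _] cp; have oc : open (~` c) by exact: closed_openC.
split=> [[_ bc] op|no].
  have [M M0 MP] := pinfty_ex_gt0 bc.
  pose y : plane := (M + 6, 0).
  have : connected_component (~` c) p y.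
    apply: joined_component; apply: joined_trans (joined_sym op) _.
    by apply: far_outside => //; apply/orP; left; apply/orP; left; rewrite /=; lra.
  move=> /MP /=; rewrite prod_normE /= ge_max => /andP[+ _].
  by rewrite ger0_norm; lra.
split=> //; exists 10; split; first by rewrite num_real.
move=> M M10 y /(component_joined oc) Jy.
rewrite /= prod_normE /= ge_max; apply: contrapT => /negP nb; apply: no.
apply: joined_trans (joined_sym Jy); apply: far_outside => //.
move: nb; rewrite negb_and -!ltNge => /orP[h|h]; rewrite (lt_trans M10 h) ?orbT //.
Qed.

Lemma outside_open c y : closed c -> outside c y -> exists2 B, nbhs y B &
  forall z, B z -> outside c z.
Proof.
move=> cc oy; have oc : open (~` c) by exact: closed_openC.
have [B nB [BV BJ]] := joined_near y oc (joined_in oy).2.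
exists B => // z Bz; apply: joined_trans oy _; apply: BJ => //; exact: nbhs_singleton.
Qed.

Lemma outside_near c y : closed c -> ~ c y -> exists2 B, nbhs y B &
  forall z z', B z -> B z' -> outside c z -> outside c z'.
Proof.
move=> cc ny; have oc : open (~` c) by exact: closed_openC.
have [B nB [BV BJ]] := joined_near y oc ny.
exists B => // z z' Bz Bz' oz; apply: joined_trans oz _; exact: BJ.
Qed.

(** A path from [far] that met [c] would, stopped there, show that a point of [c] is outside
    [c']. *)
Lemma inside_le c c' y : loop_like c -> (forall u, c u -> ~ outside c' u) ->
  outside c' y -> outside c y.
Proof.
move=> _ H [g [cg g0 g1 gc]]; exists g; split=> // s cs.
apply: H cs _; have c2 : continuous (fun t : R => clamp 1 t * s).
  by apply: contM; [exact: clamp_continuous|exact: contC].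
exists (fun t => g (clamp 1 t * s)); split=> //.
- exact: (continuous_compf c2 cg).
- by rewrite clamp_id ?lexx ?ler01 // mul0r.
- by rewrite clamp_id ?lexx ?ler01 // mul1r.
Qed.

(* Along a path from p to infinity, the first of the two curves met separates p from infinity,
   although it is connected to infinity in the complement of the other curve. *)
Lemma nested c c' p : loop_like c -> loop_like c' -> c = c' \/ c `&` c' = set0 ->
  ~ outside c p -> ~ outside c' p ->
  (forall y, outside c' y -> outside c y) \/ (forall y, outside c y -> outside c' y).
Proof.
move=> Lc Lc' E np np'; have [cc cd cJ] := Lc; have [cc' cd' cJ'] := Lc'.
case: E => [->|dis]; first by left.
have [H|H] := pselect (forall u, c u -> ~ outside c' u); first by left=> y; exact: inside_le.
have [H'|H'] := pselect (forall u, c' u -> ~ outside c u); first by right=> y; exact: inside_le.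
have nn u : c u -> c' u -> False by move=> ? ?; have : (c `&` c') u by []; rewrite dis.
have {}H u : c u -> outside c' u.
  move=> cu; apply: contrapT => nu; apply: H => v cv ov; apply: nu.
  apply: joined_trans ov _; apply: joined_sub (cJ _ _ cv cu) => w cw c'w; exact: nn c'w.
have {}H' u : c' u -> outside c u.
  move=> cu; apply: contrapT => nu; apply: H' => v cv ov; apply: nu.
  apply: joined_trans ov _; apply: joined_sub (cJ' _ _ cv cu) => w cw c'w; exact: nn cw.
exfalso; pose g s := between p far (clamp 1 s).
have cg : continuous g.
  by apply: continuous_coords; apply: contD; try exact: contC; apply: contM;
    try exact: contC; exact: clamp_continuous.
pose P s := ~ outside c (g s) /\ ~ outside c' (g s).
have : P 0 -> P 1.
  apply: (@real_induct R P) => s; have [cs|ncs] := pselect (c (g s)).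
    have [B nB BP] := outside_open cc' (H _ cs); exists (g @^-1` B); first exact: cg.
    by move=> a b /= Ba _ [_ no]; case: no; exact: BP.
  have [cs'|ncs'] := pselect (c' (g s)).
    have [B nB BP] := outside_open cc (H' _ cs'); exists (g @^-1` B); first exact: cg.
    by move=> a b /= Ba _ [no _]; case: no; exact: BP.
  have [B nB BP] := outside_near cc ncs; have [B' nB' BP'] := outside_near cc' ncs'.
  exists (g @^-1` (B `&` B')); first by apply: cg; exact: filterI.
  move=> a b /= [Ba Ba'] [Bb Bb'] [h h'].
  by split=> o; [apply: h; exact: (BP _ _ Bb Ba o)|apply: h'; exact: (BP' _ _ Bb' Ba' o)].
have g0 : g 0 = p by rewrite /g clamp_id ?lexx ?ler01 // /between !mul0r !addr0; case: (p).
have g1 : g 1 = far.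
  by rewrite /g clamp_id ?lexx ?ler01 // /between !mul1r /far /=; congr pair; ring.
rewrite /P g0 g1 => -[//|_ no]; exact: (no (far_far cd')).
Qed.

(** On the straight path to [far], as long as [c] is not met, the points stay inside and hence in
    [V]. *)
Lemma inside_joined_curve c V y : loop_like c -> open V -> (forall z, ~ outside c z -> V z) ->
  ~ outside c y -> exists2 u, c u & joined V y u.
Proof.
move=> [cc cd cJ] oV cV ny; apply: contrapT => nu.
pose g s := between y far (clamp 1 s).
have cg : continuous g.
  by apply: continuous_coords; apply: contD; try exact: contC; apply: contM;
    try exact: contC; exact: clamp_continuous.
pose P s := ~ outside c (g s) /\ joined V y (g s).
have cno z : c z -> ~ outside c z by move=> cz oz; have [_ nz] := joined_in oz; exact: nz.
have : P 0 -> P 1.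
  apply: (@real_induct R P) => s; have [cs|ncs] := pselect (c (g s)).
    have [B nB [BV BJ]] := joined_near y oV (cV _ (cno _ cs)).
    exists (g @^-1` B); first exact: cg.
    move=> a b /= Ba _ [_ Ja]; exfalso; apply: nu; exists (g s) => //.
    apply: joined_trans Ja _; apply: BJ => //; exact: nbhs_singleton.
  have [os|os] := pselect (outside c (g s)).
    have [B nB BP] := outside_open cc os; exists (g @^-1` B); first exact: cg.
    by move=> a b /= Ba _ [no _]; case: no; exact: BP.
  have [B nB BP] := outside_near cc ncs; have [B' nB' [BV' BJ']] := joined_near y oV (cV _ os).
  exists (g @^-1` (B `&` B')); first by apply: cg; exact: filterI.
  move=> a b /= [Ba Ba'] [Bb Bb'] [h h']; split; first by move=> o; apply: h; exact: (BP _ _ Bb Ba o).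
  by apply: joined_trans h' _; exact: BJ'.
have g0 : g 0 = y by rewrite /g clamp_id ?lexx ?ler01 // /between !mul0r !addr0; case: (y).
have g1 : g 1 = far.
  by rewrite /g clamp_id ?lexx ?ler01 // /between !mul1r /far /=; congr pair; ring.
rewrite /P g0 g1 => -[|no _]; first by split=> //; apply: joined_refl; exact: cV.
exact: (no (far_far cd)).
Qed.

Lemma inside_joined c V x y : loop_like c -> open V -> (forall z, ~ outside c z -> V z) ->
  ~ outside c x -> ~ outside c y -> joined V x y.
Proof.
move=> Lc oV cV nx ny; have [u cu Ju] := inside_joined_curve Lc oV cV nx.
have [v cv Jv] := inside_joined_curve Lc oV cV ny; have [_ _ cJ] := Lc.
apply: joined_trans Ju _; apply: joined_trans (joined_sym Jv).
by apply: joined_sub (cJ _ _ cu cv) => z cz; apply: cV => oz; have [_ nz] := joined_in oz; exact: nz.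
Qed.

Lemma outside_image (h : plane -> plane) (Q : set plane) c y :
  mod_homeo (~` @open_disk R) Q h -> outside c y <-> outside (h @` c) (h y).
Proof.
move=> [ch [g [cg hK gK]] hF _].
have hfar : h far = far by apply: hF; rewrite /open_disk /far /=; apply/negP; rewrite -leNgt; nra.
split=> -[k [ck k0 k1 kc]].
  exists (fun s => h (k s)); split; rewrite ?k0 ?k1 //; first exact: (continuous_compf ck ch).
  by move=> s [z cz /(can_inj hK) e]; apply: (kc s); rewrite -e.
exists (fun s => g (k s)); split; rewrite ?k0 ?k1 ?hK //; first exact: (continuous_compf ck cg).
  by rewrite -[in LHS]hfar hK.
by move=> s cs; apply: (kc s); exists (g (k s)).
Qed.

End Outside.

Section FourPoints.
Variable R : realType.
Local Notation plane := (R * R)%type.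
Local Notation config := ('I_4 -> plane).

Definition cfg (a b c d : plane) : config := fun i =>
  match val i with 0 => a | 1 => b | 2 => c | _ => d end.

Lemma cfg_continuous (Y : topologicalType) (a b c d : Y -> plane) : continuous a -> continuous b ->
  continuous c -> continuous d -> forall i, continuous (fun y => cfg (a y) (b y) (c y) (d y) i).
Proof. by move=> ca cb cc cd [[|[|[|[|//]]]] ?]. Qed.

Lemma cfg_inj a b c d : [/\ a <> b, a <> c & a <> d] -> [/\ b <> c, b <> d & c <> d] -> injective (cfg a b c d).
Proof.
move=> [ab ac ad] [bc bd cd] [[|[|[|[|//]]]] i4] [[|[|[|[|//]]]] j4] /= e; try exact: val_inj;
  exfalso; auto.
Qed.

Lemma cfg0 a b c d : cfg a b c d (o4 0) = a. Proof. by rewrite /cfg /o4 /= inordK. Qed.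
Lemma cfg1 a b c d : cfg a b c d (o4 1) = b. Proof. by rewrite /cfg /o4 /= inordK. Qed.
Lemma cfg2 a b c d : cfg a b c d (o4 2) = c. Proof. by rewrite /cfg /o4 /= inordK. Qed.
Lemma cfg3 a b c d : cfg a b c d (o4 3) = d. Proof. by rewrite /cfg /o4 /= inordK. Qed.

Lemma const_continuous (Y : topologicalType) (a : plane) : continuous (fun _ : Y => a).
Proof. by move=> y; exact: cvg_cst. Qed.

(** [early] and [late] run two motions one after the other within one parameter, so that at each
    time one of them is at rest. *)
Definition early (g : R -> plane) (s : R) : plane := g (clamp 1 (2 * s)).
Definition late (g : R -> plane) (s : R) : plane := g (clamp 1 (2 * s - 1)).

Lemma early_continuous g : continuous g -> continuous (early g).
Proof.
move=> cg; have c2 : continuous (fun s : R => clamp 1 (2 * s)); last exact: (continuous_compf c2 cg).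
by apply: cont1; [exact: clamp_continuous|apply: contM; [exact: contC|move=> s; exact: cvg_id]].
Qed.

Lemma late_continuous g : continuous g -> continuous (late g).
Proof.
move=> cg; have c2 : continuous (fun s : R => clamp 1 (2 * s - 1)); last exact: (continuous_compf c2 cg).
apply: cont1; [exact: clamp_continuous|apply: contB; last exact: contC].
by apply: contM; [exact: contC|move=> s; exact: cvg_id].
Qed.

Lemma early_late g k s : early g s = g 1 \/ late k s = k 0.
Proof.
rewrite /early /late; case: (lerP s (1 / 2)) => h; [right|left].
  by rewrite (_ : clamp 1 (2 * s - 1) = 0) // /clamp; apply/max_idPl; rewrite ge_min; apply/orP; right; lra.
by rewrite (_ : clamp 1 (2 * s) = 1) // /clamp (min_idPl _); [apply/max_idPr; lra | lra].
Qed.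

Lemma early0 g : early g 0 = g 0.
Proof. by rewrite /early mulr0 clamp_id ?lexx ?ler01. Qed.
Lemma late0 g : late g 0 = g 0.
Proof.
by rewrite /late (_ : clamp 1 _ = 0) // /clamp; apply/max_idPl; rewrite ge_min; apply/orP; right; lra.
Qed.
Lemma early1 g : early g 1 = g 1.
Proof. by rewrite /early (_ : clamp 1 _ = 1) // /clamp (min_idPl _); [apply/max_idPr; lra | lra]. Qed.
Lemma late1 g : late g 1 = g 1.
Proof.
have E : 2 * 1 - 1 = 1 :> R by ring.
by rewrite /late E clamp_id ?lexx ?ler01. Qed.

End FourPoints.

#[local] Opaque mconf.

(** * Reducible braids in the kernel *)

Section OuterMotion.
Variable R : realType.
Local Notation plane := (R * R)%type.
Local Notation config := ('I_4 -> plane).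
Variables (K : R -> plane -> plane) (h : plane -> plane) (b : B4) (Q0 Q1 Q2 Q3 : plane).
Hypothesis Kh : isotopy_to K h.
Hypothesis Kb : mconf (fun s i => K s (cfg Q0 Q1 Q2 Q3 i)) = b.

Lemma isotopy_square (z : R -> config) : (forall i, continuous (fun r => z r i)) ->
  (forall r, injective (z r)) -> z 0 = cfg Q0 Q1 Q2 Q3 ->
  (b * mconf (fun r i => h (z r i)) = mconf z * mconf (fun s i => K s (z 1%R i)))%g.
Proof.
move=> cz zi z0; have [cK Ki _ K0 K1] := Kh.
pose f (y : R * R) : config := fun i => K y.1 (z y.2 i).
have cf i : continuous (fun y => f y i).
  have c2 := continuous_compf (@continuous_proj2 R R) (cz i).
  exact: (continuous_compf (continuous_pair (@continuous_proj1 R R) c2) cK).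
have fi y : injective (f y) by move=> i j /Ki/zi.
have := mconf_square cf fi.
have -> : mconf (fun s => f (s, 0%R)) = b.
  by rewrite -Kb; apply: eq_mconf => s; rewrite /f /= z0.
have -> : mconf (fun r => f (1%R, r)) = mconf (fun r i => h (z r i)).
  by apply: eq_mconf => r; rewrite /f /= K1.
have -> : mconf (fun r => f (0%R, r)) = mconf z.
  by apply: eq_mconf => r; rewrite /f /= K0.
by [].
Qed.

Hypotheses (h0 : h Q0 = Q0) (h1 : h Q1 = Q1) (h2 : h Q2 = Q2) (h3 : h Q3 = Q3).
Hypotheses (d0 : open_disk Q0) (d1 : open_disk Q1) (d2 : open_disk Q2).
Hypothesis Qd : Q0 <> Q1 /\ Q0 <> Q2 /\ Q1 <> Q2.

Lemma far_notin_disk : (~` @open_disk R) (far R).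
Proof. by rewrite /open_disk /far /=; apply/negP; rewrite -leNgt; nra. Qed.

Let hfar : h (far R) = far R.
Proof. by have [_ _ Ko _ <-] := Kh; apply: Ko; exact: far_notin_disk. Qed.

Variables (al be0 be1 : R -> plane) (e : R).
Hypotheses (cal : continuous al) (cbe0 : continuous be0) (cbe1 : continuous be1) (e0 : 0 < e).
Hypotheses (al0 : al 0 = Q3) (al1 : al 1 = far R).
Hypotheses (be00 : be0 0 = Q0) (be01 : be0 1 = (Q2.1, Q2.2 + 2 * e)).
Hypotheses (be10 : be1 0 = Q1) (be11 : be1 1 = (Q2.1, Q2.2 + e)).
Hypothesis be0Q : forall s, be0 s <> Q1 /\ be0 s <> Q2.
Hypothesis be1Q : forall s, be1 s <> be0 1 /\ be1 s <> Q2.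
Hypothesis left50 : forall s, [/\ (be0 s).1 < 50, (be1 s).1 < 50 & Q2.1 < 50].
Hypothesis alQ : forall r, al r <> Q0 /\ al r <> Q1.
Hypothesis albe : forall r s, [/\ al r <> be0 s, al r <> be1 s, h (al r) <> be0 s & h (al r) <> be1 s].
Hypothesis alseg : forall r t, 0 <= t <= 2 * e -> al r <> (Q2.1, Q2.2 + t) /\ h (al r) <> (Q2.1, Q2.2 + t).

(** [al] takes the fourth point to [far]; [be0] and [be1] gather two points above [Q2]. With the
    fourth point at [far], the isotopy braid [X] lies in <s1, s2>. The motions [al] and [h al]
    differ by turns around the cluster, which commute with the gathering braid [Wa]. *)
Lemma outer_motion : exists v x k, in12 x /\ b = (v * (x * zexp around k) * v^-1)%g.
Proof.
have [cK Ki Ko K0 K1] := Kh; have hi : injective h by rewrite -K1; exact: Ki.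
have ch : continuous h.
  have c : continuous (fun z : plane => (1 : R, z)).
    by apply: continuous_pair => ?; [exact: cvg_cst|exact: cvg_id].
  have := continuous_compf c cK; rewrite /= K1; exact.
have alQ2 r : al r <> Q2.
  have t0 : 0 <= (0 : R) <= 2 * e by rewrite lexx /= mulr_ge0 // ltW.
  by have [+ _] := alseg r t0; rewrite addr0 => H E; apply: H; rewrite E; case: (Q2).
have halQ2 r : h (al r) <> Q2 by rewrite -{1}h2 => /hi; exact: alQ2.
have [Q01 [Q02 Q12]] := Qd.
(* The cases [d = al] and [d = h al] give two squares that share the gathering sides [Pa] and [Wa],
   since [h] fixes [Q3] and [far]. *)
pose f (d : R -> plane) (y : R * R) : config := cfg (early be0 y.1) (late be1 y.1) Q2 (d y.2).
have cf d : continuous d -> forall i, continuous (fun y => f d y i).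
  move=> cd; apply: cfg_continuous.
  - exact: (continuous_compf (@continuous_proj1 R R) (early_continuous cbe0)).
  - exact: (continuous_compf (@continuous_proj1 R R) (late_continuous cbe1)).
  - exact: const_continuous.
  - exact: (continuous_compf (@continuous_proj2 R R) cd).
have fi d : (forall r s, d r <> be0 s /\ d r <> be1 s) -> (forall r, d r <> Q2) ->
    forall y, injective (f d y).
  move=> db dQ [s r]; apply: cfg_inj; split=> /=.
  - case: (early_late be0 be1 s) => ->; first by have [+ _] := be1Q (clamp 1 (2 * s - 1)); exact: nesym.
    by rewrite be10; have [] := be0Q (clamp 1 (2 * s)).
  - by have [] := be0Q (clamp 1 (2 * s)).
  - by have [+ _] := db r (clamp 1 (2 * s)); exact: nesym.
  - by have [] := be1Q (clamp 1 (2 * s - 1)).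
  - by have [_ +] := db r (clamp 1 (2 * s - 1)); exact: nesym.
  - exact/nesym.
have cha := continuous_compf cal ch.
have fa : forall y, injective (f al y) by apply: fi => // r s; have [] := albe r s.
have fh : forall y, injective (f (fun r => h (al r)) y) by apply: fi => // r s; have [] := albe r s.
have sqa := mconf_square (cf _ cal) fa.
have sqh := mconf_square (cf _ cha) fh.
set Pa := mconf (fun s => f al (s, 0)) in sqa; set Wa := mconf (fun s => f al (s, 1)) in sqa.
set Ca := mconf (fun r => f al (1, r)) in sqa; set Ga := mconf (fun r => f al (0, r)) in sqa.
set Ch := mconf (fun r => f _ (1, r)) in sqh; set Gh := mconf (fun r => f _ (0, r)) in sqh.
have e1 : mconf (fun s => f (fun r => h (al r)) (s, 0)) = Pa.
  by apply: eq_mconf => s; rewrite /f /= al0 h3.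
have e2 : mconf (fun s => f (fun r => h (al r)) (s, 1)) = Wa.
  by apply: eq_mconf => s; rewrite /f /= al1 hfar.
rewrite e1 e2 in sqh.
have Win : in12 Wa.
  apply: mconf_last => [i|s|s _ i iM].
  - have c : continuous (fun s : R => (s, 1 : R)).
      by apply: continuous_pair => ?; [exact: cvg_id|exact: cvg_cst].
    exact: (continuous_compf c (cf _ cal i)).
  - exact: fa.
  - have [l0 _ l2] := left50 (clamp 1 (2 * s)); have [_ l1 _] := left50 (clamp 1 (2 * s - 1)).
    have -> : f al (s, 1) ord_max = far R by rewrite -al1.
    have H : (f al (s, 1) i).1 < 50; last by apply: lt_trans H _; rewrite /far /= ltr_nat.
    case: i iM => [[|[|[|[|//]]]] i4] iM; [exact: l0|exact: l1|exact: l2|].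
    by case/eqP: iM; apply: val_inj.
have tri d (cd : continuous d) (di : forall y, injective (f d y)) :
   (forall r t, 0 <= t <= 2 * e -> d r <> (Q2.1, Q2.2 + t)) -> d 1 = far R ->
   around_pow (triple_gauge (ranks (lex_lt (f d (1, 0)%R))) * mconf (fun r => f d (1, r)%R))%g.
  move=> ds d1'.
  have E0 s : f d (1, s) (o4 0) = (Q2.1, Q2.2 + 2 * e) by rewrite /f cfg0 early1 be01.
  have E1 s : f d (1, s) (o4 1) = (Q2.1, Q2.2 + e) by rewrite /f cfg1 late1 be11.
  have E2 s : f d (1, s) (o4 2) = Q2 by rewrite /f cfg2.
  have E3 s : f d (1, s) (o4 3) = d s by rewrite /f cfg3.
  have := @mconf_triple R (fun r => f d (1, r)); rewrite [triple_gauge (ranks (lex_lt (f d (1, 1)%R)))]/triple_gauge.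
  have -> : rlt (ranks (lex_lt (f d (1, 1)%R))) 0 3 = true.
    have -> : rlt (ranks (lex_lt (f d (1, 1)%R))) 0 3 = lex_lt (f d (1, 1)%R) (o4 0) (o4 3).
      by rewrite -(@rlt_lex R _ (o4 0) (o4 3) (di (1, 1))) /o4 !inordK.
    rewrite /lex_lt /f cfg0 cfg3 early1 be01 d1' /far.
    have [_ _ l2] := left50 0; apply/orP; left; apply: lt_trans l2 _.
    by rewrite /= ltr_nat.
  rewrite invg1 mulg1; apply.
  - move=> i; have c : continuous (fun r : R => (1 : R, r)).
      by apply: continuous_pair => ?; [exact: cvg_cst|exact: cvg_id].
    exact: (continuous_compf c (cf _ cd i)).
  - by move=> s; exact: di.
  - move=> s _; rewrite E0 E1 E2; split; [by []|by []| |].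
      by rewrite ltrDl.
    by rewrite ltrD2l mulr_natl mulr2n ltrDl.
  - move=> s _; rewrite E0 E2 E3 => -[x1 /andP[y1 y2]].
    apply: (ds s ((d s).2 - Q2.2)).
      by rewrite subr_ge0 y1 lerBlDl.
    by rewrite -x1 addrC subrK; case: (d s).
have ta : around_pow (triple_gauge (ranks (lex_lt (f al (1, 0)%R))) * Ca)%g.
  exact: (tri al cal fa (fun r t t2 => (alseg r t2).1) al1).
have hal1 : h (al 1) = far R by rewrite al1.
have th' := tri (fun r => h (al r)) cha fh (fun r t t2 => (alseg r t2).2) hal1.
have eh : f (fun r => h (al r)) (1, 0) = f al (1, 0) by rewrite /f al0 h3.
rewrite eh -/Ch in th'.
have [k ak] : around_pow (Ch^-1 * Ca)%g.
  have := around_powM (around_powV th') ta; move: (triple_gauge _) => g0.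
  by rewrite invgM !mulgA mulgVK.
pose z r : config := cfg Q0 Q1 Q2 (al r).
have cz : forall i, continuous (fun r => z r i).
  exact: (cfg_continuous (@const_continuous R R Q0) (@const_continuous R R Q1) (@const_continuous R R Q2) cal).
have zi r : injective (z r).
  have [a0 a1] := alQ r; have a2 := alQ2 r.
  by apply: cfg_inj; split; [exact: Q01|exact: Q02|exact/nesym|exact: Q12|exact/nesym|exact/nesym].
have z0 : z 0 = cfg Q0 Q1 Q2 Q3 by rewrite /z al0.
have := isotopy_square cz zi z0.
have -> : mconf z = Ga.
  by apply: eq_mconf => r; rewrite /z /f /= early0 late0 be00 be10.
have -> : mconf (fun r i => h (z r i)) = Gh.
  apply: eq_mconf => r; rewrite /f /= early0 late0 be00 be10 /z.
  by apply/funext => -[[|[|[|[|//]]]] ?]; rewrite /cfg /=.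
set X := mconf _ => E.
have Xin : in12 X.
  apply: mconf_last => [i|s|s _ i iM].
  - have c : continuous (fun s : R => (s, z 1 i)).
      by apply: continuous_pair => ?; [exact: cvg_id|exact: cvg_cst].
    exact: (continuous_compf c cK).
  - by move=> i j /Ki /zi.
  - have -> : K s (z 1 ord_max) = far R.
      by have -> : z 1 ord_max = far R; [rewrite -al1|exact: (Ko s _ far_notin_disk)].
    have : (K s (z 1 i)).1 < 5.
      apply: open_disk_lt; apply: (isotopy_inside s Kh).
      case: i iM => [[|[|[|[|//]]]] i4] iM; [exact: d0|exact: d1|exact: d2|].
      by case/eqP: iM; apply: val_inj.
    by move=> H; apply: lt_trans H _; rewrite /far /= ltr_nat.
clear tri e1 e2 eh z0 zi cz; clearbody Pa Wa Ca Ga Ch Gh X.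
exists Ga, X, k; split; first exact: Xin.
have hC : (Gh^-1 * Ga = zexp around k)%g.
  have -> : Ga = (Pa * Ca * Wa^-1)%g by rewrite sqa mulgK.
  have -> : Gh = (Pa * Ch * Wa^-1)%g by rewrite sqh mulgK.
  rewrite !invgM invgK -!mulgA mulKg [(Ch^-1 * _)%g]mulgA ak.
  have cm : commute (zexp around k) Wa^-1%g.
    by apply: zexp_commute; apply: commute_in12 (in12V Win) => j; exact: around_sig.
  by rewrite cm mulVKg.
rewrite -hC -!mulgA mulgV mulg1 mulgA.
by apply: (mulIg Gh); rewrite mulgVK E.
Qed.

End OuterMotion.

(** * Motions of a close pair *)

Section PairMotion.
Variable R : realType.
Local Notation plane := (R * R)%type.
Local Notation config := ('I_4 -> plane).

Lemma on_segment (w Q : plane) (e : R) : w.1 = Q.1 -> Q.2 <= w.2 <= Q.2 + e ->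
  exists2 t, 0 <= t <= e & w = (Q.1, Q.2 + t).
Proof.
move=> x1 /andP[y1 y2]; exists (w.2 - Q.2); first by rewrite subr_ge0 y1 lerBlDl.
by rewrite -x1 addrC subrK; case: w {x1 y1 y2}.
Qed.

Lemma ord4_2 (i : 'I_4) : i != ord_max -> (2 <= i)%N -> i = o4 2.
Proof.
case: i => [[|[|[|[|//]]]] i4] iM // _; apply: val_inj; first by rewrite /o4 /= inordK.
Qed.

Lemma first_gauge (z : config) : injective z -> (forall i, i != o4 0 -> lex_lt z (o4 0) i) ->
  pair_gauge (ranks (lex_lt z)) = pos_braid [::].
Proof.
move=> zi H; have pr := lex_perms4 zi; rewrite /pair_gauge /pair_word.
have r0 k (k4 : (k < 4)%N) : (0 < k)%N -> rlt (ranks (lex_lt z)) 0 k.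
  move=> k0; have -> : rlt (ranks (lex_lt z)) 0 k = lex_lt z (o4 0) (o4 k).
    by rewrite -(@rlt_lex R _ (o4 0) (o4 k) zi) /o4 !inordK.
  by apply: H; rewrite /o4 -val_eqE /= !inordK // -lt0n.
have /allP /(_ _ pr) : all (fun r => if [&& rlt r 0 1, rlt r 0 2 & rlt r 0 3]%N
   then nth 0 r 0 == 0 else true)%N perms4 by vm_compute.
by rewrite !r0 // => /eqP ->.
Qed.

Variables (K : R -> plane -> plane) (h : plane -> plane) (b : B4) (Q0 Q1 Q2 Q3 : plane).
Hypothesis Kh : isotopy_to K h.
Hypothesis Kb : mconf (fun s i => K s (cfg Q0 Q1 Q2 Q3 i)) = b.
Hypotheses (h0 : h Q0 = Q0) (h1 : h Q1 = Q1) (h2 : h Q2 = Q2) (h3 : h Q3 = Q3).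
Hypothesis Q23 : Q2 <> Q3.
Variables (al mu2 mu3 : R -> plane) (e : R).
Let q0 : plane := (Q1.1, Q1.2 + e).
Let p2 : plane := (100, 0).
Let p3 : plane := (200, 0).
Let bp (r : R) : plane := (Q1.1 + ((K r q0).1 - (K r Q1).1), Q1.2 + ((K r q0).2 - (K r Q1).2)).
Hypotheses (cal : continuous al) (cmu2 : continuous mu2) (cmu3 : continuous mu3) (e0 : 0 < e).
Hypotheses (al0 : al 0 = Q0) (al1 : al 1 = q0) (mu20 : mu2 0 = Q2) (mu21 : mu2 1 = p2).
Hypotheses (mu30 : mu3 0 = Q3) (mu31 : mu3 1 = p3).
Hypothesis alQ1 : forall r, al r <> Q1.
Hypothesis al50 : forall r, (al r).1 < 50 /\ (h (al r)).1 < 50.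
Hypothesis bp50 : forall r, (bp r).1 < 50.
Hypothesis Q150 : Q1.1 < 50.
Hypothesis mu2Q : forall s, mu2 s <> Q3.
Hypothesis mu3Q : forall s, mu3 s <> mu2 1.
Hypothesis almu : forall r s, [/\ al r <> mu2 s, al r <> mu3 s, h (al r) <> mu2 s & h (al r) <> mu3 s].
Hypothesis bpmu : forall r s, bp r <> mu2 s /\ bp r <> mu3 s.
Hypothesis segmu : forall s (t : R), 0 <= t <= e -> mu2 s <> (Q1.1, Q1.2 + t) /\ mu3 s <> (Q1.1, Q1.2 + t).
Let fp (r s : R) : plane := ((K s Q1).1 + ((K r q0).1 - (K r Q1).1), (K s Q1).2 + ((K r q0).2 - (K r Q1).2)).
Hypothesis fpK : forall r s, fp r s <> K s Q2 /\ fp r s <> K s Q3.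
Hypothesis segK : forall s (t : R), 0 <= t <= e ->
  K s Q2 <> ((K s Q1).1, (K s Q1).2 + t) /\ K s Q3 <> ((K s Q1).1, (K s Q1).2 + t).

(** The first point is brought to [q0], just above [Q1]. The isotopy of this pair splits into a
    transport of the vertical vector along the track of [Q1] and a rotation of the vector at rest.
    The transport is cabled because the pair stays adjacent, the rotation because [mu2] and [mu3]
    can first remove the other two points to the right. *)
Lemma pair_motion : exists v c, cabled c /\ b = (v * c * v^-1)%g.
Proof.
have [cK Ki Ko K0 K1] := Kh; have hi : injective h by rewrite -K1; exact: Ki.
have cK1 (z : plane) : continuous (fun s => K s z).
  have c : continuous (fun s : R => (s, z)).
    by apply: continuous_pair => ?; [exact: cvg_id|exact: cvg_cst].
  exact: (continuous_compf c cK).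
have ch : continuous h.
  have c : continuous (fun z : plane => (1 : R, z)).
    by apply: continuous_pair => ?; [exact: cvg_cst|exact: cvg_id].
  have := continuous_compf c cK; rewrite /= K1; exact.
have t00 : 0 <= (0 : R) <= e by rewrite lexx /= ltW.
have Q1E : (Q1.1, Q1.2 + 0) = Q1 by rewrite addr0; case: (Q1).
have mu2Q1 s : mu2 s <> Q1 by have [+ _] := segmu s t00; rewrite Q1E.
have mu3Q1 s : mu3 s <> Q1 by have [_ +] := segmu s t00; rewrite Q1E.
have Q1Q2 : Q1 <> Q2 by rewrite -mu20; exact/nesym.
have Q1Q3 : Q1 <> Q3 by rewrite -mu30; exact/nesym.
have halQ1 r : h (al r) <> Q1 by rewrite -{1}h1 => /hi; exact: alQ1.
have q0Q1 : q0 <> Q1.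
  by rewrite /q0 => /(congr1 snd) /= /eqP; rewrite -subr_eq0 addrC addKr (gt_eqF e0).
have sub0 (u v w : R) : u + (v - w) = u -> v = w.
  by move=> E; apply/eqP; rewrite -subr_eq0; apply/eqP; apply: (addrI u); rewrite E addr0.
have bpQ1 r : bp r <> Q1.
  move=> E; apply: q0Q1; apply: (Ki r).
  have := congr1 fst E; have := congr1 snd E; rewrite /bp /= => /sub0 e2 /sub0 e1.
  by rewrite [LHS]surjective_pairing [RHS]surjective_pairing e1 e2.
have fpQ1 r s : fp r s <> K s Q1.
  move=> E; apply: q0Q1; apply: (Ki r).
  have := congr1 fst E; have := congr1 snd E; rewrite /fp /= => /sub0 e2 /sub0 e1.
  by rewrite [LHS]surjective_pairing [RHS]surjective_pairing e1 e2.
have cd1 : continuous (fun r : R => (K r q0).1 - (K r Q1).1).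
  by apply: contB; exact: (continuous_fst (cK1 _)).
have cd2 : continuous (fun r : R => (K r q0).2 - (K r Q1).2).
  by apply: contB; exact: (continuous_snd (cK1 _)).
have cbp : continuous bp.
  apply: continuous_coords; apply: contD; [exact: contC|exact: cd1|exact: contC|exact: cd2].
have cha := continuous_compf cal ch.
pose g (d : R -> plane) (y : R * R) : config := cfg (d y.2) Q1 (early mu2 y.1) (late mu3 y.1).
have cg d : continuous d -> forall i, continuous (fun y => g d y i).
  move=> cd'; apply: cfg_continuous.
  - exact: (continuous_compf (@continuous_proj2 R R) cd').
  - exact: const_continuous.
  - exact: (continuous_compf (@continuous_proj1 R R) (early_continuous cmu2)).
  - exact: (continuous_compf (@continuous_proj1 R R) (late_continuous cmu3)).
have mu23 s : early mu2 s <> late mu3 s.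
  case: (early_late mu2 mu3 s) => ->; first exact/nesym/mu3Q.
  by rewrite mu30; exact: mu2Q.
have gi d : (forall r s, d r <> mu2 s /\ d r <> mu3 s) -> (forall r, d r <> Q1) ->
    forall y, injective (g d y).
  move=> db dQ [s r]; apply: cfg_inj; split.
  - exact: dQ.
  - exact: (db _ _).1.
  - exact: (db _ _).2.
  - exact/nesym/mu2Q1.
  - exact/nesym/mu3Q1.
  - exact: mu23.
have ga : forall y, injective (g al y) by apply: gi alQ1 => r s; have [] := almu r s.
have gh : forall y, injective (g (fun r => h (al r)) y) by apply: gi halQ1 => r s; have [] := almu r s.
have gb : forall y, injective (g bp y) by exact: gi bpmu bpQ1.
have sqa := mconf_square (cg _ cal) ga.
have sqh := mconf_square (cg _ cha) gh.
have sqb := mconf_square (cg _ cbp) gb.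
have farin d (cd' : continuous d) (di : forall y, injective (g d y)) : (forall r, (d r).1 < 50) ->
    cabled (mconf (fun r => g d (1, r))).
  move=> d50; have E2 s : g d (1, s) (o4 2) = p2 by rewrite /g cfg2 early1 mu21.
  have E3 s : g d (1, s) ord_max = p3 by rewrite -mu31 -late1.
  have H s (i : 'I_4) : (i < 2)%N -> (g d (1, s) i).1 < 50.
    by case: i => [[|[|//]] ?] _; [exact: d50|exact: Q150].
  apply: mconf_last2.
  - move=> i; have c : continuous (fun r : R => (1 : R, r)).
      by apply: continuous_pair => ?; [exact: cvg_cst|exact: cvg_id].
    exact: (continuous_compf c (cg _ cd' i)).
  - by move=> s; exact: di.
  - move=> s _ i iM; rewrite E3; have [i2|i2] := ltnP i 2.
      by apply: lt_trans (H s i i2) _; rewrite /p3 /= ltr_nat.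
    rewrite (ord4_2 iM i2).
    by rewrite E2 /p2 /p3 /= ltr_nat.
  - by move=> s _ i i2; rewrite E2; apply: lt_trans (H s i i2) _; rewrite /p2 /= ltr_nat.
have Fa := farin al cal ga (fun r => (al50 r).1).
have Fh := farin (fun r => h (al r)) cha gh (fun r => (al50 r).2).
have Fb := farin bp cbp gb bp50.
have bp0 : bp 0 = q0.
  rewrite /bp K0 /q0 /=; congr pair; ring.
have bp1 : bp 1 = h q0.
  rewrite /bp K1 h1; case: (h q0) (Q1) => u v [u' v'] /=; congr pair; ring.
have w0E : mconf (fun s => g (fun r => h (al r)) (s, 0)) = mconf (fun s => g al (s, 0)).
  by apply: eq_mconf => s; rewrite /g al0 h0.
have w2E : mconf (fun s => g bp (s, 1)) = mconf (fun s => g (fun r => h (al r)) (s, 1)).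
  by apply: eq_mconf => s; rewrite /g al1 bp1.
have w1E : mconf (fun s => g bp (s, 0)) = mconf (fun s => g al (s, 1)).
  by apply: eq_mconf => s; rewrite /g al1 bp0.
rewrite w0E in sqh; rewrite w1E w2E in sqb.
have W1 : cabled (pair_gauge (ranks (lex_lt (cfg q0 Q1 Q2 Q3))) * mconf (fun s => g al (s, 1%R)))%g.
  have c : continuous (fun s : R => (s, 1 : R)).
    by apply: continuous_pair => ?; [exact: cvg_id|exact: cvg_cst].
  have cW : forall i, continuous (fun s => g al (s, 1) i).
    by move=> i; exact: (continuous_compf c (cg _ cal i)).
  have := @mconf_pair R (fun s => g al (s, 1)) e cW (fun s => ga (s, 1)) e0.
  have -> : g al (0, 1) = cfg q0 Q1 Q2 Q3 by rewrite /g al1 early0 late0 mu20 mu30.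
  have -> : pair_gauge (ranks (lex_lt (g al (1, 1)))) = pos_braid [::].
    apply: first_gauge; first exact: ga.
    have -> : g al (1, 1) = cfg q0 Q1 p2 p3 by rewrite /g al1 early1 late1 mu21 mu31.
    move=> i; rewrite {1}/lex_lt cfg0.
    case: i => [[|[|[|[|//]]]] i4] iM.
    - by case/eqP: iM; apply: val_inj; rewrite /o4 /= inordK.
    - by apply/orP; right; rewrite /cfg /q0 /= eqxx /= ltrDl.
    - by apply/orP; left; apply: lt_trans Q150 _; rewrite /cfg /p2 /= ltr_nat.
    - by apply/orP; left; apply: lt_trans Q150 _; rewrite /cfg /p3 /= ltr_nat.
  rewrite pos_nil invg1 mulg1; apply.
    by move=> s _; rewrite /g cfg0 cfg1 al1.
  move=> s _ i i1; have -> : g al (s, 1) (o4 1) = Q1 by rewrite /g cfg1.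
  move=> [x1 y1]; have [t te E] := on_segment x1 y1; have [m2 m3] := segmu (clamp 1 (2 * s)) te.
  have [m2' m3'] := segmu (clamp 1 (2 * s - 1)) te.
  case: i i1 {x1 y1} E => [[|[|[|[|k]]]] i4] i1 E; [by []|by []|exact: m2 E|exact: m3' E|].
  by exfalso; move: (i4); rewrite !ltnS ltn0.
(* On the diagonal [F] is the isotopy itself; on the side [r = 0] the vector stays vertical, and on
   the side [s = 1] only the vector turns. *)
pose F (y : R * R) : config := cfg (fp y.1 y.2) (K y.2 Q1) (K y.2 Q2) (K y.2 Q3).
have cF : forall i, continuous (fun y => F y i).
  have c2 z : continuous (fun y : R * R => K y.2 z).
    exact: (continuous_compf (@continuous_proj2 R R) (cK1 z)).
  apply: cfg_continuous; [|exact: c2|exact: c2|exact: c2].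
  apply: continuous_coords; apply: contD.
  - exact: (continuous_fst (c2 Q1)).
  - exact: (continuous_compf (@continuous_proj1 R R) cd1).
  - exact: (continuous_snd (c2 Q1)).
  - exact: (continuous_compf (@continuous_proj1 R R) cd2).
have Fi : forall y, injective (F y).
  move=> [r s]; have [f2 f3] := fpK r s; apply: cfg_inj; split.
  - exact: fpQ1.
  - exact: f2.
  - exact: f3.
  - by move=> /Ki.
  - by move=> /Ki.
  - by move=> /Ki.
have diag := mconf_diag cF Fi.
have F0 s : F (0, s) (o4 0) = ((K s Q1).1, (K s Q1).2 + e).
  by rewrite /F cfg0 /fp K0 /q0 /=; congr pair; ring.
have A1 : cabled (pair_gauge (ranks (lex_lt (cfg q0 Q1 Q2 Q3))) * mconf (fun s => F (0%R, s)) *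
   (pair_gauge (ranks (lex_lt (cfg q0 Q1 Q2 Q3))))^-1)%g.
  have c : continuous (fun s : R => (0 : R, s)).
    by apply: continuous_pair => ?; [exact: cvg_cst|exact: cvg_id].
  have cW : forall i, continuous (fun s => F (0, s) i).
    by move=> i; exact: (continuous_compf c (cF i)).
  have := @mconf_pair R (fun s => F (0, s)) e cW (fun s => Fi (0, s)) e0.
  have E z : (fp 0 z = ((K z Q1).1, (K z Q1).2 + e)) by have := F0 z; rewrite /F cfg0.
  have -> : F (0, 0) = cfg q0 Q1 Q2 Q3 by rewrite /F E K0.
  have -> : F (0, 1) = cfg q0 Q1 Q2 Q3 by rewrite /F E K1 h1 h2 h3.
  apply; first by move=> s _; rewrite F0 /F cfg1.
  move=> s _ i i1; have -> : F (0, s) (o4 1) = K s Q1 by rewrite /F cfg1.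
  move=> [x1 y1]; have [t te E'] := on_segment x1 y1; have [m2 m3] := segK s te.
  case: i i1 {x1 y1} E' => [[|[|[|[|k]]]] i4] i1 E'; [by []|by []|exact: m2 E'|exact: m3 E'|].
  by exfalso; move: (i4); rewrite !ltnS ltn0.
pose z r : config := cfg (al r) Q1 Q2 Q3.
have cz : forall i, continuous (fun r => z r i).
  exact: (cfg_continuous cal (@const_continuous R R Q1) (@const_continuous R R Q2) (@const_continuous R R Q3)).
have zE r : z r = g al (0, r) by rewrite /z /g early0 late0 mu20 mu30.
have zi r : injective (z r) by rewrite zE; exact: ga.
have z0 : z 0 = cfg Q0 Q1 Q2 Q3 by rewrite /z al0.
have sq := isotopy_square Kh Kb cz zi z0.
have e1 : mconf z = mconf (fun r => g al (0, r)) by apply: eq_mconf => r; exact: zE.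
have e2 : mconf (fun r i => h (z r i)) = mconf (fun r => g (fun r => h (al r)) (0, r)).
  apply: eq_mconf => r; rewrite /g early0 late0 mu20 mu30 /z.
  apply/funext => -[[|[|[|[|//]]]] i4]; [by []|exact: h1|exact: h2|exact: h3].
have e3 : mconf (fun s i => K s (z 1 i)) = mconf (fun t => F (t, t)).
  apply: eq_mconf => s; rewrite /F /z al1; apply/funext => -[[|[|[|[|//]]]] i4]; [|by []|by []|by []].
  by rewrite /cfg /= /fp; case: (K s q0) (K s Q1) => u v [u' v'] /=; congr pair; ring.
have e4 : mconf (fun u => F (u, 1)) = mconf (fun r => g bp (0, r)).
  by apply: eq_mconf => r; rewrite /F /g early0 late0 mu20 mu30 K1 h1 h2 h3 /fp K1 h1.
rewrite e1 e2 e3 diag e4 in sq.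
clear e1 e2 e3 e4 diag w0E w1E w2E.
move: (pair_gauge _) W1 A1 => kap W1 A1.
move: (mconf (fun s => g al (s, 0))) (mconf (fun s => g al (s, 1))) W1
  (mconf (fun s => g (fun r => h (al r)) (s, 1))) (mconf (fun r => g al (1, r))) Fa
  (mconf (fun r => g (fun r => h (al r)) (1, r))) Fh (mconf (fun r => g bp (1, r))) Fb
  (mconf (fun r => g al (0, r))) (mconf (fun r => g (fun r => h (al r)) (0, r)))
  (mconf (fun r => g bp (0, r))) (mconf (fun s => F (0, s))) A1 sqa sqh sqb sq.
move=> w0 w1 W1 w2 fa Fa fh Fh fb Fb Ga Gh Gb A A1 sqa sqh sqb sq.
(* [Ga] brings the pair together, and the gauge [kap] relates its place to the leftmost one, where
   the generators of [cabled] live. *)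
exists (Ga * kap^-1)%g, (kap * A * kap^-1 * ((kap * w1) * (fb * fh^-1 * fa) * (kap * w1)^-1))%g; split.
  apply: cabledM => //; apply: cabledM; last exact: cabledV.
  by apply: cabledM => //; apply: cabledM => //; apply: cabledM => //; exact: cabledV.
have hb : b = (Ga * (A * Gb) * Gh^-1)%g by rewrite -sq mulgK.
have eGb : (Gb = w1 * fb * w2^-1)%g by rewrite sqb mulgK.
have eGh : (Gh = w0 * fh * w2^-1)%g by rewrite sqh mulgK.
have eGa : (fa * w1^-1 * Ga^-1 = w0^-1)%g.
  have -> : (fa = w0^-1 * (Ga * w1))%g by rewrite -sqa mulKg.
  by rewrite -!mulgA mulVKg mulgV mulg1.
rewrite hb eGb eGh !invgM !invgK -!mulgA mulKg; congr (_ * _)%g.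
by rewrite !mulKg -eGa !mulgA.
Qed.

End PairMotion.

#[local] Transparent mconf.

(** * Choice of paths, labels and uniform sizes *)

Section Assembly.
Variable R : realType.
Local Notation plane := (R * R)%type.
Local Notation config := ('I_4 -> plane).

(** Clamping makes the range compact, so that its complement is open and can host other motions. *)
Lemma clamp_path (V : set plane) x y : joined V x y -> exists g : R -> plane,
  [/\ continuous g, g 0 = x, g 1 = y & forall s, V (g s)] /\ closed (range g).
Proof.
move=> [g [cg g0 g1 Vg]]; exists (fun s => g (clamp 1 s)).
have cc : continuous (fun s => g (clamp 1 s)) by exact: (continuous_compf (@clamp_continuous R 1) cg).
split; first by split; rewrite ?clamp_id ?lexx ?ler01.
have -> : range (fun s => g (clamp 1 s)) = g @` `[0, 1].
  apply/seteqP; split=> [_ [s _ <-]|_ [s s01 <-]].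
    by exists (clamp 1 s) => //; rewrite /= in_itv /= clampP.
  by exists s => //; rewrite clamp_id //; move: s01; rewrite /= in_itv.
apply: compact_closed; first exact: (@norm_hausdorff R plane).
apply: continuous_compact; last exact: segment_compact.
exact: continuous_subspaceT.
Qed.

Lemma open_remove (V : set plane) z : open V -> open (V `\ z).
Proof.
move=> oV; rewrite setDE; apply: openI => //; apply: closed_openC; apply: accessible_closed_set1.
exact: (hausdorff_accessible (@norm_hausdorff R plane)).
Qed.

Lemma open_left : open [set y : plane | y.1 < 50].
Proof.
have := @open_comp plane R fst [set r | r < 50]; apply; last exact: open_lt.
by move=> y _; exact: continuous_proj1.
Qed.

(** Compactness of [0, 1] by continuous induction, keeping the smaller of two thresholds at each
    step. *)
Lemma uniform_pos (P : R -> R -> Prop) :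
  (forall t : R, exists2 rho : R, 0 < rho & exists2 V : set R, nbhs t V &
     forall r, V r -> forall u, 0 < u <= rho -> P r u) ->
  exists2 rho : R, 0 < rho & forall r, 0 <= r <= 1 -> forall u, 0 < u <= rho -> P r u.
Proof.
move=> loc; pose A (t : R) := exists2 rho : R, 0 < rho & forall r, 0 <= r <= t -> forall u, 0 < u <= rho -> P r u.
suff : A (-1) -> A 1.
  by apply; exists 1 => // r /andP[r0 r1]; exfalso; lra.
apply: (@real_induct R A) => t; have [rho rho0 [V nV VP]] := loc t.
have /nbhs_ballP[d /= d0 dV] := nV.
exists (ball t d); first exact: nbhsx_ballx.
move=> a b Ba Bb [rho' rho'0 H]; exists (Num.min rho rho'); first by rewrite lt_min rho0.
move=> r /andP[r0 rb] u /andP[u0]; rewrite le_min => /andP[u1 u2].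
have [ra|ar] := leP r a; first by apply: H; rewrite ?r0 ?u0.
apply: VP; last by rewrite u0.
apply: dV; move: Ba Bb; rewrite /ball /= !ltr_norml => /andP[a1 a2] /andP[b1 b2].
by apply/andP; split; lra.
Qed.

(** Punctures cannot move along an isotopy that preserves their set, so [h] permutes them as the
    word does, and kernel words are pure. *)
Lemma represents_fixes h b p : p = 2 \/ p = 3 -> burau4_ker p b -> represents h b ->
  forall i, h (puncture R i) = puncture R i.
Proof.
move=> hp kb [w wb [H [cH hH H0 H1]]] i.
have cb s : clamp 1 s \in `[0, 1 : R] by rewrite in_itv /= clampP.
have e s : H (clamp 1 s) (puncture R i) = H (clamp 1 0) (puncture R i).
  apply: (puncture_track_constant (H := fun t => H (clamp 1 t))) => [|u].
    have c2 : continuous (fun s : R => (clamp 1 s, puncture R i)).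
      by apply: continuous_pair => ?; [exact: clamp_continuous|exact: cvg_cst].
    by apply: (continuous_within_comp cH c2) => y; split => //=; exact: cb.
  by have [_ _ _ <-] := hH _ (cb u); exists (puncture R i) => //; exists i.
have := e 1; rewrite !clamp_id ?lexx ?ler01 // H0 H1 => <-.
have wi v (n : 'I_4 -> nat) : (fun j => word_homeo v (int_config R n j)) = int_config R (word_perm v \o n).
  elim: v n => [|x v IH] n //=.
  have := IH (swap_nat x \o n); rewrite -partial_twist_end partial_twist1 => <-.
  by [].
have := congr1 (fun f => f i) (wi w (fun j : 'I_4 => j.+1)).
rewrite /int_config /= (ker_pure hp (w := w)) //; first by rewrite wb.
by have := ltn_ord i; lia.
Qed.

Lemma mconf_clamp (f : R -> config) : (forall i, continuous (fun s => f s i)) ->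
  (forall s, injective (f s)) -> mconf (fun s => f (clamp 1 s)) = mconf f.
Proof.
move=> cf fi.
have lc : lcocycle setT (fun s t => tau (f s) (f t)) by exact: (@tau_lcocycle R R f cf setT).
have [L pL] := @primitive_ex R B4 1 _ ler01 lc.
have -> : mconf f = ((L 0%R)^-1 * L 1%R)%g by exact: mono_eq pL.
apply: mono_eq => y y01; have [V nV VP] := pL y y01.
exists V; first exact: nV.
move=> u v Vu Vv u01 v01; have cu := clamp_id u01; have cv := clamp_id v01.
by cbv beta; rewrite cu cv; exact: (VP u v Vu Vv u01 v01).
Qed.

#[local] Opaque mconf.

(** Every numbering of the punctures yields [b] itself, since crossings are indexed by position and
    not by label. The enclosed punctures can thus be numbered first. *)
Lemma labelled h b : represents h b -> exists K, [/\ isotopy_to K h, (forall s, K s = K (clamp 1 s)) &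
  forall a0 a1 a2 a3 : 'I_4, uniq [:: a0; a1; a2; a3] ->
  mconf (fun s i => K s (cfg (puncture R a0) (puncture R a1) (puncture R a2) (puncture R a3) i)) = b].
Proof.
move=> /represents_isotopy [w [K [wb [cK Ki Ko K0 K1] KM]]].
exists (fun s => K (clamp 1 s)); split.
- split; rewrite ?clamp_id ?lexx ?ler01 //; last by move=> s z nz; exact: Ko.
  have c1 := continuous_compf (@continuous_proj1 R plane) (@clamp_continuous R 1).
  exact: (continuous_compf (continuous_pair c1 (@continuous_proj2 R plane)) cK).
- by move=> s; rewrite (clamp_id (@clampP R 1 s ler01)).
move=> a0 a1 a2 a3 ua.
pose n (i : 'I_4) : nat := (nth ord0 [:: a0; a1; a2; a3] i).+1.
have ni : injective n.
  move=> i j [] /val_inj /eqP; rewrite nth_uniq // => /eqP /val_inj //.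
have nE : cfg (puncture R a0) (puncture R a1) (puncture R a2) (puncture R a3) = int_config R n.
  by apply/funext => -[[|[|[|[|//]]]] i4].
have n4 i : (1 <= n i <= 4)%N by rewrite /n /= ltn_ord.
have := KM n ni (fun i => proj1 (andP (n4 i))); rewrite track_braid_full // wb => <-.
rewrite nE; pose f (s : R) : config := fun i => K s (int_config R n i).
have cf i : continuous (fun s => f s i).
  have c : continuous (fun s : R => (s, int_config R n i)).
    by apply: continuous_pair => ?; [exact: cvg_id|exact: cvg_cst].
  exact: (continuous_compf c cK).
have fi s : injective (f s) by move=> i j /Ki /(int_config_inj ni).
exact: (mconf_clamp cf fi).
Qed.

Lemma outside_path c y : outside c y -> joined (outside c) (far R) y.
Proof.
move=> [g [cg g0 g1 gc]]; exists g; split=> // s.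
have c2 : continuous (fun t : R => clamp 1 t * s).
  by apply: contM; [exact: clamp_continuous|exact: contC].
exists (fun t => g (clamp 1 t * s)); split=> //.
- exact: (continuous_compf c2 cg).
- by rewrite clamp_id ?lexx ?ler01 // mul0r.
- by rewrite clamp_id ?lexx ?ler01 // mul1r.
Qed.

Lemma joined_up (V : set plane) (z : plane) e t : box z e `<=` V -> 0 <= t < e ->
  joined V z (z.1, z.2 + t).
Proof.
move=> eV /andP[t0 te]; apply: joined_segment => u u01; apply: eV.
have ee : 0 < e by exact: le_lt_trans t0 te.
apply: box_convex => //; first by split; rewrite subrr normr0.
by split=> /=; rewrite ?subrr ?normr0 // addrC addKr ger0_norm.
Qed.

Lemma puncture_inj : injective (puncture R).
Proof. by move=> i j [/eqP]; rewrite eqr_nat eqSS => /eqP /val_inj. Qed.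

Lemma puncture_disk i : open_disk (puncture R i).
Proof.
rewrite /open_disk /puncture /=.
have : 1 <= i.+1%:R :> R by rewrite (ler_nat R 1).
have : i.+1%:R <= 4 :> R by rewrite (ler_nat R _ 4) ltn_ord.
nra.
Qed.

End Assembly.

#[local] Opaque mconf.

(** * The cases of three and of two enclosed punctures *)

Section ReducibleKernel.
Variable R : realType.
Local Notation plane := (R * R)%type.
Local Notation config := ('I_4 -> plane).
Local Notation P := (puncture R).

Lemma represents_homeo (h : plane -> plane) b : represents h b ->
  mod_homeo (~` @open_disk R) (@punctures R) h.
Proof. by move=> [w wb [H [_ hH <- _]]]; apply: hH; rewrite in_itv /= lexx ler01. Qed.

Lemma ker_conj p v x : burau4_ker p (v * x * v^-1)%g -> burau4_ker p x.
Proof.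
rewrite /burau4_ker /= !burau4M => kx.
have U : burau4 p v \is a GRing.unit by exact: burau4_unit.
have UV : burau4 p v^-1%g \is a GRing.unit by exact: burau4_unit.
by apply: (mulrI U); apply: (mulIr UV); rewrite kx mulr1 -burau4M mulgV burau4_1.
Qed.

Lemma outside_left (c : set plane) (y : plane) : loop_like c -> ~ outside c y -> y.1 < 50.
Proof.
move=> [_ cd _] no; rewrite ltNge; apply/negP => y50; apply: no.
by apply: (far_outside cd); rewrite (lt_le_trans _ y50) // ltr_nat.
Qed.

Lemma puncture_neq i j : i != j -> P i <> P j.
Proof. by move=> /eqP ij /puncture_inj. Qed.

Lemma raised_neq (i : 'I_4) (z t : R) : 0 < t -> ((z, 0 + t) : plane) <> P i.
Proof. by move=> t0 /(congr1 snd) /=; rewrite add0r => t00; rewrite t00 ltxx in t0. Qed.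

(** A third of the larger coordinate distance leaves room for both displacements and for the
    tolerance [u]. *)
Lemma box_sep (A B : plane) : A <> B -> exists2 rho, 0 < rho &
  forall A' B', box A rho A' -> box B rho B' -> forall u, u <= rho -> ~ box A' u B'.
Proof.
move=> AB; pose m := Num.max `|A.1 - B.1| `|A.2 - B.2|.
have m0 : 0 < m.
  rewrite lt_max !normr_gt0 !subr_eq0; apply: contrapT => /negP; rewrite negb_or !negbK => /andP[/eqP e1 /eqP e2].
  by apply: AB; rewrite [LHS]surjective_pairing e1 e2 -surjective_pairing.
exists (m / 3); first by rewrite divr_gt0.
have tri (x y x' y' u : R) : `|x' - x| < m / 3 -> `|y' - y| < m / 3 -> u <= m / 3 -> `|y' - x'| < u -> `|x - y| < m.
  by rewrite !ltr_norml => /andP[? ?] /andP[? ?] ? /andP[? ?]; apply/andP; split; lra.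
move=> A' B' [a1 a2] [b1 b2] u um [c1 c2].
have h1 := tri _ _ _ _ _ a1 b1 um c1; have h2 := tri _ _ _ _ _ a2 b2 um c2.
have : m < m by rewrite {1}/m gt_max h1 h2.
by rewrite ltxx.
Qed.

Lemma box_triangle (z x y : plane) (d : R) : box z (d / 2) x -> box z (d / 2) y -> box x d y.
Proof.
move=> [x1 x2] [y1 y2]; split; [move: x1 y1|move: x2 y2];
  rewrite !ltr_norml => /andP[? ?] /andP[? ?]; apply/andP; split; lra.
Qed.

Lemma box_le (x y : plane) (d d' : R) : box x d y -> d <= d' -> box x d' y.
Proof. by move=> [h1 h2] dd; split; [exact: lt_le_trans h1 dd|exact: lt_le_trans h2 dd]. Qed.

Lemma box_shift (x y z : plane) (d : R) : box x d y -> box z d (z.1 + (y.1 - x.1), z.2 + (y.2 - x.2)).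
Proof. by move=> [h1 h2]; split; rewrite /= addrC addKr. Qed.

Variables (p : nat) (b : B4) (h : plane -> plane) (c : set plane) (a0 a1 a2 a3 : 'I_4).
Hypothesis hp : p = 2 \/ p = 3.
Hypothesis kb : burau4_ker p b.
Hypothesis rep : represents h b.
Hypotheses (Lc : loop_like c) (Lc' : loop_like (h @` c)).
Hypothesis cc' : c = h @` c \/ c `&` (h @` c) = set0.
Hypothesis ua : uniq [:: a0; a1; a2; a3].

Let hP i : h (P i) = P i.
Proof. exact: represents_fixes hp kb rep i. Qed.

Let hout y : outside c y <-> outside (h @` c) (h y).
Proof. exact: outside_image (represents_homeo rep). Qed.

Let n01 : P a0 <> P a1.
Proof. by apply: puncture_neq; move: ua; rewrite /= !inE !negb_or => /andP[/and3P[]]. Qed.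
Let n02 : P a0 <> P a2.
Proof. by apply: puncture_neq; move: ua; rewrite /= !inE !negb_or => /andP[/and3P[]]. Qed.
Let n12 : P a1 <> P a2.
Proof. by apply: puncture_neq; move: ua; rewrite /= !inE !negb_or => /and3P[_ /andP[]]. Qed.
Let n13 : P a1 <> P a3.
Proof. by apply: puncture_neq; move: ua; rewrite /= !inE !negb_or => /and3P[_ /andP[]]. Qed.
Let n23 : P a2 <> P a3.
Proof. by apply: puncture_neq; move: ua; rewrite /= !inE => /and4P[]. Qed.

Lemma triple_case : ~ outside c (P a0) -> ~ outside c (P a1) -> ~ outside c (P a2) ->
  outside c (P a3) -> b = 1%g.
Proof.
move=> i0 i1 i2 o3.
have [K [Kh _ Kb]] := labelled rep; have {}Kb := Kb _ _ _ _ ua.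
have [al [[cal al0 al1 alo] clal]] := clamp_path (joined_sym (outside_path o3)).
have [ch _ _ _] := represents_homeo rep.
have clhal : closed (range (fun r => h (al r))).
  have -> : range (fun r => h (al r)) = h @` (range al).
    by apply/seteqP; split=> [_ [s _ <-]|_ [_ [s _ <-] <-]]; [exists (al s) => //; exists s|exists s].
  have [_ [g [cg hK gK]] _ _] := represents_homeo rep.
  have -> : h @` (range al) = g @^-1` (range al).
    apply/seteqP; split=> [_ [z rz <-]|z rz]; first by rewrite /= hK.
    by exists (g z) => //; exact: gK.
  by apply: preimage_closed => // z _; exact: cg.
pose V : set plane := [set y | y.1 < 50] `&` (~` range al `&` ~` range (fun r => h (al r))).
have oV : open V.
  by apply: openI; [exact: open_left|apply: openI; exact: closed_openC].
have [c'' [Lc'' c''V c''i]] : exists c'', [/\ loop_like c'', (forall z, ~ outside c'' z -> V z) &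
    forall i, ~ outside c (P i) -> ~ outside c'' (P i)].
  have alV z : ~ outside c z -> ~ outside (h @` c) z -> V z.
    move=> nz nz'; split; first exact: outside_left Lc nz.
    by split=> -[s _ e]; [apply: nz|apply: nz'; rewrite -e; apply/hout]; rewrite -?e.
  have [H|H] := nested Lc Lc' cc' i0 (fun o => i0 (proj2 (hout (P a0)) (eq_ind_r (outside (h @` c)) o (hP a0)))).
    exists c; split=> // z nz; apply: alV => // o; exact: nz (H _ o).
  exists (h @` c); split=> // [z nz|i ni o]; first by apply: alV => // o; exact: nz (H _ o).
  by apply: ni; apply/hout; rewrite hP.
have {}i0 := c''i _ i0; have {}i1 := c''i _ i1; have {}i2 := c''i _ i2.
have [e' e'0 eV] := nbhs_box (open_nbhs_nbhs (conj oV (c''V _ i2))).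
(* A quarter keeps the cluster, of height [2 * e], inside the box. *)
pose e := e' / 4.
have e0 : 0 < e by rewrite divr_gt0.
have e2 : 2 * e < e' by rewrite /e; lra.
have ue t : 0 <= t <= 2 * e -> 0 <= t < e' by move=> /andP[t0 t1]; rewrite t0 (le_lt_trans t1).
have Vseg t : 0 <= t <= 2 * e -> V ((P a2).1, (P a2).2 + t).
  by move=> /ue tt; have [] := joined_in (joined_up eV tt).
have t2 : 0 <= 2 * e <= 2 * e by rewrite lexx mulr_ge0 // ltW.
have t1 : 0 <= e <= 2 * e by rewrite ltW //=; lra.
pose q0 : plane := ((P a2).1, (P a2).2 + 2 * e); pose q1 : plane := ((P a2).1, (P a2).2 + e).
have q0P i : q0 <> P i by apply: raised_neq; rewrite mulr_gt0.
have q1P i : q1 <> P i by exact: raised_neq.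
have q01 : q1 <> q0 by move=> /(congr1 snd) /=; lra.
have J0 : joined V (P a0) q0.
  exact: joined_trans (inside_joined Lc'' oV c''V i0 i2) (joined_up eV (ue _ t2)).
have J1 : joined V (P a1) q1.
  exact: joined_trans (inside_joined Lc'' oV c''V i1 i2) (joined_up eV (ue _ t1)).
have {J0} J0 := joined_remove (open_remove (z := P a1) oV) (joined_remove oV J0 n01 (q0P a1)) n02 (q0P a2).
have {J1} J1 := joined_remove (open_remove (z := q0) oV)
  (joined_remove oV J1 (nesym (q0P a1)) q01) n12 (q1P a2).
have [be0 [cbe0 be00 be01 be0V]] := J0; have [be1 [cbe1 be10 be11 be1V]] := J1.
have hal z r : V z -> al r <> z /\ h (al r) <> z.
  by move=> [_ [na nb]]; split=> E; [apply: na|apply: nb]; exists r.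
have := @outer_motion R K h b (P a0) (P a1) (P a2) (P a3) Kh Kb (hP a0) (hP a1) (hP a2) (hP a3)
  (puncture_disk R a0) (puncture_disk R a1) (puncture_disk R a2) (conj n01 (conj n02 n12))
  al be0 be1 e cal cbe0 cbe1 e0 al0 al1 be00 be01 be10 be11.
case.
- by move=> s; have [[_ ?] ?] := be0V s.
- by move=> s; rewrite be01; have [[_ ?] ?] := be1V s.
- move=> s; have [[[? _] _] _] := be0V s; have [[[? _] _] _] := be1V s; split=> //.
  by have [] := c''V _ i2.
- by move=> r; have [? _] := hal _ r (c''V _ i0); have [? _] := hal _ r (c''V _ i1).
- move=> r s; have [[v0 _] _] := be0V s; have [[v1 _] _] := be1V s.
  by have [? ?] := hal _ r v0; have [? ?] := hal _ r v1.
- by move=> r t tt; exact: hal (Vseg t tt).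
move=> v [x [k [xin bE]]]; have kb' := kb; rewrite bE in kb' *.
by rewrite (ker_in12_around xin (ker_conj kb')) mulg1 mulgV.
Qed.

(** Dually, [c''] is the outer curve: the two other punctures leave outside it, and the pair is
    brought together in [V], the points that avoid these escape paths together with their images
    under [h]. *)
Lemma pair_case : ~ outside c (P a0) -> ~ outside c (P a1) -> outside c (P a2) ->
  outside c (P a3) -> b = 1%g.
Proof.
move=> i0 i1 o2 o3.
have [K [Kh Kc Kb]] := labelled rep; have {}Kb := Kb _ _ _ _ ua.
have [cK Ki Ko K0 K1] := Kh; have [ch _ _ _] := represents_homeo rep.
have [c'' [[cl'' cd''] H1 H2 c''o]] : exists c'', [/\ closed c'' /\ c'' `<=` @disk R,
    (forall z, outside c'' z -> outside c z), (forall z, outside c'' z -> outside (h @` c) z) &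
    forall i, outside c (P i) -> outside c'' (P i)].
  have [H|H] := nested Lc Lc' cc' i0 (fun o => i0 (proj2 (hout (P a0)) (eq_ind_r (outside (h @` c)) o (hP a0)))).
    exists (h @` c); split; [by have [? ? _] := Lc'|exact: H|by []|].
    by move=> i /hout; rewrite hP.
  by exists c; split; [have [? ? _] := Lc|by []|exact: H|].
have {}o2 := c''o _ o2; have {}o3 := c''o _ o3.
pose O : set plane := [set z | outside c'' z].
have oO : open O.
  by rewrite openE => z /(outside_open cl'') [B nB BO]; apply: filterS nB => w /BO.
pose p2 : plane := (100, 0); pose p3 : plane := (200, 0).
have p2P i : p2 <> P i.
  move=> /(congr1 fst) /=; have := ltn_ord i; rewrite -(ltr_nat R) => i4 e; have : i.+1%:R <= 4 :> R.
    by rewrite (ler_nat R _ 4) ltn_ord.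
  by rewrite -e; lra.
have J2 : joined O (P a2) p2 by exact: joined_sym (outside_path o2).
have J3 : joined O (P a3) p3.
  apply: joined_trans (joined_sym (outside_path o3)) _; apply: outside_path.
  by apply: (far_outside cd''); rewrite /p3 /= (_ : 5 < 200) // ltr_nat.
have p23 : p3 <> p2 by move=> /(congr1 fst) /= /eqP; rewrite eqr_nat.
have {}J2 := joined_remove oO J2 n23 (p2P a3).
have {}J3 := joined_remove oO J3 (nesym (p2P a3)) p23.
have [mu2 [[cmu2 mu20 mu21 mu2O] clmu2]] := clamp_path J2.
have [mu3 [[cmu3 mu30 mu31 mu3O] clmu3]] := clamp_path J3.
pose W : set plane := [set y | y.1 < 50] `&` (~` range mu2 `&` ~` range mu3).
have oW : open W.
  by apply: openI; [exact: open_left|apply: openI; exact: closed_openC].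
pose V : set plane := W `&` h @^-1` W.
have oV : open V.
  by apply: openI => //; apply: (@open_comp _ _ h) => // z _; exact: ch.
have cV z : ~ outside c z -> V z.
  move=> nz; have nhz : ~ outside (h @` c) (h z) by move=> /hout.
  split; split.
  - exact: outside_left Lc nz.
  - by split=> -[s _ e]; apply: nz; rewrite -e; apply: H1; first [exact: (mu2O s).1|exact: (mu3O s).1].
  - exact: outside_left Lc' nhz.
  - by split=> -[s _ e]; apply: nhz; rewrite -e; apply: H2; first [exact: (mu2O s).1|exact: (mu3O s).1].
have [e1 e10 eV] := nbhs_box (open_nbhs_nbhs (conj oV (cV _ i1))).
have cK1 (z : plane) : continuous (fun s => K s z).
  have cc : continuous (fun s : R => (s, z)).
    by apply: continuous_pair => ?; [exact: cvg_id|exact: cvg_cst].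
  exact: (continuous_compf cc cK).
(* A lower bound, uniform in time, for the distance between two tracks of the isotopy: a pair of
   smaller size can be transported without hitting the other points. *)
have sep i : P a1 <> P i -> exists2 d, 0 < d & forall r, ~ box (K r (P a1)) d (K r (P i)).
  move=> ne; have [|d d0 H] := @uniform_pos R (fun r u => ~ box (K r (P a1)) u (K r (P i))).
    move=> t; have ne' : K t (P a1) <> K t (P i) by move=> /Ki.
    have [rho rho0 Hr] := box_sep ne'; exists rho => //.
    exists ((fun s => K s (P a1)) @^-1` box (K t (P a1)) rho `&`
      (fun s => K s (P i)) @^-1` box (K t (P i)) rho).
      by apply: filterI; [apply: (cK1 (P a1))|apply: (cK1 (P i))]; exact: box_nbhs.
    by move=> r [A B] u /andP[_ ur]; exact: Hr A B u ur.
  by exists d => // r; rewrite Kc; apply: H; rewrite ?d0 ?lexx ?clampP ?ler01.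
have [d2 d20 sep2] := sep a2 n12; have [d3 d30 sep3] := sep a3 n13.
pose eta := Num.min e1 (Num.min d2 d3).
have eta0 : 0 < eta by rewrite !lt_min e10 d20.
have etas : [/\ eta <= e1, eta <= d2 & eta <= d3].
  by rewrite /eta !ge_min !lexx ?orbT; split.
have [ee1 ed2 ed3] := etas.
have [|rho rho0 near] := @uniform_pos R (fun r u => box (K r (P a1)) eta (K r ((P a1).1, (P a1).2 + u))).
  move=> t; pose G (y : R * R) := K y.1 ((P a1).1, (P a1).2 + y.2).
  have cG : continuous G.
    have cz : continuous (fun y : R * R => ((P a1).1, (P a1).2 + y.2) : plane).
      by apply: continuous_coords; [exact: contC|apply: contD; [exact: contC|exact: continuous_proj2]].
    exact: (continuous_compf (continuous_pair (@continuous_proj1 R R) cz) cK).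
  have G0 : G (t, 0) = K t (P a1) by rewrite /G /= addr0.
  have h2 : 0 < eta / 2 by rewrite divr_gt0.
  have := cG (t, 0) (box (K t (P a1)) (eta / 2)); rewrite G0 => /(_ (box_nbhs _ h2)).
  move=> [[A B] /= [nA nB] AB].
  have /nbhs_ballP[rho /= rho0 rB] := nB.
  exists (rho / 2); first by rewrite divr_gt0.
  exists (A `&` (fun s => K s (P a1)) @^-1` box (K t (P a1)) (eta / 2)).
    by apply: filterI => //; apply: (cK1 (P a1)); exact: box_nbhs.
  move=> r [Ar Kr] u /andP[u0 ur].
  have Bu : B u by apply: rB; rewrite /ball /= sub0r normrN gtr0_norm //; lra.
  have := AB (r, u) (conj Ar Bu); rewrite /G /= => Gr.
  exact: box_triangle Kr Gr.
(* The bound by [rho] keeps the moving vector of the pair within [eta], and the bound by [eta / 2]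
   the vertical segment. *)
pose e := Num.min rho (eta / 2).
have e0 : 0 < e by rewrite lt_min rho0 divr_gt0.
have eeta : e < eta by rewrite gt_min; apply/orP; right; lra.
have erho : e <= rho by rewrite ge_min lexx.
pose q0 : plane := ((P a1).1, (P a1).2 + e).
have q0P i : q0 <> P i by exact: raised_neq.
have dK r : box (K r (P a1)) eta (K r q0).
  by rewrite Kc; apply: near; rewrite ?clampP ?ler01 // e0.
have te1 t : 0 <= t <= e -> 0 <= t < e1.
  by move=> /andP[t0 te]; rewrite t0 /=; apply: le_lt_trans te (lt_le_trans eeta ee1).
have ee : 0 <= e <= e by rewrite lexx ltW.
have J0 : joined V (P a0) q0.
  exact: joined_trans (inside_joined Lc oV cV i0 i1) (joined_up eV (te1 _ ee)).
have [al [cal al0 al1 alV]] := joined_remove oV J0 n01 (q0P a1).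
have Vmu z s : V z -> [/\ z <> mu2 s, z <> mu3 s, h z <> mu2 s & h z <> mu3 s].
  move=> [[_ [na nb]] [_ [nc nd]]].
  by split=> E; [apply: na|apply: nb|apply: nc|apply: nd]; exists s.
have bpV r : V ((P a1).1 + ((K r q0).1 - (K r (P a1)).1), (P a1).2 + ((K r q0).2 - (K r (P a1)).2)).
  by apply: eV; apply: box_shift; exact: box_le (dK r) ee1.
have ball_seg s t : 0 <= t <= e -> box (K s (P a1)) eta ((K s (P a1)).1, (K s (P a1)).2 + t).
  move=> /andP[t0 te]; split=> /=; rewrite ?subrr ?normr0 // addrC addKr ger0_norm //.
  exact: le_lt_trans te eeta.
have alW r : V (al r) by have [] := alV r.
have := @pair_motion R K h b (P a0) (P a1) (P a2) (P a3) Kh Kb (hP a0) (hP a1) (hP a2) (hP a3) n23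
  al mu2 mu3 e cal cmu2 cmu3 e0 al0 al1 mu20 mu21 mu30 mu31.
case.
- by move=> r; have [] := alV r.
- by move=> r; have [[? _] [? _]] := alW r.
- by move=> r; have [[? _] _] := bpV r.
- by have [[? _] _] := cV _ i1.
- by move=> s; have [] := mu2O s.
- by move=> s; rewrite mu21; have [] := mu3O s.
- by move=> r s; exact: Vmu s (alW r).
- by move=> r s; have [] := Vmu _ s (bpV r).
- move=> s t tt; have [_ Vt] := joined_in (joined_up eV (te1 _ tt)).
  by have [m2 m3 _ _] := Vmu _ s Vt; split; exact/nesym.
- move=> r s; split=> E; [apply: (sep2 s)|apply: (sep3 s)]; rewrite -E; apply: box_shift.
    exact: box_le (dK r) ed2.
  exact: box_le (dK r) ed3.
- move=> s t tt; split=> E; [apply: (sep2 s)|apply: (sep3 s)]; rewrite E.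
    exact: box_le (ball_seg s t tt) ed2.
  exact: box_le (ball_seg s t tt) ed3.
move=> v [y [yin bE]].
have kb' := kb; rewrite bE in kb' *.
by rewrite (ker_cabled yin (ker_conj kb')) mulg1 mulgV.
Qed.

End ReducibleKernel.

Lemma split_labels (S : {set 'I_4}) : exists a0 a1 a2 a3 : 'I_4,
  uniq [:: a0; a1; a2; a3] /\ forall k, (k < 4)%N ->
  (nth ord0 [:: a0; a1; a2; a3] k \in S) = (k < #|S|)%N.
Proof.
have us : uniq (enum S ++ enum (~: S)).
  rewrite cat_uniq !enum_uniq /= andbT; apply/hasPn => i.
  by rewrite !mem_enum inE.
have sz : size (enum S ++ enum (~: S)) = 4 by rewrite size_cat -!cardE cardsC card_ord.
have H k : (k < 4)%N -> (nth ord0 (enum S ++ enum (~: S)) k \in S) = (k < #|S|)%N.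
  move=> k4; rewrite nth_cat -cardE; case: ifP => kS.
    by rewrite -mem_enum mem_nth // -cardE.
  have h : (k - #|S| < size (enum (~: S)))%N.
    by rewrite -cardE -(ltn_add2l #|S|) subnKC ?cardsC ?card_ord // leqNgt kS.
  by have := mem_nth ord0 h; rewrite mem_enum inE => /negbTE.
case: (_ ++ _) us sz H => [|a0 [|a1 [|a2 [|a3 [|]]]]] // us _ H.
by exists a0, a1, a2, a3.
Qed.

(** One curve of the family is followed together with its image: both belong to the family, so they
    are equal or disjoint. *)
Lemma ker_reducible (R : realType) p (b : B4) : p = 2 \/ p = 3 -> burau4_ker p b ->
  reducible R b -> b = 1%g.
Proof.
move=> hp kb [h [C [rep [c Cc] Ce Cd CE]]].
have Cc' : C (h @` c) by rewrite -CE; exists c.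
have [sc cd S24] := Ce c Cc; have [sc' cd' _] := Ce _ Cc'.
have cdisk : c `<=` @disk R by move=> z /cd [].
have Lc := closed_loop_like sc cdisk.
have Lc' : loop_like (h @` c) by apply: closed_loop_like => // z /cd' [].
have cc' : c = h @` c \/ c `&` (h @` c) = set0.
  by have [e|ne] := pselect (c = h @` c); [left|right; apply: Cd].
have cP i : ~ c (puncture R i) by move=> /cd [_]; apply; exists i.
have [a0 [a1 [a2 [a3 [ua aS]]]]] := split_labels [set i | `[< encloses c (puncture R i) >]]%SET.
move: S24 aS; set n := #|_| => S24 aS.
have ins i : `[< encloses c (puncture R i) >] -> ~ outside c (puncture R i).
  by move/asboolP; have [H _] := enclosesP Lc (cP i).
have out i : `[< encloses c (puncture R i) >] = false -> outside c (puncture R i).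
  move=> /negbT/asboolP ne; apply: contrapT => no; apply: ne.
  by have [_ H] := enclosesP Lc (cP i); exact: H.
have := aS 0%N isT; have := aS 1%N isT; have := aS 2%N isT; have := aS 3%N isT.
rewrite !inE; case: n S24 {aS} => [|[|[|[|n]]]] // _ /= e3 e2 e1 e0.
  apply: (pair_case hp kb rep Lc Lc' cc' ua); [exact: ins e0|exact: ins e1|exact: out e2|exact: out e3].
apply: (triple_case hp kb rep Lc Lc' cc' ua); [exact: ins e0|exact: ins e1|exact: ins e2|exact: out e3].
Qed.

Local Close Scope ring_scope.

Theorem mainTheorem2 (R : realType) (p : nat) (hp : p = 2 \/ p = 3) :
  [/\ ~ injective (burau4 p),
      exists b : B4, burau4_ker p b /\ ~ Brunnian_braid R b,
      normal_subgroup (burau4_ker p),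
      all_pseudo_Anosov R (burau4_ker p)
    & ~ (burau4_ker p `<=` [set b | sphere_Brunnian R b])].
Proof.
have kb := kernel_element hp; have kn := @kernel_not_Brunnian R p hp.
split.
- move=> inj; apply: (kernel_element_neq1 hp); apply: inj.
  by rewrite burau4_1.
- by eexists; split; [exact: kb|move=> Br; apply: kn; left].
- split=> [|x y kx ky|x y kx].
  + exact: burau4_1.
  + rewrite /burau4_ker /= in kx ky *.
    by rewrite burau4M burau4V kx ky invr1 mulr1.
  + rewrite /burau4_ker /= in kx *; have U : burau4 p y \is a GRing.unit by exact: burau4_unit.
    by rewrite conjgE !burau4M burau4V kx mul1r mulVr.
- move=> b bk b1; split=> [[n n0 C]|rb]; apply: b1.
    exact: ker_torsion bk n0 C.
  exact: ker_reducible hp bk rb.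
- by move=> sub; apply: kn; right; exact: sub kb.
Qed.
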